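(* Let $1/2<\sigma<1$ and let $T$ be large. Then there exists $c_1(\sigma)>0$ such that, uniformly in the range $1\ll \tau\leq c_1(\sigma)(\log T)^{1-\sigma}/\log_2 T$, we have $$\Phi_{T}(\sigma,\tau)=\exp\left(-A_1(\sigma)\tau^{\frac{1}{1-\sigma}}(\log\tau)^{\frac{\sigma}{1-\sigma}}\left(1+O\left(\frac{1}{\sqrt{\log\tau}}+r(\log T,\tau)\right)\right)\right),$$ where $$\Phi_T(\sigma,\tau):=\frac{1}{T}\,\mathrm{meas}\{t\in [T,2T]: \log|\zeta(\sigma+it)|\geq \tau\}.$$
   Context: $\zeta$ is the Riemann zeta function, $\log_j$ denotes the $j$-fold iterated natural logarithm, and ''meas'' is Lebesgue measure. Let $I_0(u)=\sum_{n\ge0}(u/2)^{2n}/(n!)^2$ be the modified Bessel function of order $0$ (so $I_0(u)=\mathbb E(e^{u\,\mathrm{Re}X})$ for $X$ uniformly distributed on the unit circle). Put $G_1(\sigma)=\int_0^\infty \log I_0(u)\,u^{-1-1/\sigma}\,du$ and $$A_1(\sigma)=\left(\frac{\sigma^{2\sigma}}{(1-\sigma)^{2\sigma-1}G_1(\sigma)^{\sigma}}\right)^{\frac{1}{1-\sigma}}.$$ For $y,\tau\ge 3$, $r(y,\tau):=\left(\frac{\tau}{y^{1-\sigma}(\log y)^{-1}}\right)^{(\sigma-\frac12)/(1-\sigma)}$. *)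

(* Defs.v *)
From HB Require Import structures.
From mathcomp Require Import all_boot all_order all_algebra.
From mathcomp Require Import all_classical all_reals all_analysis.
Set Implicit Arguments. Unset Strict Implicit. Unset Printing Implicit Defensive.
Import Order.TTheory GRing.Theory Num.Theory.
Import numFieldNormedType.Exports.
Local Open Scope classical_set_scope.
Local Open Scope ring_scope.

Section Defs.
Variable R : realType.

Definition besselI0 (u : R) : R :=
  limn (series (fun n : nat => (u / 2) ^+ (2 * n) / ((n`!)%:R ^+ 2))).

(* G_1(sigma) = int_0^oo log I_0(u) u^{-1-1/sigma} du (Lebesgue integral;
   the integrand is nonnegative and integrable for 1/2 < sigma < 1) *)
Definition G1 (sigma : R) : R :=
  fine (\int[lebesgue_measure]_(u in `]0%R, +oo[)
          (ln (besselI0 u) * u `^ (-1 - sigma^-1))%:E)%E.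

Definition A1 (sigma : R) : R :=
  (sigma `^ (2 * sigma) /
     ((1 - sigma) `^ (2 * sigma - 1) * G1 sigma `^ sigma)) `^ (1 - sigma)^-1.

Definition rr (sigma y tau : R) : R :=
  (tau / (y `^ (1 - sigma) / ln y)) `^ ((sigma - 2^-1) / (1 - sigma)).

(* Riemann zeta on Re s > 0, s <> 1, via the Dirichlet eta function:
   zeta(s) = eta(s) / (1 - 2^{1-s}),  eta(s) = sum_{n>=1} (-1)^{n-1} n^{-s}
   (conditionally convergent for Re s > 0).  With s = sigma + i t and
   m^{-s} = m^{-sigma} (cos (t log m) - i sin (t log m)), we give the real
   and imaginary parts of eta. *)
Definition eta_re (sigma t : R) : R :=
  limn (series (fun n : nat =>
    (-1) ^+ n * (n.+1%:R) `^ (- sigma) * cos (t * ln n.+1%:R))).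
Definition eta_im (sigma t : R) : R :=
  limn (series (fun n : nat =>
    - ((-1) ^+ n * (n.+1%:R) `^ (- sigma) * sin (t * ln n.+1%:R)))).

(* |1 - 2^{1-s}| with 2^{1-s} = 2^{1-sigma} (cos (t log 2) - i sin (t log 2)) *)
Definition abs_den (sigma t : R) : R :=
  Num.sqrt ((1 - 2 `^ (1 - sigma) * cos (t * ln 2)) ^+ 2
            + (2 `^ (1 - sigma) * sin (t * ln 2)) ^+ 2).

Definition abs_zeta (sigma t : R) : R :=
  Num.sqrt (eta_re sigma t ^+ 2 + eta_im sigma t ^+ 2) / abs_den sigma t.

Definition PhiT (T sigma tau : R) : R :=
  T^-1 * fine (lebesgue_measure
    [set t : R | T <= t <= 2 * T /\ tau <= ln (abs_zeta sigma t)]).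

End Defs.

(* Main.v *)
Require Import Defs.
From HB Require Import structures.
From mathcomp Require Import all_boot all_order all_algebra complex.
From mathcomp Require Import all_classical all_reals all_analysis.
From mathcomp Require Import ring lra zify.
Set Implicit Arguments. Unset Strict Implicit. Unset Printing Implicit Defensive.
Import Order.TTheory GRing.Theory Num.Theory.
Import numFieldNormedType.Exports.
Local Open Scope classical_set_scope.
Local Open Scope ring_scope.
From mathcomp Require Import measurable_realfun.
Local Open Scope complex_scope.
Local Notation Re := complex.Re.
Local Notation Im := complex.Im.

(** Mean values of a mollified zeta function show that, outside a set of [t] of tiny
measure, [log |zeta (sigma + i t)|] is the real part of a prime sum of length a small power of
[T].  Comparing moments with independent uniform phases, the Laplace transform of that sum at
[k] is close to the product over primes of [I_0 (k p^-sigma)].  The prime number theorem,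
obtained from discrete Fourier analysis of [zeta] near the 1-line, turns the logarithm of the
product into [G_1(sigma) k^(1/sigma) / log k].  Chernoff's bound gives the upper estimate of
the tail, and tilting by the saddle point [k] gives the lower one. *)

(** Zeta is handled through series only: near the 1-line all work is with partial sums [n <= N],
    uniformly in [t] over bounded ranges, and finite differences in [t] take the place of
    derivatives and contours.

    The obstacle is length. Exponentials are replaced by polynomials of length [z^I], which must
    stay below a small power of [T]. With [L = log T] and [z] a power of [L] this forces [I] to be
    of order [L / log L]. The exponential is then controlled only where [k |Rp|] is below a small
    multiple of [I], so [k] is at most [c2 L^sigma] and [|Rp|] at most a constant times
    [L^(1-sigma) / log L]: this is the origin of the range of [tau]. Exceptional sets have measure
    [exp(-c L / log L)], and [c1] is small so that they stay negligible.

    The error [1/sqrt(log tau)] comes from the lower bound. The prime number theorem gives the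
    log-Laplace transform up to a relative error [1/log k], while a window of relative width [eta]
    around the saddle value gains a relative amount [eta^2] in the exponent. The tilted mass is
    therefore localised only for [eta] of order [1/sqrt(log k)]. *)

Lemma eq_ler (R : numDomainType) (x y : R) : x = y -> x <= y.
Proof. by move->. Qed.

Lemma big_nat1_widen (V : nmodType) (F : nat -> V) n N : (n<=N)%N ->
  (forall a, (n<a)%N -> F a = 0) ->
  \sum_(1<=a<n.+1) F a = \sum_(1<=a<N.+1) F a.
Proof.
move=> nN F0; rewrite [RHS](@big_cat_nat _ _ _ n.+1)//=.
have -> : \sum_(n.+1<=a<N.+1) F a = 0.
  by rewrite big_nat big1// => a /andP[na _]; exact: F0.
by rewrite addr0.
Qed.

(** * Dirichlet convolution and convolution powers *)

Section Convolution.
Variable R : comPzRingType.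
Implicit Types (f g h : nat -> R) (n N : nat).

(** A full double sum with an indicator rather than a divisor sum: the ranges can be enlarged
    freely, and commutativity and associativity become exchanges of finite sums. At [n = 0] the
    ranges are empty. *)
Definition conv f g n : R :=
  \sum_(1<=a<n.+1) \sum_(1<=b<n.+1) (a*b == n)%N%:R*(f a * g b).

Lemma conv_widen f g n N : (n<=N)%N ->
  conv f g n = \sum_(1<=a<N.+1) \sum_(1<=b<N.+1) (a*b == n)%N%:R*(f a * g b).
Proof.
move=> nN; rewrite /conv.
transitivity (\sum_(1<=a<n.+1) \sum_(1<=b<N.+1) (a*b == n)%N%:R*(f a * g b)).
  apply: eq_big_nat=> a /andP[a1 _]; apply: big_nat1_widen=>// b nb.
  case: eqP=> [abn|]; last by rewrite mul0r.
  by move: nb; rewrite -abn ltnNge leq_pmull.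
apply: big_nat1_widen=>// a na; rewrite big_nat big1// => b /andP[b1 _].
case: eqP=> [abn|]; last by rewrite mul0r.
by move: na; rewrite -abn ltnNge leq_pmulr.
Qed.

Lemma conv_divisors f g n : (0<n)%N ->
  conv f g n = \sum_(1<=d<n.+1 | (d %| n)%N) f d * g (n %/ d)%N.
Proof.
move=> n0; rewrite /conv [RHS]big_mkcond/=; apply: eq_big_nat=> a /andP[a1 an].
case: ifPn=> [/dvdnP[q nE]|adn]; last first.
  rewrite big1// => b _; case: eqP=> [abn|]; last by rewrite mul0r.
  by move: adn; rewrite -abn dvdn_mulr.
have q0: (0<q)%N by move: n0; rewrite nE muln_gt0=> /andP[].
rewrite (bigD1_seq q)/=; last 2 first.
- by rewrite mem_index_iota q0/= ltnS nE leq_pmulr.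
- exact: iota_uniq.
rewrite mulnC -nE eqxx big1 ?addr0 ?mul1r ?nE ?mulnK// => b bq.
by rewrite mulnC eqn_pmul2r// (negbTE bq) mul0r.
Qed.

Lemma conv0 f g : conv f g 0 = 0. Proof. by rewrite /conv big_geq. Qed.

Lemma eq_conv f f' g g' n : (forall a, (0<a<=n)%N -> f a = f' a) ->
  (forall a, (0<a<=n)%N -> g a = g' a) -> conv f g n = conv f' g' n.
Proof.
move=> ff gg; apply: eq_big_nat=> a an.
by apply: eq_big_nat=> b bn; rewrite ff// gg.
Qed.

Lemma convC f g n : conv f g n = conv g f n.
Proof.
rewrite /conv exchange_big/=; apply: eq_bigr=> b _; apply: eq_bigr=> a _.
by rewrite mulnC [f _ * _]mulrC.
Qed.

(** Both sides are the triple sum over [a*b*c = n]. [collapse] removes the intermediate variable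
    [d = a*b]; the other bracketing is brought to the same shape by commutativity. *)
Lemma convA f g h n : conv (conv f g) h n = conv f (conv g h) n.
Proof.
have collapse (F : nat -> R) (m c : nat) : (0<m)%N -> (0<c)%N ->
  \sum_(1<=d<n.+1) (m == d)%N%:R*((d*c == n)%N%:R*F d) =
  (m*c == n)%N%:R*F m.
  move=> m0 c0; case: (leqP m n)=> mn.
    rewrite (bigD1_seq m)/= ?mem_index_iota ?m0 ?iota_uniq// eqxx mul1r.
    by rewrite big1 ?addr0// => d dm; rewrite eq_sym (negbTE dm) mul0r.
  rewrite [in RHS]gtn_eqF ?mul0r ?(leq_trans mn)// ?leq_pmulr//.
  rewrite big_nat big1// => d /andP[_ dn].
  by rewrite gtn_eqF ?mul0r// (leq_ltn_trans _ mn).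
have left3 (u v w : nat -> R) : conv (conv u v) w n =
  \sum_(1<=a<n.+1) \sum_(1<=b<n.+1) \sum_(1<=c<n.+1)
   (a*b*c == n)%N%:R*(u a * v b*w c).
  transitivity (\sum_(1<=d<n.+1) \sum_(1<=a<n.+1) \sum_(1<=b<n.+1)
    \sum_(1<=c<n.+1) (a*b == d)%N%:R*((d*c == n)%N%:R*(u a * v b*w c))).
    apply: eq_big_nat=> d /andP[d1 dn].
    rewrite (@conv_widen u v d n)//.
    under eq_bigr=> c _.
      rewrite mulrC !big_distrl/=.
      under eq_bigr do rewrite !big_distrl/=.
      over.
    rewrite exchange_big/=; apply: eq_bigr=> a _.
    rewrite exchange_big/=; apply: eq_bigr=> b _.
    by apply: eq_bigr=> c _; ring.
  rewrite exchange_big/=; apply: eq_big_nat=> a /andP[a0 _].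
  rewrite exchange_big/=; apply: eq_big_nat=> b /andP[b0 _].
  rewrite exchange_big/=; apply: eq_big_nat=> c /andP[c0 _].
  by rewrite (collapse (fun=> u a * v b*w c)) ?muln_gt0 ?a0.
rewrite [RHS]convC !left3.
under [RHS]eq_bigr do rewrite exchange_big/=.
rewrite [RHS]exchange_big/=; apply: eq_bigr=> a _; apply: eq_bigr=> b _.
apply: eq_bigr=> c _; rewrite (_ : (b*c*a)%N=(a*b*c)%N); last by lia.
by congr (_ * _); ring.
Qed.

Lemma convDl f f' g n : conv (fun x=> f x + f' x) g n = conv f g n+conv f' g n.
Proof.
rewrite /conv -big_split/=; apply: eq_bigr=> a _; rewrite -big_split/=.
by apply: eq_bigr=> b _; ring.
Qed.

Lemma convZl (k : R) f g n : conv (fun x=> k * f x) g n = k*conv f g n.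
Proof.
rewrite /conv big_distrr/=; apply: eq_bigr=> a _; rewrite big_distrr/=.
by apply: eq_bigr=> b _; ring.
Qed.

Lemma conv_suml (I : Type) (s : seq I) (F : I -> nat -> R) g n :
  conv (fun x=> \sum_(i <- s) F i x) g n = \sum_(i <- s) conv (F i) g n.
Proof.
rewrite /conv [RHS]exchange_big/=; apply: eq_bigr=> a _; rewrite [RHS]exchange_big/=.
by apply: eq_bigr=> b _; rewrite big_distrl/= big_distrr.
Qed.

Definition delta1 (n : nat) : R := (n == 1)%N%:R.

Lemma conv1l f n : (0<n)%N -> conv delta1 f n = f n.
Proof.
move=> n0; rewrite conv_divisors// big_mkcond/= (bigD1_seq 1%N)/= ?iota_uniq//.
  rewrite dvd1n /delta1 eqxx mul1r divn1 big1 ?addr0// => d d1.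
  by rewrite /delta1 (negbTE d1) mul0r if_same.
by rewrite mem_index_iota /= ltnS.
Qed.

Lemma conv_at1 f g : conv f g 1 = f 1%N * g 1%N.
Proof. by rewrite /conv !big_nat1 eqxx mul1r. Qed.

Fixpoint cpow f k : nat -> R := if k is k'.+1 then conv f (cpow f k') else delta1.

(** A product of Dirichlet polynomials of lengths [N] and [M] has the convolution of the truncated
    sequences as coefficients; this is the true convolution only up to the smaller of the two
    lengths. *)
Definition trunc N f n : R := (n<=N)%N%:R * f n.

Lemma mul_Dirichlet_poly (S : comPzRingType) (phi : {rmorphism R -> S})
    (chi : nat -> S) f g N M :
  (forall m n, (0<m)%N -> (0<n)%N -> chi (m*n)%N = chi m*chi n) ->
  (\sum_(1<=a<N.+1) phi (f a)*chi a)*(\sum_(1<=b<M.+1) phi (g b)*chi b) =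
  \sum_(1<=n<(N*M).+1) phi (conv (trunc N f) (trunc M g) n)*chi n.
Proof.
move=> chiM; set K := (N*M)%N.
have [N0|N0] := posnP N; first by rewrite /K N0 mul0n [X in X * _]big_geq ?mul0r ?big_geq.
have [M0|M0] := posnP M; first by rewrite /K M0 muln0 [X in _*X]big_geq ?mulr0 ?big_geq.
have KN: (N<=K)%N by rewrite leq_pmulr.
have KM: (M<=K)%N by rewrite leq_pmull.
have tr (u : nat -> R) (L : nat) : (L<=K)%N ->
    \sum_(1<=a<L.+1) phi (u a)*chi a =
    \sum_(1<=a<K.+1) phi (trunc L u a)*chi a.
  move=> LK.
  rewrite -(@big_nat1_widen _ (fun a=> phi (trunc L u a)*chi a) L K LK); last first.
    by move=> a La; rewrite /trunc leqNgt La/= mul0r rmorph0 mul0r.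
  by apply: eq_big_nat=> a /andP[_ aL]; rewrite /trunc -ltnS aL mul1r.
rewrite (tr f N)// (tr g M)// big_distrl/=.
under eq_bigr do rewrite big_distrr/=.
transitivity (\sum_(1<=n<K.+1) \sum_(1<=a<K.+1) \sum_(1<=b<K.+1)
   (a*b == n)%N%:R*(phi (trunc N f a) * phi (trunc M g b)*chi n)); last first.
  apply: eq_big_nat=> n /andP[n0 nK].
  rewrite (@conv_widen _ _ n K)// rmorph_sum/= big_distrl/=; apply: eq_bigr=> a _.
  rewrite rmorph_sum/= big_distrl/=; apply: eq_bigr=> b _.
  by rewrite rmorphM rmorph_nat rmorphM mulrA; ring.
rewrite [RHS]exchange_big/=; apply: eq_big_nat=> a /andP[a0 aK].
rewrite [RHS]exchange_big/=; apply: eq_big_nat=> b /andP[b0 bK].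
have [aN|aN] := leqP a N; last first.
  rewrite /trunc leqNgt aN/= mul0r rmorph0 !mul0r big1// => n _; by rewrite mul0r mulr0.
have [bM|bM] := leqP b M; last first.
  rewrite /trunc [(b<=M)%N]leqNgt bM/= mul0r rmorph0 mul0r mulr0 big1// => n _.
  by rewrite mulr0 mul0r mulr0.
rewrite [RHS](bigD1_seq (a*b)%N)/= ?iota_uniq//; last first.
  by rewrite mem_index_iota muln_gt0 a0 b0 ltnS leq_mul.
rewrite eqxx mul1r [X in _+X]big1 ?addr0; last first.
  by move=> n; rewrite eq_sym=> /negbTE ->; rewrite mul0r.
by rewrite chiM//; ring.
Qed.

(** Each of the [k] factors has to be at least 2. Hence an exponential series of convolution powers
    is a finite sum at every coefficient. *)
Lemma cpow_trunc_small f k n : f 1%N = 0 -> (n<2 ^ k)%N -> cpow f k n = 0.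
Proof.
move=> f1; elim: k n=> [|k IH] n; first by rewrite expn0 ltnS leqn0=> /eqP ->; rewrite /= /delta1.
move=> nk /=; have [->|n0] := posnP n; first by rewrite conv0.
rewrite conv_divisors// big1_seq// => d /andP[dn]; rewrite mem_index_iota=> /andP[d0 _].
case: (leqP d 1)=> d1; first by rewrite (_ : d = 1%N) ?f1 ?mul0r//; lia.
rewrite IH ?mulr0// ltn_divLR// (leq_trans nk)// expnS mulnC leq_mul2l.
by rewrite d1 orbT.
Qed.

End Convolution.

(** * The von Mangoldt function and exponentials of Dirichlet series *)

Section Mangoldt.
Variable R : realType.
Implicit Types (f g h F : nat -> R) (n k z : nat).

(** [primes n] lists the distinct prime divisors, so it is a singleton exactly at prime powers. *)
Definition mangoldt n : R := if primes n is [:: p] then ln p%:R else 0.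
Definition one_fun n : R := 1.
Definition lnn n : R := ln n%:R.

Lemma lnnM m n : (0<m)%N -> (0<n)%N -> lnn (m*n) = lnn m+lnn n.
Proof. by move=> m0 n0; rewrite /lnn natrM lnM ?posrE ?ltr0n. Qed.

Lemma lnn_ge0 n : 0<=lnn n.
Proof. by case: n=> [|n]; rewrite /lnn; [rewrite ln0|rewrite ln_ge0// ler1n]. Qed.

Lemma lnn_gt0 n : (1<n)%N -> 0<lnn n.
Proof. by move=> n1; rewrite /lnn ln_gt0// ltr1n. Qed.

Lemma mangoldt_ge0 n : 0<=mangoldt n.
Proof.
rewrite /mangoldt; case: (primes n)=> [//|p [|? ?]//]; exact: lnn_ge0.
Qed.

Lemma mangoldt1 : mangoldt 1 = 0. Proof. by []. Qed.

Lemma mangoldt_primeX p k : prime p -> (0<k)%N -> mangoldt (p ^ k) = lnn p.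
Proof. by move=> pp k0; rewrite /mangoldt primesX// primes_prime. Qed.

(** The logarithm turns products into sums, so multiplication by [lnn] is a derivation: it is
    differentiation of Dirichlet series up to sign. The coefficient bounds below come from
    differential equations read in this way. *)
Lemma conv_derivation f g n :
  lnn n*conv f g n = conv (fun x=> lnn x * f x) g n+conv f (fun x=> lnn x * g x) n.
Proof.
rewrite /conv -big_split/= big_distrr/=; apply: eq_big_nat=> a /andP[a0 _].
rewrite -big_split/= big_distrr/=; apply: eq_big_nat=> b /andP[b0 _].
case: eqP=> [<-|_]; last by rewrite !mul0r mulr0 addr0.
by rewrite lnnM//; ring.
Qed.

Lemma cpow_derivation f k n :
  lnn n*cpow f k.+1 n = k.+1%:R*conv (fun x=> lnn x * f x) (cpow f k) n.
Proof.
elim: k n=> [|k IH] n.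
  rewrite /= mul1r conv_derivation.
  rewrite [X in _+X](_ : _ = 0) ?addr0//.
  rewrite /conv big1_seq// => a _; rewrite big1_seq// => b _.
  by rewrite /delta1; case: (b =P 1%N)=> [->|_]; rewrite /lnn ?ln1 ?mul0r ?mulr0.
rewrite [cpow f k.+2]/= conv_derivation.
rewrite (@eq_conv _ f f (fun x=> lnn x*conv f (cpow f k) x)
  (fun x=> k.+1%:R*conv (fun x=> lnn x * f x) (cpow f k) x) n)//.
rewrite [X in _+X]convC convZl convA.
rewrite (@eq_conv _ _ (fun x=> lnn x * f x) (conv (cpow f k) f) (cpow f k.+1))//; last first.
  by move=> a _; rewrite convC.
by rewrite /= [k.+2%:R]mulrSr mulrDl mul1r addrC.
Qed.

Lemma mangoldt_neq0 d : (0<d)%N -> mangoldt d != 0 ->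
  exists q j, [/\ prime q, (0<j)%N, d=(q ^ j)%N & mangoldt d = lnn q].
Proof.
move=> d0; rewrite /mangoldt; case pd: (primes d)=> [|q [|? ?]]; rewrite ?eqxx// => _.
have qd: q \in primes d by rewrite pd mem_head.
have dE: d=(q ^ logn q d)%N.
  by rewrite {1}(prod_prime_decomp d0) prime_decompE pd/= big_seq1.
exists q, (logn q d); split=>//; last by rewrite logn_gt0.
by move: qd; rewrite mem_primes=> /andP[].
Qed.

(** Induction on removing the least prime factor, [n = p * m]. Among the divisors of [n] that do not
    divide [m], only the full power of [p] in [n] has a nonzero weight, and it contributes
    [ln p]. *)
Lemma conv_mangoldt_one n : (0 < n)%N -> conv mangoldt one_fun n = lnn n.
Proof.
elim/ltn_ind: n => n IH n0.
have [->|n1] := eqVneq n 1%N.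
  by rewrite conv_at1 mangoldt1 mul0r /lnn ln1.
have {}n1 : (1 < n)%N by lia.
set p := pdiv n; have pp : prime p := pdiv_prime n1.
set m := (n %/ p)%N.
have nE : n = (p * m)%N by rewrite /m mulnC divnK// pdiv_dvd.
have m0 : (0 < m)%N by move: n0; rewrite nE muln_gt0 => /andP[].
have mn : (m < n)%N by rewrite nE ltn_Pmull// prime_gt1.
have lE : lnn n = lnn p + lnn m by rewrite nE lnnM// prime_gt0.
rewrite conv_divisors// lE -(IH m)// conv_divisors//.
rewrite (bigID (fun d => d %| m)%N)/= addrC; congr (_ + _); last first.
  rewrite [LHS]big_mkcond/= [RHS]big_mkcond/= 
    [RHS](@big_nat1_widen _ (fun d => if (d %| m)%N then mangoldt d * one_fun (m %/ d)%N else 0) m n (ltnW mn)); last first.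
    by move=> d md; case: ifPn => // /(dvdn_leq m0); lia.
  apply: eq_bigr => d _; case: (boolP (d %| m)%N) => dm; rewrite ?andbF//.
  by rewrite nE dvdn_mull.
set k := logn p n.
have pkn : (p ^ k %| n)%N := pfactor_dvdnn p n.
have kE : k = (logn p m).+1.
  have lp : logn p p = 1%N by rewrite logn_prime// eqxx.
  by have := lognM p (prime_gt0 pp) m0; rewrite -nE lp add1n.
have pkm : ~~ (p ^ k %| m)%N by rewrite pfactor_dvdn// kE -ltnNge.
rewrite big_mkcond (bigD1_seq (p ^ k)%N) ?iota_uniq//=; last first.
  by rewrite mem_index_iota expn_gt0 prime_gt0//= ltnS dvdn_leq.
rewrite pkn pkm/= mulr1 mangoldt_primeX// ?kE//.
rewrite big1_seq ?addr0// => d /andP[dk].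
rewrite mem_index_iota => /andP[d0 _]; case: ifP => // /andP[dn dm].
rewrite mulr1; apply/eqP/negPn/negP.
move=> /(mangoldt_neq0 d0)[q [j [qp j0 dE _]]].
have [qE|qNp] := eqVneq q p.
  move: dn dm dk; rewrite dE qE !pfactor_dvdn// -/k kE -ltnNge => jk mj.
  by rewrite (_ : j = (logn p m).+1) ?eqxx//; lia.
move: dm; rewrite -(@Gauss_dvdr d p m) -?nE ?dn//.
by rewrite dE coprimeXl// prime_coprime// dvdn_prime2.
Qed.

Lemma conv_ge0 f g n : (forall a, 0<=f a) -> (forall a, 0<=g a) -> 0<=conv f g n.
Proof. by move=> f0 g0; apply: sumr_ge0=> a _; apply: sumr_ge0=> b _; rewrite !mulr_ge0. Qed.

Lemma le_conv f f' g g' n : (forall a, (0<a<=n)%N -> 0<=f a<=f' a) ->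
  (forall a, (0<a<=n)%N -> 0<=g a<=g' a) -> conv f g n<=conv f' g' n.
Proof.
move=> ff gg; apply: ler_sum_nat=> a an; apply: ler_sum_nat=> b bn.
have /andP[f0 ff'] := ff _ an; have /andP[g0 gg'] := gg _ bn.
by rewrite ler_wpM2l// ler_pM.
Qed.

Lemma le_norm_conv f f' g g' n : (forall a, (0<a<=n)%N -> `|f a| <= f' a) ->
  (forall a, (0<a<=n)%N -> `|g a| <= g' a) -> `|conv f g n| <= conv f' g' n.
Proof.
move=> ff gg; apply: le_trans (ler_norm_sum _ _ _) _; apply: ler_sum_nat=> a an.
apply: le_trans (ler_norm_sum _ _ _) _; apply: ler_sum_nat=> b bn.
by rewrite !normrM normr_nat ler_wpM2l// ler_pM// ?ff ?gg.
Qed.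

Lemma cpow_ge0 f k n : (forall a, 0<=f a) -> 0<=cpow f k n.
Proof. by move=> f0; elim: k n=> [|k IH] n /=; [rewrite /delta1 | apply: conv_ge0]. Qed.

Variable z : nat.

(** The coefficients of [log zeta], cut off at [z]; the value at a prime is 1. *)
Definition rz n : R := if (1<n<=z)%N then mangoldt n / lnn n else 0.
Definition mangoldtz n : R := if (n<=z)%N then mangoldt n else 0.

Lemma lnn_rz n : lnn n*rz n = mangoldtz n.
Proof.
rewrite /rz /mangoldtz; case: (leqP n z)=> nz; rewrite ?andbF ?mulr0// andbT.
case: (ltnP 1 n)=> n1; first by rewrite mulrC divfK// gt_eqF// lnn_gt0.
by case: n nz n1=> [|[|//]] _ _; rewrite mulr0.
Qed.

Lemma rz_ge0 n : 0<=rz n.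
Proof. by rewrite /rz; case: ifP=>// _; rewrite divr_ge0 ?mangoldt_ge0 ?lnn_ge0. Qed.

Lemma rz1 : rz 1 = 0. Proof. by []. Qed.

(* Coefficients of the Dirichlet series exp(x * sum_{n <= z} rz n n^-s); only the
   terms i <= log_2 n of the exponential series are nonzero. *)
Definition expz (x : R) n : R := \sum_(i<n.+1) x^+i / i`!%:R*cpow rz i n.

Lemma expz_widen x n N : (n<=N)%N ->
  expz x n = \sum_(i<N.+1) x^+i / i`!%:R*cpow rz i n.
Proof.
move=> nN; rewrite /expz -(big_mkord xpredT (fun i=> x^+i / i`!%:R*cpow rz i n)).
rewrite -(big_mkord xpredT (fun i=> x^+i / i`!%:R*cpow rz i n)).
rewrite [RHS](@big_cat_nat _ _ _ n.+1)//= [X in _+X]big_nat.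
rewrite [X in _+X]big1 ?addr0// => i /andP[ni _].
rewrite cpow_trunc_small ?mulr0// (leq_trans (ltn_expl n (ltnSn 1)))//.
by rewrite leq_exp2l// ltnW.
Qed.

Lemma expz1 x : expz x 1 = 1.
Proof.
rewrite /expz !big_ord_recl big_ord0/= addr0 /delta1 eqxx fact0 expr0 invr1 !mulr1.
by rewrite conv_at1 rz1 mul0r mulr0 addr0.
Qed.

(** The derivative of [exp(x P)] is [x P' exp(x P)]. As [lnn n] is positive for [n > 1], this
    determines the coefficients recursively and opens the way to strong induction on [n]. *)
Lemma expz_rec x n : lnn n * expz x n = x*conv mangoldtz (expz x) n.
Proof.
rewrite /expz big_ord_recl/= mulrDr.
rewrite [X in X + _](_ : _ = 0) ?add0r; last first.
  by rewrite /delta1; case: (n =P 1%N)=> [->|_]; rewrite /lnn ?ln1 ?mul0r ?mulr0.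
have -> : conv mangoldtz (expz x) n =
    conv (fun y=> \sum_(i<n.+1) x^+i / i`!%:R*cpow rz i y) mangoldtz n.
  by rewrite convC; apply: eq_conv=>// a /andP[_ an]; exact: expz_widen.
rewrite conv_suml big_ord_recr/= convZl.
(* The top power in the sum vanishes at all arguments up to [n], because [n < 2^n]. *)
rewrite [X in _ + _*X](_ : _ = 0) ?mulr0 ?addr0; last first.
  rewrite /conv big1_seq// => a; rewrite mem_index_iota=> /andP[_ /andP[a0 an]].
  rewrite big1_seq// => b _; rewrite cpow_trunc_small ?mul0r ?mulr0//.
  by rewrite (leq_trans _ (ltn_expl n (ltnSn 1))).
rewrite !big_distrr/=; apply: eq_bigr=> i _.
rewrite convZl [conv _ mangoldtz _]convC mulrCA cpow_derivation.
rewrite [in LHS](@eq_conv _ _ mangoldtz _ (cpow rz i))//; last by move=> a _; rewrite lnn_rz.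
rewrite /bump/= add1n factS natrM invfM exprS.
have : i.+1%:R != 0 :> R by rewrite pnatr_eq0.
have : i`!%:R != 0 :> R by rewrite pnatr_eq0 -lt0n fact_gt0.
rewrite add0n; move: (i`!%:R) (i.+1%:R)=> a b a0 b0.
by field; rewrite a0 b0.
Qed.

Lemma sum_mangoldt_dvd n : (0<n)%N -> \sum_(1<=d<n.+1 | (d %| n)%N) mangoldt d = lnn n.
Proof.
move=> n0; rewrite -conv_mangoldt_one// conv_divisors//.
by apply: eq_bigr=> d _; rewrite mulr1.
Qed.

Lemma mangoldt_le_lnn n : mangoldt n<=lnn n.
Proof.
case: n=> [|n]; first by rewrite /mangoldt /lnn ln0.
rewrite -(@sum_mangoldt_dvd n.+1)// big_mkcond/= (bigD1_seq n.+1) ?iota_uniq//=; last first.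
  by rewrite mem_index_iota /= ltnS leqnn.
by rewrite dvdnn lerDl sumr_ge0// => d _; case: ifP=>// _; exact: mangoldt_ge0.
Qed.

(* A strong-induction principle shared by all coefficient bounds: a weighted average of
   values at proper divisors, with total weight at most ln n. *)
Lemma conv_le_rec (w F : nat -> R) n (B : R) : (1<n)%N ->
  (forall d, 0<=w d<=mangoldt d) -> 0<=B ->
  (forall d, (1<d)%N -> (d %| n)%N -> w d != 0 -> `|F (n %/ d)%N| <= B) ->
  `|conv w F n| <= lnn n*B.
Proof.
move=> n1 w0 B0 FB; have n0: (0<n)%N by exact: ltnW.
rewrite conv_divisors// -sum_mangoldt_dvd// big_distrl/=.
apply: le_trans (ler_norm_sum _ _ _) _.
rewrite big_seq_cond [X in _<=X]big_seq_cond.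
apply: ler_sum=> d; rewrite mem_index_iota=> /andP[/andP[d0 _] dn].
have [wd0|wd] := eqVneq (w d) 0.
  by rewrite wd0 mul0r normr0 mulr_ge0// mangoldt_ge0.
have /andP[w0d wm] := w0 d.
rewrite normrM (ger0_norm w0d) ler_pM//.
have d1: (1<d)%N.
  case: (d =P 1%N)=> [d1|]; last by lia.
  by move: wm wd; rewrite d1 mangoldt1=> wm /negP[]; rewrite eq_le wm -d1 w0d.
exact: FB.
Qed.
End Mangoldt.

(** * Coefficient bounds for the mollified zeta function *)

Section CoefBounds.
Variables (R : realType) (z : nat).
Implicit Types (f g h F : nat -> R) (n k : nat).

Let mz := @mangoldtz R z.

Definition mangoldt_gt n : R := if (n<=z)%N then 0 else mangoldt R n.

Lemma mangoldt_split n : mangoldt R n = mz n+mangoldt_gt n.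
Proof. by rewrite /mz /mangoldtz /mangoldt_gt; case: ifP; rewrite ?addr0 ?add0r. Qed.

Lemma mangoldt_gtP n : 0<=mangoldt_gt n<=mangoldt R n.
Proof. by rewrite /mangoldt_gt; case: ifP; rewrite ?lexx !mangoldt_ge0. Qed.

Lemma mangoldtzP n : 0<=mz n<=mangoldt R n.
Proof. by rewrite /mz /mangoldtz; case: ifP; rewrite ?lexx !mangoldt_ge0. Qed.

Lemma expz_ge0 n : 0<=expz z (1 : R) n.
Proof.
apply: sumr_ge0=> i _; rewrite expr1n mulr_ge0// ?divr_ge0// cpow_ge0// => a.
exact: rz_ge0.
Qed.

Lemma expz0 (x : R) : expz z x 0 = 0.
Proof. by rewrite /expz big_ord1 /= /delta1 mulr0. Qed.

(** In [expz_rec] the weights at the divisors of [n] add up to at most [lnn n], so the bound 1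
    passes from smaller arguments to [n]. *)
Lemma norm_expz_le1 (x : R) n : `|x| <= 1 -> `|expz z x n| <= 1.
Proof.
move=> x1; elim/ltn_ind: n=> -[|[|n]] IH; first by rewrite expz0 normr0.
  by rewrite expz1 normr1.
have l0: 0<lnn R n.+2 by exact: lnn_gt0.
rewrite -(ler_pM2l l0) mulr1 -{1}(ger0_norm (ltW l0)) -normrM expz_rec normrM.
rewrite -[X in _<=X]mulr1 -[X in _<=X]mul1r ler_pM//.
apply: conv_le_rec=>// d; first exact: mangoldtzP.
move=> d1 dn _; apply: IH; exact: ltn_Pdiv.
Qed.

(** The Dirichlet series is zeta divided by the exponential of the prime sum up to [z]; formally,
    the exponential of the part [n > z] of [log zeta]. It is what mollification leaves of zeta. *)
Definition cz : nat -> R := conv (one_fun R) (expz z (-1)).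

Lemma cz1 : cz 1 = 1.
Proof. by rewrite /cz conv_at1 expz1 mulr1. Qed.

Lemma lnn_one n : (0<n)%N -> lnn R n * one_fun R n = conv (mangoldt R) (one_fun R) n.
Proof. by move=> n0; rewrite conv_mangoldt_one// mulr1. Qed.

(** Logarithmic derivatives add up: the part [n <= z] of [mangoldt] contributed by zeta cancels
    against the mollifier. *)
Lemma cz_rec n : lnn R n*cz n = conv mangoldt_gt cz n.
Proof.
rewrite /cz conv_derivation.
rewrite (@eq_conv _ (fun x=> lnn R x * one_fun R x) (conv (mangoldt R) (one_fun R)) _ (expz z (-1)))//;
  last by move=> a /andP[a0 _]; exact: lnn_one.
rewrite [X in _+X](@eq_conv _ _ (one_fun R) _ (fun x=> -1*conv mz (expz z (-1)) x))//;
  last by move=> a _; rewrite expz_rec.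
rewrite convA [X in _+X]convC convZl convA.
rewrite [X in _ + _*X](@eq_conv _ _ mz _ (conv (one_fun R) (expz z (-1))))//;
  last by move=> a _; rewrite convC.
rewrite mulN1r (@eq_conv _ (mangoldt R) (fun x=> mz x+mangoldt_gt x) _
   (conv (one_fun R) (expz z (-1))))//; last by move=> a _; rewrite mangoldt_split.
by rewrite convDl addrAC subrr add0r.
Qed.

Lemma cz0 : cz 0 = 0. Proof. exact: conv0. Qed.

Lemma cz_ge0 n : 0<=cz n.
Proof.
elim/ltn_ind: n=> -[|[|n]] IH; first by rewrite cz0.
  by rewrite cz1.
have l0: 0<lnn R n.+2 by exact: lnn_gt0.
rewrite -(pmulr_rge0 _ l0) cz_rec conv_divisors// big_seq_cond sumr_ge0// => d.
rewrite mem_index_iota=> /andP[/andP[d0 _] dn].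
have [d1|d1] := eqVneq d 1%N.
  by rewrite d1 /mangoldt_gt mangoldt1 if_same mul0r.
have /andP[m0 _] := mangoldt_gtP d.
by rewrite mulr_ge0// IH// ltn_Pdiv//; lia.
Qed.

Lemma cz_small n : (1<n<=z)%N -> cz n = 0.
Proof.
move=> /andP[n1 nz]; have l0 := lnn_gt0 R n1.
apply: (mulfI (lt0r_neq0 l0)); rewrite cz_rec mulr0 conv_divisors ?(ltnW n1)//.
rewrite big1_seq// => d /andP[dn _]; rewrite /mangoldt_gt.
by rewrite (leq_trans (dvdn_leq _ dn) nz) ?mul0r// ltnW.
Qed.

Lemma cpow_cz_rec k n : lnn R n*cpow cz k n = k%:R*conv mangoldt_gt (cpow cz k) n.
Proof.
case: k=> [|k].
  by rewrite mul0r /= /delta1; case: (n =P 1%N)=> [->|_]; rewrite /lnn ?ln1 ?mul0r ?mulr0.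
rewrite cpow_derivation; congr (_ * _).
rewrite (@eq_conv _ _ (conv mangoldt_gt cz) _ (cpow cz k))//; last by move=> a _; rewrite cz_rec.
by rewrite convA.
Qed.

Lemma cpow_cz1 k : cpow cz k 1 = 1.
Proof. by elim: k=> [|k IH] /=; rewrite ?/delta1 ?eqxx// conv_at1 IH cz1 mulr1. Qed.

(** Each step of the recursion divides [n] by some [d > z] and so lowers the bound by the factor
    [z^rho], which pays for the factor [k] in front. Powers as high as [z^rho] thus cost only
    [n^rho]; this is what permits very high moments later. *)
Lemma cpow_cz_le k n (rho : R) : (0<z)%N -> (0<n)%N -> 0<=rho ->
  k%:R<=z%:R`^rho -> cpow cz k n<=n%:R`^rho.
Proof.
move=> z0+rho0 kz; elim/ltn_ind: n=> n IH n0.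
have [->|n1'] := eqVneq n 1%N; first by rewrite cpow_cz1 powR1.
have n1: (1<n)%N by lia.
have l0 := lnn_gt0 R n1.
have zr0: 0<z%:R`^rho by rewrite powR_gt0 ?ltr0n.
rewrite -(ler_pM2l l0) cpow_cz_rec.
have B: `|conv mangoldt_gt (cpow cz k) n| <= lnn R n*(n%:R`^rho / z%:R`^rho).
  apply: (conv_le_rec n1 mangoldt_gtP); first by rewrite divr_ge0 ?powR_ge0.
  move=> d d1 dn wd.
  have zd: (z<d)%N by move: wd; rewrite /mangoldt_gt; case: leqP=>//; rewrite eqxx.
  have nd0: (0<n %/ d)%N by rewrite divn_gt0 ?(ltnW d1)// dvdn_leq.
  rewrite ger0_norm ?cpow_ge0//; last exact: cz_ge0.
  apply: le_trans (IH _ _ nd0) _; first exact: ltn_Pdiv.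
  rewrite ler_pdivlMr// -powRM// ge0_ler_powR ?nnegrE// -natrM ler_nat.
  by rewrite -{2}(divnK dn) leq_mul2l ltnW ?orbT.
rewrite ger0_norm in B; last first.
  by apply: conv_ge0=> a; [case/andP: (mangoldt_gtP a)|apply: cpow_ge0=> b; exact: cz_ge0].
apply: le_trans (ler_wpM2l (ler0n _ _) B) _.
rewrite mulrCA ler_wpM2l ?(ltW l0)// mulrCA -[X in _<=X]mulr1 ler_wpM2l ?powR_ge0//.
by rewrite ler_pdivrMr ?mul1r.
Qed.

Lemma cz_le1 n : (0<z)%N -> cz n<=1.
Proof.
move=> z0; case: n=> [|n]; first by rewrite cz0.
have := @cpow_cz_le 1 n.+1 0 z0 isT (lexx _).
rewrite !powRr0=> /(_ (lexx _)) /=; rewrite convC conv1l//.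
Qed.

(** The exponential series stopped at degree [I]. Its Dirichlet series is a polynomial, of length
    [z^I], yet its coefficients are those of the full exponential below [2^I]. *)
Definition mI I n : R := \sum_(i<I.+1) (-1)^+i / i`!%:R*cpow (rz R z) i n.

Lemma mI_eq I n : (n<2 ^ I)%N -> mI I n = expz z (-1) n.
Proof.
move=> nI; pose N := maxn n I.
rewrite (@expz_widen _ _ _ n N) ?leq_maxl// /mI.
rewrite -(big_mkord xpredT (fun i=> (-1)^+i / i`!%:R*cpow (rz R z) i n)).
rewrite -(big_mkord xpredT (fun i=> (-1)^+i / i`!%:R*cpow (rz R z) i n)).
rewrite [RHS](@big_cat_nat _ _ _ I.+1) ?ltnS ?leq_maxr//= [X in _+X]big_nat.
rewrite [X in _+X]big1 ?addr0// => i /andP[ni _].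
rewrite cpow_trunc_small ?mulr0// (leq_trans nI)//.
by rewrite leq_exp2l// ltnW.
Qed.

Lemma norm_mI_le1 I n : `|mI I n| <= 1.
Proof.
apply: le_trans (ler_norm_sum _ _ _) _.
apply: le_trans (_ : expz z (1 : R) n<=_); last first.
  have := @norm_expz_le1 1 n; rewrite normr1 lexx=> /(_ isT).
  by rewrite ger0_norm// expz_ge0.
pose N := maxn n I; rewrite (@expz_widen _ _ _ n N) ?leq_maxl//.
rewrite -(big_mkord xpredT (fun i=> `|(-1)^+i / i`!%:R*cpow (rz R z) i n|)).
rewrite -(big_mkord xpredT (fun i=> 1^+i / i`!%:R*cpow (rz R z) i n)).
rewrite [X in _<=X](@big_cat_nat _ _ _ I.+1) ?ltnS ?leq_maxr//=.
have c0 i : 0<=cpow (rz R z) i n by apply: cpow_ge0=> a; exact: rz_ge0.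
rewrite -[X in X<=_]addr0 lerD//.
  apply: ler_sum=> i _; rewrite !normrM normrX normrN1 !expr1n ger0_norm ?invr_ge0//.
  by rewrite (ger0_norm (c0 i)).
by apply: sumr_ge0=> i _; rewrite expr1n mulr_ge0// divr_ge0.
Qed.

End CoefBounds.

(** * The divisor bound *)

Section DivisorBound.
Variable R : realType.
Definition dvn : nat -> R := conv (one_fun R) (one_fun R).

Lemma dvn_rec n : lnn R n*dvn n = 2*conv (mangoldt R) dvn n.
Proof.
rewrite /dvn conv_derivation [X in _+X]convC.
rewrite (@eq_conv _ _ (conv (mangoldt R) (one_fun R)) _ (one_fun R))//;
  last by move=> a /andP[a0 _]; exact: lnn_one.
by rewrite convA mulr2n mulrDl mul1r.
Qed.

Lemma dvn_le n : (0<n)%N -> dvn n<=n%:R.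
Proof.
move=> n0; rewrite /dvn conv_divisors// big_mkcond/=.
apply: le_trans (_ : \sum_(1<=i<n.+1) 1<=_).
  by apply: ler_sum=> i _; rewrite /one_fun mulr1; case: ifP.
by rewrite big_const_nat iter_addr_0 subSS subn0.
Qed.

(** Passing from [n] to [n / d] in [dvn_rec] gains [d^-e]. For [d > E0] this is at most 1/8; the
    smaller [d] have total weight at most [K], which is below [lnn n / 8] once [n > n0]. The sum
    [lnn n / 4] leaves room for the factor 2 of the recursion. Up to [n0] the trivial bound
    [dvn n <= n] serves. *)
Lemma divisor_bound (e : R) : 0<e ->
  exists2 C : R, 1<=C & forall n, (0<n)%N -> dvn n<=C*n%:R`^e.
Proof.
move=> e0.
set E0 := (Num.truncn (8`^e^-1)).+1.
set K : R := \sum_(1<=d<E0.+1) mangoldt R d.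
have K0: 0<=K by apply: sumr_ge0=> d _; exact: mangoldt_ge0.
set n0 := (Num.truncn (expR (8*K))).+2.
exists n0%:R; first by rewrite ler1n.
move=> n; elim/ltn_ind: n=> n IH npos.
have [nn0|nn0] := leqP n n0.
  apply: le_trans (dvn_le npos) _; rewrite -[X in X<=_]mulr1 ler_pM// ?ler_nat//.
  by rewrite -[X in X<=_](powRr0 n%:R) ler_powR ?ler1n// ltW.
have n1: (1<n)%N by lia.
have l0 := lnn_gt0 R n1.
have lK: 8*K<=lnn R n.
  rewrite -ler_expR /lnn lnK ?posrE ?ltr0n//.
  apply: ltW; apply: lt_le_trans (truncnS_gt _) _.
  by rewrite ler_nat; apply: leq_trans (ltnW nn0); rewrite leqnSn.
clearbody n0.
rewrite -(ler_pM2l l0) dvn_rec conv_divisors//.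
have key: \sum_(1<=d<n.+1 | (d %| n)%N) mangoldt R d*(d%:R`^(- e))<=lnn R n/4.
  apply: le_trans (_ : K+lnn R n/8<=_); last by lra.
  have dle1 d : (0<d)%N -> d%:R`^(- e)<=1 :> R.
    by move=> d0; rewrite -[X in _<=X](powRr0 d%:R) ler_powR ?oppr_le0 ?ler1n ?(ltW e0).
  rewrite (bigID (fun d=> d<=E0)%N)/=; apply: lerD.
    rewrite big_mkcond/= /K; apply: le_trans (_ : \sum_(1<=d<(maxn n E0).+1)
        (if (d<=E0)%N then mangoldt R d else 0)<=_).
      rewrite [X in _<=X](@big_cat_nat _ _ _ n.+1) ?ltnS ?leq_maxl//=.
      rewrite -[X in X<=_]addr0 lerD//; last first.
        by apply: sumr_ge0=> d _; case: ifP=>// _; exact: mangoldt_ge0.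
      apply: ler_sum_nat=> d /andP[d0 _]; case: ifP=> [/andP[_ ->]|_].
        by rewrite -[X in _<=X]mulr1 ler_wpM2l ?mangoldt_ge0 ?dle1.
      by case: ifP=>// _; exact: mangoldt_ge0.
    rewrite [X in X<=_](@big_cat_nat _ _ _ E0.+1) ?ltnS ?leq_maxr//=.
    rewrite [X in _+X<=_]big_nat [X in _+X<=_]big1 ?addr0; last first.
      by move=> d /andP[]; rewrite ltnNge=> /negbTE ->.
    by apply: ler_sum_nat=> d /andP[_]; rewrite ltnS=> ->.
  rewrite -sum_mangoldt_dvd// big_distrl/= big_mkcond [X in _<=X]big_mkcond/=.
  apply: ler_sum_nat=> d /andP[d0 _]; case: ifP=> [/andP[-> dE]|_]; last first.
    by case: ifP=>// _; rewrite divr_ge0 ?mangoldt_ge0.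
  rewrite ler_wpM2l ?mangoldt_ge0// powRN lef_pV2 ?posrE ?powR_gt0 ?ltr0n//.
  have : 8`^e^-1<=d%:R :> R.
    by apply: ltW; apply: lt_le_trans (truncnS_gt _) _; rewrite ler_nat -/E0; lia.
  move=> /(ge0_ler_powR (ltW e0)); rewrite !nnegrE powR_ge0 ler0n=> /(_ isT isT).
  by rewrite -powRrM mulVf ?gt_eqF// powRr1.
apply: le_trans (_ : 2*(n0%:R*n%:R`^e*(lnn R n/4))<=_); last first.
  have := @powR_ge0 R n%:R e; have : 0<=n0%:R :> R by [].
  move: (n0%:R : R) (n%:R`^e)=> a b a0 b0.
  have := mulr_ge0 (mulr_ge0 a0 b0) (ltW l0).
  by lra.
rewrite ler_wpM2l//; apply: le_trans (ler_wpM2l _ key); last first.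
  by rewrite mulr_ge0// powR_ge0.
rewrite big_distrr/= big_mkcond [X in _<=X]big_mkcond/=.
apply: ler_sum_nat=> d /andP[d0 dn']; case: ifP=>// dn.
have [d1|d1] := eqVneq d 1%N; first by rewrite d1 mangoldt1 !mul0r mulr0.
rewrite mulrCA ler_wpM2l ?mangoldt_ge0//.
have nd0: (0<n %/ d)%N by rewrite divn_gt0// (dvdn_leq npos dn).
apply: le_trans (IH _ _ nd0) _; first by rewrite ltn_Pdiv//; lia.
rewrite -mulrA ler_wpM2l// -{2}(divnK dn) natrM powRM// -mulrA.
rewrite -powRD ?subrr ?powRr0 ?mulr1//.
by apply/implyP=> _; rewrite pnatr_eq0; lia.
Qed.
End DivisorBound.

(** * The complex modulus and the functions n^(-s-it) *)

Section ComplexBasics.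
Variable R : realType.
Implicit Types (x y t : R) (u v : R[i]).

(** The modulus with values in [R] instead of [R[i]], so that real inequalities apply to it
    directly. *)
Definition nrm u : R := Normc.normc u.
Definition cis x : R[i] := cos x +i* sin x.

Lemma nrmM u v : nrm (u * v) = nrm u*nrm v. Proof. exact: Normc.normcM. Qed.
Lemma nrmD u v : nrm (u+v)<=nrm u+nrm v. Proof. exact: le_normcD. Qed.
Lemma nrmN u : nrm (- u) = nrm u. Proof. exact: normcN. Qed.
Lemma nrm0 : nrm 0 = 0. Proof. exact: Normc.normc0. Qed.
Lemma nrm1 : nrm 1 = 1. Proof. exact: Normc.normc1. Qed.
Lemma nrmV u : nrm u^-1=(nrm u)^-1. Proof. exact: Normc.normcV. Qed.
Lemma nrm_ge0 u : 0<=nrm u. Proof. by case: u=> a b; exact: sqrtr_ge0. Qed.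
Lemma nrm_sqr u : nrm u^+2 = Re u^+2+Im u^+2.
Proof. by case: u=> a b /=; rewrite sqr_sqrtr// addr_ge0 ?sqr_ge0. Qed.
Lemma nrmB u v : nrm (u-v)<=nrm u+nrm v. Proof. by rewrite -(nrmN v) nrmD. Qed.
Lemma nrmBC u v : nrm (u-v) = nrm (v-u). Proof. by rewrite -nrmN opprB. Qed.
Lemma nrm_leB u v : nrm u-nrm v<=nrm (u-v).
Proof. by rewrite lerBlDr -{1}(subrK v u) nrmD. Qed.
Lemma nrmX u n : nrm (u^+n) = nrm u^+n.
Proof. by elim: n=> [|n IH]; rewrite ?expr0 ?nrm1// !exprS nrmM IH. Qed.
Lemma nrmC x : nrm x%:C = `|x|.
Proof. by rewrite /nrm /= expr0n addr0 sqrtr_sqr. Qed.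
Lemma nrm_real_ge0 x : 0<=x -> nrm x%:C = x. Proof. by move=> x0; rewrite nrmC ger0_norm. Qed.
Lemma nrm_nat n : nrm n%:R = n%:R.
Proof. by rewrite -(rmorph_nat (real_complex R)) nrm_real_ge0. Qed.
Lemma nrm_sum (I : Type) (s : seq I) (P : pred I) (F : I -> R[i]) :
  nrm (\sum_(i <- s | P i) F i) <= \sum_(i <- s | P i) nrm (F i).
Proof.
elim/big_rec2: _=> [|i a b _ ab]; first by rewrite nrm0.
by apply: le_trans (nrmD _ _) _; rewrite lerD2l.
Qed.
Lemma Re_le_nrm u : `|Re u| <= nrm u.
Proof. by rewrite -(ger0_norm (nrm_ge0 u)) -!sqrtr_sqr ler_wsqrtr// nrm_sqr lerDl sqr_ge0. Qed.
Lemma Im_le_nrm u : `|Im u| <= nrm u.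
Proof. by rewrite -(ger0_norm (nrm_ge0 u)) -!sqrtr_sqr ler_wsqrtr// nrm_sqr lerDr sqr_ge0. Qed.
Lemma nrm_le_ReIm u : nrm u<=`|Re u| + `|Im u|.
Proof.
rewrite -ler_sqr ?nnegrE ?addr_ge0 ?nrm_ge0// nrm_sqr -(real_normK (num_real (Re u))) -(real_normK (num_real (Im u))).
by have := mulr_ge0 (normr_ge0 (Re u)) (normr_ge0 (Im u)); move: `|Re u| `|Im u| => a b; nra.
Qed.
Lemma ReD u v : Re (u+v) = Re u+Re v. Proof. by case: u; case: v. Qed.
Lemma ImD u v : Im (u+v) = Im u+Im v. Proof. by case: u; case: v. Qed.
Lemma ReN u : Re (- u) = - Re u. Proof. by case: u. Qed.
Lemma ImN u : Im (- u) = - Im u. Proof. by case: u. Qed.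
Lemma Re_sum (I : Type) (s : seq I) (P : pred I) (F : I -> R[i]) :
  Re (\sum_(i <- s | P i) F i) = \sum_(i <- s | P i) Re (F i).
Proof. by elim/big_rec2: _=>// i a b _ <-; rewrite ReD. Qed.
Lemma Im_sum (I : Type) (s : seq I) (P : pred I) (F : I -> R[i]) :
  Im (\sum_(i <- s | P i) F i) = \sum_(i <- s | P i) Im (F i).
Proof. by elim/big_rec2: _=>// i a b _ <-; rewrite ImD. Qed.
Lemma ReZ x u : Re (x%:C*u) = x*Re u.
Proof. by case: u=> a b /=; rewrite mul0r subr0. Qed.
Lemma ImZ x u : Im (x%:C*u) = x*Im u.
Proof. by case: u=> a b /=; rewrite mul0r addr0. Qed.

Lemma cisD x y : cis (x+y) = cis x*cis y.
Proof.
apply/eqP; rewrite eq_complex /cis /= cosD sinD eqxx/=.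
by rewrite addrC eqxx.
Qed.
Lemma cis0 : cis 0 = 1. Proof. by rewrite /cis cos0 sin0. Qed.
Lemma nrm_cis x : nrm (cis x) = 1.
Proof. by rewrite /nrm /cis /= cos2Dsin2 sqrtr1. Qed.

Definition nit t n : R[i] := cis (- (t * lnn R n)).

Lemma nitM t m n : (0<m)%N -> (0<n)%N -> nit t (m*n) = nit t m*nit t n.
Proof. by move=> m0 n0; rewrite /nit lnnM// mulrDr opprD cisD. Qed.
Lemma nrm_nit t n : nrm (nit t n) = 1. Proof. exact: nrm_cis. Qed.

Definition nst (s t : R) n : R[i] := (n%:R`^(- s))%:C*nit t n.

Lemma nstM s t m n : (0<m)%N -> (0<n)%N -> nst s t (m*n) = nst s t m*nst s t n.
Proof.
by move=> m0 n0; rewrite /nst nitM// natrM powRM// rmorphM/=; ring.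
Qed.
Lemma nrm_nst s t n : nrm (nst s t n) = n%:R`^(- s).
Proof. by rewrite /nst nrmM nrm_nit mulr1 nrm_real_ge0// powR_ge0. Qed.
Lemma nst1 s t : nst s t 1 = 1.
Proof. by rewrite /nst /nit /lnn ln1 mulr0 oppr0 cis0 mulr1 powR1. Qed.

Lemma nrm_sqr_trigsum (J : finType) (b x : J -> R) :
  nrm (\sum_j (b j)%:C*cis (x j))^+2 = \sum_j \sum_l b j*b l*cos (x j-x l).
Proof.
rewrite nrm_sqr Re_sum Im_sum.
under eq_bigr do rewrite ReZ /=.
under [X in _+X^+2]eq_bigr do rewrite ImZ /=.
rewrite !expr2 !big_distrlr/= -big_split/=; apply: eq_bigr=> j _.
by rewrite -big_split/=; apply: eq_bigr=> l _; rewrite cosB; ring.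
Qed.
End ComplexBasics.

(** * Averages over [T, 2T] *)

Section Expectation.
Variables (R : realType) (T : R).
Hypothesis T0 : 0<T.
Implicit Types (f g : R -> R) (A : set R).
Local Notation mu := (@lebesgue_measure R).

Definition Ex f : R := T^-1 * \int[mu]_(t in `[T, 2*T]) f t.
(** A class closed under ring operations and sufficient for integrability on the segment, so that
    linearity and monotonicity of [Ex] share one side condition. *)
Definition bm f := measurable_fun [set: R] f /\
  exists M : R, forall t, T<=t<=2*T -> `|f t| <= M.

Lemma mu_seg : mu `[T, 2*T] = T%:E.
Proof.
have T2: T<2*T by move: T0; lra.
by rewrite lebesgue_measure_itv/= lte_fin T2 -EFinB; congr EFin; ring.
Qed.

Lemma bm_integrable f : bm f -> mu.-integrable `[T, 2*T] (EFin \o f).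
Proof.
move=> [mf [M fM]]; apply: measurable_bounded_integrable=>//.
- by rewrite [X in (X<_)%E]mu_seg ltry.
- exact: measurable_funTS.
- exists M; split; rewrite ?num_real// => x Mx t /=; rewrite in_itv/= => tT.
  by apply: le_trans (fM _ tT) (ltW Mx).
Qed.

Lemma bm_cst (r : R) : bm (fun=> r).
Proof. by split; [exact: measurable_cst|exists `|r|]. Qed.

Lemma bmD f g : bm f -> bm g -> bm (fun t=> f t+g t).
Proof.
move=> [mf [M fM]] [mg [N gN]]; split; first exact: measurable_funD.
exists (M+N)=> t tT; apply: le_trans (ler_normD _ _) _; rewrite lerD ?fM ?gN//.
Qed.

Lemma bmM f g : bm f -> bm g -> bm (fun t=> f t * g t).
Proof.
move=> [mf [M fM]] [mg [N gN]]; split; first exact: measurable_funM.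
by exists (M*N)=> t tT; rewrite normrM ler_pM ?fM ?gN.
Qed.

Lemma bmX f n : bm f -> bm (fun t=> f t^+n).
Proof.
move=> bf; elim: n=> [|n IH]; first by under eq_fun do rewrite expr0; exact: bm_cst.
by under eq_fun do rewrite exprS; exact: bmM.
Qed.

Lemma bmZ (r : R) f : bm f -> bm (fun t=> r * f t).
Proof. by move=> bf; apply: bmM=>//; exact: bm_cst. Qed.

Lemma bm_sum (I : Type) (s : seq I) (F : I -> R -> R) :
  (forall i, bm (F i)) -> bm (fun t=> \sum_(i <- s) F i t).
Proof.
move=> bF; elim: s=> [|i s IH]; first by under eq_fun do rewrite big_nil; exact: bm_cst.
by under eq_fun do rewrite big_cons; exact: bmD.
Qed.

Lemma bm_cont f : continuous f -> (exists M, forall t, `|f t| <= M) -> bm f.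
Proof.
move=> cf [M fM]; split; last by exists M=> t _.
exact: continuous_measurable_fun.
Qed.

Lemma bm_cos (w p : R) : bm (fun t=> cos (w * t+p)).
Proof.
apply: bm_cont; last by exists 1=> t; rewrite ler_norml cos_geN1 cos_le1.
move=> t; apply: continuous_comp; last exact: continuous_cos.
apply: cvgD; last exact: cvg_cst.
by apply: cvgM; [exact: cvg_cst|exact: cvg_id].
Qed.

Lemma bm_indic A : measurable A -> bm (\1_A).
Proof.
move=> mA; split; first exact: measurable_indic.
by exists 1=> t _; rewrite indicE; case: (t \in A); rewrite ?normr1 ?normr0.
Qed.

Lemma ExD f g : bm f -> bm g -> Ex (fun t=> f t+g t) = Ex f+Ex g.
Proof.
by move=> bf bg; rewrite /Ex RintegralD ?mulrDr//; exact: bm_integrable.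
Qed.

Lemma ExZ (r : R) f : bm f -> Ex (fun t=> r * f t) = r*Ex f.
Proof. move=> bf; have i := bm_integrable bf.
have e: \int[mu]_(t in `[T, 2*T]) (r * f t) = r * \int[mu]_(t in `[T, 2*T]) f t by exact: RintegralZl.
by rewrite /Ex e mulrCA. Qed.

Lemma Ex_sum (I : Type) (s : seq I) (F : I -> R -> R) : (forall i, bm (F i)) ->
  Ex (fun t=> \sum_(i <- s) F i t) = \sum_(i <- s) Ex (F i).
Proof.
move=> bF; elim: s=> [|i s IH].
  rewrite big_nil /Ex; under eq_Rintegral do rewrite big_nil.
  by rewrite Rintegral_cst// mul0r mulr0.
rewrite big_cons -IH -ExD//; last exact: bm_sum.
by congr (_ * _); apply: eq_Rintegral=> t _; rewrite big_cons.
Qed.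

Lemma Ex_cst (r : R) : Ex (fun=> r) = r.
Proof. by rewrite /Ex Rintegral_cst// [X in fine X]mu_seg/= mulrCA mulVf ?gt_eqF// mulr1. Qed.

Lemma eq_Ex f g : (forall t, T<=t<=2*T -> f t = g t) -> Ex f = Ex g.
Proof.
move=> fg; congr (_ * _); apply: eq_Rintegral=> t; rewrite inE/= in_itv/= => tT.
exact: fg.
Qed.

Lemma Ex_le f g : bm f -> bm g -> (forall t, T<=t<=2*T -> f t<=g t) ->
  Ex f<=Ex g.
Proof.
move=> bf bg fg; rewrite /Ex ler_pM2l ?invr_gt0//; apply: le_Rintegral=>//.
- exact: bm_integrable.
- exact: bm_integrable.
Qed.

Lemma Ex_ge0 f : (forall t, T<=t<=2*T -> 0<=f t) -> 0<=Ex f.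
Proof.
move=> f0; rewrite /Ex mulr_ge0 ?invr_ge0 ?(ltW T0)//; apply: Rintegral_ge0=> t /=.
by rewrite in_itv/=; exact: f0.
Qed.

Lemma Ex_indic A : measurable A -> Ex (\1_A) = T^-1 * fine (mu (A `&` `[T, 2*T])).
Proof.
by move=> mA; rewrite /Ex /Rintegral integral_indic.
Qed.

Lemma Ex_cos_le (w : R) : w != 0 -> `|Ex (fun t=> cos (t*w))| <= 2/(T * `|w|).
Proof.
move=> w0.
have T2: T<2*T by move: T0; lra.
pose F : R -> R := w^-1 \*: (sin \o (w \*: (@id R))).
have dF (t : R) : is_derive t (1 : R) F (cos (t*w)).
  have h: is_derive t (1 : R) (w \*: (@id R)) (w *: (1 : R)) by exact: is_deriveZ.
  have := is_deriveZ w^-1 (is_derive1_comp (is_derive_sin _) h).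
  rewrite /= [w *: 1]mulr1=> d; apply: (is_derive_eq d).
  by rewrite /GRing.scale/= [w * t]mulrC mulrCA mulVf ?mulr1.
have cF (t : R) : {for t, continuous F}.
  by apply/differentiable_continuous/derivable1_diffP; exact: (@ex_derive _ _ _ _ _ _ _ (dF t)).
have cc: continuous (fun t : R=> cos (t*w)).
  move=> t; apply: continuous_comp; last exact: continuous_cos.
  by apply: cvgM; [exact: cvg_id|exact: cvg_cst].
have -> : Ex (fun t=> cos (t*w)) = T^-1*(F (2*T)-F T).
  congr (_ * _); rewrite /Rintegral (@continuous_FTC2 _ (fun t=> cos (t*w)) F _ _ T2)//.
  - exact: continuous_subspaceT.
  - split; first by move=> t _; exact: (@ex_derive _ _ _ _ _ _ _ (dF t)).
    + by apply: cvg_at_right_filter; exact: cF.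
    + by apply: cvg_at_left_filter; exact: cF.
  - by move=> t _; rewrite derive1E; exact: (@derive_val _ _ _ _ _ _ _ (dF t)).
have FB t : `|F t| <= `|w|^-1.
  rewrite /F /= normrM normfV -[X in _<=X]mulr1 ler_wpM2l ?invr_ge0//.
  by rewrite ler_norml sin_geN1 sin_le1.
rewrite normrM ger0_norm ?invr_ge0 ?(ltW T0)// invfM mulrCA ler_wpM2l ?invr_ge0 ?(ltW T0)//.
apply: le_trans (ler_normB _ _) _; have := FB T; have := FB (2*T); lra.
Qed.

End Expectation.

(** * Mean values of Dirichlet polynomials *)

Section MeanValue.
Variables (R : realType) (T : R).
Hypothesis T0 : 0<T.

Lemma lnn_diff (m n N : nat) : (0<m)%N -> (0<n)%N -> (m<=N)%N -> (n<=N)%N ->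
  `|m%:R-n%:R : R| / N%:R<=`|lnn R m-lnn R n|.
Proof.
wlog mn : m n/(m<=n)%N=> [W m0 n0 mN nN|m0 n0 mN nN].
  have [mn|/ltnW nm] := leqP m n; first exact: W.
  by rewrite distrC [X in _<=X]distrC; exact: W.
have m0': 0<m%:R :> R by rewrite ltr0n.
have n0': 0<n%:R :> R by rewrite ltr0n.
have mn': m%:R<=n%:R :> R by rewrite ler_nat.
rewrite distrC [X in _<=X]distrC ger0_norm ?subr_ge0//.
apply: le_trans (ler_norm _); rewrite /lnn -ln_div ?posrE//.
have h: ln (m%:R / n%:R)<=m%:R / n%:R - 1 :> R.
  rewrite -{1}(subrKC 1 (m%:R / n%:R)); apply: le_ln1Dx.
  by rewrite ltrBrDl subrr divr_gt0.
move: h; rewrite !ln_div ?posrE// => h.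
apply: le_trans (_ : 1-m%:R / n%:R<=_); last by move: h; lra.
rewrite -[X in _<=X - _](@divff _ (n%:R : R)) ?gt_eqF// -mulrBl.
rewrite ler_wpM2l ?subr_ge0// lef_pV2 ?posrE ?ler_nat// ltr0n (leq_trans n0)//.
Qed.

Lemma harmonic_le (N : nat) : (0<N)%N -> \sum_(1<=k<N.+1) k%:R^-1<=1+lnn R N.
Proof.
elim: N=>// -[|N] IH _; first by rewrite big_nat1 /lnn ln1 invr1 addr0.
rewrite big_nat_recr//=; apply: le_trans (lerD (IH isT) (lexx _)) _.
rewrite -addrA lerD2l -lerBrDl.
have := @lnn_diff N.+1 N.+2 N.+2 isT isT (leqnSn _) (leqnn _).
rewrite distrC [X in _<=X]distrC !ger0_norm.
- by rewrite -natrB// subSnn mul1r.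
- by rewrite subr_ge0 ler_ln ?posrE ?ltr0n// ler_nat.
- by rewrite subr_ge0 ler_nat.
Qed.

Lemma sum_inv_dist (m N : nat) : (0<m<=N)%N ->
  \sum_(1<=n<N.+1 | n != m) `|m%:R-n%:R : R|^-1<=2*(1+lnn R N).
Proof.
move=> /andP[m0 mN]; rewrite big_mkcond/= (@big_cat_nat _ _ _ m)//=; last exact: leqW.
have H := harmonic_le (leq_trans m0 mN).
rewrite mulr2n mulrDl mul1r; apply: lerD.
  apply: le_trans H; apply: le_trans (_ : \sum_(1<=k<m) k%:R^-1<=_).
    rewrite [X in _<=X]big_nat_rev/=; apply: eq_ler.
    apply: eq_big_nat=> n /andP[n0 nm]; rewrite (ltn_eqF nm)/= ger0_norm ?subr_ge0 ?ler_nat ?(ltnW nm)//.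
    by rewrite -natrB ?(ltnW nm)// add1n subSS.
  rewrite [X in _<=X](@big_cat_nat _ _ _ m)//= ?(leqW mN)// lerDl.
  by apply: sumr_ge0=> k _; rewrite invr_ge0.
rewrite big_ltn// eqxx add0r; apply: le_trans H.
rewrite -[m.+1]add1n big_addn subSn//.
rewrite [X in _<=X](@big_cat_nat _ _ _ (N-m).+1)//= ?ltnS ?leq_subr//.
rewrite -[X in X<=_]addr0 lerD//; last by apply: sumr_ge0=> k _; rewrite invr_ge0.
apply: ler_sum_nat=> k /andP[k0 _]; case: ifP=> _; last by rewrite invr_ge0.
by rewrite natrD opprD addrCA subrr addr0 normrN normr_nat.
Qed.

(** The diagonal gives the sum of squares. Off it, a cosine of frequency [log (n/m)] averages to at
    most [2N / (T |m-n|)]; after [2 |b_j b_l| <= b_j^2 + b_l^2] the inverse distances add up to a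
    logarithm. The indexing by [J] through an injection lets exponent vectors of primes serve as
    indices. *)
Lemma mean_value (J : finType) (b : J -> R) (nu : J -> nat) (N : nat) :
  injective nu -> (forall j, (0<nu j<=N)%N) ->
  `|Ex T (fun t=> nrm (\sum_j (b j)%:C*nit t (nu j))^+2) - \sum_j b j^+2|
   <= (4*N%:R*(1+lnn R N)/T) * \sum_j b j^+2.
Proof.
move=> inj nuN.
have bcos j l : bm T (fun t : R=> cos (t*(lnn R (nu l)-lnn R (nu j)))).
  have := bm_cos T (lnn R (nu l)-lnn R (nu j)) 0.
  by under eq_fun do rewrite addr0 mulrC.
have bc j l : bm T (fun t : R=> b j*b l*cos (t*(lnn R (nu l)-lnn R (nu j)))).
  exact: bmZ.
rewrite (@eq_Ex _ _ _ (fun t=> \sum_j \sum_l b j*b l*cos (t*(lnn R (nu l)-lnn R (nu j))))); last first.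
  move=> t _; rewrite nrm_sqr_trigsum; apply: eq_bigr=> j _; apply: eq_bigr=> l _.
  by congr (_*cos _); rewrite mulrBr opprK addrC.
rewrite Ex_sum//; last by move=> j; exact: bm_sum.
pose e j l := Ex T (fun t : R=> cos (t*(lnn R (nu l)-lnn R (nu j)))).
rewrite [X in `|X - _|](_ : _ = \sum_j \sum_l b j*b l * e j l); last first.
  apply: eq_bigr=> j _; rewrite Ex_sum//; apply: eq_bigr=> l _; exact: ExZ.
have ejj j : e j j = 1.
  rewrite /e (@eq_Ex _ _ _ (fun=> 1)) ?Ex_cst// => t _.
  by rewrite subrr mulr0 cos0.
pose K j l : R := 2*N%:R/T * `|(nu j)%:R-(nu l)%:R : R|^-1.
have K0 j l : 0<=K j l by rewrite mulr_ge0 ?invr_ge0 ?normr_ge0// divr_ge0 ?mulr_ge0// ltW.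
have eK j l : l != j -> `|e j l| <= K j l.
  move=> lj; have /andP[j0 jN] := nuN j; have /andP[l0 lN] := nuN l.
  have N0: (0<N)%N := leq_trans j0 jN.
  have d0: 0<`|(nu l)%:R-(nu j)%:R : R|.
    by rewrite normr_gt0 subr_eq0 eqr_nat; apply: contra lj=> /eqP/inj ->.
  have h := lnn_diff l0 j0 lN jN.
  have w0: 0<`|lnn R (nu l)-lnn R (nu j)|.
    by apply: lt_le_trans h; rewrite divr_gt0// ltr0n.
  apply: le_trans (Ex_cos_le T0 _) _; first by rewrite -normr_gt0.
  rewrite /K -!mulrA ler_wpM2l// invfM [X in _<=X]mulrCA ler_wpM2l ?invr_ge0 ?(ltW T0)//.
  rewrite -[X in _<=X]invrK lef_pV2 ?posrE//; last first.
    by rewrite invr_gt0 divr_gt0 ?ltr0n// distrC.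
  by rewrite invfM invrK mulrC distrC.
have sumK j : \sum_(l | l != j) K j l<=4*N%:R*(1+lnn R N)/T.
  rewrite -big_distrr/= (_ : 4 * _ * _ / _ = 2*N%:R/T*(2*(1+lnn R N))); last by ring.
  rewrite ler_wpM2l ?divr_ge0 ?mulr_ge0 ?(ltW T0)//.
  apply: le_trans (sum_inv_dist (nuN j)).
  rewrite [X in _<=X]big_mkcond/=.
  apply: le_trans (_ : \sum_(1<=n<N.+1) \sum_(l | l != j)
     (nu l == n)%:R * `|(nu j)%:R-n%:R : R|^-1<=_).
    rewrite exchange_big/=; apply: eq_ler; apply: eq_bigr=> l lj.
    rewrite (bigD1_seq (nu l)) ?iota_uniq//=; last by rewrite mem_index_iota ltnS nuN.
    by rewrite eqxx mul1r big1 ?addr0// => n; rewrite eq_sym=> /negbTE ->; rewrite mul0r.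
  apply: ler_sum=> n _; rewrite -big_distrl/=.
  have [[l0 /andP[lj /eqP ln]]|no] := pselect (exists l, (l != j) && (nu l == n)).
    rewrite ifT; last by rewrite -ln; apply: contra lj=> /eqP/inj ->.
    rewrite (bigD1 l0)//= ln eqxx big1 ?addr0 ?mul1r// => l /andP[_ ll0].
    by case: eqP=>// nl; move: ll0; rewrite (inj l l0) ?eqxx// nl ln.
  rewrite big1 ?mul0r; first by case: ifP=>// _; rewrite invr_ge0.
  by move=> l lj; case: eqP=>// nl; case: no; exists l; rewrite lj nl eqxx.
have -> : \sum_j \sum_l b j*b l * e j l - \sum_j b j^+2 =
          \sum_j \sum_(l | l != j) b j*b l * e j l.
  rewrite -sumrB; apply: eq_bigr=> j _; rewrite (bigD1 j)//= ejj mulr1 expr2.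
  by rewrite addrAC subrr add0r.
apply: le_trans (_ : \sum_j \sum_(l | l != j) (b j^+2+b l^+2)/2*K j l<=_).
  apply: le_trans (ler_norm_sum _ _ _) _; apply: ler_sum=> j _.
  apply: le_trans (ler_norm_sum _ _ _) _; apply: ler_sum=> l lj.
  have ab: `|b j*b l| <= (b j^+2+b l^+2)/2.
    rewrite ler_norml; have := sqr_ge0 (b j-b l); have := sqr_ge0 (b j+b l).
    by move: (b j) (b l)=> x y ? ?; apply/andP; split; nra.
  by rewrite normrM ler_pM ?eK.
rewrite [X in X<=_](_ : _ = \sum_j \sum_(l | l != j) b j^+2*K j l); last first.
  rewrite [LHS](_ : _ = \sum_j \sum_(l | l != j) (b j^+2/2*K j l) +
      \sum_j \sum_(l | l != j) (b l^+2/2*K j l)); last first.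
    rewrite -big_split/=; apply: eq_bigr=> j _; rewrite -big_split/=.
    by apply: eq_bigr=> l _; ring.
  rewrite [X in _+X](exchange_big_dep xpredT)//=.
  rewrite -big_split/=; apply: eq_bigr=> j _.
  rewrite [X in _+X](eq_bigl (fun l=> l != j)); last by move=> l; rewrite eq_sym.
  rewrite -big_split/=; apply: eq_bigr=> l _.
  by rewrite {2}/K distrC -/(K j l); field.
rewrite big_distrr/=; apply: ler_sum=> j _.
by rewrite -big_distrr/= mulrC ler_wpM2r// sqr_ge0.
Qed.
End MeanValue.

(** * The mean value inequality for complex functions *)

Section ComplexMeanValue.
Variable R : realType.

(* Apply the real mean value theorem to the component of F along F b - F a. *)
Lemma nrm_mean_value (u v du dv : R -> R) (a b M : R) : a<=b ->
  (forall x, a<=x<=b -> is_derive x (1 : R) u (du x)) ->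
  (forall x, a<=x<=b -> is_derive x (1 : R) v (dv x)) ->
  (forall x, a<=x<=b -> nrm (du x +i* dv x)<=M) ->
  nrm ((u b +i* v b)-(u a +i* v a))<=M*(b-a).
Proof.
move=> ab hu hv hM.
set d := _ - _; pose p := Re d; pose q := Im d.
have dE: nrm d^+2 = p*(u b-u a)+q*(v b-v a) by rewrite nrm_sqr !expr2.
pose phi : R -> R := (p \*: u)+(q \*: v).
have dphi x : a<=x<=b -> is_derive x (1 : R) phi (p*du x+q*dv x).
  move=> xab; apply: is_deriveD; apply: is_deriveZ; [exact: hu|exact: hv].
have cphi: {within `[a, b], continuous phi}.
  apply: continuous_in_subspaceT=> x; rewrite inE/= in_itv/= => xab.
  apply/differentiable_continuous/derivable1_diffP.
  exact: (@ex_derive _ _ _ _ _ _ _ (dphi _ xab)).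
have [x|c] := @MVT_segment _ phi (fun x=> p*du x+q*dv x) a b ab _ cphi.
  by rewrite in_itv/= => /andP[ax xb]; apply: dphi; rewrite !ltW.
rewrite in_itv/= => cab phiE.
have pE: phi b-phi a = nrm d^+2.
  rewrite dE /phi; have e y : ((p \*: u)+(q \*: v)) y = p*u y+q * v y by [].
  by rewrite !e; ring.
have M0: 0<=M by apply: le_trans (nrm_ge0 _) (hM _ cab).
rewrite -[X in X<=_]/(nrm d).
have [d0|d0] := eqVneq (nrm d) 0; first by rewrite d0 mulr_ge0// subr_ge0.
have dpos: 0<nrm d by rewrite lt_def d0 nrm_ge0.
rewrite -(ler_pM2l dpos) -expr2 -pE phiE mulrA ler_wpM2r ?subr_ge0//.
apply: le_trans (ler_wpM2l (nrm_ge0 _) (hM _ cab)).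
have -> : p*du c+q*dv c = Re (d^*%C*(du c +i* dv c)).
  by rewrite /p /q; case: (d)=> ? ? /=; ring.
apply: le_trans (ler_norm _) _; apply: le_trans (Re_le_nrm _) _; rewrite nrmM.
by rewrite [nrm d^*%C](_ : _ = nrm d)//; case: (d)=> ? ? /=; rewrite /nrm/= sqrrN.
Qed.

Lemma cis_lip (x y : R) : nrm (cis x-cis y)<=`|x-y|.
Proof.
wlog xy : x y / y<=x=> [W|].
  have [|/ltW xy] := leP y x; first exact: W.
  by rewrite nrmBC distrC; exact: W.
rewrite (ger0_norm (_ : 0<=x-y)) ?subr_ge0// -[x-y]mul1r.
apply: (@nrm_mean_value cos sin (fun x=> - sin x) cos)=>// w _.
by rewrite /nrm/= sqrrN addrC cos2Dsin2 sqrtr1.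
Qed.

End ComplexMeanValue.

(** * Abel summation *)

Section Abel.
Variable R : realType.

Lemma abel_sum (S : comPzRingType) (u w : nat -> S) (P Q : nat) : (P<=Q)%N ->
  \sum_(P<=m<Q) u m*w m=(\sum_(P<=m<Q) u m)*w Q +
   \sum_(P<=m<Q) (\sum_(P<=k<m.+1) u k)*(w m-w m.+1).
Proof.
elim: Q=> [|Q IH]; first by rewrite leqn0=> /eqP ->; rewrite !big_geq// mul0r addr0.
rewrite leq_eqVlt=> /orP[/eqP ->|]; first by rewrite !big_geq// mul0r addr0.
rewrite ltnS=> PQ; rewrite !big_nat_recr//= IH//.
by rewrite ?big_nat_recr//=; ring.
Qed.

Lemma abel_bound (u : nat -> R[i]) (w : nat -> R) (P Q : nat) (B : R) : (P<=Q)%N ->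
  (forall m, (P<=m)%N -> 0<=w m.+1<=w m) -> 0<=w P ->
  (forall k, (P<=k<=Q)%N -> nrm (\sum_(P<=m<k) u m)<=B) ->
  nrm (\sum_(P<=m<Q) u m*(w m)%:C)<=B*w P.
Proof.
move=> PQ wd wP uB; rewrite (abel_sum _ (fun m=> (w m)%:C))//.
have w0 m : (P<=m)%N -> 0<=w m.
  by rewrite leq_eqVlt=> /orP[/eqP <-//|]; case: m=>// m; rewrite ltnS=> /wd/andP[].
apply: le_trans (nrmD _ _) _.
apply: le_trans (_ : B*w Q+B * \sum_(P<=m<Q) (w m-w m.+1)<=_); last first.
  have -> : \sum_(P<=m<Q) (w m-w m.+1) = w P-w Q.
    by rewrite -[RHS]opprB -telescope_sumr// -sumrN; apply: eq_bigr=> m _; rewrite opprB.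
  by rewrite -mulrDr addrC subrK.
apply: lerD.
  by rewrite nrmM nrm_real_ge0 ?w0// ler_wpM2r ?w0// uB// leqnn PQ.
apply: le_trans (nrm_sum _ _ _) _; rewrite big_distrr/=.
apply: ler_sum_nat=> m /andP[Pm mQ]; rewrite nrmM -rmorphB nrm_real_ge0; last first.
  by rewrite subr_ge0; case/andP: (wd _ Pm).
rewrite ler_wpM2r ?uB ?mQ ?(leqW Pm)//.
by rewrite subr_ge0; case/andP: (wd _ Pm).
Qed.

End Abel.

(** * Approximation of the eta series by partial sums *)

Section EtaApprox.
Variables (R : realType) (sigma t : R).
Hypotheses (s0 : 0<sigma) (t0 : 0<t).

Definition altnit (m : nat) : R[i] := (-1)^+m*nit t m.

Lemma lnn_incr (m : nat) : (0<m)%N -> 0<=lnn R m.+1-lnn R m<=m%:R^-1.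
Proof.
move=> m0; have m0': 0<m%:R :> R by rewrite ltr0n.
apply/andP; split; first by rewrite subr_ge0 ler_ln ?posrE ?ltr0n// ler_nat.
rewrite /lnn -ln_div ?posrE ?ltr0n//.
have -> : m.+1%:R / m%:R = 1+m%:R^-1 :> R by rewrite -natr1 mulrDl divff ?gt_eqF// mul1r.
by apply: le_ln1Dx; apply: lt_trans (_ : 0<_); rewrite ?invr_gt0// ltrN10.
Qed.

(* Kusmin-Landau: consecutive terms are nearly opposite, so u_m = (u_m - u_{m+1}) W_m with
   W_m bounded and of bounded variation. *)
Lemma altnit_sum_bound (P Q : nat) : (0<P)%N -> (P<=Q)%N -> t<=P%:R ->
  nrm (\sum_(P<=m<Q) altnit m)<=3.
Proof.
move=> P0 PQ tP.
(* [th m] is the phase step between neighbouring terms apart from the sign. The condition [t <= P]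
   keeps it in [[0, 1]], so [V m] has real part at least 1 and can be inverted. *)
pose th m := t*(lnn R m.+1-lnn R m).
pose V m := 1+cis (- th m).
have thP m : (P<=m)%N -> 0<=th m<=1.
  move=> Pm; have m0: (0<m)%N := leq_trans P0 Pm.
  have /andP[l0 l1] := lnn_incr m0.
  rewrite mulr_ge0 ?(ltW t0)//=; apply: le_trans (_ : P%:R * m%:R^-1<=_).
    by rewrite ler_pM// ltW.
  by rewrite ler_pdivrMr ?ltr0n// mul1r ler_nat.
have thd m : (P<=m)%N -> th m.+1<=th m.
  move=> Pm; have m0: (0<m)%N := leq_trans P0 Pm.
  rewrite ler_wpM2l ?(ltW t0)// lerBlDr addrAC lerBrDr -!lnnM// /lnn ler_ln ?posrE ?ltr0n ?muln_gt0//.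
  by rewrite ler_nat; lia.
have Vn m : (P<=m)%N -> 1<=nrm (V m).
  move=> /thP/andP[h0 h1]; apply: le_trans (Re_le_nrm _); apply: le_trans (ler_norm _).
  rewrite /V ReD /= lerDl cosN cos_ge0_pihalf//.
  have := pihalf_ge1 R; move: (pi/2)=> p p1.
  by apply/andP; split; lra.
have V0 m : (P<=m)%N -> V m != 0.
  by move=> /Vn h; apply/eqP=> e; move: h; rewrite e nrm0 ler10.
have uE m : (P<=m)%N -> altnit m=(altnit m-altnit m.+1)*(V m)^-1.
  move=> Pm; apply: (mulIf (V0 _ Pm)); rewrite divfK ?V0//.
  have -> : altnit m.+1 = - (altnit m*cis (- th m)).
    rewrite /altnit exprS mulN1r mulNr -mulrA -cisD; congr (- (_*cis _)).
    by rewrite /th; ring.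
  by rewrite /V; ring.
have W1 m : (P<=m)%N -> nrm (V m)^-1<=1.
  by move=> Pm; rewrite nrmV invf_le1 ?Vn//; apply: lt_le_trans (Vn _ Pm).
have dW m : (P<=m)%N -> nrm ((V m)^-1-(V m.+1)^-1)<=th m-th m.+1.
  move=> Pm; have Pm1: (P<=m.+1)%N by exact: leqW.
  have -> : (V m)^-1-(V m.+1)^-1=(V m.+1-V m)*((V m)^-1*(V m.+1)^-1).
    by field; rewrite !V0.
  rewrite nrmM -[X in _<=X]mulr1 ler_pM ?nrm_ge0//; last first.
    by rewrite nrmM mulr_ile1 ?nrm_ge0 ?W1.
  rewrite /V opprD addrACA subrr add0r; apply: le_trans (cis_lip _ _) _.
  by rewrite opprK addrC ger0_norm ?subr_ge0 ?thd.
have u1 m : nrm (altnit m) = 1 by rewrite /altnit nrmM nrmX nrmN nrm1 expr1n nrm_nit mul1r.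
rewrite (eq_big_nat _ _ (F2 := fun m=> (altnit m-altnit m.+1)*(V m)^-1)); last first.
  by move=> m /andP[Pm _]; exact: uE.
rewrite abel_sum//.
have tel k : (P<=k)%N -> \sum_(P<=m<k) (altnit m-altnit m.+1) = altnit P-altnit k.
  move=> Pk; rewrite -[RHS]opprB -(telescope_sumr _ Pk) -sumrN.
  by apply: eq_bigr=> m _; rewrite opprB.
rewrite tel//.
have -> : \sum_(P<=m<Q) (\sum_(P<=k<m.+1) (altnit k-altnit k.+1))*((V m)^-1-(V m.+1)^-1)
  = altnit P*((V P)^-1-(V Q)^-1) - \sum_(P<=m<Q) altnit m.+1*((V m)^-1-(V m.+1)^-1).
  transitivity (\sum_(P<=m<Q) (altnit P*((V m)^-1-(V m.+1)^-1)-altnit m.+1*((V m)^-1-(V m.+1)^-1))).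
    by apply: eq_big_nat=> m /andP[Pm _]; rewrite tel ?mulrBl// leqW.
  rewrite sumrB -big_distrr/=; congr (_ * _ - _).
  rewrite -[RHS]opprB -(telescope_sumr (fun m=> (V m)^-1) PQ) -sumrN.
  by apply: eq_bigr=> m _; rewrite opprB.
have -> : forall a b c d e : R[i], (a-b)*c+(a*(d-c)-e) = a*d-b*c-e.
  by move=> *; ring.
apply: le_trans (nrmB _ _) _; apply: le_trans (lerD (nrmB _ _) (lexx _)) _.
have -> : 3 = 1+1+1 :> R by ring.
apply: lerD; first by apply: lerD; rewrite nrmM u1 mul1r W1.
apply: le_trans (nrm_sum _ _ _) _.
apply: le_trans (_ : \sum_(P<=m<Q) (th m-th m.+1)<=_).
  by apply: ler_sum_nat=> m /andP[Pm _]; rewrite nrmM u1 mul1r dW.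
have -> : \sum_(P<=m<Q) (th m-th m.+1) = th P-th Q.
  by rewrite -[RHS]opprB -(telescope_sumr th PQ) -sumrN; apply: eq_bigr=> m _; rewrite opprB.
have /andP[_ h1] := thP P (leqnn _); have /andP[h2 _] := thP Q PQ.
by lra.
Qed.

Lemma altnst_tail (P Q : nat) : (0<P)%N -> (P<=Q)%N -> t<=P%:R ->
  nrm (\sum_(P<=m<Q) (-1)^+m*nst sigma t m)<=3*P%:R`^(- sigma).
Proof.
move=> P0 PQ tP.
rewrite (eq_bigr (fun m=> altnit m*(m%:R`^(- sigma))%:C)); last first.
  by move=> m _; rewrite /altnit /nst; ring.
apply: abel_bound=>//; last first.
  move=> k /andP[Pk _]; exact: altnit_sum_bound.
move=> m Pm; rewrite powR_ge0/= !powRN lef_pV2 ?posrE ?powR_gt0 ?ltr0n ?(leq_trans P0) ?leqW//.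
by rewrite ge0_ler_powR ?nnegrE ?(ltW s0)// ler_nat.
Qed.

Lemma cvg_of_tail (x : nat -> R) (b : nat -> R) (N0 : nat) :
  (forall P Q, (N0<=P)%N -> (P<=Q)%N -> `|x Q-x P| <= b P) -> b @ \oo --> 0 ->
  cvgn x /\ forall P, (N0<=P)%N -> `|limn x-x P| <= b P.
Proof.
move=> xb b0.
have cx: cvgn x.
  apply/cauchy_cvgP/cauchy_ballP=> e e0.
  have e20: 0<e/2 by rewrite divr_gt0.
  have /cvgrPdist_lt/(_ _ e20) [M _ hM] := b0.
  pose K := maxn M N0.
  have hK n : (K<=n)%N -> `|x n-x K| < e/2.
    move=> Kn; apply: le_lt_trans (xb _ _ (leq_maxr _ _) Kn) _.
    by apply: le_lt_trans (ler_norm _) _; rewrite -normrN -sub0r; apply: hM; exact: leq_maxl.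
  exists ([set y | `|y-x K| < e/2], [set y | `|y-x K| < e/2]).
    by split; exists K.
  move=> [y y']/= [yK y'K]; rewrite -ball_normE/=.
  have -> : y-y'=(y-x K)-(y'-x K) by ring.
  by apply: le_lt_trans (ler_normB _ _) _; rewrite (splitr e) ltrD.
split=>// P NP.
apply/ler_addgt0Pl=> e e0.
have /cvgrPdist_le/(_ _ e0) [M _ hM] := cx.
pose K := maxn M P.
have := hM K (leq_maxl _ _); have := xb P K NP (leq_maxr _ _).
move=> h1 h2; have -> : limn x-x P=(limn x-x K)+(x K-x P) by ring.
by apply: le_trans (ler_normD _ _) _; rewrite lerD.
Qed.

Definition etac : R[i] := eta_re sigma t +i* eta_im sigma t.

(** Past [t] the alternating terms nearly cancel in pairs, so the tail is of the size of its first
    term; real and imaginary parts cost 3 each. *)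
Lemma eta_approx (N : nat) : (0<N)%N -> t<=N%:R ->
  nrm (etac - \sum_(1<=m<N.+1) (-1)^+m.+1*nst sigma t m)<=6*N%:R`^(- sigma).
Proof.
move=> N0 tN.
pose S (M : nat) : R[i] := \sum_(1<=m<M.+1) (-1)^+m.+1*nst sigma t m.
have sgn (m : nat) : (-1)^+m=((-1)^+m : R)%:C by rewrite rmorphXn rmorphN rmorph1.
have SP P Q : (N<=P)%N -> (P<=Q)%N -> nrm (S Q-S P)<=3*P%:R`^(- sigma).
  move=> NP PQ; rewrite /S (@big_cat_nat _ _ _ P.+1)//= addrAC subrr add0r.
  rewrite (eq_bigr (fun m=> - ((-1)^+m*nst sigma t m))); last first.
    by move=> m _; rewrite exprS !mulN1r mulNr.
  rewrite sumrN nrmN; apply: le_trans (altnst_tail _ _ _) _=>//.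
    by apply: le_trans tN _; rewrite ler_nat leqW.
  rewrite ler_wpM2l// !powRN lef_pV2 ?posrE ?powR_gt0 ?ltr0n ?(leq_trans N0) ?leqW//.
  by rewrite ge0_ler_powR ?nnegrE ?(ltW s0)// ler_nat.
have b0: (fun P : nat=> 3*P%:R`^(- sigma)) @ \oo --> 0.
  apply/cvgrPdist_le=> e e0; exists (Num.truncn ((3 / e)`^sigma^-1)).+1=>// P /= hP.
  have P0: 0<P%:R :> R by rewrite ltr0n; exact: leq_trans hP.
  rewrite sub0r normrN ger0_norm ?mulr_ge0 ?powR_ge0// powRN ler_pdivrMr ?powR_gt0//.
  rewrite -ler_pdivrMl// mulrC.
  have : (3 / e)`^sigma^-1<=P%:R.
    by apply: ltW; apply: lt_le_trans (truncnS_gt _) _; rewrite ler_nat.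
  move=> /(ge0_ler_powR (ltW s0)); rewrite !nnegrE powR_ge0 (ltW P0)=> /(_ isT isT).
  by rewrite -powRrM mulVf ?gt_eqF// powRr1// divr_ge0// ltW.
have reE: series (fun n : nat=> (-1)^+n*(n.+1%:R)`^(- sigma)*cos (t * ln n.+1%:R))=(fun M=> Re (S M)).
  apply/funext=> M; rewrite /series/= /S Re_sum big_add1/=.
  apply: eq_bigr=> n _; rewrite sgn ReZ /nst ReZ /= cosN /lnn !exprS; ring.
have imE: series (fun n : nat=> - ((-1)^+n*(n.+1%:R)`^(- sigma)*sin (t * ln n.+1%:R)))=(fun M=> Im (S M)).
  apply/funext=> M; rewrite /series/= /S Im_sum big_add1/=.
  apply: eq_bigr=> n _; rewrite sgn ImZ /nst ImZ /= sinN /lnn !exprS; ring.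
have [_ hr] : cvgn (fun M=> Re (S M)) /\ forall P, (N<=P)%N -> `|limn (fun M=> Re (S M))-Re (S P)| <= 3*P%:R`^(- sigma).
  apply: cvg_of_tail=>// P Q NP PQ.
  by rewrite -ReN -ReD; apply: le_trans (Re_le_nrm _) (SP _ _ NP PQ).
have [_ hi] : cvgn (fun M=> Im (S M)) /\ forall P, (N<=P)%N -> `|limn (fun M=> Im (S M))-Im (S P)| <= 3*P%:R`^(- sigma).
  apply: cvg_of_tail=>// P Q NP PQ.
  by rewrite -ImN -ImD; apply: le_trans (Im_le_nrm _) (SP _ _ NP PQ).
have hR := hr N (leqnn _); have hI := hi N (leqnn _).
apply: le_trans (nrm_le_ReIm _) _.
rewrite ReD ImD ReN ImN /etac /= /eta_re /eta_im reE imE.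
by move: hR hI; rewrite /S; lra.
Qed.

End EtaApprox.

(** * The Bessel function I_0 *)

Section Bessel.
Variable R : realType.
Implicit Types u v x : R.

Definition bterm u n : R := (u/2)^+(2*n)/(n`!%:R^+2).

Lemma bterm_ge0 u n : 0<=bterm u n.
Proof. rewrite /bterm exprM; apply: divr_ge0; last exact: sqr_ge0.
by apply: exprn_ge0; exact: sqr_ge0. Qed.

Lemma bterm_le_exp u n : bterm u n<=exp_coeff (u^+2/4) n.
Proof.
rewrite /bterm /exp_coeff/= exprM expr_div_n (_ : 2^+2 = 4 :> R); last by ring.
rewrite ler_wpM2l ?exprn_ge0 ?divr_ge0 ?sqr_ge0// lef_pV2 ?posrE ?exprn_gt0 ?ltr0n ?fact_gt0//.
by rewrite expr2 ler_peMr// ler1n fact_gt0.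
Qed.

Lemma bI0_cvg u : cvgn (series (bterm u)).
Proof.
apply: (series_le_cvg (bterm_ge0 u) _ (bterm_le_exp u)).
  by move=> n; rewrite exp_coeff_ge0// divr_ge0 ?sqr_ge0.
exact: is_cvg_series_exp_coeff.
Qed.

Lemma bI0E u : besselI0 u = limn (series (bterm u)). Proof. by []. Qed.

Lemma bI0_ge_partial u n : \sum_(i<n) bterm u i<=besselI0 u.
Proof.
rewrite bI0E -(big_mkord xpredT (bterm u)).
apply: (@nondecreasing_cvgn_le _ (series (bterm u))); last exact: bI0_cvg.
by apply: nondecreasing_series=> m _ _; exact: bterm_ge0.
Qed.

Lemma bI0_le u (B : R) : (forall n, \sum_(i<n) bterm u i<=B) -> besselI0 u<=B.
Proof.
move=> h; rewrite bI0E; apply: limr_le; [exact: bI0_cvg|apply: nearW=> n].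
by rewrite /series/= big_mkord.
Qed.

Lemma bI0_ge1 u : 1<=besselI0 u.
Proof.
by apply: le_trans (bI0_ge_partial u 1); rewrite big_ord1 /bterm muln0 expr0 fact0 expr1n divr1.
Qed.

Lemma bI0_gt0 u : 0<besselI0 u. Proof. exact: lt_le_trans (bI0_ge1 u). Qed.

Lemma bI0_gesq u : 1+u^+2/4<=besselI0 u.
Proof.
apply: le_trans (bI0_ge_partial u 2); rewrite big_ord_recr big_ord1/= /bterm muln0 muln1 expr0 fact0 expr1n divr1.
by rewrite expr_div_n (_ : 2^+2 = 4 :> R) ?divr1//; ring.
Qed.

Lemma bI0_le_expsq u : besselI0 u<=expR (u^+2/4).
Proof.
rewrite bI0E; apply: ler_lim; [exact: bI0_cvg|exact: is_cvg_series_exp_coeff|].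
by apply: nearW=> n; apply: ler_sum=> i _; exact: bterm_le_exp.
Qed.

Lemma bI0_mono u v : 0<=u -> u<=v -> besselI0 u<=besselI0 v.
Proof.
move=> u0 uv; rewrite !bI0E; apply: ler_lim; [exact: bI0_cvg|exact: bI0_cvg|].
apply: nearW=> n; apply: ler_sum=> i _; rewrite /bterm ler_wpM2r ?invr_ge0 ?sqr_ge0//.
apply: lerXn2r; rewrite ?nnegrE ?divr_ge0//; first exact: le_trans uv.
by rewrite ler_wpM2r.
Qed.

Lemma exp_coeff_le_expR x n : 0<=x -> \sum_(i<n) exp_coeff x i<=expR x.
Proof.
move=> x0; rewrite -(big_mkord xpredT (exp_coeff x)).
apply: (@nondecreasing_cvgn_le _ (series (exp_coeff x))); last exact: is_cvg_series_exp_coeff.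
by apply: nondecreasing_series=> m _ _; exact: exp_coeff_ge0.
Qed.

Lemma central_bin_le n : ('C(2*n, n)<=4 ^ n)%N.
Proof.
apply: leq_trans (_ : 2 ^ (2*n)<=_)%N; last by rewrite expnM.
rewrite -[X in (_<=X)%N]/((1+1) ^ (2*n))%N expnDn.
rewrite (bigD1 (inord n))//= inordK; last by rewrite ltnS mul2n -addnn leq_addr.
by rewrite !exp1n !muln1 leq_addr.
Qed.

(** The central binomial coefficient is at most [4^n], that is [(2n)! <= 4^n n!^2], so the series of
    [I_0] is dominated by the even terms of the exponential. *)
Lemma bterm_le_exp2 u n : 0<=u -> bterm u n<=exp_coeff u (2*n)%N.
Proof.
move=> u0; rewrite /bterm /exp_coeff/= expr_div_n -mulrA ler_wpM2l ?exprn_ge0//.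
rewrite -invfM lef_pV2 ?posrE ?mulr_gt0 ?exprn_gt0 ?ltr0n ?fact_gt0//.
have := @bin_fact (2*n) n; rewrite {1 3}mul2n -addnn leq_addr addnK=> /(_ isT) <-.
rewrite !natrM -expr2 ler_wpM2r ?sqr_ge0// exprM.
rewrite (_ : 2^+2 = 4%:R :> R); last by ring.
by rewrite -natrX ler_nat central_bin_le.
Qed.

Lemma bI0_le_exp u : 0<=u -> besselI0 u<=expR u.
Proof.
move=> u0; apply: bI0_le=> n; apply: le_trans (exp_coeff_le_expR (2*n)%N u0).
elim: n=> [|n IH]; first by rewrite muln0 !big_ord0.
rewrite big_ord_recr/= mulnSr addn2 !big_ord_recr/= -addrA; apply: lerD=>//.
by rewrite ler_wpDr ?exp_coeff_ge0 ?bterm_le_exp2.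
Qed.

(** Two bounds are used throughout at arguments [k n^-sigma]: [lb u <= u] for small [n], where
    [sigma < 1] helps, and [lb u <= u^2/4] for large [n], where [2 sigma > 1] gives convergence. *)
Definition lb u : R := ln (besselI0 u).

Lemma lb_ge0 u : 0<=lb u. Proof. by rewrite ln_ge0 ?bI0_ge1. Qed.
Lemma lb_le u : 0<=u -> lb u<=u.
Proof. by move=> u0; rewrite /lb -[X in _<=X]expRK ler_ln ?posrE ?bI0_gt0 ?expR_gt0 ?bI0_le_exp. Qed.
Lemma lb_lesq u : lb u<=u^+2/4.
Proof. by rewrite /lb -[X in _<=X]expRK ler_ln ?posrE ?bI0_gt0 ?expR_gt0 ?bI0_le_expsq. Qed.
Lemma lb_mono u v : 0<=u -> u<=v -> lb u<=lb v.
Proof. by move=> u0 uv; rewrite ler_ln ?posrE ?bI0_gt0// bI0_mono. Qed.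
Lemma expR_lb u : expR (lb u) = besselI0 u.
Proof. by rewrite lnK ?posrE ?bI0_gt0. Qed.
End Bessel.

(** * The multinomial theorem *)

Section MultiExp.
Variable R : realType.

Lemma exp_coef_add (F : numFieldType) (x y : F) (i : nat) :
  (x+y)^+i / i`!%:R = \sum_(j<i.+1) (x^+j / j`!%:R)*(y^+(i-j)/(i-j)`!%:R).
Proof.
rewrite exprDn_comm; last exact: mulrC.
rewrite (reindex_inj rev_ord_inj)/= big_distrl/=; apply: eq_bigr=> j _.
have ji: (j<=i)%N by rewrite -ltnS.
rewrite subSS subKn// -mulr_natr.
have n0 (k : nat) : k`!%:R != 0 :> F by rewrite pnatr_eq0 -lt0n fact_gt0.
have := bin_fact ji; rewrite -bin_sub// => /(congr1 (fun n=> n%:R : F)); rewrite !natrM=> <-.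
rewrite bin_sub//.
have c0: 'C(i, j)%:R != 0 :> F by rewrite pnatr_eq0 -lt0n bin_gt0.
by field; rewrite !n0 c0.
Qed.

Variables (P : finType) (I : nat).
Let mi := {ffun P -> 'I_I.+1}.
Definition mdeg (al : mi) : nat := (\sum_q al q)%N.

(** Both sides are the coefficient of [X^i] in a product of exponential polynomials cut at degree
    [I]; for [i <= I] the cut is invisible. *)
Lemma multi_exp (x : P -> R[i]) (i : nat) : (i<=I)%N ->
  (\sum_q x q)^+i / i`!%:R =
  \sum_(al : mi | mdeg al == i) \prod_q (x q^+al q/(al q)`!%:R).
Proof.
move=> iI.
pose E (y : R[i]) : {poly R[i]} := \sum_(a<I.+1) (y^+a / a`!%:R) *: 'X^a.
have Ecoef y j : (j<=I)%N -> (E y)`_j = y^+j / j`!%:R.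
  move=> jI; rewrite /E coef_sum (bigD1 (inord j))//= inordK ?ltnS//.
  rewrite coefZ coefXn eqxx mulr1 big1 ?addr0// => a aj.
  rewrite coefZ coefXn; case: eqP=> [ja|]; last by rewrite mulr0.
  by move: aj; rewrite ja inord_val eqxx.
have H (s : seq P) j : (j<=I)%N ->
    (\prod_(q <- s) E (x q))`_j=(\sum_(q <- s) x q)^+j / j`!%:R.
  elim: s j=> [|q s IH] j jI.
    rewrite !big_nil coef1 expr0n; case: j jI=> [|j] _ /=; first by rewrite fact0 divr1.
    by rewrite mul0r.
  rewrite !big_cons coefM exp_coef_add; apply: eq_bigr=> k _.
  have kj: (k<=j)%N by rewrite -ltnS.
  rewrite Ecoef ?(leq_trans kj)// IH// (leq_trans (leq_subr _ _))//.
rewrite -H// /E bigA_distr_bigA/= coef_sum [RHS]big_mkcond/=.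
apply: eq_bigr=> al _.
have -> : \prod_q ((x q^+al q/(al q)`!%:R) *: 'X^(al q)) =
   (\prod_q (x q^+al q/(al q)`!%:R)) *: 'X^(mdeg al) :> {poly R[i]}.
  by rewrite scaler_prod /mdeg prodrXr.
by rewrite coefZ coefXn eq_sym; case: eqP; rewrite ?mulr1 ?mulr0.
Qed.
End MultiExp.

(** * Sums over primes and their mean squares *)

Section PrimeSums.
Variables (R : realType) (sigma : R) (z : nat).

Definition pr : Type := {p : 'I_z.+1 | prime p}.
HB.instance Definition _ := Finite.on pr.
Definition pv (q : pr) : nat := val (val q).
Lemma pv_prime q : prime (pv q). Proof. by case: q. Qed.
Lemma pv_gt0 q : (0<pv q)%N. Proof. exact: prime_gt0 (pv_prime q). Qed.
Lemma pv_le q : (pv q<=z)%N. Proof. by rewrite -ltnS; case: q=> [[p pz]]. Qed.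
Lemma pv_inj : injective pv. Proof. by move=> p q /val_inj/val_inj. Qed.

Definition up (q : pr) : R := (pv q)%:R`^(- sigma).
Definition Rp (t : R) : R[i] := \sum_(q : pr) nst sigma t (pv q).
(** The log-Laplace transform of the random model: replacing each [p^-it] by an independent uniform
    point of the unit circle makes the prime [p] contribute the factor [I_0 (k p^-sigma)]. *)
Definition Fz (k : R) : R := \sum_(q : pr) lb (k*up q).

Lemma up_ge0 q : 0<=up q. Proof. exact: powR_ge0. Qed.

Lemma expR_Fz k : expR (Fz k) = \prod_(q : pr) besselI0 (k*up q).
Proof. by rewrite /Fz expR_sum; apply: eq_bigr=> q _; rewrite expR_lb. Qed.

Lemma Fz_ge0 k : 0<=Fz k. Proof. by apply: sumr_ge0=> q _; exact: lb_ge0. Qed.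

Lemma Fz_mono k l : 0<=k -> k<=l -> Fz k<=Fz l.
Proof.
move=> k0 kl; apply: ler_sum=> q _; apply: lb_mono; rewrite ?mulr_ge0 ?up_ge0//.
by rewrite ler_wpM2r ?up_ge0.
Qed.

Variable I : nat.
Let mi := {ffun pr -> 'I_I.+1}.

(** By unique factorisation distinct exponent vectors give distinct integers, so the mean value
    theorem applies to powers of [Rp] expanded over multi-indices. *)
Definition nuq (al : mi) : nat := (\prod_q pv q ^ al q)%N.

Lemma logn_nuq (al : mi) p : logn (pv p) (nuq al) = al p.
Proof.
have H (s : seq pr) : uniq s -> p \in s -> logn (pv p) (\prod_(q <- s) pv q ^ al q) = al p.
  elim: s=>// q s IH /= /andP[qs us]; rewrite inE big_cons=> ps.
  rewrite lognM ?expn_gt0 ?pv_gt0//; last by apply: prodn_gt0=> r; rewrite expn_gt0 pv_gt0.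
  rewrite lognX logn_prime ?pv_prime//.
  have [pq|pq] := eqVneq p q.
    rewrite -pq eqxx muln1 -[RHS]addn0; congr (_ + _)%N.
    rewrite -{}pq in qs; move: qs; elim: (s)=> [|r s' IH'].
      by rewrite big_nil logn1.
    rewrite inE negb_or big_cons=> /andP[pr' ps'].
    rewrite lognM ?expn_gt0 ?pv_gt0//; last by apply: prodn_gt0=> r'; rewrite expn_gt0 pv_gt0.
    rewrite IH'// addn0 lognX logn_prime ?pv_prime//.
    by rewrite (negbTE (contra_neq (@pv_inj _ _) pr')) muln0.
  rewrite (negbTE (contra_neq (@pv_inj _ _) pq)) muln0 add0n IH//.
  by move: ps; rewrite (negbTE pq).
rewrite /nuq -big_enum/=; apply: H; first exact: enum_uniq.
by rewrite mem_enum.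
Qed.

Lemma nuq_inj : injective nuq.
Proof.
move=> al be ab; apply/ffunP=> p; apply: val_inj=> /=.
by rewrite -logn_nuq ab logn_nuq.
Qed.

Lemma nuq_gt0 al : (0<nuq al)%N.
Proof. by apply: prodn_gt0=> q; rewrite expn_gt0 pv_gt0. Qed.

Lemma nuq_le al : (nuq al<=z ^ mdeg al)%N.
Proof.
rewrite /nuq /mdeg expn_sum; apply: leq_prod=> q _.
by case: (al q : nat)=>// k; rewrite leq_exp2r// pv_le.
Qed.

Lemma nit_nuq (t : R) al : nit t (nuq al) = \prod_q nit t (pv q)^+al q.
Proof.
rewrite /nuq.
have nitX m k : (0<m)%N -> nit t (m ^ k) = nit t m^+k.
  move=> m0; elim: k=> [|k IH]; first by rewrite expn0 expr0 /nit /lnn ln1 mulr0 oppr0 cis0.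
  by rewrite expnS exprS nitM ?expn_gt0 ?m0// IH.
have : (0 < \prod_q pv q ^ al q)%N /\ nit t (\prod_q pv q ^ al q) = \prod_q nit t (pv q)^+al q.
  elim/big_rec2: _=> [|q y1 y2 _ [y0 <-]]; first by rewrite /nit /lnn ln1 mulr0 oppr0 cis0.
  by rewrite muln_gt0 expn_gt0 pv_gt0 y0 nitM ?expn_gt0 ?pv_gt0// nitX ?pv_gt0.
by case.
Qed.

Definition mcoef (q : nat -> R) (al : mi) : R :=
  q (mdeg al)*(mdeg al)`!%:R * \prod_p (up p^+al p/(al p)`!%:R).

Lemma poly_Rp (q : nat -> R) (t : R) :
  \sum_(i<I.+1) (q i)%:C*Rp t^+i =
  \sum_(al : mi | (mdeg al<=I)%N) (mcoef q al)%:C*nit t (nuq al).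
Proof.
rewrite (partition_big (fun al : mi=> inord (mdeg al) : 'I_I.+1) xpredT)//=.
apply: eq_bigr=> i _.
have iI: (i<=I)%N by rewrite -ltnS.
have f0: i`!%:R != 0 :> R[i] by rewrite pnatr_eq0 -lt0n fact_gt0.
have -> : Rp t^+i = i`!%:R*(Rp t^+i / i`!%:R) by rewrite mulrC divfK.
rewrite /Rp (multi_exp _ iI) !big_distrr/=.
apply: eq_big=> [al|al /eqP di].
  apply/idP/idP=> [/eqP di|/andP[dI /eqP <-]]; last by rewrite inordK.
  by rewrite di iI/=; apply/eqP/val_inj; rewrite /= inordK.
rewrite /mcoef di nit_nuq !rmorphM/= rmorph_nat rmorph_prod/= -!mulrA; congr (_*(_ * _)).
rewrite -big_split/=; apply: eq_bigr=> p _.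
by rewrite /nst exprMn mulrAC rmorphM/= fmorphV/= rmorph_nat rmorphXn.
Qed.

Definition msum (q : nat -> R) : R := \sum_(al : mi | (mdeg al<=I)%N) mcoef q al^+2.

Lemma mean_poly_Rp (T : R) (q : nat -> R) : 0<T -> (0<z)%N ->
  `|Ex T (fun t=> nrm (\sum_(i<I.+1) (q i)%:C*Rp t^+i)^+2)-msum q|
   <= (4*(z ^ I)%:R*(1+lnn R (z ^ I))/T) * msum q.
Proof.
move=> T0 z0.
pose A : {pred mi} := fun al=> (mdeg al<=I)%N.
have := @mean_value R T T0 {al : mi | al \in A} (fun j=> mcoef q (\val j)) (fun j=> nuq (\val j)) (z ^ I).
move=> /(_ _ _) H.
have -> : msum q = \sum_(j : {al : mi | al \in A}) mcoef q (\val j)^+2.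
  by rewrite -(big_sub A (fun al=> mcoef q al^+2)).
rewrite (@eq_Ex _ _ _ (fun t=> nrm (\sum_(j : {al : mi | al \in A}) (mcoef q (\val j))%:C*nit t (nuq (\val j)))^+2)).
  apply: H; first by move=> j k /nuq_inj/val_inj.
  move=> [al alA] /=; rewrite nuq_gt0/=; apply: leq_trans (nuq_le _) _.
  by rewrite leq_pexp2l.
by move=> t _; rewrite poly_Rp -(big_sub A (fun al=> (mcoef q al)%:C*nit t (nuq al))).
Qed.

(** The square of [(k u)^a / a!] is the [a]-th term of the series of [I_0 (2 k u)]. Summed over all
    multi-indices, the squared coefficients therefore factor into partial sums of Bessel series, one
    for each prime. *)
Lemma msum_le (q : nat -> R) (k : R) : 0<=k ->
  (forall i, (i<=I)%N -> 0<=q i<=k^+i / i`!%:R) -> msum q<=expR (Fz (2*k)).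
Proof.
move=> k0 qk; rewrite expR_Fz.
apply: le_trans (_ : \sum_(al : mi) \prod_p bterm (2*k*up p) (al p)<=_); last first.
  rewrite -(bigA_distr_bigA (fun p (a : 'I_I.+1)=> bterm (2*k*up p) a)).
  apply: ler_prod=> p _; rewrite bI0_ge_partial sumr_ge0// => a _; exact: bterm_ge0.
rewrite /msum big_mkcond/=; apply: ler_sum=> al _; case: ifP=> [dI|_]; last first.
  by apply: prodr_ge0=> p _; exact: bterm_ge0.
have /andP[q0 qle] := qk _ dI.
have f0: 0<(mdeg al)`!%:R :> R by rewrite ltr0n fact_gt0.
have u0: 0 <= \prod_p (up p^+al p/(al p)`!%:R).
  by apply: prodr_ge0=> p _; rewrite divr_ge0 ?exprn_ge0 ?up_ge0.
apply: le_trans (_ : (k^+mdeg al * \prod_p (up p^+al p/(al p)`!%:R))^+2<=_).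
  rewrite lerXn2r ?nnegrE ?mulr_ge0 ?exprn_ge0// ?(ltW f0)//.
  by rewrite ler_wpM2r// -ler_pdivlMr.
rewrite /mdeg -prodrXr -big_split/= -prodrXl; apply: ler_prod=> p _.
rewrite sqr_ge0/=; apply: eq_ler.
rewrite /bterm (_ : 2*k*up p/2 = k*up p); last by field.
by rewrite mulrA -exprMn expr_div_n -exprM mulnC.
Qed.

Lemma bterm2 (u : R) m : bterm (2*u) m = 4^+m*bterm u m.
Proof.
rewrite /bterm (_ : 2*u/2 = 2*(u/2)); last by ring.
by rewrite exprMn [2^+(2 * m)]exprM (_ : 2^+2 = 4) ?mulrA//; ring.
Qed.

(** Rankin's trick: doubling the argument multiplies the [m]-th term by [4^m], which is at least
    [4^n] in the tail. *)
Lemma bI0_tail (u : R) (n : nat) :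
  besselI0 u - 4 ^- n*besselI0 (2*u) <= \sum_(i<n.+1) bterm u i.
Proof.
have t0: 0<=4 ^- n*besselI0 (2*u) by rewrite mulr_ge0 ?invr_ge0 ?exprn_ge0// ltW ?bI0_gt0.
rewrite lerBlDr; apply: bI0_le=> m.
have bg0 k : 0<=bterm u k := bterm_ge0 u k.
have [mn|nm] := leqP m n.+1.
  rewrite -(big_mkord xpredT (bterm u)) -(big_mkord xpredT (bterm u)) ler_wpDr//.
  by rewrite [X in _<=X](@big_cat_nat _ _ _ m)//= lerDl sumr_ge0.
rewrite -(big_mkord xpredT (bterm u)) -(big_mkord xpredT (bterm u)).
rewrite (@big_cat_nat _ _ _ n.+1)//=; last exact: ltnW.
rewrite lerD2l; apply: le_trans (_ : 4 ^- n * \sum_(i<m) bterm (2*u) i<=_); last first.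
  by rewrite ler_wpM2l ?bI0_ge_partial// invr_ge0 exprn_ge0.
rewrite -(big_mkord xpredT (bterm (2*u))) [X in _<=_*X](@big_cat_nat _ _ _ n.+1)//=; last exact: ltnW.
rewrite mulrDr ler_wpDl//.
  by rewrite mulr_ge0 ?invr_ge0 ?exprn_ge0// sumr_ge0// => i _; exact: bterm_ge0.
rewrite big_distrr/=; apply: ler_sum_nat=> i /andP[ni _].
rewrite bterm2 mulrA ler_peMl// mulrC ler_pdivlMr ?exprn_gt0// mul1r ler_weXn2l//; [lra|exact: ltnW].
Qed.

(** Since every [a q] is at least 1, the relative loss [d q / a q] is at most [d q], and relative
    losses add up. *)
Lemma prodB_ge (Q : finType) (a d : Q -> R) : (forall q, 1<=a q) ->
  (forall q, 0<=d q<=a q) ->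
  (\prod_q a q)*(1 - \sum_q d q) <= \prod_q (a q-d q).
Proof.
move=> a1 da.
have H (s : seq Q) : [/\ 0 <= \prod_(q <- s) a q, 0 <= \sum_(q <- s) d q, 0 <= \prod_(q <- s) (a q-d q) &
   (\prod_(q <- s) a q)*(1 - \sum_(q <- s) d q) <= \prod_(q <- s) (a q-d q)].
  elim: s=> [|q s [A0 D0 B0 IH]]; first by rewrite !big_nil subr0 mulr1.
  have a1q := a1 q; have /andP[d0 dqa] := da q.
  rewrite !big_cons; move: A0 D0 B0 IH.
  move: (\prod_(q <- s) a q) (\sum_(q <- s) d q) (\prod_(q <- s) (a q-d q))=> A D B A0 D0 B0 IH.
  split; [by rewrite mulr_ge0// (le_trans _ a1q)|by rewrite addr_ge0|by rewrite mulr_ge0// subr_ge0|].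
  have h1: (a q-d q)*(A*(1-D))<=(a q-d q)*B by rewrite ler_wpM2l// subr_ge0.
  have h2: d q*(A*(1-D))<=d q*(A*a q).
    by rewrite ler_wpM2l// ler_wpM2l//; lra.
  by apply: le_trans h1; move: h2; lra.
by have [] := H (index_enum Q).
Qed.

(** Two losses against the full product: exponents above [I] at a single prime, at most [z + 1]
    times, and multi-indices of total degree above [I]. Rankin's trick bounds each by [4^-I] times
    the product at the doubled argument; together this is the factor [z.+2]. *)
Lemma msum_ge (k : R) : 0<=k ->
  expR (Fz (2*k))*(1-(z.+2)%:R*4 ^- I * expR (Fz (4*k))) <=
  msum (fun i=> k^+i / i`!%:R).
Proof.
move=> k0.
have mE: msum (fun i=> k^+i / i`!%:R) =
    \sum_(al : mi | (mdeg al<=I)%N) \prod_p bterm (2*k*up p) (al p).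
  apply: eq_bigr=> al _; have f0: (mdeg al)`!%:R != 0 :> R by rewrite pnatr_eq0 -lt0n fact_gt0.
  rewrite /mcoef divfK// /mdeg -prodrXr -big_split/= -prodrXl; apply: eq_bigr=> p _.
  rewrite /bterm (_ : 2*k*up p/2 = k*up p); last by field.
  by rewrite mulrA -exprMn expr_div_n -exprM mulnC.
set E4 := expR (Fz (4*k)).
have E40: 0<E4 by exact: expR_gt0.
have tail: \sum_(al : mi | ~~ (mdeg al<=I)%N) \prod_p bterm (2*k*up p) (al p)<=4 ^- I*E4.
  rewrite /E4 expR_Fz.
  apply: le_trans (_ : \sum_(al : mi) 4 ^- I * \prod_p bterm (4*k*up p) (al p)<=_); last first.
    rewrite -big_distrr/= ler_wpM2l ?invr_ge0 ?exprn_ge0//.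
    rewrite -(bigA_distr_bigA (fun p (a : 'I_I.+1)=> bterm (4*k*up p) a)).
    apply: ler_prod=> p _; rewrite bI0_ge_partial sumr_ge0// => a _; exact: bterm_ge0.
  rewrite big_mkcond/=; apply: ler_sum=> al _.
  have t0: 0 <= \prod_p bterm (4*k*up p) (al p) by apply: prodr_ge0=> p _; exact: bterm_ge0.
  case: ifP=> [|_]; last by rewrite mulr_ge0 ?invr_ge0 ?exprn_ge0.
  rewrite -ltnNge=> dI; rewrite ler_pdivlMl ?exprn_gt0//.
  have -> : \prod_p bterm (4*k*up p) (al p) = 4^+mdeg al * \prod_p bterm (2*k*up p) (al p).
    rewrite /mdeg -prodrXr -big_split/=; apply: eq_bigr=> p _; rewrite -bterm2.
    by congr (bterm _ _); ring.
  rewrite ler_wpM2r ?prodr_ge0// => [p _|]; first exact: bterm_ge0.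
  by rewrite ler_weXn2l//; [lra|exact: ltnW].
have full: expR (Fz (2*k))*(1-(z.+1)%:R*(4 ^- I*E4)) <=
    \sum_(al : mi) \prod_p bterm (2*k*up p) (al p).
  rewrite -(bigA_distr_bigA (fun p (a : 'I_I.+1)=> bterm (2*k*up p) a)) expR_Fz.
  pose d p := besselI0 (2*k*up p) - \sum_(a<I.+1) bterm (2*k*up p) a.
  rewrite [X in _<=X](eq_bigr (fun p=> besselI0 (2*k*up p)-d p)); last first.
    by move=> p _; rewrite /d opprB addrCA subrr addr0.
  have dP p : 0<=d p<=besselI0 (2*k*up p).
    rewrite subr_ge0 bI0_ge_partial/= gerBl sumr_ge0// => a _; exact: bterm_ge0.
  apply: le_trans (prodB_ge (fun p=> bI0_ge1 _) dP).
  rewrite ler_wpM2l ?prodr_ge0// => [p _|]; first exact: ltW (bI0_gt0 _).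
  rewrite lerD2l lerN2.
  apply: le_trans (_ : \sum_(p : pr) (4 ^- I*E4)<=_).
    apply: ler_sum=> p _; rewrite lerBlDr -lerBlDl.
    apply: le_trans (bI0_tail _ _); rewrite lerD2l lerN2 ler_wpM2l ?invr_ge0 ?exprn_ge0//.
    rewrite !mulrA (_ : 2*2 = 4); last by ring.
    rewrite /E4 -expR_lb ler_expR /Fz (bigD1 p)//= lerDl sumr_ge0// => q _; exact: lb_ge0.
  rewrite sumr_const -[X in X<=_]mulr_natl ler_wpM2r ?mulr_ge0 ?invr_ge0 ?exprn_ge0 ?(ltW E40)// ler_nat.
  by rewrite card_sub; apply: leq_trans (max_card _) _; rewrite card_ord.
rewrite mE; move: full; rewrite (bigID (fun al : mi=> mdeg al<=I)%N)/= => full.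
have F1: 1<=expR (Fz (2*k)) by rewrite -expR0 ler_expR Fz_ge0.
have h: 4 ^- I*E4<=expR (Fz (2*k))*(4 ^- I*E4).
  by rewrite ler_peMl// mulr_ge0 ?invr_ge0 ?exprn_ge0 ?(ltW E40).
have -> : z.+2%:R*4 ^- I*E4 = z.+1%:R*(4 ^- I*E4)+4 ^- I*E4.
  by rewrite -mulrA -[z.+2%:R]natr1 mulrDl mul1r.
rewrite opprD addrA mulrBr; apply: le_trans (lerB full h) _.
by rewrite -addrA gerDl subr_le0.
Qed.
End PrimeSums.

(** * Complex functions of a real variable; the exponential *)

Section ComplexDerive.
Variable R : realType.
Implicit Types (F G : R -> R[i]) (x a b : R) (c d e : R[i]).

Definition cderiv F x d :=
  is_derive x (1 : R) (fun y=> Re (F y)) (Re d) /\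
  is_derive x (1 : R) (fun y=> Im (F y)) (Im d).

Lemma cderiv_eq F x d e : cderiv F x d -> d = e -> cderiv F x e.
Proof. by move=> h <-. Qed.

Lemma eq_cderiv F G x d : F =1 G -> cderiv F x d -> cderiv G x d.
Proof. by move=> FG; rewrite (_ : F = G)//; exact/funext. Qed.

Lemma cderiv_cst c x : cderiv (fun=> c) x 0.
Proof. by split; exact: is_derive_cst. Qed.

Lemma cderivD F G x d e : cderiv F x d -> cderiv G x e -> cderiv (fun y=> F y+G y) x (d+e).
Proof.
move=> [F1 F2] [G1 G2]; split; rewrite ?ReD ?ImD.
  rewrite (_ : (fun y=> _)=(fun y=> Re (F y))+(fun y=> Re (G y))); first exact: is_deriveD.
  by apply/funext=> y; rewrite ReD.
rewrite (_ : (fun y=> _)=(fun y=> Im (F y))+(fun y=> Im (G y))); first exact: is_deriveD.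
by apply/funext=> y; rewrite ImD.
Qed.

Lemma ReM c d : Re (c*d) = Re c*Re d-Im c*Im d. Proof. by case: c; case: d. Qed.
Lemma ImM c d : Im (c*d) = Re c*Im d+Im c*Re d.
Proof. by case: c=> ? ?; case: d=> ? ? /=; rewrite addrC. Qed.

Lemma is_derive_sub (f g : R -> R) x (df dg : R) : is_derive x (1 : R) f df ->
  is_derive x (1 : R) g dg -> is_derive x (1 : R) (fun y=> f y-g y) (df-dg).
Proof. by move=> hf hg; exact: is_deriveB. Qed.
Lemma is_derive_add (f g : R -> R) x (df dg : R) : is_derive x (1 : R) f df ->
  is_derive x (1 : R) g dg -> is_derive x (1 : R) (fun y=> f y+g y) (df+dg).
Proof. by move=> hf hg; exact: is_deriveD. Qed.
Lemma is_derive_mul (f g : R -> R) x (df dg : R) : is_derive x (1 : R) f df ->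
  is_derive x (1 : R) g dg -> is_derive x (1 : R) (fun y=> f y * g y) (df * g x + f x*dg).
Proof.
move=> hf hg; have := is_deriveM hf hg=> h; apply: (is_derive_eq h).
by rewrite /GRing.scale/= addrC mulrC.
Qed.

Lemma cderivM F G x d e : cderiv F x d -> cderiv G x e ->
  cderiv (fun y=> F y*G y) x (d*G x+F x * e).
Proof.
move=> [F1 F2] [G1 G2]; split.
  rewrite (_ : (fun y=> _)=(fun y=> Re (F y)*Re (G y)-Im (F y)*Im (G y))).
    apply: is_derive_eq (is_derive_sub (is_derive_mul F1 G1) (is_derive_mul F2 G2)) _.
    by rewrite ReD !ReM; ring.
  by apply/funext=> y; rewrite ReM.
rewrite (_ : (fun y=> _)=(fun y=> Re (F y)*Im (G y)+Im (F y)*Re (G y))).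
  apply: is_derive_eq (is_derive_add (is_derive_mul F1 G2) (is_derive_mul F2 G1)) _.
  by rewrite ImD !ImM; ring.
by apply/funext=> y; rewrite ImM.
Qed.

Lemma cderivZ c F x d : cderiv F x d -> cderiv (fun y=> c*F y) x (c*d).
Proof. by move=> h; apply: cderiv_eq (cderivM (cderiv_cst c x) h) _; rewrite mul0r add0r. Qed.

Lemma cderivN F x d : cderiv F x d -> cderiv (fun y=> - F y) x (- d).
Proof.
move=> h; apply: cderiv_eq (eq_cderiv _ (cderivZ (-1) h)) _; last by rewrite mulN1r.
by move=> y; rewrite mulN1r.
Qed.

Lemma cderivB F G x d e : cderiv F x d -> cderiv G x e -> cderiv (fun y=> F y-G y) x (d-e).
Proof. by move=> hF hG; apply: cderivD=>//; exact: cderivN. Qed.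

Lemma cderiv_real (f : R -> R) x (df : R) : is_derive x (1 : R) f df ->
  cderiv (fun y=> (f y)%:C) x df%:C.
Proof. by move=> h; split=>//; exact: is_derive_cst. Qed.

Lemma cderiv_sum (I : Type) (s : seq I) (F : I -> R -> R[i]) (d : I -> R[i]) x :
  (forall i, cderiv (F i) x (d i)) ->
  cderiv (fun y=> \sum_(i <- s) F i y) x (\sum_(i <- s) d i).
Proof.
move=> h; elim: s=> [|i s IH].
  by rewrite big_nil; apply: eq_cderiv (cderiv_cst 0 x)=> y; rewrite big_nil.
by rewrite big_cons; apply: eq_cderiv (cderivD (h i) IH)=> y; rewrite big_cons.
Qed.

Lemma cderivX F x d n : cderiv F x d -> cderiv (fun y=> F y^+n) x (n%:R*F x^+n.-1*d).
Proof.
move=> h; elim: n=> [|n IH].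
  by rewrite mul0r mul0r; apply: eq_cderiv (cderiv_cst 1 x)=> y; rewrite expr0.
apply: cderiv_eq (eq_cderiv _ (cderivM h IH)) _; first by move=> y; rewrite exprS.
case: n {IH} => [|n] /=; first by rewrite !expr0 mul0r !mulr1 mul0r mulr0 addr0 mul1r.
by rewrite exprS -[n.+2%:R]natr1; ring.
Qed.

Lemma cderiv_cis_lin (w x : R) : cderiv (fun y=> cis (w*y)) x (w%:C * 'i%C*cis (w*x)).
Proof.
have lin: is_derive x (1 : R) (fun y : R=> w*y) w.
  have h: is_derive x (1 : R) (w \*: (@id R)) (w *: (1 : R)) by exact: is_deriveZ.
  by apply: (is_derive_eq h); rewrite /GRing.scale/= mulr1.
split; rewrite /cis /=.
  by apply: (is_derive_eq (is_derive1_comp (is_derive_cos (w*x)) lin)); ring.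
by apply: (is_derive_eq (is_derive1_comp (is_derive_sin (w*x)) lin)); ring.
Qed.

Lemma cmean F (d : R -> R[i]) (a b M : R) : a<=b ->
  (forall x, a<=x<=b -> cderiv F x (d x)) ->
  (forall x, a<=x<=b -> nrm (d x)<=M) -> nrm (F b-F a)<=M*(b-a).
Proof.
move=> ab hF hd.
have := @nrm_mean_value _ (fun y=> Re (F y)) (fun y=> Im (F y)) (fun y=> Re (d y)) (fun y=> Im (d y)) a b M ab.
have e u : Re u +i* Im u = u by case: u.
rewrite !e; apply=> x xab; [by have [] := hF x xab|by have [] := hF x xab|].
by rewrite e; exact: hd.
Qed.

Lemma cderiv_comp F (f : R -> R) x d (df : R) : cderiv F (f x) d -> is_derive x (1 : R) f df ->
  cderiv (fun y=> F (f y)) x (df%:C*d).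
Proof.
move=> [h1 h2] hf; split; rewrite ?ReZ ?ImZ mulrC.
  exact: (is_derive1_comp h1 hf).
exact: (is_derive1_comp h2 hf).
Qed.

Definition cexp c : R[i] := (expR (Re c))%:C*cis (Im c).

Lemma nrm_cexp c : nrm (cexp c) = expR (Re c).
Proof. by rewrite /cexp nrmM nrm_cis mulr1 nrm_real_ge0// ltW// expR_gt0. Qed.

Lemma cexpD c d : cexp (c+d) = cexp c*cexp d.
Proof. by rewrite /cexp ReD ImD expRD cisD rmorphM/=; ring. Qed.

Lemma cexp0 : cexp 0 = 1. Proof. by rewrite /cexp/= expR0 cis0 mulr1. Qed.

Lemma cderiv_cexp c x : cderiv (fun y=> cexp (y%:C*c)) x (c*cexp (x%:C*c)).
Proof.
have lin (k : R) : is_derive x (1 : R) (fun y : R=> k*y) k.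
  have h: is_derive x (1 : R) (k \*: (@id R)) (k *: (1 : R)) by exact: is_deriveZ.
  by apply: (is_derive_eq h); rewrite /GRing.scale/= mulr1.
have e y : cexp (y%:C*c)=(expR (Re c*y))%:C*cis (Im c*y).
  by rewrite /cexp ReZ ImZ ![y * _]mulrC.
have h1 := cderiv_real (is_derive1_comp (is_derive_expR (Re c*x)) (lin (Re c))).
apply: eq_cderiv (_ : cderiv (fun y=> (expR (Re c*y))%:C*cis (Im c*y)) x _).
  by move=> y; rewrite e.
apply: cderiv_eq (cderivM h1 (cderiv_cis_lin (Im c) x)) _.
by rewrite e /= rmorphM/= [X in _ = X * _](complexE c); ring.
Qed.

(** After multiplication by [exp(- x c)] the derivative in [x] of the partial sum collapses to the
    single term [- c (x c)^n / n! exp(- x c)]; the mean value inequality on [[0, 1]] finishes. The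
    distance from 1 is the form needed, because later only ratios of polynomial and exponential are
    compared. *)
Lemma cexp_taylor c n :
  nrm (1-(\sum_(i<n.+1) c^+i / i`!%:R)*cexp (- c))<=nrm c^+n.+1 / n`!%:R * expR (nrm c).
Proof.
pose F x := (\sum_(i<n.+1) (x%:C*c)^+i / i`!%:R)*cexp (x%:C * - c).
have f0 (k : nat) : k`!%:R != 0 :> R[i] by rewrite pnatr_eq0 -lt0n fact_gt0.
have dl x : cderiv (fun y=> y%:C*c) x c.
  apply: cderiv_eq (cderivM (cderiv_real (is_derive_id _ _)) (cderiv_cst c x)) _.
  by rewrite mulr0 addr0 mul1r.
have dF x : cderiv F x (- (c*(x%:C*c)^+n / n`!%:R*cexp (x%:C * - c))).
  have h i : cderiv (fun y=> (y%:C*c)^+i / i`!%:R) x (i%:R*(x%:C*c)^+i.-1*c / i`!%:R).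
    apply: cderiv_eq (cderivM (cderivX i (dl x)) (cderiv_cst (i`!%:R^-1) x)) _.
    by rewrite mulr0 addr0.
  have hs := cderiv_sum (index_enum 'I_n.+1) (fun i : 'I_n.+1=> h i).
  apply: cderiv_eq (cderivM hs (cderiv_cexp (- c) x)) _.
  rewrite /= [in X in X*cexp _ + _]big_ord_recl/= mul0r mul0r mul0r add0r.
  rewrite [X in X*cexp _ + _](_ : _ = c * \sum_(i<n) (x%:C*c)^+i / i`!%:R); last first.
    rewrite big_distrr/=; apply: eq_bigr=> i _; rewrite /bump/= add1n factS natrM.
    have : i.+1%:R != 0 :> R[i] by rewrite pnatr_eq0.
    have := f0 i; rewrite add0n; move: (i.+1%:R) (i`!%:R)=> p q q0 p0.
    by field; rewrite q0 p0.
  by rewrite big_ord_recr/=; ring.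
have F0: F 0 = 1.
  rewrite /F !mul0r cexp0 mulr1 big_ord_recl/= expr0 fact0 divr1 big1 ?addr0// => i _.
  by rewrite exprS !mul0r.
have F1: F 1=(\sum_(i<n.+1) c^+i / i`!%:R)*cexp (- c).
  by rewrite /F !mul1r.
rewrite -F1 -[X in nrm (X - _)]F0 nrmBC -[X in _<=X]mulr1 -[X in _<=_*X](subr0 1).
apply: (cmean ler01 (fun x _=> dF x))=> x /andP[x0 x1].
rewrite nrmN nrmM nrm_cexp nrmM nrmV nrm_nat nrmM nrmX nrmM nrm_real_ge0// exprS -!mulrA.
rewrite ler_wpM2l ?nrm_ge0// exprMn -mulrA.
rewrite -[X in _<=X]mul1r ler_pM ?exprn_ge0 ?mulr_ge0 ?invr_ge0 ?exprn_ge0 ?nrm_ge0 ?(ltW (expR_gt0 _))//.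
  by rewrite exprn_ile1.
rewrite ler_wpM2l ?exprn_ge0 ?nrm_ge0// ler_wpM2l ?invr_ge0// ler_expR.
apply: le_trans (ler_norm _) _; apply: le_trans (Re_le_nrm _) _.
by rewrite nrmM nrmN nrm_real_ge0// ler_piMl ?nrm_ge0.
Qed.
End ComplexDerive.

(** * Difference quotients with a fixed step *)

Section Differences.
Variables (R : realType) (h : R).
Hypothesis h0 : 0<h.
Implicit Types (phi psi : R -> R[i]) (A B a b c : R).

Definition dh phi (t : R) : R[i] := (phi (t+h)-phi t) / h%:C.

(* Bounds on a function and on its first m difference quotients of step h; the right end
   of the interval recedes by h at each order. *)
Fixpoint Bm m phi A a b : Prop :=
  (forall t, a<=t<=b -> nrm (phi t)<=A) /\
  (if m is m'.+1 then Bm m' (dh phi) A a (b-h) else True).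

Lemma Bm_sup m phi A a b : Bm m phi A a b -> forall t, a<=t<=b -> nrm (phi t)<=A.
Proof. by case: m=> [|m] []. Qed.

Lemma Bm_le m phi A B a b : A<=B -> Bm m phi A a b -> Bm m phi B a b.
Proof.
move=> AB; elim: m phi b=> [|m IH] phi b [h1 h2]; split=>//.
- by move=> t /h1/le_trans; apply.
- by move=> t /h1/le_trans; apply.
- exact: IH.
Qed.

Lemma Bm_sub m phi A a b a' b' : a<=a' -> b'<=b -> Bm m phi A a b -> Bm m phi A a' b'.
Proof.
move=> aa; elim: m phi b b'=> [|m IH] phi b b' bb [h1 h2]; split=>//.
- by move=> t /andP[t1 t2]; apply: h1; rewrite (le_trans aa t1) (le_trans t2 bb).
- by move=> t /andP[t1 t2]; apply: h1; rewrite (le_trans aa t1) (le_trans t2 bb).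
- by apply: IH h2; rewrite lerD2r.
Qed.

Lemma BmW m phi A a b : Bm m.+1 phi A a b -> Bm m phi A a b.
Proof.
elim: m phi b=> [|m IH] phi b [h1 h2]; split=>//.
exact: IH.
Qed.

Lemma BmWr m phi A a b : Bm m phi A a b -> Bm m phi A a (b-h).
Proof. by apply: Bm_sub=>//; rewrite gerBl ltW. Qed.

Lemma Bm_shift m phi A a b : Bm m phi A a b -> Bm m (fun t=> phi (t+h)) A a (b-h).
Proof.
elim: m phi b=> [|m IH] phi b [h1 h2]; split=>//.
- by move=> t /andP[t1 t2]; apply: h1; rewrite (le_trans t1) ?lerDl ?(ltW h0)//= -lerBrDr.
- by move=> t /andP[t1 t2]; apply: h1; rewrite (le_trans t1) ?lerDl ?(ltW h0)//= -lerBrDr.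
- exact: (IH (dh phi) (b-h) h2).
Qed.

Lemma Bm_cst m (c : R[i]) A a b : nrm c<=A -> Bm m (fun=> c) A a b.
Proof.
elim: m c b=> [|m IH] c b cA; split=>//.
rewrite (_ : dh _ = fun=> 0); last by apply/funext=> t; rewrite /dh subrr mul0r.
by apply: IH; rewrite nrm0 (le_trans (nrm_ge0 c)).
Qed.

Lemma BmD m phi psi A B a b : Bm m phi A a b -> Bm m psi B a b ->
  Bm m (fun t=> phi t+psi t) (A+B) a b.
Proof.
elim: m phi psi b=> [|m IH] phi psi b [h1 h2] [k1 k2]; split=>//.
- by move=> t tab; apply: le_trans (nrmD _ _) _; rewrite lerD ?h1 ?k1.
- by move=> t tab; apply: le_trans (nrmD _ _) _; rewrite lerD ?h1 ?k1.
- rewrite (_ : dh _ = fun t=> dh phi t+dh psi t); first exact: IH.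
  by apply/funext=> t; rewrite /dh; ring.
Qed.

Lemma BmN m phi A a b : Bm m phi A a b -> Bm m (fun t=> - phi t) A a b.
Proof.
elim: m phi b=> [|m IH] phi b [h1 h2]; split=>//.
- by move=> t tab; rewrite nrmN h1.
- by move=> t tab; rewrite nrmN h1.
- rewrite (_ : dh _ = fun t=> - dh phi t); first exact: IH.
  by apply/funext=> t; rewrite /dh; ring.
Qed.

(** Discrete Leibniz rule, with one factor shifted by [h]; the two summands double the bound at each
    order. *)
Lemma BmM m phi psi A B a b : 0<=A -> 0<=B -> Bm m phi A a b -> Bm m psi B a b ->
  Bm m (fun t=> phi t * psi t) (2^+m*(A*B)) a b.
Proof.
move=> A0 B0; elim: m phi psi b=> [|m IH] phi psi b H K.
  by case: H K=> [h1 _] [k1 _]; split=>// t tab; rewrite expr0 mul1r nrmM ler_pM ?nrm_ge0 ?h1 ?k1.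
have [h1 h2] := H; have [k1 k2] := K; split.
  move=> t tab; rewrite nrmM; apply: le_trans (_ : A*B<=_).
    by rewrite ler_pM ?nrm_ge0 ?h1 ?k1.
  by rewrite ler_peMl ?mulr_ge0// exprn_ege1//; lra.
rewrite (_ : dh _ = fun t=> dh phi t * psi (t+h)+phi t*dh psi t); last first.
  by apply/funext=> t; rewrite /dh; ring.
rewrite exprS (_ : 2*2^+m*(A*B) = 2^+m*(A*B)+2^+m*(A*B)); last by ring.
apply: BmD; apply: IH=>//; first exact/Bm_shift/BmW.
exact/BmWr/BmW.
Qed.

(** The constants produced by iterating [dh (1/phi) = - dh phi / (phi t * phi (t+h))]; the power of
    4 collects the doublings of two product rules. *)
Fixpoint invK m A c : R := if m is m'.+1 then invK m' A c+4^+m'*A * invK m' A c^+2 else c^-1.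

Lemma invK_ge0 m A c : 0<=A -> 0<c -> 0<=invK m A c.
Proof.
move=> A0 c0; elim: m=> [|m IH] /=; first by rewrite invr_ge0 ltW.
by rewrite addr_ge0// !mulr_ge0// ?exprn_ge0//.
Qed.

Lemma invK_ge m A c : 0<=A -> 0<c -> c^-1<=invK m A c.
Proof.
move=> A0 c0; elim: m=> [|m IH] //=; rewrite ler_wpDr//.
by rewrite !mulr_ge0 ?exprn_ge0 ?invK_ge0// .
Qed.

(** From above only the differences of [phi] are controlled, [phi] itself only from below. This
    covers [wt], which is not bounded by 1 but has difference quotient of modulus 1. *)
Lemma BmV m phi A c a b : 0<=A -> 0<c -> (forall t, a<=t<=b -> c<=nrm (phi t)) ->
  (if m is m'.+1 then Bm m' (dh phi) A a (b-h) else True) ->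
  Bm m (fun t=> (phi t)^-1) (invK m A c) a b.
Proof.
move=> A0 c0.
have inv1 b' : (forall t, a<=t<=b' -> c<=nrm (phi t)) ->
    forall t, a<=t<=b' -> nrm (phi t)^-1<=c^-1.
  move=> lo t tab; rewrite nrmV lef_pV2 ?posrE ?lo//.
  by apply: lt_le_trans (lo _ tab).
elim: m b=> [|m IH] b lo H; split=>//; first exact: inv1.
  by move=> t tab; apply: le_trans (inv1 _ lo _ tab) _; exact: (@invK_ge m.+1).
have lo' t : a<=t<=b-h -> c<=nrm (phi t).
  move=> /andP[t1 t2]; apply: lo; rewrite t1 (le_trans t2)// gerBl ltW//.
have phi0 t : a<=t<=b -> phi t != 0.
  by move=> /lo; apply: contraTneq=> ->; rewrite nrm0 leNgt c0.
pose psi t := - (dh phi t*((phi t)^-1*(phi (t+h))^-1)).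
have Hm: Bm m (fun t=> (phi t)^-1) (invK m A c) a b.
  by apply: IH=>//; case: (m) H=>// m' H; exact: BmW.
have : Bm m psi (4^+m*A * invK m A c^+2) a (b-h).
  rewrite (_ : 4^+m*A * _ = 2^+m*(A*(2^+m*(invK m A c * invK m A c)))); last first.
    by rewrite (_ : 4 = 2*2) ?exprMn; ring.
  apply: BmN; apply: BmM=>//; first by rewrite !mulr_ge0 ?exprn_ge0 ?invK_ge0.
  apply: BmM; rewrite ?invK_ge0//; first exact: BmWr.
  exact: (Bm_shift Hm).
(* The quotient formula holds only where [phi] does not vanish, so [Bm] has to be transferred
   between functions that agree merely on the interval. *)
have ext m' f g B' b' : (forall t, a<=t<=b' -> f t = g t) -> Bm m' f B' a b' -> Bm m' g B' a b'.
  elim: m' f g b'=> [|m' IH'] f g b' fg [g1 g2]; split=>//.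
  - by move=> t tab; rewrite -fg// g1.
  - by move=> t tab; rewrite -fg// g1.
  - apply: IH' g2=> t /andP[t1 t2].
    have tb: t<=b' by rewrite (le_trans t2)// gerBl ltW.
    rewrite /dh !fg ?t1// (le_trans t1) ?lerDl ?(ltW h0)//= -lerBrDr//.
move=> Hpsi; apply: (@Bm_le _ _ (4^+m*A * invK m A c^+2)); first by rewrite /= lerDr invK_ge0.
apply: ext Hpsi=> t /andP[t1 t2]; rewrite /psi /dh.
have p1: phi t != 0 by apply: phi0; rewrite t1 (le_trans t2)// gerBl ltW.
have p2: phi (t+h) != 0 by apply: phi0; rewrite (le_trans t1) ?lerDl ?(ltW h0)//= -lerBrDr.
have p3: h%:C != 0 :> R[i] by rewrite eq_complex/= negb_and gt_eqF.
by field; rewrite p1 p2 p3.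
Qed.

Lemma Bm_iter m phi A a b : Bm m phi A a b ->
  forall t, a<=t<=b-m%:R * h -> nrm (iter m dh phi t)<=A.
Proof.
elim: m phi b=> [|m IH] phi b H t; first by rewrite mul0r subr0; exact: (Bm_sup H).
have [_ h2] := H; rewrite iterSr=> tab; apply: (IH _ _ h2).
by move: tab; rewrite -natr1 mulrDl mul1r opprD addrA addrAC.
Qed.

Lemma iter_Bm m phi A a b :
  (forall k t, (k<=m)%N -> a<=t<=b-k%:R * h -> nrm (iter k dh phi t)<=A) ->
  Bm m phi A a b.
Proof.
elim: m phi b=> [|m IH] phi b H; split=>//.
- by move=> t tab; apply: (H 0%N)=>//; rewrite mul0r subr0.
- by move=> t tab; apply: (H 0%N)=>//; rewrite mul0r subr0.
- apply: IH=> k t km tab; rewrite -iterSr; apply: H=>//.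
  by rewrite -natr1 mulrDl mul1r opprD addrA addrAC.
Qed.

Lemma iter_dhD m phi psi t :
  iter m dh (fun t=> phi t+psi t) t = iter m dh phi t + iter m dh psi t.
Proof.
elim: m phi psi t=> [|m IH] phi psi t //; rewrite !iterSr -IH.
by congr (iter m dh _ t); apply/funext=> s; rewrite /dh; ring.
Qed.
Lemma iter_dhN m phi t : iter m dh (fun t=> - phi t) t = - iter m dh phi t.
Proof.
elim: m phi t=> [|m IH] phi t //; rewrite !iterSr -IH.
by congr (iter m dh _ t); apply/funext=> s; rewrite /dh; ring.
Qed.
Lemma iter_dh_sum m (I : Type) (s : seq I) (F : I -> R -> R[i]) t :
  iter m dh (fun t=> \sum_(i <- s) F i t) t = \sum_(i <- s) iter m dh (F i) t.
Proof.
elim: s=> [|i s IH].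
  rewrite big_nil (_ : (fun t=> _) = fun=> 0); last by apply/funext=> x; rewrite big_nil.
  by elim: m=>// m IH; rewrite iterSr (_ : dh _ = fun=> 0)//; apply/funext=> x; rewrite /dh subrr mul0r.
rewrite big_cons -IH -iter_dhD; congr (iter m dh _ t).
by apply/funext=> x; rewrite big_cons.
Qed.
Lemma iter_dh_cderiv m (Q q : R -> R -> R[i]) x t : (forall t, cderiv (Q t) x (q t x)) ->
  cderiv (fun y=> iter m dh (Q^~ y) t) x (iter m dh (q^~ x) t).
Proof.
elim: m Q q t=> [|m IH] Q q t H; first exact: H.
pose Q' s y := dh (Q^~ y) s; pose q' s y := dh (q^~ y) s.
apply: (@eq_cderiv _ (fun y=> iter m dh (Q'^~ y) t)); first by move=> y; rewrite iterSr.
rewrite iterSr; apply: (IH Q' q')=> s; rewrite /Q' /q' /dh.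
apply: cderiv_eq (cderivM (cderivB (H _) (H _)) (cderiv_cst _ _)) _.
by rewrite mulr0 addr0.
Qed.
End Differences.

(** * Complex powers and the terms of zeta near the 1-line *)

Section ComplexPower.
Variable R : realType.

(* x^c for real x > 0 and complex c *)
Definition cx (c : R[i]) (x : R) : R[i] := cexp ((ln x)%:C*c).

Lemma cxD c d x : cx (c+d) x = cx c x*cx d x.
Proof. by rewrite /cx mulrDr cexpD. Qed.

Lemma nrm_cx c x : nrm (cx c x) = expR (ln x*Re c).
Proof. by rewrite /cx nrm_cexp ReZ. Qed.

Lemma cderiv_cx c x : 0<x -> cderiv (cx c) x (x^-1%:C*(c*cx c x)).
Proof.
move=> x0; apply: (@cderiv_comp _ (fun y=> cexp (y%:C*c)) (@ln R) x); first exact: cderiv_cexp.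
exact: is_derive1_ln.
Qed.

Lemma nst_cx (s t : R) n : (0<n)%N -> nst s t n = cx (- (s +i* t)) n%:R.
Proof.
move=> n0; rewrite /nst /cx /cexp ReZ ImZ /= /powR pnatr_eq0 eqn0Ngt n0/=.
by rewrite /nit /lnn !mulrN mulNr [s * _]mulrC [t * _]mulrC.
Qed.
End ComplexPower.

Section ZetaTerms.
Variables (R : realType) (h de : R).
Hypotheses (h0 : 0<h) (de0 : 0<de) (de1 : de<=1).

(** This is [s - 1] at the point [s = 1 + de + i t]. *)
Definition wt (t : R) : R[i] := de +i* t.
Definition qj (j : nat) (t x : R) : R[i] := ((ln x)^+j)%:C*cx (- (1+wt t)) x.

Lemma wt_neq0 t : wt t != 0.
Proof. by rewrite eq_complex/= negb_and gt_eqF. Qed.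

(* Antiderivatives in x of qj 0 and qj 1. *)
Definition Qj (j : nat) (t x : R) : R[i] :=
  if j is 0 then-(cx (- wt t) x / wt t)
  else-(((ln x)%:C / wt t+(wt t^+2)^-1)*cx (- wt t) x).

Lemma cderiv_Qj j t x : (j<=1)%N -> 0<x -> cderiv (Qj j t) x (qj j t x).
Proof.
move=> j1 x0; have w0 := wt_neq0 t.
have xc: x%:C != 0 :> R[i] by rewrite eq_complex/= negb_and gt_eqF.
have e: cx (- (1+wt t)) x = x^-1%:C*cx (- wt t) x.
  rewrite opprD cxD; congr (_ * _); rewrite /cx /cexp ReZ ImZ /= oppr0 mulr0 cis0 mulr1 mulrN1.
  by rewrite expRN lnK.
case: j j1=> [|[|//]] _; rewrite /qj /Qj e.
  apply: cderiv_eq (cderivN (cderivM (cderiv_cx (- wt t) x0) (cderiv_cst (wt t)^-1 x))) _.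
  rewrite mulr0 addr0 expr0 (_ : (1 : R)%:C = 1 :> R[i])// mul1r.
  move: (cx (- wt t) x)=> b; move: (x^-1%:C)=> a; move: (wt t) w0=> w w0.
  by field.
have dl: cderiv (fun y=> (ln y)%:C) x x^-1%:C by apply: cderiv_real; exact: is_derive1_ln.
have dlw := cderivD (cderivM dl (cderiv_cst (wt t)^-1 x)) (cderiv_cst (wt t^+2)^-1 x).
apply: cderiv_eq (cderivN (cderivM dlw (cderiv_cx (- wt t) x0))) _.
by rewrite mulr0 !addr0 expr1 fmorphV/=; field; rewrite w0 xc.
Qed.

(** A difference quotient in [t] multiplies [x^-s] by [vh x], the discrete counterpart of the factor
    [- i ln x] produced by a derivative; for [x >= 1] its modulus is at most [ln x]. *)
Definition vh (x : R) : R[i] := (cx (0 -i* h) x - 1) / h%:C.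

Lemma iter_dh_qj m j t x : iter m (dh h) (fun t=> qj j t x) t = qj j t x * vh x^+m.
Proof.
elim: m t=> [|m IH] t; first by rewrite expr0 mulr1.
rewrite iterS /dh !IH exprS.
have -> : qj j (t+h) x = qj j t x*cx (0 -i* h) x.
  have ew: - (1+wt (t+h)) = - (1+wt t)+(0 -i* h).
    by apply/eqP; rewrite eq_complex/= addr0 eqxx/= !add0r opprD.
  by rewrite /qj ew cxD mulrA.
by rewrite /vh; ring.
Qed.

Definition ell (n : nat) : R := 1+lnn R n.+1.

Lemma ell_ge1 n : 1<=ell n. Proof. by rewrite lerDl lnn_ge0. Qed.

Section OneTerm.
Variable n : nat.
Hypothesis n0 : (0<n)%N.
Let l := ell n.
Let inI (x : R) := n%:R<=x<=n.+1%:R.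

Lemma inI_gt0 x : inI x -> 0<x.
Proof. by move=> /andP[nx _]; apply: lt_le_trans nx; rewrite ltr0n. Qed.

Lemma inI_ln x : inI x -> 0<=ln x<=l.
Proof.
move=> /andP[nx xn]; have x1: 1<=x by apply: le_trans nx; rewrite ler1n.
rewrite ln_ge0//= /l /ell; apply: le_trans (_ : lnn R n.+1<=_); last by rewrite lerDr.
by rewrite ler_ln ?posrE ?ltr0n// (lt_le_trans _ x1).
Qed.

Lemma nrm_vh x : inI x -> nrm (vh x)<=l.
Proof.
move=> xI; have /andP[l0 ll] := inI_ln xI.
rewrite /vh nrmM nrmV nrm_real_ge0 ?(ltW h0)// ler_pdivrMr//.
have -> : cx (0 -i* h) x = cis (- (ln x * h)).
  by rewrite /cx /cexp ReZ ImZ /= mulr0 expR0 mul1r mulrN.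
have := cis_lip (- (ln x * h)) 0; rewrite cis0 subr0 normrN=> /le_trans; apply.
by rewrite ger0_norm ?mulr_ge0 ?(ltW h0)// ler_wpM2r ?(ltW h0).
Qed.

Lemma nrm_base t x : inI x -> nrm (cx (- (1+wt t)) x)<=n%:R^-1.
Proof.
move=> xI; have x0 := inI_gt0 xI; have /andP[l0 _] := inI_ln xI; have /andP[nx _] := xI.
rewrite nrm_cx /= opprD mulrDr mulrN1 expRD.
apply: le_trans (_ : expR (- ln x)*1<=_).
  rewrite ler_wpM2l ?(ltW (expR_gt0 _))// -expR0 ler_expR mulrN oppr_le0 mulr_ge0// ltW//.
by rewrite mulr1 expRN lnK ?posrE// lef_pV2 ?posrE ?ltr0n.
Qed.

Lemma nrm_qm m j t x : inI x -> nrm (qj j t x * vh x^+m)<=l^+(j+m) / n%:R.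
Proof.
move=> xI; have /andP[l0 ll] := inI_ln xI.
have l1: 0<=l by exact: le_trans ll.
rewrite /qj nrmM nrmM nrmX nrm_real_ge0 ?exprn_ge0// exprD mulrAC.
by rewrite ler_pM ?mulr_ge0 ?exprn_ge0 ?nrm_ge0 ?nrm_base// ler_pM ?exprn_ge0 ?nrm_ge0 ?lerXn2r ?nnegrE ?nrm_ge0 ?nrm_vh.
Qed.

(** Mean value inequality in [x]: the derivative gains a further [1/n], which makes the sum over [n]
    converge, at the price of a factor linear in [|t|] from the derivative of [x^-s]. *)
Lemma nrm_qm_diff m j t x : inI x ->
  nrm (qj j t x * vh x^+m-qj j t n%:R * vh n%:R^+m) <=
  (3+j%:R+m%:R + `|t|) * l^+(j+m) / n%:R^+2.
Proof.
move=> /andP[nx xn].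
set B := _ / _.
have B0: 0<=B.
  by rewrite /B divr_ge0 ?exprn_ge0 ?mulr_ge0 ?addr_ge0// exprn_ge0// (le_trans ler01 (ell_ge1 n)).
pose d y : R[i] := y^-1%:C*(j%:R*((ln y)^+j.-1)%:C*cx (- (1+wt t)) y * vh y^+m
   + (- (1+wt t))*(qj j t y * vh y^+m)
   + m%:R*(qj j t y * vh y^+m.-1)*((0 -i* 1)*cx (0 -i* h) y)).
apply: le_trans (_ : B*(x-n%:R)<=_); last first.
  by rewrite ler_piMr// lerBlDr addrC natr1.
apply: (@cmean _ (fun y=> qj j t y * vh y^+m) d)=>// y /andP[ny yx].
all: have yI: inI y by rewrite /inI ny (le_trans yx xn).
all: have y0 := inI_gt0 yI.
  have dlnX: cderiv (fun y=> ((ln y)^+j)%:C) y (y^-1%:C*(j%:R*((ln y)^+j.-1)%:C)).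
    have dl: cderiv (fun y=> (ln y)%:C) y y^-1%:C by apply: cderiv_real; exact: is_derive1_ln.
    apply: cderiv_eq (eq_cderiv _ (cderivX j dl)) _; first by move=> s; rewrite rmorphXn.
    by rewrite rmorphXn; ring.
  have dv: cderiv vh y (y^-1%:C*((0 -i* 1)*cx (0 -i* h) y)).
    apply: cderiv_eq (cderivM (cderivB (cderiv_cx (0 -i* h) y0) (cderiv_cst 1 y)) (cderiv_cst (h%:C)^-1 y)) _.
    rewrite mulr0 addr0 subr0; move: (cx (0 -i* h) y)=> b.
    have -> : (0 -i* h : R[i]) = h%:C*(0 -i* 1) by apply/eqP; rewrite eq_complex/= !mul0r mulr0 subr0 addr0 mulrN1 !eqxx.
    have hc: h%:C != 0 :> R[i] by rewrite eq_complex/= negb_and gt_eqF.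
    by move: (y^-1%:C)=> a; field.
  apply: cderiv_eq (cderivM (cderivM dlnX (cderiv_cx (- (1+wt t)) y0)) (cderivX m dv)) _.
  by rewrite /d /qj; ring.
have /andP[l0 ll] := inI_ln yI.
have l1: 1<=l := ell_ge1 n.
have n0': 0<n%:R :> R by rewrite ltr0n.
have ln0: 0<=l := le_trans ler01 l1.
rewrite /d nrmM nrm_real_ge0 ?invr_ge0 ?(ltW y0)//.
rewrite /B expr2 invfM [X in _<=X]mulrA [X in X<=_]mulrC ler_pM ?nrm_ge0 ?invr_ge0 ?(ltW y0)//; last first.
  by rewrite lef_pV2 ?posrE//; case/andP: yI.
apply: le_trans (nrmD _ _) _; apply: le_trans (lerD (nrmD _ _) (lexx _)) _.
have -> : (3+j%:R+m%:R + `|t|) * l^+(j+m) / n%:R =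
   j%:R*(l^+(j+m) / n%:R)+(3 + `|t|)*(l^+(j+m) / n%:R)+m%:R*(l^+(j+m) / n%:R) by ring.
have lm k : (k<=j+m)%N -> l^+k / n%:R<=l^+(j+m) / n%:R.
  by move=> kjm; rewrite ler_wpM2r ?invr_ge0// ler_weXn2l.
apply: lerD; first apply: lerD.
- rewrite nrmM nrmM nrmM nrm_nat nrmX nrm_real_ge0 ?exprn_ge0// -!mulrA ler_wpM2l//.
  apply: le_trans (_ : l^+(j.-1+m) / n%:R<=_); last by rewrite lm// leq_add2r leq_pred.
  rewrite exprD [X in _*X]mulrC mulrA.
  by rewrite ler_pM ?mulr_ge0 ?exprn_ge0 ?nrm_ge0 ?nrm_base// ler_pM ?exprn_ge0 ?nrm_ge0 ?lerXn2r ?nnegrE ?nrm_ge0 ?nrm_vh.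
- rewrite nrmM ler_pM ?nrm_ge0 ?nrm_qm// nrmN.
  apply: le_trans (nrm_le_ReIm _) _; rewrite /= add0r ger0_norm ?addr_ge0 ?(ltW de0)//.
  by rewrite lerD2r; move: de1; lra.
- rewrite nrmM nrmM nrm_nat -mulrA ler_wpM2l//.
  apply: le_trans (_ : l^+(j+m.-1) / n%:R<=_); last by rewrite lm// leq_add2l leq_pred.
  rewrite -[X in _<=X]mulr1 ler_pM ?nrm_ge0 ?nrm_qm// nrmM nrm_cx /= mulr0 expR0 mulr1.
  by rewrite /nrm/= expr0n add0r sqrrN expr1n sqrtr1.
Qed.

(** A term minus its integral over [[n, n+1]]: summed over [n], this removes the pole at [s = 1]. *)
Definition uj j t : R[i] := qj j t n%:R-(Qj j t n.+1%:R-Qj j t n%:R).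

(** Difference quotients in [t] commute with the antiderivative in [x], so only the variation of the
    integrand over [[n, n+1]] counts. *)
Lemma iter_uj j m t (B : R) : (j<=1)%N ->
  (forall x, inI x -> nrm (qj j t x * vh x^+m-qj j t n%:R * vh n%:R^+m)<=B) ->
  nrm (iter m (dh h) (uj j) t)<=B.
Proof.
move=> j1 HB.
have -> : iter m (dh h) (uj j) t = iter m (dh h) (fun t=> qj j t n%:R) t -
    (iter m (dh h) (fun t=> Qj j t n.+1%:R) t - iter m (dh h) (fun t=> Qj j t n%:R) t).
  rewrite (iter_dhD h m (fun s=> qj j s n%:R) (fun s=> - (Qj j s n.+1%:R-Qj j s n%:R))).
  rewrite (iter_dhN h m (fun s=> Qj j s n.+1%:R-Qj j s n%:R)).
  by rewrite (iter_dhD h m (fun s=> Qj j s n.+1%:R) (fun s=> - Qj j s n%:R)) iter_dhN.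
rewrite iter_dh_qj.
pose F y := iter m (dh h) (fun t=> Qj j t y) t-y%:C*(qj j t n%:R * vh n%:R^+m).
have dF y : inI y -> cderiv F y (qj j t y * vh y^+m-qj j t n%:R * vh n%:R^+m).
  move=> /inI_gt0 y0; apply: cderivB.
    rewrite -iter_dh_qj; apply: (@iter_dh_cderiv _ h m (Qj j) (qj j) y t)=> s; exact: cderiv_Qj.
  apply: cderiv_eq (cderivM (cderiv_real (is_derive_id _ _)) (cderiv_cst _ y)) _.
  by rewrite mulr0 addr0 mul1r.
have nn: (n%:R : R)<=n.+1%:R by rewrite ler_nat.
have := cmean nn dF HB.
have e1: (n.+1%:R-n%:R : R) = 1 by rewrite -natr1 addrAC subrr add0r.
rewrite e1 mulr1=> H.
rewrite -nrmN; apply: le_trans H; apply: eq_ler; congr nrm.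
by rewrite /F -natr1 rmorphD/=; ring.
Qed.
End OneTerm.
End ZetaTerms.

(** * Elementary sums of powers *)

Section RealSums.
Variable R : realType.

Lemma ln_ge_1Vn (n : nat) : (1<n)%N -> n%:R^-1<=lnn R n-lnn R n.-1 :> R.
Proof.
case: n=>// n n0; have n1: (0<n)%N by [].
have := @lnn_diff R n n.+1 n.+1 n1 isT (leqnSn _) (leqnn _).
rewrite distrC [X in _<=X]distrC !ger0_norm /=.
- by rewrite -natrB// subSnn mul1r.
- by have /andP[] := @lnn_incr R n n1.
- by rewrite subr_ge0 ler_nat.
Qed.

Lemma powR_expR (n : nat) (b : R) : (0<n)%N -> n%:R`^b = expR (b * lnn R n).
Proof. by move=> n0; rewrite /powR pnatr_eq0 eqn0Ngt n0. Qed.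

(** From [1 + y <= e^y] and [1/n <= ln n - ln (n-1)] each term is at most
    [((n-1)^(1-b) - n^(1-b)) / (b-1)], and these telescope: an integral comparison without
    integrals. *)
Lemma sum_tail (b : R) (M N : nat) : 1<b -> (0<M)%N ->
  \sum_(M.+1<=n<N.+1) n%:R`^(- b)<=M%:R`^(1-b)/(b - 1).
Proof.
move=> b1 M0.
have b0: 0<b - 1 by rewrite subr_gt0.
have step n : (1<n)%N -> n%:R`^(- b)<=(n.-1%:R`^(1-b)-n%:R`^(1-b))/(b - 1) :> R.
  move=> n1; have n0: (0<n)%N := ltnW n1; have p0: (0<n.-1)%N by rewrite -subn1 subn_gt0.
  rewrite ler_pdivlMr// lerBrDr.
  have -> : n%:R`^(- b)*(b - 1)+n%:R`^(1-b) = n%:R`^(1-b)*(1+(b - 1) / n%:R).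
    have -> : n%:R`^(1-b) = n%:R*n%:R`^(- b) :> R.
      by rewrite powRD ?powRr1// pnatr_eq0 -lt0n n0 implybT.
    by field; rewrite pnatr_eq0 -lt0n.
  apply: le_trans (_ : n%:R`^(1-b) * expR ((b - 1)*(lnn R n-lnn R n.-1))<=_).
    rewrite ler_wpM2l ?powR_ge0//; apply: le_trans (expR_ge1Dx _) _.
    by rewrite ler_expR ler_wpM2l ?(ltW b0) ?ln_ge_1Vn.
  by rewrite !powR_expR// -expRD ler_expR; apply: eq_le_ || (apply: eq_ler; ring).
have [NM|MN] := leqP N M.
  by rewrite big_geq ?divr_ge0 ?powR_ge0 ?(ltW b0)// ltnS.
apply: le_trans (_ : \sum_(M.+1<=n<N.+1) (n.-1%:R`^(1-b)-n%:R`^(1-b))/(b - 1)<=_).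
  by apply: ler_sum_nat=> n /andP[Mn _]; apply: step; apply: leq_ltn_trans Mn.
rewrite -big_distrl/= ler_wpM2r ?invr_ge0 ?(ltW b0)//.
rewrite big_add1/= (eq_bigr (fun n : nat=> - (n.+1%:R`^(1-b)-n%:R`^(1-b)))); last first.
  by move=> n _; rewrite opprB.
rewrite sumrN (telescope_sumr (fun n : nat=> n%:R`^(1-b))) ?(ltnW MN)// opprB.
by rewrite gerBl powR_ge0.
Qed.

Lemma sum_head (a : R) (N : nat) : 0<a<1 ->
  \sum_(1<=n<N.+1) n%:R`^(- a)<=2/(1-a)*N%:R`^(1-a).
Proof.
move=> /andP[a0 a1]; have c0: 0<1-a by rewrite subr_gt0.
elim: N=> [|N IH]; first by rewrite big_geq// mulr_ge0 ?powR_ge0 ?divr_ge0 ?(ltW c0).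
rewrite big_nat_recr//=; apply: le_trans (lerD IH (lexx _)) _.
case: N {IH} => [|N].
  rewrite powR0 ?gt_eqF// mulr0 add0r !powR1 mulr1 ler_pdivlMr// mul1r.
  by move: a0; lra.
set n := N.+2; have nE: N.+1 = n.-1 by []; rewrite nE.
have n1: (1<n)%N by []; have n0: (0<n)%N by [].
rewrite -lerBrDl -mulrBr mulrAC ler_pdivlMr//.
have -> : n%:R`^(- a) = n%:R`^(1-a) / n%:R :> R.
  rewrite powRD; last by rewrite pnatr_eq0 implybT.
  by rewrite powRr1// mulrC mulrA mulVf ?mul1r// pnatr_eq0.
have n00: 0<n%:R :> R by rewrite ltr0n.
pose y : R := (1-a) / n%:R.
have y0: 0<y by rewrite divr_gt0.
have y1: y<=1.
  rewrite ler_pdivrMr// mul1r; apply: le_trans (_ : 1<=_); last by rewrite ler1n.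
  by move: a0; lra.
have h: n.-1%:R`^(1-a)<=n%:R`^(1-a) * expR (- y).
  rewrite !powR_expR// -expRD ler_expR -lerBlDl -mulrBr.
  have := ln_ge_1Vn n1; rewrite /y=> h1.
  by rewrite -mulrN ler_wpM2l ?(ltW c0)// -lerN2 opprB opprK.
have hy: 0<1-y/2 by move: y1; lra.
have h2: expR (- y)<=1-y/2.
  rewrite expRN -[1-y/2]invrK lef_pV2 ?posrE ?expR_gt0 ?invr_gt0//.
  apply: le_trans (expR_ge1Dx y); rewrite -[X in X<=_]mul1r ler_pdivrMr//.
  by have := mulr_ge0 (ltW y0) (ltW y0); move: y0 y1; nra.
have P0: 0<=n%:R`^(1-a) :> R by exact: powR_ge0.
have : n.-1%:R`^(1-a)<=n%:R`^(1-a)*(1-y/2) by apply: le_trans h _; rewrite ler_wpM2l.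
rewrite /y; move: (n.-1%:R`^(1-a)) (n%:R`^(1-a)) P0=> u v v0 huv.
have -> : v / n%:R*(1-a) = v*((1-a) / n%:R) by ring.
by move: huv; rewrite -/y; move: y0 y1; lra.
Qed.

Lemma ln_pow_le (K : nat) (e : R) : 0<e ->
  exists2 C : R, 1<=C & forall x, 1<=x -> (1+ln x)^+K<=C*x`^e.
Proof.
move=> e0; case: K=> [|K].
  exists 1=>// x x1; rewrite expr0 mul1r -[X in X<=_](powRr0 x) ler_powR ?x1//.
  exact: ltW.
pose f := e/K.+1%:R; have f0: 0<f by rewrite divr_gt0.
exists ((1 + f^-1)^+K.+1); first by rewrite exprn_ege1// lerDl invr_ge0 ltW.
move=> x x1; have x0: 0<x by exact: lt_le_trans x1.
have l0: 0<=ln x by rewrite ln_ge0.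
have xf1: 1<=x`^f by rewrite -[X in X<=_](powRr0 x) ler_powR ?x1// ltW.
have lf: ln x<=f^-1*x`^f.
  rewrite ler_pdivlMl//; have := expR_ge1Dx (f * ln x); rewrite /powR gt_eqF//.
  by apply: le_trans; rewrite lerDr.
have -> : x`^e=(x`^f)^+K.+1.
  by rewrite -powR_mulrn ?powR_ge0// -powRrM /f divfK// pnatr_eq0.
have q0: 0<=1 + f^-1 by rewrite addr_ge0// invr_ge0 ltW.
rewrite -exprMn lerXn2r ?nnegrE ?addr_ge0// ?mulr_ge0 ?powR_ge0//.
by rewrite mulrDl mul1r lerD.
Qed.
End RealSums.

(** * Zeta and its derivative with the pole removed *)

Section ZTilde.
Variable R : realType.

(** Up to a boundary term at [N + 1]: for [j = 0] the function [zeta(s) - 1/(s-1)], for [j = 1] the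
    function [- zeta'(s) - 1/(s-1)^2]. *)
Definition Zt (de : R) (N j : nat) (t : R) : R[i] := \sum_(1<=n<N.+1) uj de n j t.

(** Uniformity in [h], [de] and [N] is the point: [N] is sent to infinity and [de] to 0 only
    afterwards. *)
Lemma Zt_bound (m j : nat) : (j<=1)%N -> exists2 C : R, 1<=C &
  forall h de N t D, 0<h -> 0<de -> de<=1 -> 2<=D -> `|t| <= D ->
   nrm (iter m (dh h) (Zt de N j) t)<=C*(1+ln D)^+(j+m).+1.
Proof.
move=> j1; have hh: 0<2^-1 :> R by rewrite invr_gt0.
have [C0 C01 HC0] := ln_pow_le (j+m) hh.
set K := (j+m)%N in HC0 *.
have C00: 0<=C0 := le_trans ler01 C01.
have k1: 1<=2*4^+K.+1 :> R by rewrite mulr_ege1// ?exprn_ege1//; lra.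
exists (2*4^+K.+1+4*C0*(4+K%:R)).
  by rewrite ler_wpDr ?mulr_ge0// addr_ge0.
move=> h de N t D h0 de0 de1 D2 tD.
have D0: 0<D by move: D2; lra.
pose d := (Num.truncn D).+1.
have Dd: D<=d%:R by exact: ltW (truncnS_gt _).
have dD: d%:R<=D+1 by rewrite -natr1 lerD2r truncn_le ltW.
(* The cut lies at about [D^2]. Up to it the terms are bounded trivially by a power of the logarithm
   over [n]. Beyond it the bound is of order [D n^(-3/2)], whose sum is of order [D / d] and hence
   bounded. *)
pose M := (d*d)%N.
have M0: (0<M)%N by [].
pose L := 1+ln D.
have lD0: 0<=ln D by rewrite ln_ge0//; move: D2; lra.
have L1: 1<=L by rewrite lerDl.
have lM: ell R M<=4*L.
  have : lnn R M.+1<=4 * ln D.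
    rewrite /lnn -[4 * ln D]mulr_natl || idtac.
    rewrite (_ : 4 * ln D = ln (D^+4)); last by rewrite lnXn// mulr_natl.
    rewrite ler_ln ?posrE ?exprn_gt0// -natr1 natrM.
    apply: le_trans (_ : (D+1)*(D+1)+1<=_).
      by rewrite lerD2r ler_pM.
    have D2': 4<=D^+2 by rewrite (_ : 4 = 2^+2 :> R) ?lerXn2r ?nnegrE ?(ltW D0)//; ring.
    by rewrite (_ : D^+4 = D^+2*D^+2); [move: D2 D2'; nra|ring].
  by rewrite /ell /L; lra.
rewrite /Zt iter_dh_sum; apply: le_trans (nrm_sum _ _ _) _.
pose be n : R := if (n<=M)%N then 2 * ell R n^+K / n%:R else (3+K%:R+D) * ell R n^+K / n%:R^+2.
have e0 n : 0<=ell R n := le_trans ler01 (ell_ge1 R n).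
have be0 n : 0<=be n.
  by rewrite /be; case: ifP=> _; do ?[apply: mulr_ge0|apply: addr_ge0]; rewrite ?invr_ge0 ?exprn_ge0 ?e0 ?(ltW D0).
apply: le_trans (_ : \sum_(1<=n<N.+1) be n<=_).
  apply: ler_sum_nat=> n /andP[n0 _]; apply: iter_uj=>// x xI; rewrite /be; case: ifP=> _.
    apply: le_trans (nrmB _ _) _.
    have nI: n%:R<=(n%:R : R)<=n.+1%:R by rewrite lexx ler_nat leqnSn.
    have q1 := nrm_qm h0 de0 n0 m j t xI; have q2 := nrm_qm h0 de0 n0 m j t nI.
    by rewrite -mulrA mulr2n mulrDl mul1r lerD.
  apply: le_trans (nrm_qm_diff h0 de0 de1 n0 m j t xI) _.
  rewrite -/K ler_wpM2r ?invr_ge0 ?exprn_ge0// ler_wpM2r ?exprn_ge0//.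
  by rewrite natrD addrA; move: tD; lra.
apply: le_trans (_ : \sum_(1<=n<(maxn N M).+1) be n<=_).
  rewrite [X in _<=X](@big_cat_nat _ _ _ N.+1)//= ?ltnS ?leq_maxl// lerDl.
  by apply: sumr_ge0.
rewrite (@big_cat_nat _ _ _ M.+1)//= ?ltnS ?leq_maxr// mulrDl; apply: lerD.
  apply: le_trans (_ : \sum_(1<=n<M.+1) (2*(4*L)^+K)*n%:R^-1<=_).
    apply: ler_sum_nat=> n /andP[n0 nM]; rewrite /be -ltnS nM ler_wpM2r ?invr_ge0// ler_wpM2l//.
    rewrite lerXn2r ?nnegrE ?mulr_ge0 ?(le_trans ler01 L1)//; apply: le_trans lM.
    by rewrite lerD2l ler_ln ?posrE ?ltr0n// ler_nat.
  rewrite -big_distrr/=; apply: le_trans (_ : 2*(4*L)^+K*(4*L)<=_).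
    rewrite ler_wpM2l ?mulr_ge0 ?exprn_ge0 ?mulr_ge0 ?(le_trans ler01 L1)//.
    apply: le_trans (harmonic_le R M0) _; apply: le_trans lM.
    by rewrite lerD2l ler_ln ?posrE ?ltr0n// ler_nat.
  by rewrite -mulrA -exprSr exprMn mulrA.
apply: le_trans (_ : \sum_(M.+1<=n<(maxn N M).+1) (2*C0*(3+K%:R+D))*n%:R`^(- (3/2))<=_).
  apply: ler_sum_nat=> n /andP[Mn _]; rewrite /be leqNgt Mn/=.
  have n0: (0<n)%N := leq_ltn_trans (leq0n _) Mn.
  have n0': 0<n%:R :> R by rewrite ltr0n.
  rewrite mulrAC [X in _<=X]mulrAC -mulrA [X in _<=X]mulrC ler_wpM2l ?addr_ge0 ?(ltW D0)//.
  have x1: 1<=n.+1%:R :> R by rewrite ler1n.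
  have := HC0 _ x1; rewrite -/(lnn R n.+1) -/(ell R n)=> H.
  rewrite ler_pdivrMl ?exprn_gt0//; apply: le_trans H _.
  rewrite [X in _<=X]mulrC [2*C0]mulrC -!mulrA ler_wpM2l//.
  have -> : n%:R`^(- (3/2))*n%:R^+2 = n%:R`^2^-1 :> R.
    by rewrite -powR_mulrn// -powRD; [congr (_`^_); lra|rewrite (gt_eqF n0') implybT].
  apply: le_trans (_ : (4*n%:R)`^2^-1<=_).
    rewrite ge0_ler_powR ?nnegrE ?mulr_ge0// -natrM ler_nat.
    by rewrite mulSn -addn1 leq_add2l muln_gt0 n0.
  rewrite powRM// ler_wpM2r ?powR_ge0// (_ : 4 = 2^+2 :> R); last by ring.
  by rewrite -powR_mulrn// -powRrM divff ?powRr1.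
rewrite -big_distrr/=.
have b1: 1<3/2 :> R by lra.
have := sum_tail (maxn N M) b1 M0=> H.
apply: le_trans (ler_wpM2l _ H) _; first by rewrite !mulr_ge0 ?addr_ge0 ?(ltW D0).
have d0: 0<d%:R :> R by rewrite ltr0n.
have -> : M%:R`^(1 - 3/2) = d%:R^-1 :> R.
  rewrite natrM -expr2 -powR_mulrn ?(ltW d0)// -powRrM (_ : 2%:R*(1 - 3/2) = -1); last by lra.
  by rewrite powR_inv1 ?(ltW d0).
apply: le_trans (_ : 4*C0*(4+K%:R)*1<=_); last first.
  by rewrite ler_wpM2l ?exprn_ege1// !mulr_ge0// addr_ge0.
rewrite mulr1 (_ : 2*C0*(3+K%:R+D)*(d%:R^-1/(3/2 - 1)) = 4*C0*((3+K%:R+D) / d%:R)); last first.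
  by field; rewrite (gt_eqF d0)/= ; lra.
rewrite ler_wpM2l ?mulr_ge0// ler_pdivrMr//.
have : 0<=K%:R :> R by []; have : 1<=d%:R :> R by rewrite ler1n.
by move: Dd; move: (K%:R : R) (d%:R : R)=> a b; nra.
Qed.
End ZTilde.

(** * Algebra of Dirichlet polynomials *)

Section DirichletPoly.
Variables (R : realType) (s t : R).
Implicit Types (f g : nat -> R).

Definition Dp f (N : nat) : R[i] := \sum_(1<=n<N.+1) (f n)%:C*nst s t n.

Lemma DpM f g N M : Dp f N*Dp g M = Dp (conv (trunc N f) (trunc M g)) (N*M).
Proof.
by apply: (mul_Dirichlet_poly (real_complex R) f g N M)=> m n m0 n0; exact: nstM.
Qed.

Lemma eq_Dp f g N : (forall n, (0<n<=N)%N -> f n = g n) -> Dp f N = Dp g N.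
Proof. by move=> fg; apply: eq_big_nat=> n n0; rewrite fg. Qed.

Lemma Dp_widen f N M : (N<=M)%N -> (forall n, (N<n)%N -> f n = 0) -> Dp f N = Dp f M.
Proof.
move=> NM f0; apply: big_nat1_widen=>// n Nn.
by rewrite f0// mul0r.
Qed.

Lemma nrm_Dp f N : nrm (Dp f N) <= \sum_(1<=n<N.+1) `|f n| * n%:R`^(- s).
Proof.
apply: le_trans (nrm_sum _ _ _) _; apply: ler_sum=> n _.
by rewrite nrmM nrmC nrm_nst.
Qed.

Lemma cpow_supp f (z i n : nat) : (forall n, (z<n)%N -> f n = 0) ->
  (z ^ i<n)%N -> cpow f i n = 0.
Proof.
move=> fz; elim: i n=> [|i IH] n /=.
  by rewrite expn0 /delta1; case: n=> [|[|n]].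
move=> zn; have [->|n0] := posnP n; first by rewrite conv0.
rewrite conv_divisors// big1_seq// => d /andP[dn]; rewrite mem_index_iota=> /andP[d0 _].
have [dz|dz] := leqP d z; last by rewrite fz// mul0r.
rewrite IH ?mulr0// ltn_divRL//.
by apply: leq_ltn_trans zn; rewrite expnS mulnC leq_mul2r dz orbT.
Qed.

Lemma Dp_cpow f (z i : nat) : (0<z)%N -> (forall n, (z<n)%N -> f n = 0) ->
  Dp f z^+i = Dp (cpow f i) (z ^ i).
Proof.
move=> z0 fz; elim: i=> [|i IH].
  by rewrite expr0 expn0 /Dp big_nat1 /= /delta1 eqxx nst1 mulr1.
rewrite exprS IH DpM expnS; apply: eq_Dp=> n _ /=; apply: eq_conv=> a _; rewrite /trunc.
  by have [|az] := leqP a z; rewrite ?mul1r// fz ?mulr0.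
by have [|az] := leqP a (z ^ i); rewrite ?mul1r// mul0r (cpow_supp fz).
Qed.

Lemma Dp_sum (I : nat) (c : nat -> R) (F : nat -> nat -> R) N :
  \sum_(i<I) (c i)%:C*Dp (F i) N = Dp (fun n=> \sum_(i<I) c i*F i n) N.
Proof.
rewrite /Dp; under eq_bigr do rewrite big_distrr/=.
rewrite exchange_big/=; apply: eq_bigr=> n _; rewrite rmorph_sum/= big_distrl/=.
by apply: eq_bigr=> i _; rewrite rmorphM/= mulrA.
Qed.

Lemma rz_supp z n : (z<n)%N -> rz R z n = 0.
Proof. by rewrite /rz ltnNge=> /negbTE ->; rewrite andbF. Qed.

Lemma Dp_mI (z I : nat) : (0<z)%N ->
  \sum_(i<I.+1) (- Dp (rz R z) z)^+i / i`!%:R = Dp (mI R z I) (z ^ I).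
Proof.
move=> z0; rewrite /mI.
transitivity (\sum_(i<I.+1) ((-1)^+i / i`!%:R : R)%:C*Dp (cpow (rz R z) i) (z ^ I)); last first.
  exact: (Dp_sum _ (fun i=> (-1)^+i / i`!%:R)).
apply: eq_bigr=> i _; rewrite -(@Dp_widen (cpow (rz R z) i) (z ^ i) (z ^ I)); last 2 first.
- by rewrite leq_pexp2l// -ltnS.
- by move=> n; apply: cpow_supp=> m; exact: rz_supp.
rewrite -Dp_cpow//; last by move=> n; exact: rz_supp.
have -> : ((-1)^+i / i`!%:R : R)%:C=(-1)^+i / i`!%:R by rewrite fmorph_div rmorph_sign rmorph_nat.
by rewrite [in LHS]exprNn mulrAC.
Qed.

Lemma le_conv_dvn f g n : (forall a, `|f a| <= 1) -> (forall a, `|g a| <= 1) ->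
  `|conv f g n| <= dvn R n.
Proof. by move=> f1 g1; apply: le_norm_conv=> a _; [exact: f1|exact: g1]. Qed.

Lemma norm_trunc N f a : (forall a, `|f a| <= 1) -> `|trunc N f a| <= 1.
Proof.
by move=> f1; rewrite /trunc normrM normr_nat; case: (a<=N)%N; rewrite ?mul1r ?mul0r.
Qed.
End DirichletPoly.

(** * The approximate Euler product and the 3-4-1 inequality *)

Section EulerProduct.
Variable R : realType.

Definition ZN (de t : R) N : R[i] := Dp (1+de) t (one_fun R) N.
Definition Lz (de t : R) z : R[i] := Dp (1+de) t (rz R z) z.

(** The product has coefficients 1, 0, ..., 0 up to [z]; the rest is a tail controlled by the
    divisor bound, uniformly in [t], [I] and [N]. *)
Lemma zeta_mI (de : R) : 0<de -> exists2 C : R, 0<=C & forall t z I N, (0<z)%N ->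
  (z<2 ^ I)%N -> (z<=N)%N ->
  nrm (ZN de t N*Dp (1+de) t (mI R z I) (z ^ I) - 1)<=C*z%:R`^(- (de/2)).
Proof.
move=> de0; have e0: 0<de/2 by rewrite divr_gt0.
have [C0 C01 HC] := divisor_bound e0.
exists (C0/(de/2)); first by rewrite divr_ge0 ?(ltW e0)// (le_trans ler01).
move=> t z I N z0 zI zN; rewrite DpM.
set c := conv _ _; set M := (N*z ^ I)%N.
have N0: (0<N)%N := leq_trans z0 zN.
have zM: (z<=M)%N by apply: leq_trans zN _; rewrite leq_pmulr// expn_gt0 z0.
have csmall n : (0<n<=z)%N -> c n=(n == 1)%:R.
  move=> /andP[n0 nz].
  have -> : c n = cz R z n.
    rewrite /cz /c; apply: eq_conv=> a /andP[a0 an].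
      by rewrite /trunc (leq_trans an (leq_trans nz zN)) mul1r.
    have az := leq_trans an nz; rewrite /trunc mI_eq ?(leq_ltn_trans az)//.
    case: (leqP a (z ^ I))=> aI; rewrite ?mul1r//.
    case: I zI aI {c M zM} => [|I] zI aI; last by move: aI; rewrite ltnNge (leq_trans az)// -[X in (X<=_)%N]expn1 leq_pexp2l.
    by move: zI; rewrite expn0 ltnS leqn0 (gtn_eqF z0).
  have [->|n1] := eqVneq n 1%N; first by rewrite cz1.
  by rewrite cz_small// nz andbT ltn_neqAle eq_sym n1.
have cbig n : `|c n| <= dvn R n.
  apply: le_conv_dvn=> a; apply: norm_trunc=> b; last exact: norm_mI_le1.
  by rewrite normr1.
rewrite /Dp (@big_cat_nat _ _ _ z.+1)//= (bigD1_seq 1%N) ?iota_uniq//=; last by rewrite mem_index_iota.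
rewrite csmall ?z0// eqxx nst1 mulr1 big_seq_cond [X in _+X + _ - _]big1 ?addr0; last first.
  move=> n /andP[]; rewrite mem_index_iota=> /andP[n0 nz] n1.
  by rewrite csmall ?n0// (negbTE n1) mul0r.
rewrite addrAC subrr add0r; apply: le_trans (nrm_sum _ _ _) _.
apply: le_trans (_ : \sum_(z.+1<=n<M.+1) C0*n%:R`^(- (1+de/2))<=_).
  apply: ler_sum_nat=> n /andP[zn _]; have n0: (0<n)%N := leq_ltn_trans (leq0n _) zn.
  rewrite nrmM nrmC nrm_nst; apply: le_trans (_ : C0*n%:R`^(de/2)*n%:R`^(- (1+de))<=_).
    by rewrite ler_wpM2r ?powR_ge0//; apply: le_trans (cbig n) (HC n n0).
  rewrite -mulrA -powRD; last by rewrite pnatr_eq0 -lt0n n0 implybT.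
  by rewrite (_ : de/2 + - (1+de) = - (1+de/2))//; field.
rewrite -big_distrr/=; have b1: 1<1+de/2 by rewrite ltrDl.
apply: le_trans (ler_wpM2l (le_trans ler01 C01) (sum_tail M b1 z0)) _.
rewrite (_ : 1-(1+de/2) = - (de/2)); last by ring.
by rewrite (_ : 1+de/2 - 1 = de/2) ?mulrA 1?mulrAC//; ring.
Qed.

Lemma fact_exp_small (x e : R) : 0<=x -> 0<e ->
  exists I0, forall I, (I0<=I)%N -> x^+I.+1/I`!%:R<=e.
Proof.
move=> x0 e0.
have := cvg_exp_coeff x=> /cvgrPdist_le.
have [->|xn0] := eqVneq x 0.
  by move=> _; exists 0%N=> I _; rewrite exprS !mul0r ltW.
have xpos: 0<x by rewrite lt_def xn0.
move=> /(_ (e / x)) []; first by rewrite divr_gt0.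
move=> I0 _ H; exists I0=> I /H; rewrite sub0r normrN ger0_norm ?exp_coeff_ge0//.
by rewrite /exp_coeff/= ler_pdivlMr// exprSr mulrAC.
Qed.

Lemma nrm_Lz_le (de t : R) z : 0<de -> nrm (Lz de t z)<=z%:R.
Proof.
move=> de0; apply: le_trans (nrm_Dp _ _ _ _) _.
apply: le_trans (_ : \sum_(1<=n<z.+1) 1<=_); last by rewrite big_const_nat iter_addr_0 subSS subn0.
apply: ler_sum_nat=> n /andP[n0 _]; rewrite -[X in _<=X]mulr1 ler_pM ?powR_ge0//.
  rewrite ger0_norm ?rz_ge0// /rz; case: ifP=>// /andP[n1 _].
  by rewrite ler_pdivrMr ?lnn_gt0// mul1r mangoldt_le_lnn.
by rewrite powRN invf_le1 ?powR_gt0 ?ltr0n// -[X in X<=_](powRr0 n%:R) ler_powR ?ler1n// addr_ge0// ltW.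
Qed.

Lemma absorb_quarter (y e : R) : 0<e -> e<1 -> 0<=y -> y<=e/4+y*(e/4)+e/4 -> y<=e.
Proof. by move=> e0 e1 y0 h; nra. Qed.

Lemma zeta_euler (de e : R) : 0<de -> 0<e -> e<1 -> exists z N0, (0<z)%N /\
  forall N t, (N0<=N)%N -> nrm (ZN de t N*cexp (- Lz de t z) - 1)<=e.
Proof.
move=> de0 e0 e1; have [C C0 HC] := zeta_mI de0.
have e40: 0<e/4 by rewrite divr_gt0.
have d20: 0<de/2 by rewrite divr_gt0.
pose z := (Num.truncn ((4*C / e)`^(de/2)^-1)).+1.
have z0: (0<z)%N by [].
have Cz: C*z%:R`^(- (de/2))<=e/4.
  have : (4*C / e)`^(de/2)^-1<=z%:R by exact: ltW (truncnS_gt _).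
  move=> /(ge0_ler_powR (ltW d20)); rewrite !nnegrE powR_ge0 ler0n=> /(_ isT isT).
  rewrite -powRrM mulVf ?gt_eqF// powRr1; last by rewrite divr_ge0 ?mulr_ge0// ltW.
  rewrite ler_pdivrMr// => H; rewrite powRN ler_pdivrMr ?powR_gt0 ?ltr0n//; move: H.
  by move: (z%:R`^(de/2))=> y; lra.
pose x : R := z%:R.
have b0: 0<e/4 / expR x by rewrite divr_gt0// expR_gt0.
have [I0 HI] := fact_exp_small (ler0n R z) b0.
pose I := maxn I0 z; exists z, z; split=>// N t zN.
have zI: (z<2 ^ I)%N.
  by apply: leq_trans (ltn_expl z (ltnSn 1)) _; rewrite leq_pexp2l// leq_maxr.
have H1 := HC t z I N z0 zI zN.
set M := Dp _ _ _ _ in H1; set Z := ZN de t N in H1 *; set L := Lz de t z.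
have ME: M = \sum_(i<I.+1) (- L)^+i / i`!%:R by rewrite Dp_mI.
have := cexp_taylor (- L) I; rewrite -ME opprK nrmN=> H2.
have Lx: nrm L<=x := nrm_Lz_le t z de0.
have H2': nrm (1-M*cexp L)<=e/4.
  apply: le_trans H2 _; apply: le_trans (_ : x^+I.+1/I`!%:R * expR x<=_).
    rewrite ler_pM ?mulr_ge0 ?exprn_ge0 ?nrm_ge0 ?invr_ge0 ?(ltW (expR_gt0 _)) ?ler_expR//.
    by rewrite ler_wpM2r ?invr_ge0// lerXn2r ?nnegrE ?nrm_ge0// ler0n.
  by rewrite -ler_pdivlMr ?expR_gt0// HI// leq_maxl.
have LL: cexp L*cexp (- L) = 1 by rewrite -cexpD subrr cexp0.
set Y := Z*cexp (- L).
have E: Y*(M*cexp L) = Z*M by rewrite /Y; transitivity (Z*M*(cexp L*cexp (- L))); [ring|rewrite LL mulr1].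
(* The Taylor error multiplies the unknown [Y - 1] itself; being at most [e/4] it can be absorbed on
   the left. *)
have E2: Y - 1=(Z*M - 1)+(Y - 1)*(1-M*cexp L)+(1-M*cexp L) by rewrite -E; ring.
have : nrm (Y - 1)<=e/4+nrm (Y - 1)*(e/4)+e/4.
  rewrite {1}E2; apply: le_trans (nrmD _ _) _; apply: lerD=>//.
  apply: le_trans (nrmD _ _) _; apply: lerD; first exact: le_trans H1 Cz.
  by rewrite nrmM ler_wpM2l ?nrm_ge0.
by apply: absorb_quarter=>//; exact: nrm_ge0.
Qed.

(** Mertens' inequality [3 + 4 cos x + cos 2x >= 0] applied to finite prime sums. Each of the eight
    factors loses at most 1/16 in passing to partial sums of zeta, and [(15/16)^8] exceeds 1/2. *)
Lemma three_four_one (de : R) : 0<de -> exists N0, forall N t, (N0<=N)%N ->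
  2^-1<=nrm (ZN de 0 N)^+3*nrm (ZN de t N)^+4*nrm (ZN de (2 * t) N).
Proof.
move=> de0; have e0: 0<16^-1 :> R by rewrite invr_gt0.
have e1: 16^-1<1 :> R by lra.
have [z [N0 [z0 H]]] := zeta_euler de0 e0 e1; exists N0=> N t NN.
have lo u : 15/16 * expR (Re (Lz de u z))<=nrm (ZN de u N).
  have := H N u NN; set Z := ZN _ _ _; set L := Lz _ _ _=> h.
  have h1: 15/16<=nrm (Z*cexp (- L)).
    have := nrm_leB 1 (1-Z*cexp (- L)).
    by rewrite opprB addrCA subrr addr0 nrm1 nrmBC; move: h; lra.
  move: h1; rewrite nrmM nrm_cexp ReN expRN=> h1.
  by rewrite -ler_pdivlMr ?expR_gt0.
have key: 0<=3*Re (Lz de 0 z)+4*Re (Lz de t z)+Re (Lz de (2 * t) z).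
  rewrite /Lz /Dp !Re_sum !big_distrr/= -!big_split/=; apply: sumr_ge0=> n _.
  rewrite !mul0r !subr0 oppr0 cos0 !cosN -[2 * t * _]mulrA.
  set th := t * lnn R n.
  have -> : cos (2 * th) = 2*cos th^+2 - 1.
    by rewrite mulr_natl cos_mulr2n mulr_natl.
  have := sqr_ge0 (1+cos th).
  have := mulr_ge0 (rz_ge0 R z n) (powR_ge0 n%:R (- (1+de))).
  move: (rz R z n) (n%:R`^_) (cos th)=> r p c r0 c0.
  rewrite [X in _<=X](_ : _ = r * p*(2*(1+c)^+2)); last by ring.
  by rewrite mulr_ge0// mulr_ge0.
set a := Re (Lz de 0 z) in key *; have := lo 0; have := lo t; have := lo (2 * t).
move: key; rewrite -/a; set b := Re (Lz de t z); set c := Re (Lz de (2 * t) z)=> key lc lb la.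
have p (x : R) : 0<=15/16 * expR x by rewrite mulr_ge0// ltW// expR_gt0.
apply: le_trans (_ : (15/16 * expR a)^+3*(15/16 * expR b)^+4*(15/16 * expR c)<=_); last first.
  rewrite !ler_pM ?mulr_ge0 ?exprn_ge0 ?p//; apply: lerXn2r; rewrite ?nnegrE ?p ?nrm_ge0//.
rewrite !exprMn -!expRM_natl.
rewrite [X in _<=X](_ : _=(15/16)^+8 * expR (3*a+4*b+c)); last by rewrite !expRD; field.
apply: le_trans (_ : (15/16)^+8*1<=_); last first.
  by rewrite ler_wpM2l ?exprn_ge0 ?divr_ge0// -[X in X<=_]expR0 ler_expR.
by rewrite mulr1 !exprS expr0; lra.
Qed.
End EulerProduct.

(** * Partial sums of zeta, of its derivative and of its logarithmic derivative *)

Section ZetaDecomposition.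
Variable R : realType.
Implicit Types (de t : R) (N : nat).

(** The value of zeta at [1 + de + i t] with its pole displayed; it differs from the partial sum
    [ZN] by a boundary term that vanishes as [N] grows. *)
Definition Vt de N t : R[i] := Zt de N 0 t+(wt de t)^-1.
Definition LN de t N : R[i] := Dp (1+de) t (lnn R) N.
Definition AN de t N : R[i] := Dp (1+de) t (mangoldt R) N.

Lemma cx1 (c : R[i]) : cx c 1 = 1.
Proof. by rewrite /cx ln1 rmorph0 mul0r cexp0. Qed.

Lemma qj_nst de j t n : (0<n)%N -> qj de j t n%:R=(lnn R n^+j)%:C*nst (1+de) t n.
Proof.
move=> n0; have E: 1+wt de t=(1+de) +i* t by apply/eqP; rewrite eq_complex/= add0r !eqxx.
rewrite /qj nst_cx// E; reflexivity. Qed.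

Lemma sum_qj de j t N :
  \sum_(1<=n<N.+1) qj de j t n%:R = Zt de N j t+(Qj de j t N.+1%:R-Qj de j t 1).
Proof.
rewrite /Zt /uj sumrB /= (telescope_sumr (fun n=> Qj de j t n%:R))//.
by rewrite subrK.
Qed.

Lemma ZN_eq de t N : 0<de -> ZN de t N = Vt de N t+Qj de 0 t N.+1%:R.
Proof.
move=> de0; have := sum_qj de 0 t N; rewrite /= cx1 mul1r opprK=> E.
rewrite /Vt -addrA [_^-1 + _]addrC -E /ZN /Dp; apply: eq_big_nat=> n /andP[n0 _].
by rewrite qj_nst// expr0.
Qed.

Lemma LN_eq de t N : 0<de ->
  LN de t N = Zt de N 1 t+(wt de t^+2)^-1+Qj de 1 t N.+1%:R.
Proof.
move=> de0; have := sum_qj de 1 t N.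
rewrite [Qj de 1 t 1]/= cx1 ln1 rmorph0 mul0r add0r mulr1 opprK=> E.
rewrite -addrA [_^-1 + _]addrC -E /LN /Dp; apply: eq_big_nat=> n /andP[n0 _].
by rewrite qj_nst// expr1.
Qed.

Lemma nrm_wt_ge_de de t : 0<de -> de<=nrm (wt de t).
Proof. by move=> de0; have := Re_le_nrm (wt de t); rewrite /= ger0_norm// ltW. Qed.

Lemma nrm_wt_ge de t : `|t| <= nrm (wt de t).
Proof. by have := Im_le_nrm (wt de t). Qed.

Lemma nrm_cxw de t x : nrm (cx (- wt de t) x) = expR (- (de * ln x)).
Proof. by rewrite nrm_cx /= mulrN mulrC. Qed.

Lemma nrm_Q0 de t x : 0<de -> nrm (Qj de 0 t x)<=expR (- (de * ln x)) / de.
Proof.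
move=> de0; rewrite /Qj nrmN nrmM nrm_cxw nrmV ler_wpM2l ?(ltW (expR_gt0 _))//.
by rewrite lef_pV2 ?posrE ?nrm_wt_ge_de// (lt_le_trans de0)// nrm_wt_ge_de.
Qed.

Lemma nrm_Q1 de t x : 0<de -> 1<=x ->
  nrm (Qj de 1 t x)<=(ln x / de+(de^+2)^-1) * expR (- (de * ln x)).
Proof.
move=> de0 x1; have W := nrm_wt_ge_de t de0; have W0 := lt_le_trans de0 W.
rewrite /Qj nrmN nrmM nrm_cxw ler_wpM2r ?(ltW (expR_gt0 _))//.
apply: le_trans (nrmD _ _) _; rewrite nrmM !nrmV nrmX nrm_real_ge0 ?ln_ge0//; apply: lerD.
  by rewrite ler_wpM2l ?ln_ge0// lef_pV2 ?posrE.
by rewrite lef_pV2 ?posrE ?exprn_gt0// lerXn2r// nnegrE ltW.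
Qed.

Lemma pow_small (a e C : R) : 0<a -> 0<e -> exists N0, forall N, (N0<=N)%N ->
  (0<N)%N /\ C*N%:R`^(- a)<=e.
Proof.
move=> a0 e0; pose B : R := Num.max (C / e) 1.
have B0: 0<B by rewrite lt_max ltr01 orbT.
exists (Num.truncn (B`^a^-1)).+1=> N HN; have N0: (0<N)%N by exact: leq_ltn_trans HN.
split=>//; rewrite powRN ler_pdivrMr ?powR_gt0 ?ltr0n// mulrC -ler_pdivrMr//.
apply: le_trans (_ : B<=_); first by rewrite le_max lexx.
have : B`^a^-1<=N%:R by apply: le_trans (ltW (truncnS_gt _)) _; rewrite ler_nat.
move=> /(ge0_ler_powR (ltW a0)); rewrite !nnegrE powR_ge0 ler0n=> /(_ isT isT).
by rewrite -powRrM mulVf ?gt_eqF// powRr1// ltW.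
Qed.

Lemma expR_powN de (x : R) : 0<x -> expR (- (de * ln x)) = x`^(- de).
Proof. by move=> x0; rewrite /powR gt_eqF// mulNr. Qed.

Lemma ln_le_powR de : 0<de -> exists2 C : R, 1<=C & forall x, 1<=x ->
  (1+ln x)*x`^(- de)<=C*x`^(- (de/2)).
Proof.
move=> de0; have d2: 0<de/2 by rewrite divr_gt0.
have [C C1 HC] := ln_pow_le 1 d2; exists C=>// x x1.
have x0: 0<x := lt_le_trans ltr01 x1.
apply: le_trans (_ : C*x`^(de/2)*x`^(- de)<=_).
  by rewrite ler_wpM2r ?powR_ge0// -[X in X<=_]expr1 HC.
rewrite -mulrA -powRD; last by rewrite (gt_eqF x0) implybT.
by rewrite (_ : de/2 + - de = - (de/2))//; field.
Qed.

Lemma Q_small de e : 0<de -> 0<e -> exists N0, forall N, (N0<=N)%N -> forall j t, (j<=1)%N ->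
  nrm (Qj de j t N.+1%:R)<=e.
Proof.
move=> de0 e0; have [C C1 HC] := ln_le_powR de0.
pose K := (de^-1+(de^+2)^-1).
have i0: 0<=de^-1 by rewrite invr_ge0 ltW.
have i2: 0<=(de^+2)^-1 by rewrite invr_ge0 exprn_ge0// ltW.
have K0: 0<=K by rewrite addr_ge0.
have d2: 0<de/2 by rewrite divr_gt0.
have [N0 HN] := pow_small (K*C) d2 e0; exists N0=> N NN j t j1.
have [_ H] := HN N.+1 (leqW NN); apply: le_trans H.
have x1: 1<=N.+1%:R :> R by rewrite ler1n.
move: x1; move: (N.+1%:R : R)=> x x1; have x0 := lt_le_trans ltr01 x1.
rewrite -mulrA; apply: le_trans (ler_wpM2l K0 (HC x x1)); rewrite mulrA.
have l0 := ln_ge0 x1.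
case: j j1=> [|[|//]] _.
  apply: le_trans (nrm_Q0 _ _ de0) _; rewrite expR_powN// mulrC ler_wpM2r ?powR_ge0//.
  by rewrite /K; move: i0 i2 l0; move: (de^-1) ((de^+2)^-1) (ln x)=> a b c; nra.
apply: le_trans (nrm_Q1 _ de0 x1) _; rewrite expR_powN// ler_wpM2r ?powR_ge0//.
by rewrite /K; move: i0 i2 l0; move: (de^-1) ((de^+2)^-1) (ln x)=> a b c; nra.
Qed.

Lemma conv_trunc2 (N M : nat) (f g : nat -> R) n : (n<=N)%N -> (n<=M)%N ->
  conv (trunc N f) (trunc M g) n = conv f g n.
Proof.
move=> nN nM; apply: eq_conv=> a /andP[_ an]; rewrite /trunc.
  by rewrite (leq_trans an nN) mul1r.
by rewrite (leq_trans an nM) mul1r.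
Qed.

(** The relation between zeta and its logarithmic derivative for partial sums: the coefficients
    agree up to [N], and from [N] to [N^2] those of the product are at most [1 + ln n]. *)
Lemma AN_ZN de e : 0<de -> 0<e -> exists N0, forall N, (N0<=N)%N -> forall t,
  nrm (AN de t N*ZN de t N-LN de t N)<=e.
Proof.
move=> de0 e0; have [C C1 HC] := ln_le_powR de0.
have d2: 0<de/2 by rewrite divr_gt0.
have [N0 HN] := pow_small (C/(de/2)) d2 e0; exists N0=> N NN t.
have [Np H] := HN N NN; apply: le_trans H.
rewrite DpM; set c := conv _ _.
have NM: (N<=N*N)%N by rewrite leq_pmulr.
have -> : Dp (1+de) t c (N*N)-LN de t N = \sum_(N.+1<=n<(N*N).+1) (c n)%:C*nst (1+de) t n.
  rewrite /Dp (@big_cat_nat _ _ _ N.+1)//= (_ : \sum_(1<=i<N.+1) _ = LN de t N); first by rewrite addrAC subrr add0r.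
  rewrite /LN /Dp; apply: eq_big_nat=> n /andP[n0 nN].
  by rewrite /c conv_trunc2// conv_mangoldt_one.
apply: le_trans (nrm_sum _ _ _) _.
apply: le_trans (_ : \sum_(N.+1<=n<(N*N).+1) C*n%:R`^(- (1+de/2))<=_).
  apply: ler_sum_nat=> n /andP[Nn _]; have n0: (0<n)%N := leq_ltn_trans (leq0n _) Nn.
  have n1: 1<=n%:R :> R by rewrite ler1n.
  have n0': 0<n%:R :> R by rewrite ltr0n.
  rewrite nrmM nrmC nrm_nst.
  have cl: `|c n| <= 1+ln n%:R.
    apply: le_trans (_ : lnn R n<=_); last by rewrite lerDr.
    rewrite -conv_mangoldt_one//; apply: le_norm_conv=> a _; rewrite /trunc normrM.
      rewrite [X in _*X]ger0_norm ?mangoldt_ge0//.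
      by case: (a<=N)%N; rewrite ?normr1 ?mul1r// normr0 mul0r mangoldt_ge0.
    by case: (a<=N)%N; rewrite /one_fun ?normr1 ?mul1r// normr0 mul0r.
  have spl (b : R) : n%:R`^(- (1+b)) = n%:R`^(- b)*n%:R^-1.
    by rewrite addrC opprD powRD ?powR_inv1 ?(ltW n0')// (gt_eqF n0') implybT.
  rewrite !spl !mulrA ler_wpM2r ?invr_ge0 ?(ltW n0')//.
  by apply: le_trans (HC _ n1); rewrite ler_wpM2r ?powR_ge0.
rewrite -big_distrr/=; have b1: 1<1+de/2 by rewrite ltrDl.
apply: le_trans (ler_wpM2l (le_trans ler01 C1) (sum_tail (N*N) b1 Np)) _.
rewrite (_ : 1-(1+de/2) = - (de/2)); last by ring.
by rewrite (_ : 1+de/2 - 1 = de/2) ?mulrA 1?mulrAC//; ring.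
Qed.

Lemma cderiv_wtV t de : 0<de -> cderiv (fun y=> (wt y t)^-1) de (- (wt de t^+2)^-1).
Proof.
move=> de0; have n0: de^+2+t^+2 != 0 by rewrite gt_eqF// ltr_wpDr ?sqr_ge0// exprn_gt0.
have dn: is_derive de (1 : R) (fun y : R=> y^+2+t^+2) (2*de).
  have h := is_derive_mul (is_derive_id de (1 : R)) (is_derive_id de (1 : R)).
  have := is_derive_add h (is_derive_cst (t^+2) de (1 : R))=> k.
  by apply: (is_derive_eq k); ring.
have dV: is_derive de (1 : R) (fun y : R=> (y^+2+t^+2)^-1) (- (de^+2+t^+2) ^- 2*(2*de)).
  have k := @is_deriveV R (fun y : R=> y^+2+t^+2) de (2*de) (1 : R) n0 dn.
  by apply: (is_derive_eq k).
have sq: wt de t^+2=(de^+2-t^+2) +i* (2*de * t).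
  by apply/eqP; rewrite eq_complex expr2 /=; apply/andP; split; apply/eqP; ring.
have nn: (de^+2-t^+2)^+2+(2*de * t)^+2=(de^+2+t^+2)^+2 by ring.
split.
  have := is_derive_mul (is_derive_id de (1 : R)) dV=> h; apply: (is_derive_eq h).
  by rewrite sq /= nn; field.
have := is_derive_mul (is_derive_cst (- t) de (1 : R)) dV=> h.
rewrite (_ : (fun y=> _)=(fun y : R=> - t*(y^+2+t^+2)^-1)); last first.
  by apply/funext=> y /=; rewrite mulNr.
apply: (is_derive_eq h); rewrite sq /= nn mul0r add0r.
by field.
Qed.

Lemma cderiv_cxw t x de : cderiv (fun y=> cx (- wt y t) x) de (- (ln x)%:C*cx (- wt de t) x).
Proof.
have E y : cx (- wt y t) x = cx (0 -i* t) x*cexp (y%:C*(- ln x)%:C).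
  rewrite (_ : - wt y t=(0 -i* t)+(- y)%:C); last by apply/eqP; rewrite eq_complex /= add0r addr0 !eqxx.
  rewrite cxD [X in _*X]/cx -!rmorphM/= (_ : ln x * - y = y * - ln x)//; ring.
have := cderivZ (cx (0 -i* t) x) (cderiv_cexp (- ln x)%:C de)=> h.
apply: cderiv_eq (eq_cderiv _ h) _; first by move=> y; rewrite E.
by rewrite E rmorphN/=; ring.
Qed.

Lemma cderiv_uj0 t n de : 0<de -> (0<n)%N -> cderiv (fun y=> uj y n 0 t) de (- uj de n 1 t).
Proof.
move=> de0 n0.
have dQ x : cderiv (fun y=> Qj y 0 t x) de (- Qj de 1 t x).
  have := cderivN (cderivM (cderiv_cxw t x de) (cderiv_wtV t de0))=> h.
  apply: cderiv_eq h _; rewrite /=; have := wt_neq0 de0 t; move: (wt de t) (cx _ _)=> w c w0.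
  by field.
have dq: cderiv (fun y=> qj y 0 t n%:R) de (- qj de 1 t n%:R).
  have E y : qj y 0 t n%:R = n%:R^-1%:C*cx (- wt y t) n%:R.
    rewrite /qj expr0 mul1r opprD cxD [X in X * _](_ : _ = n%:R^-1%:C)//.
    rewrite /cx /cexp ReZ ImZ /= oppr0 mulr0 cis0 mulr1 mulrN1 expRN lnK// posrE ltr0n//.
  apply: cderiv_eq (eq_cderiv _ (cderivZ (n%:R^-1%:C) (cderiv_cxw t n%:R de))) _.
    by move=> y; rewrite E.
  have := E de; rewrite /qj expr0 mul1r expr1=> ->.
  by move: (cx _ _)=> c; ring.
apply: cderiv_eq (cderivB dq (cderivB (dQ n.+1%:R) (dQ n%:R))) _.
by rewrite /uj; ring.
Qed.

(** The derivative in [de] of the sum with [j = 0] is minus the sum with [j = 1], which is already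
    bounded. *)
Lemma Zt_lip : exists2 C : R, 1<=C & forall de de' N t D, 0<de -> de<=de' -> de'<=1 ->
  2<=D -> `|t| <= D -> nrm (Zt de' N 0 t-Zt de N 0 t)<=C*(1+ln D)^+2*(de'-de).
Proof.
have [C C1 HC] := @Zt_bound R 0 1 isT; exists C=>// de de' N t D de0 dd de1 D2 tD.
apply: (@cmean _ (fun y=> Zt y N 0 t) (fun y=> - Zt y N 1 t))=>// y /andP[y1 y2].
  rewrite /Zt -sumrN; apply: (eq_cderiv (F := fun y=> \sum_(n <- index_iota 1 N.+1) uj y n 0 t))=>//.
  have y0 := lt_le_trans de0 y1.
  suff H (s : seq nat) : all (fun n=> (0<n)%N) s -> cderiv (fun y=> \sum_(n <- s) uj y n 0 t) y
      (\sum_(n <- s)-uj y n 1 t).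
    by apply: H; apply/allP=> n; rewrite mem_index_iota=> /andP[].
  elim: s=> [_|n s IH /= /andP[n0 s0]].
    by rewrite big_nil; apply: eq_cderiv (cderiv_cst 0 y)=> u; rewrite big_nil.
  rewrite big_cons; apply: eq_cderiv (cderivD (cderiv_uj0 t y0 n0) (IH s0))=> u.
  by rewrite big_cons.
rewrite nrmN; apply: (HC 1)=>//; first exact: lt_le_trans de0 y1.
exact: le_trans y2 de1.
Qed.
End ZetaDecomposition.

(** * A lower bound for zeta near the 1-line *)

Section LowerBound.
Variable R : realType.
Implicit Types (de t D : R) (N : nat).

Lemma ln2_le1 : ln 2<=1 :> R.
Proof. by rewrite (_ : 2 = 1+1 :> R)// le_ln1Dx//; lra. Qed.

Lemma ln2D D : 2<=D -> 1+ln (2*D)<=2*(1+ln D).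
Proof.
move=> D2; have D0: 0<D by apply: lt_le_trans D2.
rewrite lnM ?posrE//; have : ln 2<=ln D by rewrite ler_ln ?posrE.
by lra.
Qed.

Lemma root4_le (x y : R) : 0<=x -> 0<=y -> x^+4<=y^+4 -> x<=y.
Proof. by move=> x0 y0; rewrite ler_pXn2r. Qed.

Lemma nrm_wtV_lip de de' t (t0 : R) : 0<t0 -> 0<de -> de<=de' -> t0<=`|t| ->
  nrm ((wt de' t)^-1-(wt de t)^-1)<=(t0^+2)^-1*(de'-de).
Proof.
move=> t00 de0 dd tt; have de0' := lt_le_trans de0 dd.
have w0 := wt_neq0 de0 t; have w0' := wt_neq0 de0' t.
have -> : (wt de' t)^-1-(wt de t)^-1 = - ((de'-de)%:C*((wt de' t)^-1*(wt de t)^-1)).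
  have -> : (de'-de)%:C = wt de' t-wt de t by apply/eqP; rewrite eq_complex/= subrr !eqxx.
  by move: (wt de t) (wt de' t) w0 w0'=> a b a0 b0; field; rewrite a0 b0.
have W x : t0<=nrm (wt x t) by apply: le_trans tt (nrm_wt_ge _ _).
have V x : (nrm (wt x t))^-1<=t0^-1 by rewrite lef_pV2 ?posrE// (lt_le_trans t00).
rewrite nrmN nrmM nrm_real_ge0 ?subr_ge0// mulrC ler_wpM2r ?subr_ge0//.
by rewrite nrmM !nrmV expr2 invfM ler_pM ?invr_ge0 ?nrm_ge0.
Qed.

(** The 3-4-1 inequality at abscissa [1 + de'] bounds the fourth power of zeta below by a constant
    times [de'^3 / l], with [l = 1 + ln D]; a Lipschitz bound then returns to [1 + de] at a cost of
    order [l^2 (de' - de)]. *)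
Lemma V_lower (t0 : R) : 0<t0 -> exists2 c : R, 0<c & forall de D, 0<de -> de<=1 -> 2<=D ->
  exists N0, forall N, (N0<=N)%N -> forall t, t0<=`|t| <= D ->
    c*((1+ln D)^-1)^+7<=nrm (Vt de N t).
Proof.
move=> t00.
have [C C1 HC] := @Zt_bound R 0 0 isT; have [C' C'1 HL] := @Zt_lip R.
have it0: 0<t0^-1 by rewrite invr_gt0.
pose K : R := 2*C+t0^-1+1; pose K2 : R := C'+(t0^+2)^-1.
pose P : R := 2*(2*C+2)^+3*K.
have K1: 1<=K by rewrite /K; move: C1 it0; lra.
have K21: 1<=K2 by rewrite /K2 ler_wpDr// invr_ge0 exprn_ge0// ltW.
have P1: 1<=P.
  by rewrite /P mulr_ege1// mulr_ege1// ?exprn_ege1//; move: C1; lra.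
have P0 := lt_le_trans ltr01 P1.
pose b : R := P^-1; pose mu : R := b/(4*K2).
have b0: 0<b by rewrite invr_gt0.
have b1: b<=1 by rewrite invf_le1.
have K20 := lt_le_trans ltr01 K21.
have mu0: 0<mu by rewrite divr_gt0// mulr_gt0.
have mu1: mu<=1 by rewrite ler_pdivrMr ?mulr_gt0// mul1r; move: K21 b1; lra.
exists (b * mu^+3/2); first by rewrite divr_gt0// mulr_gt0// exprn_gt0.
move=> de D de0 de1 D2.
have lD: 0<=ln D by rewrite ln_ge0//; move: D2; lra.
pose l : R := 1+ln D; have l1: 1<=l by rewrite lerDl.
have l0 := lt_le_trans ltr01 l1.
rewrite -/l; pose q := l^-1; rewrite -/q.
have q0: 0<q by rewrite invr_gt0.
have q1: q<=1 by rewrite invf_le1.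
have lq: l*q = 1 by rewrite /q divff ?gt_eqF.
(* The exponent 9 balances both sides: the inequality gives [q] to the power [(3 * 9 + 1) / 4 = 7],
   the Lipschitz bound costs [q] to the power [9 - 2 = 7]. The power of [mu] makes the cost a
   quarter of the gain [g]. *)
pose d0 := mu^+4*q^+9.
have d00: 0<d0 by rewrite mulr_gt0// exprn_gt0.
have d01: d0<=1 by rewrite mulr_ile1 ?exprn_ge0 ?exprn_ile1 ?(ltW q0) ?(ltW mu0).
pose de' := Num.max de d0.
have dd: de<=de' by rewrite le_max lexx.
have d0d: d0<=de' by rewrite le_max lexx orbT.
have de'0: 0<de' := lt_le_trans de0 dd.
have de'1: de'<=1 by rewrite ge_max de1.
have ddd: de'-de<=d0 by rewrite /de' maxEle; case: ifP=> _; move: de0 d00; lra.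
pose g := b * mu^+3*q^+7.
have g0: 0<g by rewrite mulr_gt0 ?exprn_gt0// mulr_gt0 ?exprn_gt0.
have g4: 0<g/4 by rewrite divr_gt0.
have e1: 0<(Num.min (g/4) 1) by rewrite lt_min g4 ltr01.
have [N1 H1] := Q_small de'0 e1; have [N2 H2] := three_four_one de'0.
exists (maxn N1 N2)=> N; rewrite geq_max=> /andP[NN1 NN2] t /andP[tt tD].
have qs u : nrm (Qj de' 0 u N.+1%:R)<=g/4.
  by apply: le_trans (H1 N NN1 0%N u isT) _; rewrite ge_min lexx.
have qs1 u : nrm (Qj de' 0 u N.+1%:R)<=1.
  by apply: le_trans (H1 N NN1 0%N u isT) _; rewrite ge_min lexx orbT.
have Z0: nrm (ZN de' 0 N)<=(2*C+2) / de'.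
  rewrite ZN_eq// /Vt; apply: le_trans (nrmD _ _) _; apply: le_trans (lerD (nrmD _ _) (qs1 _)) _.
  have : nrm (Zt de' N 0 0)<=2*C.
    have := HC 1 de' N 0 2 ltr01 de'0 de'1 (lexx _); rewrite normr0 /= => /(_ (ler0n _ _)).
    rewrite expr1=> /le_trans; apply; rewrite mulrC ler_wpM2r ?(le_trans ler01 C1)//.
    by have := ln2_le1; lra.
  have : nrm (wt de' 0)^-1<=de'^-1.
    by rewrite nrmV lef_pV2 ?posrE ?nrm_wt_ge_de// (lt_le_trans de'0)// nrm_wt_ge_de.
  have d1: 1<=de'^-1 by rewrite invf_ge1.
  by move: (nrm _) (nrm _)=> x y; move: d1 C1; move: (de'^-1)=> u; nra.
have Z2: nrm (ZN de' (2 * t) N)<=K * l.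
  rewrite ZN_eq// /Vt; apply: le_trans (nrmD _ _) _; apply: le_trans (lerD (nrmD _ _) (qs1 _)) _.
  have : nrm (Zt de' N 0 (2 * t))<=2*C * l.
    have D4: 2<=2*D by move: D2; lra.
    have := HC 1 de' N (2 * t) (2*D) ltr01 de'0 de'1 D4; rewrite normrM normr_nat ler_pM2l// => /(_ tD) /=.
    rewrite expr1=> /le_trans; apply; rewrite [2*C]mulrC -mulrA ler_wpM2l ?(le_trans ler01 C1)//.
    exact: ln2D.
  have : nrm (wt de' (2 * t))^-1<=t0^-1.
    have h: t0<=nrm (wt de' (2 * t)).
      apply: le_trans (nrm_wt_ge _ _); rewrite normrM normr_nat; move: tt t00; lra.
    by rewrite nrmV lef_pV2 ?posrE// (lt_le_trans t00).
  rewrite /K; move: (nrm _) (nrm _)=> x y; move: l1 C1 it0; move: (t0^-1)=> u; nra.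
have v4: g^+4<=nrm (ZN de' t N)^+4.
  have := H2 N t NN2; set v := nrm (ZN de' t N)=> h.
  have v0: 0<=v^+4 by rewrite exprn_ge0// nrm_ge0.
  have {}h : 2^-1<=((2*C+2) / de')^+3 * v^+4*(K * l).
    apply: le_trans h _; rewrite ler_pM ?mulr_ge0 ?exprn_ge0 ?nrm_ge0// ler_wpM2r//.
    by rewrite lerXn2r ?nnegrE ?nrm_ge0// divr_ge0 ?(ltW de'0)//; move: C1; lra.
  have h2: b*de'^+3*q<=v^+4.
    have E: ((2*C+2) / de')^+3 * v^+4*(K * l) = 2^-1*(P * v^+4*(de'^-1^+3 * l)).
      by rewrite /P; field; rewrite gt_eqF.
    move: h; rewrite E -[X in X<=_]mulr1 ler_pM2l// => h.
    have i3: de'^-1^+3*de'^+3 = 1 by rewrite -exprMn mulVf ?expr1n// gt_eqF.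
    have s0: 0<=b*de'^+3*q by rewrite !mulr_ge0 ?exprn_ge0// ltW.
    have := ler_wpM2l s0 h; rewrite mulr1=> /le_trans; apply.
    rewrite [X in X<=_](_ : _=(b*P)*(de'^-1^+3*de'^+3)*(l*q) * v^+4); last first.
      have gen (a1 a2 a3 a4 a5 a6 a7 : R) : a1*a2*a3*(a4*a5*(a6*a7)) = a1*a4*(a6*a2)*(a7*a3)*a5 by ring.
      exact: gen.
    by rewrite i3 lq /b mulVf ?gt_eqF// !mul1r.
  apply: le_trans h2.
  have -> : g^+4 = b^+4*d0^+3*q by rewrite /g /d0; ring.
  rewrite ler_wpM2r ?(ltW q0)// ler_pM ?exprn_ge0 ?(ltW b0) ?(ltW d00)//.
    by rewrite -[X in _<=X]mulr1 exprS ler_wpM2l ?(ltW b0)// exprn_ile1// ltW.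
  by rewrite lerXn2r ?nnegrE ?(ltW d00) ?(ltW de'0).
have v1: g<=nrm (ZN de' t N) by apply: root4_le; rewrite ?nrm_ge0 ?(ltW g0).
have V1: g-g/4<=nrm (Vt de' N t).
  have := nrm_leB (ZN de' t N) (Qj de' 0 t N.+1%:R); rewrite {2}ZN_eq// addrK.
  by have := qs t; move: v1; lra.
have V2: nrm (Vt de' N t-Vt de N t)<=g/4.
  rewrite /Vt opprD addrACA; apply: le_trans (nrmD _ _) _.
  apply: le_trans (lerD (HL de de' N t D de0 dd de'1 D2 tD) (nrm_wtV_lip t00 de0 dd tt)) _.
  rewrite -mulrDl; apply: le_trans (_ : K2 * l^+2*d0<=_).
    have i2: 0<=(t0^+2)^-1 by rewrite invr_ge0 exprn_ge0// ltW.
    have c0: 0<=C'*(1+ln D)^+2 by rewrite mulr_ge0 ?(le_trans ler01 C'1)// exprn_ge0// ltW.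
    rewrite ler_pM ?subr_ge0 ?addr_ge0//.
    rewrite mulrDl lerD2l -[X in X<=_]mulr1 ler_wpM2l ?invr_ge0 ?exprn_ge0 ?(ltW t00)//.
    by rewrite exprn_ege1.
  apply: eq_ler.
  have -> : K2 * l^+2*d0=(l*q)^+2*(K2 * mu)*(mu^+3*q^+7) by rewrite /d0; ring.
  rewrite lq expr1n mul1r (_ : K2 * mu = b/4); last by rewrite /mu; field; rewrite gt_eqF.
  by rewrite /g; field.
have := nrm_leB (Vt de' N t) (Vt de' N t-Vt de N t); rewrite opprB addrCA subrr addr0.
have -> : b * mu^+3/2*q^+7 = g/2 by rewrite /g mulrAC.
by move: V1 V2; lra.
Qed.
End LowerBound.

Ltac nneg := repeat first [assumption | exact: ler01 | exact: ler0n | exact: lexx | exact: expR_ge0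
  | exact: powR_ge0 | exact: nrm_ge0 | exact: sqr_ge0 | exact: normr_ge0 | (apply: ltW; assumption) | rewrite invr_ge0
  | apply: exprn_ge0 | apply: mulr_ge0 | apply: addr_ge0].

(** * Difference quotients of -zeta'/zeta - zeta *)

Section DifferenceTools.
Variables (R : realType) (h : R).
Hypothesis h0 : 0<h.
Implicit Types (phi psi : R -> R[i]) (A a b c : R).

Lemma BmV' m phi A c a b : 0<=A -> 0<c -> (forall t, a<=t<=b -> c<=nrm (phi t)) ->
  Bm h m phi A a b -> Bm h m (fun t=> (phi t)^-1) (invK m A c) a b.
Proof. by move=> A0 c0 H; case: m=> [|m] [_ B]; apply: BmV. Qed.

(** Without smoothness each order costs [2/h]. This serves for errors that can be made arbitrarily
    small once [h] is fixed. *)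
Lemma iter_dh_triv m phi (e a b : R) : (forall t, a<=t<=b -> nrm (phi t)<=e) ->
  forall t, a<=t<=b-m%:R * h -> nrm (iter m (dh h) phi t)<=(2 / h)^+m * e.
Proof.
move=> H; elim: m=> [|m IH] t; first by rewrite mul0r subr0 expr0 mul1r; exact: H.
rewrite -natr1 mulrDl mul1r=> /andP[t1 t2]; rewrite iterS {1}/dh nrmM nrmV nrm_real_ge0 ?(ltW h0)//.
rewrite ler_pdivrMr//; apply: le_trans (nrmB _ _) _.
have I1: nrm (iter m (dh h) phi (t+h))<=(2 / h)^+m * e.
  by apply: IH; apply/andP; split; move: t1 t2 h0; lra.
have I2: nrm (iter m (dh h) phi t)<=(2 / h)^+m * e.
  by apply: IH; apply/andP; split; move: t1 t2 h0; lra.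
rewrite exprS (_ : _ * h = 2*((2 / h)^+m * e)); first by move: I1 I2; lra.
by move: ((2 / h)^+m)=> x; field; rewrite gt_eqF.
Qed.

Lemma Bm_wt m de D : 0<de -> de<=1 -> 0<=D -> Bm h m (wt de) (D+1) (- D) D.
Proof.
move=> d0 d1 D0.
have B t : - D<=t<=D -> nrm (wt de t)<=D+1.
  move=> tD; apply: le_trans (nrm_le_ReIm _) _; rewrite /= ger0_norm ?(ltW d0)// addrC lerD//.
  by rewrite ler_norml.
case: m=> [|m]; split=>//.
rewrite (_ : dh h (wt de) = fun=> 'i%C); last first.
  apply/funext=> t; rewrite /dh; have -> : wt de (t+h)-wt de t = h%:C * 'i%C.
    by apply/eqP; rewrite eq_complex/= subrr addrAC subrr add0r !mul0r mulr0 mulr1 subr0 addr0 !eqxx.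
  by rewrite mulrAC divff ?mul1r// eq_complex/= negb_and gt_eqF.
by apply: Bm_cst; rewrite /nrm/= expr0n expr1n add0r sqrtr1; move: D0; lra.
Qed.

Lemma Bm_wtV m de a b : 0<de -> (forall t, a<=t<=b -> 1<=`|t|) ->
  Bm h m (fun t=> (wt de t)^-1) (invK m 1 1) a b.
Proof.
move=> d0 H; apply: BmV=>//; first by move=> t /H/le_trans; apply; exact: nrm_wt_ge.
case: m=> [|m] //.
rewrite (_ : dh h (wt de) = fun=> 'i%C); last first.
  apply/funext=> t; rewrite /dh; have -> : wt de (t+h)-wt de t = h%:C * 'i%C.
    by apply/eqP; rewrite eq_complex/= subrr addrAC subrr add0r !mul0r mulr0 mulr1 subr0 addr0 !eqxx.
  by rewrite mulrAC divff ?mul1r// eq_complex/= negb_and gt_eqF.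
by apply: Bm_cst; rewrite /nrm/= expr0n expr1n add0r sqrtr1.
Qed.

Lemma Bm_Zt_aux m (C : R) de N j D p : 0<de -> de<=1 -> 2<=D ->
  (forall i t, (i<=m)%N -> `|t| <= D -> nrm (iter i (dh h) (Zt de N j) t)<=C*(1+ln D)^+p) ->
  Bm h m (Zt de N j) (C*(1+ln D)^+p) (- D) D.
Proof.
move=> d0 d1 D2 H; apply: iter_Bm=> k t km /andP[t1 t2]; apply: H=>//.
have : 0<=k%:R * h by rewrite mulr_ge0// ltW.
by rewrite ler_norml t1/=; move: t2; lra.
Qed.
End DifferenceTools.

Section GBound.
Variable R : realType.
Implicit Types (de t D h : R) (N : nat).

Lemma Bm_Zt m : exists2 C : R, 1<=C & forall h de N j D, (j<=1)%N -> 0<h -> 0<de -> de<=1 ->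
  2<=D -> Bm h m (Zt de N j) (C*(1+ln D)^+m.+2) (- D) D.
Proof.
suff [C C1 H] : exists2 C : R, 1<=C & forall h de N j D i t, (j<=1)%N -> (i<=m)%N -> 0<h ->
    0<de -> de<=1 -> 2<=D -> `|t| <= D ->
    nrm (iter i (dh h) (Zt de N j) t)<=C*(1+ln D)^+m.+2.
  by exists C=>// h de N j D j1 h0 d0 d1 D2; apply: Bm_Zt_aux=>// i t im tD; exact: H.
elim: m=> [|m [C C1 IH]].
  have [C C1 H] := @Zt_bound R 0 0 isT; have [C' C'1 H'] := @Zt_bound R 0 1 isT.
  exists (C+C'); first by move: C1 C'1; lra.
  move=> h de N j D i t j1; rewrite leqn0=> /eqP-> h0 d0 d1 D2 tD.
  have l1: 1<=1+ln D by rewrite lerDl ln_ge0//; move: D2; lra.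
  case: j j1=> [|[|//]] _.
    apply: le_trans (H h de N t D h0 d0 d1 D2 tD) _; rewrite ler_pM ?exprn_ge0 ?(le_trans ler01)//.
      by rewrite lerDl (le_trans ler01 C'1).
    by rewrite ler_weXn2l// .
  apply: le_trans (H' h de N t D h0 d0 d1 D2 tD) _; rewrite ler_pM ?exprn_ge0 ?(le_trans ler01)//.
  by rewrite lerDr (le_trans ler01 C1).
have [C0 C01 H] := @Zt_bound R m.+1 0 isT; have [C' C'1 H'] := @Zt_bound R m.+1 1 isT.
exists (C+C0+C'); first by move: C1 C'1 C01; lra.
move=> h de N j D i t j1; rewrite leq_eqVlt=> /orP[/eqP->|im] h0 d0 d1 D2 tD; last first.
  have l1: 1<=1+ln D by rewrite lerDl ln_ge0//; move: D2; lra.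
  apply: le_trans (IH h de N j D i t j1 _ h0 d0 d1 D2 tD) _; first by rewrite -ltnS.
  rewrite ler_pM ?exprn_ge0 ?(le_trans ler01)//; first by move: C1 C'1 C01; lra.
  by rewrite ler_weXn2l.
have l1: 1<=1+ln D by rewrite lerDl ln_ge0//; move: D2; lra.
case: j j1=> [|[|//]] _.
  apply: le_trans (H h de N t D h0 d0 d1 D2 tD) _; rewrite ler_pM ?exprn_ge0 ?(le_trans ler01)//.
    by move: C1 C'1 C01; lra.
  by rewrite ler_weXn2l.
apply: le_trans (H' h de N t D h0 d0 d1 D2 tD) _; rewrite ler_pM ?exprn_ge0 ?(le_trans ler01)//.
by move: C1 C'1 C01; lra.
Qed.

Lemma invK_poly m (a c : R) (p q : nat) : 0<=a -> 0<c -> exists B r, 0<=B /\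
  forall l, 1<=l -> invK m (a * l^+p) (c * l^-1^+q)<=B * l^+r.
Proof.
move=> a0 c0; elim: m=> [|m [B [r [B0 IH]]]].
  exists c^-1, q; split; first by rewrite invr_ge0 ltW.
  by move=> l l1 /=; rewrite invfM exprVn invrK.
exists (B+4^+m*a*B^+2), (p+(r+r))%N; split.
  by rewrite addr_ge0// !mulr_ge0// exprn_ge0.
move=> l l1; have l0 := lt_le_trans ltr01 l1; have lX k : 0<=l^+k by rewrite exprn_ge0// ltW.
have cl: 0<c * l^-1^+q by rewrite mulr_gt0// exprn_gt0// invr_gt0.
have I := IH l l1; have I0: 0<=invK m (a * l^+p) (c * l^-1^+q) by rewrite invK_ge0// mulr_ge0.
rewrite /= mulrDl; apply: lerD.
  by apply: le_trans I _; rewrite ler_wpM2l// ler_weXn2l// addnA leq_addl.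
rewrite (_ : 4^+m*a*B^+2 * l^+(p+(r+r)) = 4^+m*(a * l^+p)*(B * l^+r)^+2); last first.
  by rewrite !exprD; ring.
apply: ler_wpM2l; first by nneg.
by rewrite lerXn2r// nnegrE; nneg.
Qed.

(** The function [- zeta'/zeta - zeta] in terms of regular parts. The two simple poles at [s = 1]
    cancel, and the denominator is [(s-1) zeta(s)], which stays away from 0 near that point. *)
Definition Gs de N t : R[i] :=
  (wt de t*Zt de N 1 t-Zt de N 0 t)/(1+wt de t*Zt de N 0 t)-Zt de N 0 t.

Lemma wV de N t : 0<de -> 1+wt de t*Zt de N 0 t = wt de t*Vt de N t.
Proof. by move=> d0; have w0 := wt_neq0 d0 t; rewrite /Vt mulrDr divff// addrC. Qed.

Lemma Gs_far de N : 0<de -> Gs de N = fun t =>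
  (Zt de N 1 t + - (Zt de N 0 t*(wt de t)^-1))*(Vt de N t)^-1 + - Zt de N 0 t.
Proof.
move=> d0; apply/funext=> t; rewrite /Gs wV// invfM; have w0 := wt_neq0 d0 t.
move: (wt de t) (Zt de N 1 t) (Zt de N 0 t) (Vt de N t)^-1 w0=> w z1 z0 v w0.
by congr (_ + _); rewrite mulrA; congr (_ * _); rewrite mulrBl mulrAC divff// mul1r.
Qed.

Lemma Gs_eq de N t : 0<de -> Vt de N t != 0 ->
  Gs de N t=(Zt de N 1 t+(wt de t^+2)^-1)/Vt de N t-Vt de N t.
Proof.
move=> d0 v0; have w0 := wt_neq0 d0 t; rewrite /Gs wV// /Vt in v0 *.
move: (wt de t) (Zt de N 1 t) (Zt de N 0 t) w0 v0=> w z1 z0 w0 v0.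
field; rewrite w0 /= ; have -> : z0*w+1 = w*(z0+w^-1) by rewrite mulrDr divff// mulrC.
by rewrite mulf_neq0.
Qed.

(** For [|t| < t0] and [de <= t0] the product [wt * Zt] is at most 1/2, which is how [t0] is chosen;
    for larger [t] up to 3 [V_lower] applies. *)
Lemma near_lower : exists c de1 : R, [/\ 0<c, 0<de1, de1<=1 & forall de, 0<de -> de<=de1 ->
  exists N0, forall N, (N0<=N)%N -> forall t, `|t| <= 3 -> c<=nrm (1+wt de t*Zt de N 0 t)].
Proof.
have [C C1 H] := @Zt_bound R 0 0 isT; pose A := C*(1+ln 3).
have l3: 0<=ln 3 :> R by rewrite ln_ge0// ler1n.
have A1: 1<=A by rewrite mulr_ege1// lerDl.
have A0 := lt_le_trans ltr01 A1.
pose t0 := (4*A)^-1; have t00: 0<t0 by rewrite invr_gt0 mulr_gt0.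
have tA: t0*A = 4^-1 by rewrite /t0; field; rewrite gt_eqF.
have [c c0 Hc] := V_lower t00.
pose c' := t0*(c*(1+ln 3)^-1^+7).
have c'0: 0<c' by rewrite mulr_gt0// mulr_gt0// exprn_gt0// invr_gt0 ltr_pwDl.
have t01: t0<=1 by rewrite invf_le1 ?mulr_gt0//; move: A1; lra.
exists (Num.min 2^-1 c'), t0; split=>//; first by rewrite lt_min invr_gt0 ltr0n.
move=> de d0 d1; have d11 := le_trans d1 t01.
have D3: 2<=3 :> R by rewrite ler_nat.
have [N0 HN] := Hc de 3 d0 d11 D3; exists N0=> N NN t t3.
have [tt|tt] := lerP t0 `|t|.
  rewrite ge_min; apply/orP; right; rewrite wV// nrmM /c' ler_pM ?(ltW t00)//.
  - by rewrite mulr_ge0 ?(ltW c0)// exprn_ge0// invr_ge0 addr_ge0.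
  - exact: le_trans tt (nrm_wt_ge _ _).
  - by apply: HN=>//; rewrite tt.
rewrite ge_min; apply/orP; left.
have Z: nrm (Zt de N 0 t)<=A by have := H 1 de N t 3 ltr01 d0 d11 D3 t3; rewrite /= expr1.
have W: nrm (wt de t)<=2 * t0.
  apply: le_trans (nrm_le_ReIm _) _; rewrite /= ger0_norm ?(ltW d0)//; move: d1 tt; lra.
have P: nrm (wt de t*Zt de N 0 t)<=2^-1.
  rewrite nrmM; apply: le_trans (ler_pM (nrm_ge0 _) (nrm_ge0 _) W Z) _.
  by rewrite -mulrA tA; lra.
have := nrm_leB 1 (- (wt de t*Zt de N 0 t)); rewrite opprK nrmN nrm1; move: P; lra.
Qed.

(** Near the real axis the regular form is used, away from it the form [Gs_far] with [1 / Vt]. The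
    quotient rule and [V_lower] cost powers of the logarithm only. *)
Lemma Gs_bound m : exists C K de1, [/\ 0 <= C, 0 < de1, de1 <= 1 & forall de D, 0 < de -> de <= de1 -> 3 <= D ->
  exists N0, forall N, (N0 <= N)%N -> forall h, 0 < h -> m%:R * h <= 1 ->
    Bm h m (Gs de N) (C * (1 + ln D) ^+ K) (- D) D].
Proof.
have [C C1 HZ] := Bm_Zt m.
have [c [de1 [c0 d10 d11 Hn]]] := near_lower.
have [c' c'0 Hf] := V_lower (@ltr01 R).
have C0 := le_trans ler01 C1.
have D3 : 2 <= 3 :> R by rewrite ler_nat.
have l3 : 0 <= ln 3 :> R by rewrite ln_ge0// ler1n.
pose A := C * (1 + ln 3) ^+ m.+2.
have A0 : 0 <= A by rewrite mulr_ge0// exprn_ge0// addr_ge0.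
pose iw := invK m 1 (1 : R).
have iw0 : 0 <= iw by rewrite invK_ge0.
have [B [r [B0 HB]]] := @invK_poly m (C + iw) c' m.+2 7 (addr_ge0 C0 iw0) c'0.
pose X := invK m (1 + 2 ^+ m * ((3 + 1) * A)) c.
have p2 k : 0 <= 2 ^+ k :> R by rewrite exprn_ge0.
have X0 : 0 <= X by rewrite invK_ge0// addr_ge0// mulr_ge0// mulr_ge0// addr_ge0.
pose Cn := 2 ^+ m * ((2 ^+ m * ((3 + 1) * A) + A) * X) + A.
have Cn0 : 0 <= Cn by rewrite /Cn; nneg.
pose Cf := 2 ^+ m * ((C + 2 ^+ m * (C * iw)) * B) + C.
have Cf0 : 0 <= Cf by rewrite /Cf; nneg.
exists (Cn + Cf), (m.+2 + r)%N, de1; split => //; first exact: addr_ge0.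
move=> de D d0 d1 DD; have de1' := le_trans d1 d11.
have D2 : 2 <= D := le_trans D3 DD.
have [N1 H1] := Hn de d0 d1; have [N2 H2] := Hf de D d0 de1' D2.
exists (maxn N1 N2) => N; rewrite geq_max => /andP[NN1 NN2] h h0 mh.
have lD : 1 <= 1 + ln D by rewrite lerDl ln_ge0//; move: D2; lra.
set l := 1 + ln D in lD *; have l0 := lt_le_trans ltr01 lD.
have lX k : 0 <= l ^+ k by rewrite exprn_ge0// ltW.
have near : Bm h m (Gs de N) Cn (- 3) 3.
  have Z0 := HZ h de N 0%N 3 isT h0 d0 de1' D3; have Z1 := HZ h de N 1%N 3 isT h0 d0 de1' D3.
  have W := @Bm_wt _ h h0 m de 3 d0 de1' (ler0n _ _).
  have w3 : 0 <= 3 + 1 :> R by rewrite addr_ge0.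
  have P0 := BmM h0 w3 A0 W Z0; have P1 := BmM h0 w3 A0 W Z1.
  have one : Bm h m (fun=> 1) 1 (- 3) 3 by apply: Bm_cst; rewrite nrm1.
  have I : Bm h m (fun t => (1 + wt de t * Zt de N 0 t)^-1) X (- 3) 3.
    apply: (BmV' h0 _ c0); last exact: BmD one P0.
      by nneg.
    by move=> t t3; apply: H1 => //; rewrite ler_norml.
  have q0 : 0 <= 2 ^+ m * ((3 + 1) * A) + A by nneg.
  exact: (BmD (BmM h0 q0 X0 (BmD P1 (BmN Z0)) I) (BmN Z0)).
have far a b : - D <= a -> b <= D -> (forall t, a <= t <= b -> 1 <= `|t|) ->
    Bm h m (Gs de N) (Cf * l ^+ (m.+2 + r)) a b.
  move=> aD bD ab; rewrite Gs_far//.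
  have sub phi E : Bm h m phi E (- D) D -> Bm h m phi E a b by apply: Bm_sub.
  have Z0 := sub _ _ (HZ h de N 0%N D isT h0 d0 de1' D2); have Z1 := sub _ _ (HZ h de N 1%N D isT h0 d0 de1' D2).
  rewrite -/l in Z0 Z1; set E := C * l ^+ m.+2 in Z0 Z1.
  have E0 : 0 <= E by rewrite mulr_ge0.
  have W := @Bm_wtV _ h h0 m de a b d0 ab; rewrite -/iw in W.
  have V : Bm h m (Vt de N) ((C + iw) * l ^+ m.+2) a b.
    apply: Bm_le (BmD Z0 W); rewrite mulrDl lerD2l -[X in X <= _]mulr1 ler_wpM2l// exprn_ege1//.
  have I : Bm h m (fun t => (Vt de N t)^-1) (B * l ^+ r) a b.
    apply: Bm_le (HB l lD) _; apply: (BmV' h0 _ _ _ V).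
    - by rewrite mulr_ge0// addr_ge0.
    - by rewrite mulr_gt0// exprn_gt0// invr_gt0.
    - move=> t tab; apply: H2 => //; rewrite ab//=; case/andP: tab => t1 t2.
      by rewrite ler_norml (le_trans aD t1) (le_trans t2 bD).
  have ZW := BmM h0 E0 iw0 Z0 W.
  have q0 : 0 <= E + 2 ^+ m * (E * iw) by nneg.
  have r0 : 0 <= B * l ^+ r by rewrite mulr_ge0.
  apply: Bm_le (BmD (BmM h0 q0 r0 (BmD Z1 (BmN ZW)) I) (BmN Z0)).
  rewrite /Cf [X in _ <= X]mulrDl; apply: lerD; last by rewrite ler_wpM2l// ler_weXn2l// leq_addr.
  rewrite le_eqVlt; apply/orP; left; apply/eqP; rewrite /E exprD; ring.
have F1 : Bm h m (Gs de N) (Cf * l ^+ (m.+2 + r)) 1 D.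
  by apply: far => //; [move: D2; lra|move=> t /andP[t1 _]; rewrite ger0_norm// (le_trans ler01)].
have F2 : Bm h m (Gs de N) (Cf * l ^+ (m.+2 + r)) (- D) (- 1).
  apply: far => //; first by move: D2; lra.
  by move=> t /andP[_ t1]; rewrite ler0_norm; move: t1; lra.
have le1 : Cn <= (Cn + Cf) * l ^+ (m.+2 + r).
  by rewrite -[X in X <= _]mulr1 ler_pM// ?lerDl// exprn_ege1.
have le2 : Cf * l ^+ (m.+2 + r) <= (Cn + Cf) * l ^+ (m.+2 + r) by rewrite ler_wpM2r// lerDr.
have sm k : (k <= m)%N -> 0 <= k%:R * h <= 1.
  by move=> km; rewrite mulr_ge0 ?(ltW h0)//=; apply: le_trans mh; rewrite ler_pM2r// ler_nat.
have red k phi E a b : (k <= m)%N -> Bm h m phi E a b -> Bm h k phi E a b.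
  by move=> /subnK <-; elim: (m - k)%N => [|n IH]//; rewrite addSn => /BmW.
(* Since [k h <= 1], the points from [t] to [t + k h] lie in one of [[1, D]], [[-3, 3]] and
   [[-D, -1]], and on each of these one of the bounds holds. *)
apply: iter_Bm => k t km /andP[t1 t2]; have /andP[s0 s1] := sm k km.
have [u1|u1] := lerP 1 t.
  by apply: le_trans le2; apply: (Bm_iter (red _ _ _ _ _ km F1)); rewrite u1.
have [u2|u2] := lerP (- 3) t.
  apply: le_trans le1; apply: (Bm_iter (red _ _ _ _ _ km near)); rewrite u2/=; move: u1 s1; lra.
apply: le_trans le2; apply: (Bm_iter (red _ _ _ _ _ km F2)); rewrite t1/=; move: u2 s1; lra.
Qed.

Definition GN de N t : R[i] := AN de t N-ZN de t N.

Lemma nrm_AN de : 0<de -> exists2 C : R, 0<=C & forall t N, nrm (AN de t N)<=C.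
Proof.
move=> d0; have [C C1 HC] := ln_le_powR d0.
have C0 := le_trans ler01 C1; have d2: 0<de/2 by rewrite divr_gt0.
exists (C*(1+(de/2)^-1)); first by nneg.
move=> t [|N]; first by rewrite /AN /Dp big_geq// nrm0; nneg.
apply: le_trans (nrm_Dp _ _ _ _) _.
apply: le_trans (_ : \sum_(1<=n<N.+2) C*n%:R`^(- (1+de/2))<=_).
  apply: ler_sum_nat=> n /andP[n0 _]; have n1: 1<=n%:R :> R by rewrite ler1n.
  have n0': 0<n%:R :> R by rewrite ltr0n.
  have spl (b : R) : n%:R`^(- (1+b)) = n%:R`^(- b)*n%:R^-1.
    by rewrite addrC opprD powRD ?powR_inv1 ?(ltW n0')// (gt_eqF n0') implybT.
  rewrite !spl !mulrA ler_wpM2r ?invr_ge0 ?(ltW n0')//.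
  apply: le_trans (HC _ n1); rewrite ler_wpM2r ?powR_ge0//.
  rewrite ger0_norm ?mangoldt_ge0//; apply: le_trans (mangoldt_le_lnn _ _) _.
  by rewrite lerDr.
rewrite -big_distrr/= ler_wpM2l// big_ltn// powR1 lerD2l.
have b1: 1<1+de/2 by rewrite ltrDl.
have := sum_tail N.+1 b1 (ltn0Sn 0); rewrite powR1 mul1r.
by rewrite (_ : 1+de/2 - 1 = de/2); [|ring].
Qed.

Lemma GN_Gs : exists de1 : R, [/\ 0<de1, de1<=1 & forall de D e, 0<de -> de<=de1 -> 3<=D -> 0<e ->
  exists N0, forall N, (N0<=N)%N -> forall t, `|t| <= D -> nrm (GN de N t-Gs de N t)<=e].
Proof.
have [c [de1 [c0 d10 d11 Hn]]] := near_lower; have [c' c'0 Hf] := V_lower (@ltr01 R).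
exists de1; split=>// de D e d0 d1 D3 e0; have de1' := le_trans d1 d11.
have D2: 2<=D by move: D3; lra.
have l0: 0<1+ln D by rewrite ltr_pwDl// ln_ge0//; move: D2; lra.
pose v := Num.min (c/4) (c'*((1+ln D)^-1)^+7).
have v0: 0<v by rewrite lt_min divr_gt0// mulr_gt0// exprn_gt0// invr_gt0.
have [Ca Ca0 HA] := nrm_AN d0.
pose e' : R := e/((2+Ca) / v+1).
have e'0: 0<e'.
  have : 0<=(2+Ca) / v by nneg.
  by move=> z; rewrite divr_gt0// ltr_wpDl.
have [N1 H1] := Hn de d0 d1; have [N2 H2] := Hf de D d0 de1' D2.
have [N3 H3] := Q_small d0 e'0; have [N4 H4] := AN_ZN d0 e'0.
exists (maxn (maxn N1 N2) (maxn N3 N4))=> N; rewrite !geq_max=> /andP[/andP[n1 n2] /andP[n3 n4]] t tD.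
have Vv: v<=nrm (Vt de N t).
  have [t1|t1] := lerP 1 `|t|.
    by apply: le_trans (H2 N n2 t _); rewrite ?t1// ge_min lexx orbT.
  have t3: `|t| <= 3 by move: t1; lra.
  have := H1 N n1 t t3; rewrite wV// nrmM=> h.
  have W: nrm (wt de t)<=4.
    apply: le_trans (nrm_le_ReIm _) _; rewrite /= ger0_norm ?(ltW d0)//; move: t3 de1'; lra.
  rewrite ge_min; apply/orP; left; rewrite ler_pdivrMr// mulrC; apply: le_trans h _.
  by rewrite ler_wpM2r// nrm_ge0.
have V0: 0<nrm (Vt de N t) := lt_le_trans v0 Vv.
have Vn0: Vt de N t != 0 by apply/eqP=> z; move: V0; rewrite z nrm0 ltxx.
have q0 := H3 N n3 0%N t isT; have q1 := H3 N n3 1%N t isT; have ee := H4 N n4 t.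
rewrite /GN (Gs_eq d0 Vn0); have A := HA t N.
have LE := LN_eq t N d0; have ZE := ZN_eq t N d0.
set a := AN de t N in A ee *; set Q0 := Qj de 0 t _ in q0 ZE; set Q1 := Qj de 1 t _ in q1 LE.
rewrite LE ZE in ee *; set V := Vt de N t in V0 Vn0 ee Vv *.
set L := Zt de N 1 t + _ in ee *.
have -> : a-(V+Q0)-(L/V-V)=((a*(V+Q0)-(L+Q1))+Q1-a*Q0)/V-Q0.
  by move: a V Q0 L Q1 Vn0 {ee LE ZE q0 q1 A V0 Vv} => a V Q0 L Q1 V0; field.
apply: le_trans (nrmB _ _) _; rewrite nrmM nrmV.
have B: nrm (a*(V+Q0)-(L+Q1)+Q1-a*Q0)<=(2+Ca) * e'.
  apply: le_trans (nrmB _ _) _; rewrite nrmM; apply: le_trans (lerD (nrmD _ _) (lexx _)) _.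
  have : nrm a*nrm Q0<=Ca * e' by apply: ler_pM; rewrite ?nrm_ge0.
  by move: ee q1; lra.
have : nrm (a*(V+Q0)-(L+Q1)+Q1-a*Q0) / nrm V<=(2+Ca) * e' / v.
  apply: ler_pM=>//; first by nneg.
    by rewrite invr_ge0 nrm_ge0.
  by rewrite lef_pV2 ?posrE.
have : (2+Ca) * e' / v+e' = e.
  rewrite /e'; field; rewrite (gt_eqF v0)/= gt_eqF//; move: v0 Ca0; lra.
by move: q0; lra.
Qed.

Lemma G_bound m : exists C K de1, [/\ 0<=C, 0<de1, de1<=1 & forall h de D, 0<h -> m%:R * h<=1 ->
  0<de -> de<=de1 -> 3<=D ->
  exists N0, forall N, (N0<=N)%N -> Bm h m (GN de N) (C*(1+ln D)^+K) (- D) D].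
Proof.
have [C [K [d1 [C0 d10 d11 H]]]] := Gs_bound m; have [d2 [d20 d21 H2]] := GN_Gs.
exists (C+1), K, (Num.min d1 d2); split.
- by nneg.
- by rewrite lt_min d10.
- by rewrite ge_min d11.
move=> h de D h0 mh d0; rewrite le_min=> /andP[dd1 dd2] D3.
(* [e] beats all the factors [(2/h)^i] of the trivial bound. So [N0] depends on [h], while [C] and
   [K] do not. *)
pose e := \big[Num.min/1]_(i<m.+1) ((2 / h)^+i)^-1.
have h2: 0<2 / h by rewrite divr_gt0.
have e0: 0<e.
  by apply: (big_ind (fun x=> 0<x))=>// [x y x0 y0|i _]; rewrite ?lt_min ?x0// invr_gt0 exprn_gt0.
have eb i : (i<m.+1)%N -> (2 / h)^+i * e<=1.
  move=> im; have : e<=((2 / h)^+i)^-1.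
    rewrite /e (bigD1 (Ordinal im))//= ge_min lexx//.
  by rewrite -ler_pdivlMl ?exprn_gt0// mulr1.
have [N1 H1] := H de D d0 dd1 D3; have [N2 HN2] := H2 de D e d0 dd2 D3 e0.
exists (maxn N1 N2)=> N; rewrite geq_max=> /andP[n1 n2].
have l1: 1<=1+ln D by rewrite lerDl ln_ge0//; move: D3; lra.
rewrite (_ : GN de N = fun t=> Gs de N t+(GN de N t-Gs de N t)); last first.
  by apply/funext=> t; rewrite addrC subrK.
rewrite mulrDl mul1r; apply: BmD; first exact: H1.
apply: Bm_le (exprn_ege1 K l1) _; apply: iter_Bm=> k t km tt.
apply: le_trans (@iter_dh_triv _ h h0 k _ e (- D) D _ t tt) _; last by rewrite eb.
by move=> u uD; apply: HN2=>//; rewrite ler_norml.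
Qed.
End GBound.

(** * Summation by parts with step M *)

Section SequenceDifferences.
Variables (R : realType) (M : nat).
Implicit Types (f g : nat -> R[i]) (k : nat -> R).

Definition dM (V : zmodType) (f : nat -> V) j : V := f (j+M)%N - f j.

Lemma iter_dM_supp (V : zmodType) (f : nat -> V) m Q : (forall j, (Q<=j)%N -> f j = 0) ->
  forall j, (Q<=j)%N -> iter m (@dM V) f j = 0.
Proof.
move=> H; elim: m=> [|m IH] j Qj; first exact: H.
by rewrite iterS /dM !IH ?subr0// (leq_trans Qj)// leq_addr.
Qed.

(** A shift of the index by [M]; the vanishing of [f] below [M] and from [Q] on removes the boundary
    terms. *)
Lemma phase_dM (u : R[i]) f Q : (forall j, (j<M)%N -> f j = 0) ->
  (forall j, (Q<=j)%N -> f j = 0) ->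
  (1-u^+M)*(\sum_(j<Q) u^+j * f j) = u^+M * \sum_(j<Q) u^+j*dM f j.
Proof.
move=> f0 fQ; rewrite mulrBl mul1r -(big_mkord xpredT (fun j=> u^+j * f j)) -(big_mkord xpredT (fun j=> u^+j*dM f j)).
rewrite [X in _ = X]big_distrr/=.
rewrite [RHS](eq_bigr (fun j=> u^+(j+M) * f (j+M)%N-u^+M*(u^+j * f j))); last first.
  by move=> j _; rewrite /dM exprD; move: (f _) (f _) (u^+j) (u^+M)=> *; ring.
rewrite sumrB -big_distrr/=; congr (_ - _).
have E: \sum_(0<=j<Q) u^+(j+M) * f (j+M)%N = \sum_(M<=j<Q+M) u^+j * f j.
  by rewrite [RHS](@big_addn _ _ _ 0 _ M) ?addnK// -[X in _ = \sum_(X<=_<_) _]add0n big_addn addnK.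
rewrite E; transitivity (\sum_(0<=j<Q+M) u^+j * f j).
  rewrite [RHS](@big_cat_nat _ _ _ Q)//= ?leq_addr// [X in _+X]big_nat_cond [X in _+X]big1 ?addr0//.
  by move=> j /andP[/andP[Qj _] _]; rewrite fQ// mulr0.
rewrite (@big_cat_nat _ _ _ M)//= ?leq_addl// big_nat_cond big1 ?add0r//.
by move=> j /andP[/andP[_ jM] _]; rewrite f0// mulr0.
Qed.

Lemma phase_iter_dM (u : R[i]) m f Q : nrm u = 1 -> (forall j, (j<m*M)%N -> f j = 0) ->
  (forall j, (Q<=j)%N -> f j = 0) ->
  nrm (1-u^+M)^+m*nrm (\sum_(j<Q) u^+j * f j) <= \sum_(j<Q) nrm (iter m (@dM _) f j).
Proof.
move=> u1; have uX e : nrm (u^+e) = 1 by rewrite nrmX u1 expr1n.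
elim: m f=> [|m IH] f f0 fQ.
  rewrite expr0 mul1r; apply: le_trans (nrm_sum _ _ _) _; apply: ler_sum=> j _.
  by rewrite nrmM uX mul1r.
rewrite exprSr -mulrA -nrmM phase_dM//; last by move=> j jM; apply: f0; rewrite mulSn (leq_trans jM)// leq_addr.
rewrite nrmM uX mul1r; have := IH (dM f); rewrite -iterSr; apply.
  by move=> j jm; rewrite /dM !f0 ?subr0// mulSn ?(leq_trans jm) ?leq_addl// addnC ltn_add2l.
by move=> j jQ; rewrite /dM !fQ ?subr0// (leq_trans jQ)// leq_addr.
Qed.

(** Leibniz rule for a real weight times a smooth factor. Every difference that falls on [g] gains a
    factor [h], so the [i]-th differences of the weight only have to be summable with the help of
    [h^(m-i)]. *)
Lemma iter_dM_mul (h : R) m k g A S Q Q' : 0<h -> 0<=A -> (Q+m*M<=Q')%N ->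
  (forall i j, (i<=m)%N -> (j<Q')%N -> nrm (iter i (@dM _) g j)<=A * h^+i) ->
  (forall i, (i<=m)%N -> h^+(m - i)*(\sum_(j<Q) `|iter i (@dM _) k j|)<=S) ->
  \sum_(j<Q) nrm (iter m (@dM _) (fun j=> (k j)%:C * g j) j)<=2^+m*(A*S).
Proof.
move=> h0; elim: m k g A S Q'=> [|m IH] k g A S Q' A0 QQ Hg Hk.
  have := Hk 0%N isT; rewrite subnn expr0 !mul1r /= => Hk0.
  apply: le_trans (ler_wpM2l A0 Hk0); rewrite big_distrr/=; apply: ler_sum=> j _.
  rewrite nrmM nrmC mulrC ler_wpM2r//; have := Hg 0%N j isT; rewrite expr0 mulr1; apply.
  by apply: leq_trans (ltn_ord j) _; move: QQ; rewrite mul0n addn0.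
have E: dM (fun j=> (k j)%:C * g j) = fun j=> ((dM k j)%:C * g (j+M)%N+(k j)%:C*dM g j).
  by apply/funext=> j; rewrite /dM rmorphB/=; move: (k _)%:C (k _)%:C (g _) (g _)=> *; ring.
have itD m' (f1 f2 : nat -> R[i]) j : iter m' (@dM _) (fun j=> f1 j + f2 j) j = iter m' (@dM _) f1 j + iter m' (@dM _) f2 j.
  elim: m' j=> [|n IHn] j //; rewrite !iterS {1}/dM !IHn /dM.
  by rewrite opprD addrACA.
have itS m' (f1 : nat -> R[i]) j : iter m' (@dM _) (fun j=> f1 (j+M)%N) j = iter m' (@dM _) f1 (j+M)%N.
  by elim: m' j=> [|n IHn] j //; rewrite !iterS {1}/dM !IHn /dM.
under eq_bigr do rewrite iterSr E itD.
apply: le_trans (ler_sum _ (fun j _=> nrmD _ _)) _; rewrite big_split/=.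
have -> : 2^+m.+1*(A*S) = 2^+m*(A*S)+2^+m*((A * h)*(S / h)).
  by rewrite exprS; move: (2^+m)=> x; field; rewrite gt_eqF.
apply: lerD.
  apply: (IH _ (fun j=> g (j+M)%N) _ _ (Q'-M)%N)=>//.
  - by rewrite leq_subRL ?(leq_trans _ QQ)// ?mulSn 1?addnCA// ?leq_addr// addnCA leq_addr.
  - move=> i j im jQ; rewrite itS; apply: Hg; first exact: leqW.
    by rewrite -ltn_subRL addnC || rewrite addnC -ltn_subRL.
  - by move=> i im; have := Hk i.+1 im; rewrite subSS iterSr.
apply: (IH _ _ _ _ Q')=>//.
- by rewrite mulr_ge0// ltW.
- by apply: leq_trans QQ; rewrite leq_add2l leq_mul2r leqnSn orbT.
- by move=> i j im jQ; rewrite -iterSr -mulrA -exprS; apply: Hg.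
- by move=> i im; rewrite ler_pdivlMr// mulrAC -exprSr -subSn//; apply: Hk; exact: leqW.
Qed.
End SequenceDifferences.

(** * Triangular weights *)

Section TriangleWeights.
Variables (R : realType) (a n M : nat).
Hypothesis n0 : (0<n)%N.
Let Q := (a+2*n)%N.

(** The convolution of two intervals of length [n], started at [a] and divided by [n]: these are the
    Fourier coefficients of the Fejer kernel, shifted. *)
Definition tri (j : nat) : R :=
  n%:R^-1 * \sum_(l<n) (((a+l<=j)%N)%:R-((a+l+n<=j)%N)%:R).

(** [tri] is a combination of three such functions. They are convex, so the sums of their absolute
    second differences telescope. *)
Definition hin (c : R) (j : nat) : R := `|j%:R-c|.

Lemma hin_step (c j : nat) : ((c<=j)%N)%:R=(1+hin (c%:R - 1) j-hin c%:R j)/2 :> R.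
Proof.
rewrite /hin; case: leqP=> cj.
  have : c%:R<=j%:R :> R by rewrite ler_nat.
  have -> : true%:R = 1 :> R by [].
  by move=> h; rewrite !ger0_norm; move: h; lra.
have : j%:R+1<=c%:R :> R by rewrite natr1 ler_nat.
have -> : false%:R = 0 :> R by [].
by move=> h; rewrite !ler0_norm; move: h; lra.
Qed.

Lemma tri_hin j : tri j =
  (2*n%:R)^-1*(hin (a%:R - 1) j - 2 * hin (a%:R+n%:R - 1) j+hin (a%:R+2*n%:R - 1) j).
Proof.
have S (c : nat) : \sum_(l<n) ((c+l<=j)%N)%:R=(n%:R+hin (c%:R - 1) j-hin (c%:R+n%:R - 1) j)/2 :> R.
  elim: n=> [|p IH]; first by rewrite big_ord0 addr0 add0r subrr mul0r.
  rewrite big_ord_recr/= IH hin_step natrD -[p.+1%:R]natr1.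
  by rewrite (_ : c%:R+(p%:R+1) - 1 = c%:R+p%:R); [field|ring].
have S2: \sum_(l<n) ((a+l+n<=j)%N)%:R=(n%:R+hin ((a+n)%:R - 1) j-hin ((a+n)%:R+n%:R - 1) j)/2 :> R.
  by rewrite -S; apply: eq_bigr=> l _; rewrite addnAC.
have e: (a+n)%:R+n%:R - 1 = a%:R+2*n%:R - 1 :> R by rewrite natrD; ring.
rewrite /tri sumrB S S2 e natrD.
by field; rewrite pnatr_eq0 -lt0n.
Qed.

Lemma tri_small j : (j<a)%N -> tri j = 0.
Proof.
move=> ja; rewrite /tri big1 ?mulr0// => l _.
have h1: (a+l<=j)%N = false by apply/negbTE; rewrite -ltnNge (leq_trans ja)// leq_addr.
have h2: (a+l+n<=j)%N = false by apply/negbTE; rewrite -ltnNge (leq_trans ja)// -addnA leq_addr.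
by rewrite h1 h2 subrr.
Qed.

Lemma tri_big j : (Q<=j)%N -> tri j = 0.
Proof.
move=> Qj; rewrite /tri big1 ?mulr0// => l _; have ln := ltn_ord l.
have h: (a+l+n<=j)%N.
  by apply: leq_trans Qj; rewrite /Q -addnA leq_add2l mul2n -addnn leq_add2r ltnW.
by rewrite h (leq_trans _ h) ?leq_addr// subrr.
Qed.

Lemma tri_01 j : 0<=tri j<=1.
Proof.
have b (l : 'I_n) : 0<=(((a+l<=j)%N)%:R-((a+l+n<=j)%N)%:R : R)<=1.
  case: (leqP (a+l+n) j)=> h; last by rewrite subr0 ler0n /= lern1 leq_b1.
  by rewrite (leq_trans _ h) ?leq_addr// subrr lexx ler01.
rewrite /tri mulr_ge0 ?invr_ge0 ?ler0n ?sumr_ge0//=; last by move=> l _; case/andP: (b l).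
rewrite ler_pdivrMl ?ltr0n// mulr1; apply: le_trans (_ : \sum_(l<n) 1<=_).
  by apply: ler_sum=> l _; case/andP: (b l).
by rewrite sumr_const card_ord.
Qed.

Lemma dM2_hin_ge0 c j : 0<=iter 2 (@dM M R) (hin c) j.
Proof.
rewrite /= /dM /hin !natrD; set x := j%:R-c; set y : R := M%:R.
have -> : j%:R+y+y-c = x+y+y by rewrite /x; ring.
have -> : j%:R+y-c = x+y by rewrite /x; ring.
have := ler_normD (x+y+y) x.
have -> : x+y+y+x = 2*(x+y) by ring.
by rewrite normrM normr_nat; lra.
Qed.

Lemma dM_hin_le c j : `|dM M (hin c) j| <= M%:R.
Proof.
rewrite /dM /hin natrD; apply: le_trans (ler_dist_dist _ _) _.
by rewrite (_ : j%:R+M%:R-c-(j%:R-c) = M%:R) ?ger0_norm//; ring.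
Qed.

Lemma sum_dM2_hin c q : \sum_(j<q) iter 2 (@dM M R) (hin c) j<=2*M%:R^+2.
Proof.
have T (f : nat -> R) : \sum_(j<q) dM M f j = \sum_(0<=j<M) (f (q+j)%N - f j).
  elim: q=> [|p IH]; first by rewrite big_ord0 big1// => j _; rewrite add0n subrr.
  rewrite big_ord_recr/= IH /dM; case: M=> [|m]; first by rewrite !big_geq// addn0 subrr addr0.
  rewrite [RHS]sumrB [in LHS]sumrB [X in _ = X - _]big_nat_recr//= [X in X - _ + _]big_nat_recl//= addn0.
  rewrite addSnnS; under [in RHS]eq_bigr do rewrite addSnnS.
  by move: (\sum_(_<=_<_) _) (\sum_(_<=_<_) _)=> u v; rewrite addnS; ring.
rewrite /= T; apply: le_trans (_ : \sum_(0<=j<M) (M%:R+M%:R)<=_).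
  apply: ler_sum=> j _; apply: lerD; first by apply: le_trans (ler_norm _) (dM_hin_le _ _).
  by apply: le_trans (ler_norm _) _; rewrite normrN dM_hin_le.
by rewrite big_const_nat iter_addr_0 subn0 -mulr_natr expr2; lra.
Qed.

Lemma sum_lin3 (c : R) (f g k : nat -> R) q :
  \sum_(j<q) c*(f j+2 * g j+k j) =
  c*(\sum_(j<q) f j+2*(\sum_(j<q) g j) + \sum_(j<q) k j).
Proof. by rewrite -big_distrr/= !big_split/= -big_distrr. Qed.

Lemma sum_dM2_tri q : \sum_(j<q) `|iter 2 (@dM M R) tri j| <= 4*M%:R^+2 / n%:R.
Proof.
have E j : iter 2 (@dM M R) tri j=(2*n%:R)^-1*(iter 2 (@dM M R) (hin (a%:R - 1)) j
   - 2 * iter 2 (@dM M R) (hin (a%:R+n%:R - 1)) j + iter 2 (@dM M R) (hin (a%:R+2*n%:R - 1)) j).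
  by rewrite /= /dM !tri_hin; move: (hin _) (hin _) (hin _)=> f1 f2 f3; ring.
have p: 0<(2*n%:R)^-1 :> R by rewrite invr_gt0 mulr_gt0// ltr0n.
have n0': n%:R != 0 :> R by rewrite pnatr_eq0 -lt0n.
apply: le_trans (_ : \sum_(j<q) (2*n%:R)^-1*(iter 2 (@dM M R) (hin (a%:R - 1)) j
   + 2 * iter 2 (@dM M R) (hin (a%:R+n%:R - 1)) j + iter 2 (@dM M R) (hin (a%:R+2*n%:R - 1)) j)<=_).
  apply: ler_sum=> j _; rewrite E normrM (ger0_norm (ltW p)) ler_wpM2l ?(ltW p)//.
  have := dM2_hin_ge0 (a%:R - 1) j; have := dM2_hin_ge0 (a%:R+n%:R - 1) j.
  have := dM2_hin_ge0 (a%:R+2*n%:R - 1) j.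
  move: (iter 2 _ (hin (a%:R - 1)) j) (iter 2 _ (hin (a%:R+n%:R - 1)) j) (iter 2 _ (hin (a%:R+2*n%:R - 1)) j).
  by move=> x y z x0 y0 z0; rewrite ler_norml; apply/andP; split; lra.
rewrite (sum_lin3 _ (iter 2 (@dM M R) (hin (a%:R - 1))) (iter 2 (@dM M R) (hin (a%:R+n%:R - 1)))
  (iter 2 (@dM M R) (hin (a%:R+2*n%:R - 1)))).
have hx := sum_dM2_hin (a%:R - 1) q; have hy := sum_dM2_hin (a%:R+n%:R - 1) q.
have hz := sum_dM2_hin (a%:R+2*n%:R - 1) q.
rewrite mulrC ler_pdivrMr ?mulr_gt0 ?ltr0n//.
rewrite (_ : 4*M%:R^+2 / n%:R*(2*n%:R) = 8*M%:R^+2); last by field.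
by move: hx hy hz; lra.
Qed.

(** Orders 0 and 1 get the trivial bound by the length. From order 2 on the sum is governed by the
    three kinks of the weight, with a factor 2 for each further difference. *)
Lemma sum_iter_tri i : \sum_(j<Q) `|iter i (@dM M R) tri j| <=
  if (i<=1)%N then Q%:R else 2^+i*(4*M%:R^+2 / n%:R).
Proof.
case: i=> [|[|i]] /=.
- apply: le_trans (_ : \sum_(j<Q) 1<=_); last by rewrite sumr_const card_ord.
  by apply: ler_sum=> j _; have /andP[t0 t1] := tri_01 j; rewrite ger0_norm.
- apply: le_trans (_ : \sum_(j<Q) 1<=_); last by rewrite sumr_const card_ord.
  apply: ler_sum=> j _; have /andP[t0 t1] := tri_01 j; have /andP[s0 s1] := tri_01 (j+M).
  by rewrite /dM ler_norml; apply/andP; split; lra.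
elim: i=> [|i IH].
  apply: le_trans (sum_dM2_tri Q) _; rewrite ler_peMl ?mulr_ge0 ?invr_ge0 ?exprn_ge0// ?exprn_ege1//.
  by rewrite ler1n.
rewrite exprS -mulrA; set f := iter i (@dM M R) _ in IH *.
have f0 j : (Q<=j)%N -> dM M (dM M f) j = 0.
  have -> : dM M (dM M f) = iter i.+2 (@dM M R) tri by [].
  by apply: iter_dM_supp; exact: tri_big.
set g := dM M (dM M f) in IH f0 *.
apply: le_trans (_ : \sum_(j<Q) (`|g (j+M)%N| + `|g j|)<=_).
  by apply: ler_sum=> j _; rewrite {1}/dM; exact: ler_normB.
rewrite big_split/= [2 * _]mulr_natl mulr2n; apply: lerD=>//; apply: le_trans IH.
rewrite -(big_mkord xpredT (fun j=> `|g (j+M)%N|)) -(big_mkord xpredT (fun j=> `|g j|)).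
have -> : \sum_(0<=j<Q) `|g (j+M)%N| = \sum_(M<=j<Q+M) `|g j|.
  by rewrite -[X in _ = \sum_(X<=_<_) _]add0n big_addn addnK.
have [MQ|MQ] := leqP M Q.
  rewrite (@big_cat_nat _ _ _ Q)//= ?leq_addr// [X in _+X]big_nat_cond [X in _+X]big1 ?addr0; last first.
    by move=> j /andP[/andP[Qj _] _]; rewrite f0// normr0.
  by rewrite [X in _<=X](@big_cat_nat _ _ _ M)//= lerDr sumr_ge0.
rewrite [X in X<=_]big_nat_cond [X in X<=_]big1 ?sumr_ge0// => j /andP[/andP[Mj _] _].
by rewrite f0 ?normr0// (leq_trans (ltnW MQ)).
Qed.

Lemma tri_double (F : nat -> R[i]) :
  (n%:R^-1)%:C*(\sum_(l<n) \sum_(l'<n) F (a+l+l')%N) = \sum_(j<Q) (tri j)%:C*F j.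
Proof.
rewrite [RHS](eq_bigr (fun j : 'I_Q=> (n%:R^-1)%:C*(\sum_(l<n) ((((a+l<=j)%N)%:R-((a+l+n<=j)%N)%:R) : R)%:C*F j))); last first.
  by move=> j _; rewrite /tri rmorphM/= rmorph_sum/= -mulrA big_distrl.
rewrite -big_distrr/= [X in _=_*X]exchange_big/=; congr (_ * _); apply: eq_bigr=> l _; have ln := ltn_ord l.
rewrite -(big_mkord xpredT (fun l'=> F (a+l+l')%N)).
rewrite -(big_mkord xpredT (fun j=> ((((a+l<=j)%N)%:R-((a+l+n<=j)%N)%:R) : R)%:C*F j)).
have h1: (a+l+n<=Q)%N by rewrite /Q -addnA leq_add2l mul2n -addnn leq_add2r ltnW.
rewrite [RHS](@big_cat_nat _ _ _ (a+l))//=; last by apply: leq_trans h1; rewrite leq_addr.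
rewrite [X in _ = X + _]big_nat_cond [X in _ = X + _]big1 ?add0r; last first.
  move=> j /andP[/andP[_ jl] _].
  have g1: (a+l<=j)%N = false by apply/negbTE; rewrite -ltnNge.
  have g2: (a+l+n<=j)%N = false by apply/negbTE; rewrite -ltnNge (leq_trans jl)// leq_addr.
  by rewrite g1 g2 subrr mul0r.
rewrite [RHS](@big_cat_nat _ _ _ (a+l+n))//=; last by rewrite leq_addr.
rewrite [X in _=_+X]big_nat_cond [X in _=_+X]big1 ?addr0; last first.
  by move=> j /andP[/andP[jl _] _]; rewrite jl (leq_trans _ jl) ?leq_addr// subrr mul0r.
rewrite -[X in _ = \sum_(X<=_<_) _]add0n big_addn addKn.
apply: eq_big_nat=> j /andP[_ jn].
have g2: (a+l+n<=j+(a+l))%N = false by apply/negbTE; rewrite -ltnNge addnC ltn_add2l.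
by rewrite g2 leq_addl subr0 mul1r addnC.
Qed.
End TriangleWeights.

(** * Phases at a distance from 1 *)

Section CisFacts.
Variable R : realType.
Implicit Types (x y z : R).

Lemma cisX y k : cis (k%:R*y) = cis y^+k.
Proof.
elim: k=> [|k IH]; first by rewrite mul0r cis0 expr0.
by rewrite -natr1 mulrDl mul1r cisD IH exprSr.
Qed.

Lemma nrm1cis_sqr y : nrm (1-cis y)^+2 = 2 - 2*cos y.
Proof.
rewrite nrm_sqr /= sub0r sqrrN; have := cos2Dsin2 y; move: (cos y) (sin y)=> c s.
by move=> h; transitivity (1 - 2*c+(c^+2+s^+2)); [ring|rewrite h; ring].
Qed.

Lemma nrm1cisN y : nrm (1-cis (- y)) = nrm (1-cis y).
Proof. by apply/eqP; rewrite -(@eqrXn2 _ 2) ?nrm_ge0// !nrm1cis_sqr cosN. Qed.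

Lemma nrm1cis_small z : 0<z -> z<=2^-1 -> z/2<=nrm (1-cis z).
Proof.
move=> z0 z2.
pose F (y : R) : R[i] := cis (1*y)-y%:C * 'i%C.
have dF y : cderiv F y (1%:C * 'i%C*cis (1*y) - 1%:C * 'i%C).
  apply: cderivB; first exact: cderiv_cis_lin.
  have := cderivM (cderiv_real (is_derive_id y (1 : R))) (cderiv_cst 'i%C y)=> h.
  by apply: cderiv_eq h _; rewrite mulr0 addr0.
have := @cmean _ F _ 0 z z (ltW z0) (fun y _=> dF y).
have i1: nrm 'i%C = 1 :> R by rewrite /nrm/= expr0n expr1n add0r sqrtr1.
have H y : 0<=y<=z -> nrm (1%:C * 'i%C*cis (1*y) - 1%:C * 'i%C)<=z.
  move=> /andP[y0 yz]; rewrite !mul1r -{2}['i%C]mulr1 -mulrBr nrmM i1 mul1r -cis0.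
  by apply: le_trans (cis_lip _ _) _; rewrite subr0 ger0_norm.
move=> /(_ H); rewrite /F !mul1r mul0r subr0 cis0 subr0=> h.
have := nrm_leB (z%:C * 'i%C) (1-cis z - - (z%:C * 'i%C))=> k.
have E: z%:C * 'i%C-(1-cis z - - (z%:C * 'i%C)) = - (1-cis z).
  by move: (cis z) (z%:C * _)=> u v; ring.
rewrite E nrmN nrmM i1 nrm_real_ge0 ?(ltW z0)// mulr1 in k.
have E2: nrm (1-cis z - - (z%:C * 'i%C)) = nrm (cis z-z%:C * 'i%C - 1).
  by rewrite -nrmN; congr nrm; move: (cis z) (z%:C * _)=> u v; ring.
by rewrite E2 in k; move: h k z2 z0; nra.
Qed.

Lemma nrm1cis_lower z y : 0<z -> z<=2^-1 -> z<=y<=2 * pi-z -> z/2<=nrm (1-cis y).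
Proof.
move=> z0 z2 /andP[zy yz]; apply: le_trans (nrm1cis_small z0 z2) _.
have pi2 := @pi_ge2 R.
rewrite -(@lerXn2r_iff _ 2) || rewrite -(@ler_pXn2r _ 2) ?nnegrE ?nrm_ge0// !nrm1cis_sqr.
suff : cos y<=cos z by lra.
have mono u v : 0<=u -> u<=v -> v<=pi -> cos v<=cos u :> R.
  move=> u0 uv vp; rewrite leNgt ltr_cos ?in_itv/= -?leNgt ?u0 ?vp ?(le_trans u0 uv) ?(le_trans uv vp)//.
have [yp|yp] := lerP y pi; first by apply: mono=>//; exact: ltW.
have -> : cos y = cos (2 * pi-y).
  by rewrite -(cosN y) -(cosD2pi (- y)) mulr_natl addrC.
apply: mono; [exact: ltW| |]; move: yz yp; lra.
Qed.

Lemma cis2pin k : cis (k%:R*(2 * pi)) = 1 :> R[i].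
Proof. by rewrite cisX /cis mulr_natl cos2pi sin2pi expr1n. Qed.

Lemma cis_neq1 y : 0<y -> y<2 * pi -> cis y != 1.
Proof.
move=> y0 y2; pose z := Num.min 2^-1 (Num.min y (2 * pi-y)).
have z0: 0<z by rewrite !lt_min invr_gt0 ltr0n y0 subr_gt0.
have z2: z<=2^-1 by rewrite ge_min lexx.
have zy: z<=y by rewrite !ge_min lexx orbT.
have zy2: z<=2 * pi-y by rewrite !ge_min lexx !orbT.
have : z<=y<=2 * pi-z by rewrite zy/=; move: zy2; lra.
move=> /(nrm1cis_lower z0 z2) h; apply/eqP=> e; move: h.
by rewrite e subrr nrm0; move: z0; lra.
Qed.
End CisFacts.

(** * The Fejer kernel and discrete Fejer means *)

Section FejerKernel.
Variables (R : realType) (n : nat).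
Hypothesis n0 : (0<n)%N.
Implicit Types (x y u : R).
Let n0' : 0<n%:R :> R. Proof. by rewrite ltr0n. Qed.

Definition Kn y : R := n%:R^-1*nrm (\sum_(l<n) cis (l%:R*y))^+2.

Lemma Kn_ge0 y : 0<=Kn y.
Proof. by rewrite mulr_ge0 ?invr_ge0 ?ler0n// exprn_ge0// nrm_ge0. Qed.

Lemma Kn_cos y : Kn y = n%:R^-1 * \sum_(l<n) \sum_(l'<n) cos ((l%:R-l'%:R)*y).
Proof.
rewrite /Kn; congr (_ * _).
have := @nrm_sqr_trigsum R 'I_n (fun=> 1) (fun l=> l%:R*y).
under eq_bigr do rewrite mul1r.
move=> ->; apply: eq_bigr=> l _; apply: eq_bigr=> l' _.
by rewrite !mul1r mulrBl.
Qed.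

Lemma Kn_Re y : Kn y =
  Re ((n%:R^-1)%:C * \sum_(l<n) \sum_(l'<n) cis (- ((l%:R+l'%:R-(n%:R - 1))*y))).
Proof.
rewrite Kn_cos ReZ; congr (_ * _); rewrite Re_sum; apply: eq_bigr=> l _.
rewrite Re_sum (reindex_inj rev_ord_inj)/=; apply: eq_bigr=> l' _.
rewrite cosN natrB ?ltn_ord// -natr1; congr (cos (_ * _)); ring.
Qed.

Lemma Kn_bound y : 0<nrm (1-cis y) -> Kn y<=4/(n%:R*nrm (1-cis y)^+2).
Proof.
move=> d0; rewrite /Kn; under eq_bigr do rewrite cisX.
set c := cis y in d0 *; set S := \sum_(l<n) _.
have E: (1-c)*S = 1-c^+n by rewrite -opprB mulNr -subrX1 opprB.
have : nrm (1-c)*nrm S<=2.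
  rewrite -nrmM E; apply: le_trans (nrmB _ _) _; rewrite nrm1 nrmX nrm_cis expr1n; lra.
move=> h; rewrite invfM [X in _<=X]mulrCA ler_pM2l ?invr_gt0// ler_pdivlMr ?exprn_gt0// mulrC -exprMn.
rewrite (_ : 4 = 2^+2 :> R); last by ring.
by rewrite lerXn2r ?nnegrE ?mulr_ge0 ?nrm_ge0.
Qed.

Lemma sum_cos_root (y : R) (l l' : 'I_n) : \sum_(i<n) cos ((l%:R-l'%:R)*(y - i%:R*(2 * pi / n%:R)))
  = if l == l' then n%:R else 0.
Proof.
have [->|ll] := eqVneq l l'.
  rewrite (eq_bigr (fun=> 1)); first by rewrite sumr_const card_ord.
  by move=> i _; rewrite subrr mul0r cos0.
wlog lt : l l' ll/(l'<l)%N=> [W|].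
  have := ll; rewrite -val_eqE neq_ltn=> /orP[lt|lt]; last exact: W.
  rewrite -[RHS](W l' l)//; last by rewrite eq_sym.
  by apply: eq_bigr=> i _; rewrite -cosN -mulNr opprB.
pose q := (l-l')%N; have q0: (0<q)%N by rewrite subn_gt0.
have qn: (q<n)%N by apply: leq_ltn_trans (ltn_ord l); rewrite leq_subr.
have qE: l%:R-l'%:R = q%:R :> R by rewrite natrB// ltnW.
pose w : R[i] := cis (q%:R*(2 * pi / n%:R)).
have w1: w != 1.
  have p0 := @pi_gt0 R; apply: cis_neq1; first by rewrite !mulr_gt0 ?ltr0n ?invr_gt0.
  rewrite mulrCA -[X in _<X]mulr1 ltr_pM2l ?mulr_gt0// ltr_pdivrMr// mul1r ltr_nat//.
have wn: w^+n = 1.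
  by rewrite /w -cisX (_ : _ * _ = q%:R*(2 * pi)) ?cis2pin//; field; rewrite gt_eqF.
have S0: \sum_(i<n) w^+i = 0.
  have := subrX1 w n; rewrite wn subrr=> /esym/eqP; rewrite mulf_eq0 subr_eq0 (negbTE w1)/=.
  by move/eqP.
transitivity (Re (cis (- (q%:R*y)) * \sum_(i<n) w^+i)); last by rewrite S0 mulr0.
rewrite big_distrr/= Re_sum; apply: eq_bigr=> i _.
rewrite /w -!cisX -cisD -[in LHS]cosN qE; congr (cos _).
by ring.
Qed.

(** Exact, by orthogonality of the [n]-th roots of unity. It allows an average over [n] grid points
    in place of an integral over the period. *)
Lemma Kn_partition y : \sum_(i<n) Kn (y - i%:R*(2 * pi / n%:R)) = n%:R.
Proof.
under eq_bigr do rewrite Kn_cos.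
rewrite -big_distrr/= exchange_big/=; under eq_bigr do rewrite exchange_big/=.
rewrite (eq_bigr (fun=> n%:R)); last first.
  move=> l _; under eq_bigr do rewrite sum_cos_root.
  by rewrite (bigD1 l)//= eqxx big1 ?addr0// => l'; rewrite eq_sym=> /negbTE ->.
by rewrite sumr_const card_ord -[n%:R *+ n]mulr_natr mulrA mulVf ?mul1r// gt_eqF.
Qed.

Variables (th : R) (psi : R -> R) (B L rho a0 b0 : R).
Hypothesis th0 : 0<th.
Let P := 2 * pi / th.
Definition xg i : R := i%:R*(2 * pi / th / n%:R).
(** A Fejer mean of [psi] sampled at [n] points over one period [2 pi / th] of the kernel. *)
Definition psis u : R := n%:R^-1 * \sum_(i<n) psi (xg i)*Kn (th*(u-xg i)).

Lemma th_xg u i : th*(u-xg i) = th*u - i%:R*(2 * pi / n%:R).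
Proof. by rewrite /xg; field; rewrite !gt_eqF. Qed.

Lemma sum_Kn u : \sum_(i<n) Kn (th*(u-xg i)) = n%:R.
Proof. by under eq_bigr do rewrite th_xg; exact: Kn_partition. Qed.

Hypothesis psiB : forall x, `|psi x| <= B.

Lemma psis_le u : `|psis u| <= B.
Proof.
rewrite normrM ger0_norm ?invr_ge0 ?ler0n// ler_pdivrMl// mulrC -[X in _<=_*X](sum_Kn u) mulr_sumr.
apply: le_trans (ler_norm_sum _ _ _) _; apply: ler_sum=> i _.
by rewrite normrM (ger0_norm (Kn_ge0 _)) ler_wpM2r// Kn_ge0.
Qed.

Hypothesis psiL : forall x y, `|psi x-psi y| <= L * `|x-y|.
Hypothesis psi0 : forall x, ~~ (a0<=x<=b0) -> psi x = 0.
Hypotheses (rho0 : 0<rho) (thr : th*rho<=2^-1) (ra : rho<a0) (bP : b0<P-rho).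

(** Grid points within [rho] of [u] are handled by the Lipschitz bound, the others by the decay of
    the kernel. *)
Lemma psis_approx u : 0<=u -> u<=P/2 ->
  `|psi u-psis u| <= L*rho+32*B/(n%:R*(th*rho)^+2).
Proof.
move=> u0 uP; set E := 32*B / _.
have B0: 0<=B by apply: le_trans (psiB 0); rewrite normr_ge0.
have tr0: 0<th*rho by rewrite mulr_gt0.
have E0: 0<=E by rewrite /E; nneg.
have L0: 0<=L.
  by have := psiL 1 0; rewrite subr0 normr1 mulr1=> /(le_trans _); apply.
have P0: 0<P by rewrite divr_gt0// mulr_gt0// pi_gt0.
have thP: th*P = 2 * pi by rewrite /P mulrCA divff ?mulr1// gt_eqF.
have rP: rho<=P/2.
  rewrite -(ler_pM2l th0) mulrA thP; apply: le_trans thr _; have := @pi_ge2 R; lra.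
have -> : psi u-psis u = n%:R^-1 * \sum_(i<n) (psi u-psi (xg i))*Kn (th*(u-xg i)).
  rewrite /psis; under [in RHS]eq_bigr do rewrite mulrBl.
  by rewrite sumrB -big_distrr/= sum_Kn mulrBr mulrCA mulVf ?mulr1// gt_eqF.
rewrite normrM ger0_norm ?invr_ge0 ?ler0n// ler_pdivrMl//.
apply: le_trans (ler_norm_sum _ _ _) _.
apply: le_trans (_ : \sum_(i<n) (L*rho*Kn (th*(u-xg i))+E)<=_); last first.
  by rewrite big_split/= -big_distrr/= sum_Kn sumr_const card_ord -[E *+ n]mulr_natr; lra.
apply: ler_sum=> i _; rewrite normrM (ger0_norm (Kn_ge0 _)).
have K0 := Kn_ge0 (th*(u-xg i)).
have [near|far] := lerP `|u-xg i| rho.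
  rewrite ler_wpDr// ler_wpM2r//; apply: le_trans (psiL _ _) _; exact: ler_wpM2l.
apply: le_trans (_ : E<=_); last by rewrite ler_wpDl//; nneg.
have xi0: 0<=xg i by rewrite /xg !mulr_ge0 ?invr_ge0 ?ler0n ?pi_ge0 ?(ltW th0).
have xiP: xg i<P.
  rewrite /xg -/P mulrCA -[X in _<X]mulr1 ltr_pM2l// ltr_pdivrMr// mul1r ltr_nat ltn_ord//.
(* By periodicity the kernel is also large when [u] and the grid point lie at opposite ends of the
   period; there [psi] vanishes at both. *)
have [wrap|nowrap] := lerP `|u-xg i| (P-rho); last first.
  have ux: u-xg i<=0.
    rewrite leNgt; apply/negP=> pos; move: nowrap; rewrite gtr0_norm//.
    by move: uP xi0 rP; lra.
  rewrite (ler0_norm ux) in nowrap.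
  rewrite !psi0 ?subrr ?normr0 ?mul0r//; apply/negP=> /andP[h1 h2]; move: h1 h2 nowrap u0 xiP bP ra; lra.
have lowr: th*rho/2<=nrm (1-cis (th*(u-xg i))).
  have -> : nrm (1-cis (th*(u-xg i))) = nrm (1-cis (th * `|u-xg i|)).
    by case: (ger0P (u-xg i))=> _ //; rewrite mulrN nrm1cisN.
  apply: nrm1cis_lower=>//; rewrite ler_pM2l// (ltW far)/= -thP -mulrBr ler_pM2l//.
have low0: 0<nrm (1-cis (th*(u-xg i))) by apply: lt_le_trans lowr; rewrite divr_gt0.
apply: le_trans (_ : 2*B*(4/(n%:R*(th*rho/2)^+2))<=_); last first.
  apply: eq_ler; rewrite /E; field.
  by rewrite !gt_eqF.
apply: ler_pM=>//.
  by apply: le_trans (ler_normB _ _) _; rewrite mulr2n mulrDl mul1r lerD.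
apply: le_trans (Kn_bound low0) _; rewrite ler_pM2l// lef_pV2 ?posrE ?mulr_gt0 ?exprn_gt0 ?divr_gt0//.
by rewrite ler_pM2l// lerXn2r ?nnegrE ?nrm_ge0 ?divr_ge0 ?(ltW tr0).
Qed.
End FejerKernel.

(** * Sums of mangoldt - 1 against the Fejer kernel *)

Section MangoldtSums.
Variable R : realType.
Implicit Types (de x u : R) (k N : nat).

Definition cc de k : R := (mangoldt R k - 1)*k%:R`^(- (1+de)).

Lemma norm_cc de k : `|cc de k| <= (1+lnn R k)*k%:R`^(- (1+de)).
Proof.
rewrite normrM [X in _*X]ger0_norm ?powR_ge0// ler_wpM2r ?powR_ge0//.
apply: le_trans (ler_normB _ _) _; rewrite normr1 addrC lerD2l ger0_norm ?mangoldt_ge0//.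
exact: mangoldt_le_lnn.
Qed.

Lemma one_ln_le de k : 0<de -> de<=1 -> (0<k)%N ->
  (1+lnn R k)*k%:R`^(- (1+de))<=2 / de*k%:R`^(- (1+de/2)).
Proof.
move=> d0 d1 k0; rewrite !powR_expR//; set l := lnn R k.
have l0: 0<=l := lnn_ge0 R k.
have -> : - (1+de) * l = - (1+de/2) * l + - (de/2 * l) by field.
rewrite expRD expRN mulrCA [X in _<=X]mulrC ler_pM2l ?expR_gt0// ler_pdivrMr ?expR_gt0//.
have := expR_ge1Dx (de/2 * l)=> h.
apply: le_trans (_ : 2 / de*(1+de/2 * l)<=_); last by rewrite ler_wpM2l// divr_ge0// ltW.
have -> : 2 / de*(1+de/2 * l) = 2 / de+l by field; rewrite gt_eqF.
by rewrite lerD2r ler_pdivlMr// mul1r; move: d1; lra.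
Qed.

Lemma sum_far de (M N : nat) : 0<de -> de<=1 -> (0<M)%N ->
  \sum_(M.+1<=k<N.+1) (1+lnn R k)*k%:R`^(- (1+de)) <=
  (2 / de)^+2*M%:R`^(- (de/2)).
Proof.
move=> d0 d1 M0; apply: le_trans (_ : \sum_(M.+1<=k<N.+1) 2 / de*k%:R`^(- (1+de/2))<=_).
  by apply: ler_sum_nat=> k /andP[Mk _]; apply: one_ln_le=>//; exact: leq_ltn_trans Mk.
have d2: 0<de/2 by rewrite divr_gt0.
have b1: 1<1+de/2 by rewrite ltrDl.
have c0: 0<=2 / de by rewrite divr_ge0// ltW.
rewrite -big_distrr/=; apply: le_trans (ler_wpM2l c0 (sum_tail N b1 M0)) _.
rewrite (_ : 1-(1+de/2) = - (de/2)); last by ring.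
rewrite (_ : 1+de/2 - 1 = de/2); last by ring.
apply: eq_ler; move: (_`^_)=> w; field; rewrite gt_eqF//.
Qed.

Lemma sum_all de N : 0<de -> de<=1 ->
  \sum_(1<=k<N.+1) (1+lnn R k)*k%:R`^(- (1+de))<=2*(2 / de)^+2.
Proof.
move=> d0 d1; have c1: 1<=2 / de by rewrite ler_pdivlMr// mul1r; move: d1; lra.
have c2: 1<=(2 / de)^+2 by rewrite exprn_ege1.
case: N=> [|N]; first by rewrite big_geq//; move: c2; lra.
rewrite big_ltn// powR1 mulr1 /lnn ln1 addr0.
have := @sum_far de 1 N.+1 d0 d1 isT; rewrite powR1 mulr1 /lnn; move: c2; lra.
Qed.

Lemma GN_cc de N t : GN de N t = \sum_(1<=k<N.+1) (cc de k)%:C*cis (- (t * lnn R k)).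
Proof.
rewrite /GN /AN /ZN /Dp -sumrB; apply: eq_bigr=> k _.
rewrite /cc /nst /nit rmorphM rmorphB/=; move: (cis _) (mangoldt R k)%:C (_`^_)%:C=> c m p.
by rewrite /one_fun rmorph1; ring.
Qed.
End MangoldtSums.

Section KernelSum.
Variables (R : realType) (n M m : nat) (th de : R) (N : nat).
Hypotheses (n0 : (0<n)%N) (M0 : (0<M)%N) (th0 : 0<th).
Let a := (m*M)%N.
Let Q := (a+2*n)%N.
Let h := M%:R * th.

Definition tt (j : nat) : R := (j%:R-(m*M+n)%:R+1) * th.

(** Expanding the kernel into phases turns the sum over integers into values of [GN] on the grid
    [tt], weighted by the triangle. *)
Lemma kernel_sum x : \sum_(1<=k<N.+1) cc de k*Kn n (th*(lnn R k-x)) =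
  Re (\sum_(j<Q) (tri R a n j)%:C*(cis (tt j*x)*GN de N (tt j))).
Proof.
rewrite -(@tri_double R a n (fun j=> cis (tt j*x)*GN de N (tt j))).
transitivity (\sum_(1<=k<N.+1) Re ((cc de k)%:C*((n%:R^-1)%:C *
   \sum_(l<n) \sum_(l'<n) cis (- ((l%:R+l'%:R-(n%:R - 1))*(th*(lnn R k-x))))))).
  by apply: eq_bigr=> k _; rewrite Kn_Re// ReZ.
rewrite -Re_sum; congr Re.
under eq_bigr do rewrite mulrCA; rewrite -big_distrr/=; congr (_ * _).
under eq_bigr do rewrite big_distrr/=; rewrite exchange_big/=; apply: eq_bigr=> l _.
under eq_bigr do rewrite big_distrr/=; rewrite exchange_big/=; apply: eq_bigr=> l' _.
rewrite GN_cc big_distrr/=; apply: eq_bigr=> k _.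
have -> : (- ((l%:R+l'%:R-(n%:R - 1))*(th*(lnn R k-x)))) =
   tt (a+l+l')*x + - (tt (a+l+l') * lnn R k).
  by rewrite /tt /a !natrD; ring.
by rewrite cisD mulrCA.
Qed.

Lemma tt_M j : tt (j+M) = tt j+h.
Proof. by rewrite /tt /h natrD; ring. Qed.

Lemma iter_g (F : R -> R[i]) i j : iter i (@dM M _) (fun j=> F (tt j)) j=(h^+i)%:C * iter i (dh h) F (tt j).
Proof.
have h0: 0<h by rewrite mulr_gt0// ltr0n.
have hn: h%:C != 0 :> R[i] by rewrite eq_complex/= negb_and gt_eqF.
elim: i j=> [|i IH] j; first by rewrite expr0 mul1r.
have E: (h * h^+i)%:C = h%:C*(h^+i)%:C :> R[i] by exact: rmorphM.
rewrite !iterS {1}/dM !IH tt_M exprS E.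
have -> : dh h (iter i (dh h) F) (tt j)=(iter i (dh h) F (tt j+h) - iter i (dh h) F (tt j)) / h%:C by [].
by move: (h%:C) (h^+i)%:C (iter i _ F _) (iter i _ F _) hn=> w p u v w0; field.
Qed.

Variables (A D x : R).
Hypotheses (A0 : 0<=A) (HB : Bm h m (GN de N) A (- D) D) (HD : (n%:R+3*(m*M)%:R+1) * th<=D).
Hypotheses (h1 : h<=1) (hx : 4^-1<=nrm (1-cis (h*x))) (m0 : (0<m)%N).

(** [m] summations by parts against the phases [cis (th * x)^j]: each one divides by
    [1 - cis (h * x)], of modulus at least 1/4, and gains [h] when the difference falls on [GN].
    This does the work of [m] integrations by parts in [t]. *)
Lemma kernel_sum_bound : `|\sum_(1<=k<N.+1) cc de k*Kn n (th*(lnn R k-x))| <=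
  4^+m*(2^+m*(A*(h^+m.-1*Q%:R+2^+m*(4*M%:R^+2 / n%:R)))).
Proof.
have h0: 0<h by rewrite mulr_gt0// ltr0n.
rewrite kernel_sum; apply: le_trans (Re_le_nrm _) _.
set S := h^+m.-1*Q%:R + _.
pose u := cis (th*x).
have -> : \sum_(j<Q) (tri R a n j)%:C*(cis (tt j*x)*GN de N (tt j)) =
    cis (- (((m*M+n)%:R - 1) * th*x)) * \sum_(j<Q) u^+j*((tri R a n j)%:C*GN de N (tt j)).
  rewrite big_distrr/=; apply: eq_bigr=> j _.
  have -> : tt j*x = - (((m*M+n)%:R - 1) * th*x)+j%:R*(th*x) by rewrite /tt; ring.
  by rewrite cisD cisX -/u; move: (cis _) (u^+j) (tri _ _ _ _)%:C (GN _ _ _)=> *; ring.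
rewrite nrmM nrm_cis mul1r; set G := nrm _.
have uM: u^+M = cis (h*x) by rewrite /u -cisX mulrA.
have key: 4^-1^+m*G<=2^+m*(A*S).
  apply: le_trans (_ : nrm (1-u^+M)^+m*G<=_).
    rewrite ler_wpM2r ?nrm_ge0// lerXn2r ?nnegrE ?nrm_ge0 ?invr_ge0// uM//.
  apply: le_trans (@phase_iter_dM R M u m (fun j=> (tri R a n j)%:C*GN de N (tt j)) Q _ _ _) _.
  - exact: nrm_cis.
  - by move=> j ja; rewrite tri_small// mul0r.
  - by move=> j ja; rewrite tri_big// mul0r.
  apply: (iter_dM_mul h0 A0 (leqnn _)).
    move=> i j im jQ; rewrite iter_g nrmM nrm_real_ge0 ?exprn_ge0 ?(ltW h0)// mulrC ler_wpM2r ?exprn_ge0 ?(ltW h0)//.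
    have red phi E b c : Bm h m phi E b c -> Bm h i phi E b c.
      by rewrite -(subnK im); elim: (m - i)%N=> [|d IH]//; rewrite addSn=> /BmW.
    apply: (Bm_iter (red _ _ _ _ HB)).
    have ih: i%:R * h<=(m*M)%:R * th.
      by rewrite natrM -mulrA -/h ler_pM2r// ler_nat.
    have j0: 0<=j%:R * th by rewrite mulr_ge0// ltW.
    have jj: j%:R * th<=(2*(m*M)%:R+2*n%:R) * th.
      rewrite ler_pM2r//; have : j%:R<=(Q+m*M)%:R :> R by rewrite ler_nat ltnW.
      by rewrite /Q /a !natrD natrM; lra.
    move: HD ih j0 jj; rewrite /tt natrD; move: ((m*M)%:R : R) (n%:R : R) (j%:R : R) (ler0n R (m*M)) (ler0n R n).
    move=> w y z w0 y0 HD' ih j0 jj; have wt: 0<=w * th by rewrite mulr_ge0// ltW.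
    have yt: 0<=y * th by rewrite mulr_ge0// ltW.
    by apply/andP; split; move: th0; lra.
  move=> i im; have hX e : h^+e<=1 by rewrite exprn_ile1// ltW.
  have hX0 e : 0<=h^+e by rewrite exprn_ge0// ltW.
  apply: le_trans (ler_wpM2l (hX0 _) (sum_iter_tri R a M n0 i)) _.
  have T0: 0<=4*M%:R^+2 / n%:R :> R by nneg.
  have T1: 0<=2^+m*(4*M%:R^+2 / n%:R) :> R by nneg.
  case: leqP=> i1.
    rewrite ler_wpDr// ler_wpM2r//; case: i i1 im=> [|[|//]] _ im.
      by rewrite subn0; move: m0; case: (m)=>// m' _; rewrite exprS -[X in _<=X]mul1r ler_wpM2r// ltW.
    by rewrite subn1.
  apply: le_trans (_ : 2^+m*(4*M%:R^+2 / n%:R)<=_); last by rewrite ler_wpDl// mulr_ge0.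
  have i20: 0<=2^+i*(4*M%:R^+2 / n%:R) :> R by rewrite mulr_ge0// exprn_ge0.
  rewrite -[X in _<=X]mul1r; apply: ler_pM; rewrite ?hX ?hX0 ?i20//.
  apply: ler_wpM2r=>//.
  by rewrite ler_weXn2l// ler1n.
rewrite -ler_pdivrMl ?exprn_gt0// -exprVn //.
Qed.
End KernelSum.

(** * The smoothed prime number theorem *)

Section SmoothPNT.
Variable R : realType.

Lemma expR_lip (a b c : R) : a<=c -> b<=c -> `|expR a-expR b| <= expR c * `|a-b|.
Proof.
wlog ab : a b / b<=a=> [W ac bc|ac _].
  case/orP: (le_total b a)=> ba; first exact: W.
  by rewrite distrC [X in _*X]distrC; apply: W.
rewrite !ger0_norm ?subr_ge0 ?ler_expR//.
have h: expR a*(1+(b-a))<=expR b.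
  have -> : expR b = expR a * expR (b-a) by rewrite -expRD addrC subrK.
  by rewrite ler_pM2l ?expR_gt0// expR_ge1Dx.
apply: le_trans (_ : expR a*(a-b)<=_); first by move: h; lra.
by rewrite ler_wpM2r ?subr_ge0// ler_expR.
Qed.

Lemma expRN_sq (y : R) : 0<y -> expR (- y)<=2 / y^+2.
Proof.
move=> y0; rewrite expRN -[X in _<=X]invrK lef_pV2 ?posrE ?expR_gt0 ?invr_gt0 ?divr_gt0 ?exprn_gt0//.
apply: le_trans (_ : 1+y^+2/2<=_); last by have := expR_ge1Dxn 1 (ltW y0); rewrite (_ : 2`! = 2)%N.
by rewrite invf_div; lra.
Qed.

(** The series is taken at abscissa [1 + 1/X]; the factor [expR (x/X)] restores the weight [1/k],
    and on the support it is at most [e^2]. *)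
Lemma twist_bounds (X : R) (phi : R -> R) : 1<=X -> (forall x, `|phi x| <= 1) ->
  (forall x y, `|phi x-phi y| <= `|x-y|) -> (forall x, ~~ (X/2<=x<=2*X) -> phi x = 0) ->
  (forall x, `|expR (x/X) * phi x| <= expR 2) /\
  (forall x y, `|expR (x/X) * phi x-expR (y/X) * phi y| <= 2 * expR 2 * `|x-y|).
Proof.
move=> X1 phi1 phiL phi0; have X0 := lt_le_trans ltr01 X1.
set B : R := expR 2; have B0: 0<=B := expR_ge0 _.
have dbl (d : R) : 2*B*d = B*d+B*d by ring.
split=> [x|x y].
  have [xs|/phi0 xs] := boolP (X/2<=x<=2*X); last by rewrite xs mulr0 normr0.
  rewrite normrM (ger0_norm (expR_ge0 _)) -[X in _<=X]mulr1 ler_pM ?expR_ge0// ler_expR ler_pdivrMr//.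
  by case/andP: xs.
have aux u v : u<=2*X -> v<=2*X ->
    `|expR (u/X) * phi u-expR (v/X) * phi v| <= 2*B * `|u-v|.
  move=> u2 v2; have uX: u/X<=2 by rewrite ler_pdivrMr.
  have vX: v/X<=2 by rewrite ler_pdivrMr.
  have -> : expR (u/X) * phi u-expR (v/X) * phi v =
     expR (u/X)*(phi u-phi v)+(expR (u/X)-expR (v/X)) * phi v by ring.
  apply: le_trans (ler_normD _ _) _; rewrite dbl; apply: lerD.
    by rewrite normrM (ger0_norm (expR_ge0 _)) ler_pM ?expR_ge0// ler_expR.
  rewrite normrM -[X in _<=X]mulr1 ler_pM//; apply: le_trans (expR_lip uX vX) _.
  rewrite ler_wpM2l// -mulrBl normrM ler_piMr// ger0_norm ?invr_ge0 ?(ltW X0)//.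
  by rewrite invf_le1.
have z u : 2*X<u -> phi u = 0 by move=> u2; apply: phi0; rewrite negb_and -!ltNge u2 orbT.
have out u v : 2*X<u -> v<=2*X ->
    `|expR (v/X) * phi v-expR (u/X) * phi u| <= 2*B * `|v-u|.
  move=> u2 v2; have u0 := z _ u2; have vX: v/X<=2 by rewrite ler_pdivrMr.
  rewrite u0 mulr0 subr0; apply: le_trans (_ : B * `|v-u| <= _); last by rewrite dbl lerDl mulr_ge0.
  rewrite normrM (ger0_norm (expR_ge0 _)) ler_pM ?expR_ge0// ?ler_expR//.
  by have := phiL v u; rewrite u0 subr0.
case: (leP x (2*X))=> x2; case: (leP y (2*X))=> y2.
- exact: aux.
- exact: out.
- by rewrite distrC (distrC x); exact: out.
- by rewrite !z// !mulr0 subrr normr0 mulr_ge0// mulr_ge0.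
Qed.

Section Tuning.
Variable X : R.
Hypothesis X40 : 40<=X.

(** The step [ph = pM * pth] equals [pi / (2X)], so [ph * x] stays in [[pi/4, pi]] for [x] in
    [[X/2, 2X]] and the phase avoids 1. With [pM] of order [X^2] the period [2 pi / pth] is of order
    [X^3], long enough for [k^(-1/X)] to make everything beyond half a period negligible. *)
Definition pM : nat := (Num.truncn (X^+2)).+1.
Definition pth : R := pi/(2 * pM%:R*X).
Definition ph : R := pM%:R * pth.
(** The height reached in [t] is [pn * pth], of order [X^13], so about [X^16] points are used; with
    20 differences the factor [ph^19] beats this count by [X^-3]. *)
Definition pn : nat := (Num.truncn (X^+13 / pth)).+1.

Lemma pX0 : 0<X. Proof. by apply: lt_le_trans X40; rewrite ltr0n. Qed.
Lemma pX1 : 1<=X. Proof. by move: X40; lra. Qed.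
Lemma pXX : 40<=X^+2. Proof. by rewrite expr2; move: X40; nra. Qed.
Lemma pM_lo : X^+2<=pM%:R. Proof. exact: ltW (truncnS_gt _). Qed.
Lemma pM_hi : pM%:R<=2*X^+2.
Proof.
have : (Num.truncn (X^+2))%:R<=X^+2 by rewrite truncn_le exprn_ge0// ltW// pX0.
have -> : pM%:R=(Num.truncn (X^+2))%:R+1 :> R by rewrite /pM natr1.
by have := pXX; lra.
Qed.
Lemma pM0 : 0<pM%:R :> R. Proof. by rewrite ltr0n. Qed.
Lemma pi4 : pi<=4 :> R. Proof. by have := @pihalf_lt2 R; lra. Qed.
Lemma pMX0 : 0<2 * pM%:R*X. Proof. by rewrite mulr_gt0 ?pX0// mulr_gt0// pM0. Qed.
Lemma pth0 : 0<pth. Proof. by rewrite divr_gt0 ?pi_gt0// pMX0. Qed.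
Lemma pthM : pth*(2 * pM%:R*X) = pi. Proof. by rewrite /pth divfK// gt_eqF// pMX0. Qed.
Lemma pMX_ge : 40<=pM%:R*X.
Proof. by have := pM_lo; have := pXX; move: X40; move: (pM%:R : R) (X^+2)=> a b; nra. Qed.
Lemma pth1 : pth<=1.
Proof.
rewrite ler_pdivrMr ?pMX0// mul1r -mulrA; apply: le_trans pi4 _.
by have := pMX_ge; lra.
Qed.
Lemma phE : ph = pi/(2*X).
Proof. by rewrite /ph /pth; field; rewrite !gt_eqF ?pX0 ?pM0. Qed.
Lemma ph0 : 0<ph. Proof. by rewrite mulr_gt0 ?pM0 ?pth0. Qed.
Lemma phX : ph<=2/X.
Proof.
have x0 := pX0; rewrite phE ler_pdivrMr ?mulr_gt0//.
rewrite (_ : 2/X*(2*X) = 4); first exact: pi4.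
by field; rewrite gt_eqF.
Qed.
Lemma pmh : 20%:R * ph<=1.
Proof.
apply: le_trans (ler_wpM2l (ler0n _ _) phX) _; rewrite mulrA ler_pdivrMr ?pX0// mul1r.
by rewrite -natrM.
Qed.
Lemma ph1 : ph<=1.
Proof. by apply: le_trans pmh; rewrite ler_peMl ?(ltW ph0)// ler1n. Qed.
Lemma pX13 : 40<=X^+13.
Proof. by apply: le_trans X40 _; rewrite -[X in X<=_]expr1 ler_weXn2l// pX1. Qed.
Lemma pn0 : 0<pn%:R :> R. Proof. by rewrite ltr0n. Qed.
Lemma pn_lo : X^+13<=pn%:R * pth.
Proof. by rewrite -ler_pdivrMr ?pth0// ltW// truncnS_gt. Qed.
Lemma pn_hi : pn%:R * pth<=2*X^+13.
Proof.
have -> : pn%:R=(Num.truncn (X^+13 / pth))%:R+1 :> R by rewrite /pn natr1.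
rewrite mulrDl mul1r; have : (Num.truncn (X^+13 / pth))%:R<=X^+13 / pth.
  by rewrite truncn_le divr_ge0 ?(ltW pth0)// exprn_ge0// ltW// pX0.
rewrite ler_pdivlMr ?pth0//; have := pth1; have := pX13.
by move: (X^+13) pth=> a b; lra.
Qed.
Lemma pn_D : (pn%:R+3*(20 * pM)%:R+1) * pth<=3*X^+13.
Proof.
rewrite natrM.
have -> : (pn%:R+3*(20%:R * pM%:R)+1) * pth = pn%:R * pth+3*(20%:R * ph)+pth by rewrite /ph; ring.
have := pmh; have := pn_hi; have := pth1; have := pX13.
by move: (X^+13) pth (20%:R * ph)=> a b c; lra.
Qed.
Lemma pn16 : pn%:R<=4*X^+16.
Proof.
have p0 := @pi_gt0 R; rewrite -(ler_pM2r p0) (_ : pn%:R * pi = pn%:R * pth*(2 * pM%:R*X)); last by rewrite -mulrA pthM.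
apply: le_trans (ler_wpM2r (ltW pMX0) pn_hi) _.
have : pM%:R*X<=2*X^+2*X by rewrite ler_wpM2r ?pM_hi// ltW// pX0.
rewrite (_ : X^+16 = X^+13*(X^+2*X)); last by rewrite -exprSr -exprD.
rewrite (_ : 2*X^+13*(2 * pM%:R*X) = X^+13*(4*(pM%:R*X))); last by ring.
move=> hh; rewrite (_ : 4*(X^+13*(X^+2*X)) * pi = X^+13*(4*(X^+2*X) * pi)); last by ring.
apply: ler_wpM2l; first by rewrite exprn_ge0// ltW// pX0.
have y0: 0<=X^+2*X by rewrite mulr_ge0 ?exprn_ge0 ?(ltW pX0).
have : X^+2*X*2<=X^+2*X * pi by rewrite ler_wpM2l// pi_ge2.
by move: hh; lra.
Qed.
Lemma pn20 : (20 * pM)%:R<=pn%:R :> R.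
Proof.
rewrite natrM.
have h1: 2 * pM%:R*X*X^+13<=pn%:R * pi.
  by rewrite -pthM mulrA [X in _<=X]mulrC ler_pM2l ?pMX0// pn_lo.
have h2: pn%:R * pi<=pn%:R*4 :> R by rewrite ler_wpM2l// pi4.
have h3: 40*40<=X*X^+13 by rewrite ler_pM// pX13.
have h4: 2 * pM%:R*(40*40)<=2 * pM%:R*(X*X^+13) by rewrite ler_wpM2l// mulr_ge0.
by have := pM0; move: h1 h2 h4; lra.
Qed.
Lemma pn13 : X^+13<=pn%:R.
Proof. by apply: le_trans pn_lo _; rewrite -[X in _<=X]mulr1 ler_wpM2l// pth1. Qed.

Lemma pS : ph^+19*(20 * pM+2 * pn)%:R+2^+20*(4 * pM%:R^+2 / pn%:R) <=
  (2^+19*12+2^+20*16)/X^+3.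
Proof.
have x0 := pX0; have X3: 0<X^+3 by rewrite exprn_gt0.
rewrite [X in _<=X]mulrDl; apply: lerD.
  have Q3: (20 * pM+2 * pn)%:R<=12*X^+16.
    have := pn20; have := pn16; rewrite natrD (natrM _ 2 pn).
    by move: ((20 * pM)%:R : R) (pn%:R : R) (X^+16)=> a b c; lra.
  have hm: ph^+19<=(2/X)^+19 by rewrite lerXn2r ?nnegrE ?(ltW ph0) ?phX// divr_ge0 ?(ltW x0).
  apply: le_trans (ler_pM _ _ hm Q3) _; rewrite ?exprn_ge0 ?(ltW ph0)//.
  rewrite exprMn exprVn (_ : X^+19 = X^+16*X^+3); last by rewrite -exprD.
  have X16: 0<X^+16 by rewrite exprn_gt0.
  apply: eq_ler; move: (2^+19) (X^+16) X16 (X^+3) X3=> c a a0 b b0.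
  by field; rewrite !gt_eqF.
rewrite -[X in _<=X]mulrA; apply: ler_wpM2l; first by nneg.
rewrite ler_pdivrMr ?pn0// mulrAC ler_pdivlMr//.
apply: le_trans (_ : 16*X^+13<=_); last by rewrite ler_wpM2l// pn13.
have M2: pM%:R^+2<=(2*X^+2)^+2.
  by rewrite lerXn2r ?nnegrE ?pM_hi// mulr_ge0// exprn_ge0// ltW.
apply: le_trans (_ : 4*(2*X^+2)^+2*X^+3<=_).
  by rewrite ler_wpM2r ?exprn_ge0 ?(ltW x0)// ler_wpM2l.
rewrite (_ : 4*(2*X^+2)^+2*X^+3 = 16*X^+7); last by ring.
by rewrite ler_wpM2l// ler_weXn2l// pX1.
Qed.

(** Smoothing at scale [rho = X^-3] costs [O(X^-3)], which is affordable since the weights add up to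
    [O(X^2)]. *)
Lemma pE (B : R) : 0<=B -> 2*B*(X^+3)^-1+32*B/(pn%:R*(pth*(X^+3)^-1)^+2) <=
  (2*B+128*B)*(X^+3)^-1.
Proof.
move=> B0; have x0 := pX0; have t0 := pth0; set rho := (X^+3)^-1.
have X3: 0<X^+3 by rewrite exprn_gt0.
have rho0: 0<rho by rewrite invr_gt0.
rewrite [X in _<=X]mulrDl lerD2l.
have t2: 2^-1*rho<=pth.
  rewrite /pth ler_pdivlMr ?pMX0//; apply: le_trans (@pi_ge2 R).
  have : pM%:R*X<=2*X^+3 by rewrite exprSr mulrA ler_wpM2r ?pM_hi// ltW.
  rewrite -(ler_pM2l rho0) [rho*(2 * _)]mulrCA [rho*X^+3]mulVf ?gt_eqF// mulr1.
  have gen (a b c : R) : 2^-1*a*(2*b*c) = a*(b*c) by field.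
  by rewrite gen.
have d1: (4*rho)^-1<=pn%:R*(pth*rho)^+2.
  rewrite (_ : pn%:R*(pth*rho)^+2 = pn%:R * pth*(pth*rho^+2)); last by ring.
  apply: le_trans (_ : X^+13*(2^-1*rho*rho^+2)<=_); last first.
    apply: ler_pM; [by nneg|by nneg|exact: pn_lo|].
    by rewrite ler_wpM2r// exprn_ge0// ltW.
  rewrite /rho invfM invrK (_ : X^+13 * _ = 2^-1*X^+4); last by field; rewrite gt_eqF.
  rewrite ler_pM ?exprn_ge0 ?(ltW x0)//; last by rewrite ler_weXn2l// pX1.
  by rewrite lef_pV2 ?posrE// ler_nat.
have r4: 0<(4*rho)^-1 by rewrite invr_gt0 mulr_gt0.
apply: le_trans (_ : 32*B*(4*rho)<=_); last by lra.
rewrite ler_wpM2l ?mulr_ge0// -[X in _<=X]invrK lef_pV2 ?posrE//.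
exact: lt_le_trans d1.
Qed.

(** [Mx] is about [exp] of half the period. Up to it [psis_approx] is available; beyond it [psi]
    vanishes, only the size of [psis] counts, and [Mx^(-1/(2X))] is at most [exp(-X^2/2)]. *)
Lemma p_tail (N : nat) : exists Mx, [/\ (0<Mx)%N,
  forall k, (Mx<k)%N -> 2*X<lnn R k, forall k, (k<=Mx)%N -> (0<k)%N -> lnn R k<=2 * pi / pth/2 &
  \sum_(Mx.+1<=k<N.+1) (1+lnn R k)*k%:R`^(- (1+X^-1))<=32/X^+2].
Proof.
have x0 := pX0; set P := 2 * pi / pth.
have PE: P = 4 * pM%:R*X by rewrite /P -pthM; field; rewrite gt_eqF ?pth0.
have PX: P = 4*(pM%:R*X) by rewrite PE mulrA.
pose Mx := Num.truncn (expR (P/2)).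
have Mx_gt: expR (P/2)<Mx.+1%:R := truncnS_gt _.
have P8: 8<=P by rewrite PX; have := pMX_ge; lra.
have eP: 2<=expR (P/4) by apply: le_trans (expR_ge1Dx _); move: P8; lra.
have MxP: expR (P/4)<=Mx%:R.
  have : expR (P/2) = expR (P/4) * expR (P/4) by rewrite -expRD; congr expR; field.
  move: Mx_gt; rewrite -[Mx.+1%:R]natr1; move: eP; clear; move: (expR (P/4)) (expR (P/2)) (Mx%:R : R)=> x y z h2 h3 h4; nra.
have Mx0: (0<Mx)%N by rewrite -(ltr0n R) (lt_le_trans (expR_gt0 _) MxP).
exists Mx; split=>// [k kM|k kM k0|].
- have : P/2<lnn R k.
    rewrite -ltr_expR /lnn lnK ?posrE ?ltr0n ?(leq_ltn_trans _ kM)//; apply: lt_le_trans Mx_gt _.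
    by rewrite ler_nat.
  have : X<=pM%:R*X by rewrite ler_peMl ?(ltW x0)// ler1n.
  by rewrite PX; move: x0; lra.
- rewrite -ler_expR /lnn lnK ?posrE ?ltr0n//.
  have : Mx%:R<=expR (P/2) by rewrite truncn_le expR_ge0.
  by apply: le_trans; rewrite ler_nat.
have de0: 0<X^-1 by rewrite invr_gt0.
have de1: X^-1<=1 by rewrite invf_le1// pX1.
have MP: Mx%:R`^(- (X^-1/2))<=8/X^+4.
  apply: le_trans (_ : expR (- (X^+2/2))<=_); last first.
    apply: le_trans (expRN_sq _) _; first by rewrite divr_gt0// exprn_gt0.
    by apply: eq_ler; field; rewrite gt_eqF.
  rewrite powR_expR// ler_expR mulNr lerN2.
  have lM: P/4<=lnn R Mx by rewrite -ler_expR /lnn lnK// posrE ltr0n.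
  have : X^-1/2*(P/4)<=X^-1/2 * lnn R Mx by rewrite ler_wpM2l// divr_ge0// ltW.
  apply: le_trans; rewrite PX (_ : X^-1/2*(4*(pM%:R*X)/4) = pM%:R/2); last by field; rewrite gt_eqF.
  by rewrite ler_pM2r ?pM_lo// invr_gt0.
apply: le_trans (sum_far N de0 de1 Mx0) _; apply: le_trans (ler_wpM2l _ MP) _; first by rewrite exprn_ge0// divr_ge0// ltW.
by rewrite invrK; apply: eq_ler; field; rewrite gt_eqF.
Qed.
End Tuning.

(** In the variable [x = ln k] the trivial bound would be of order [X]. The powers of the logarithm
    in [G_bound] at height [3 X^13] cost at most a constant times [X], by [ln_pow_le] with exponent
    1/13, and the saving [X^-3] of [pS] covers this. *)
Lemma PNT_smooth : exists C X0 : R, [/\ 0<=C, 1<=X0 & forall X (phi : R -> R), X0<=X ->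
  (forall x, `|phi x| <= 1) -> (forall x y, `|phi x-phi y| <= `|x-y|) ->
  (forall x, ~~ (X/2<=x<=2*X) -> phi x = 0) ->
  exists N1, forall N, (N1<=N)%N ->
   `|\sum_(1<=k<N.+1) (mangoldt R k - 1) / k%:R * phi (lnn R k)| <= C/X].
Proof.
have [C0 [K [de1 [C00 de10 de11 HG]]]] := @G_bound R 20.
have e13: 0<13^-1 :> R by rewrite invr_gt0.
have [C1 C11 HC1] := ln_pow_le K e13.
have C10 := le_trans ler01 C11.
pose Y : R := 2^+19*12+2^+20*16.
have Y0: 0<=Y by rewrite /Y; nneg.
pose B : R := expR 2; have B0: 0<B := expR_gt0 _.
pose W0 : R := 4^+20*(2^+20*(C0*(C1*3)*Y)).
have W00: 0<=W0 by rewrite /W0; nneg.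
exists (B*W0+(8*(2*B+128*B)+32*B)), (Num.max 40 de1^-1); split.
- by nneg.
- by rewrite le_max (ler_nat _ 1 40).
move=> X phi; rewrite ge_max=> /andP[X40 Xde] phi1 phiL phi0.
have X0 := pX0 X40; have X1 := pX1 X40.
pose de := X^-1; have de0: 0<de by rewrite invr_gt0.
have dede1: de<=de1 by rewrite -[X in _<=X]invrK lef_pV2 ?posrE ?invr_gt0.
have de_1: de<=1 := le_trans dede1 de11.
pose D := 3*X^+13.
have D3: 3<=D by rewrite /D; have := pX13 X40; lra.
have h0 := ph0 X40; have th0 := pth0 X40.
have [N0 HN0] := HG (ph X) de D h0 (pmh X40) de0 dede1 D3.
pose A := C0*(1+ln D)^+K.
have A0: 0<=A.
  by rewrite /A mulr_ge0// exprn_ge0// addr_ge0// ln_ge0// (le_trans _ D3)// ler1n.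
have AX: A<=C0*(C1*3)*X.
  have X130: 0<=X^+13 by rewrite exprn_ge0// ltW.
  rewrite /A -!mulrA ler_wpM2l//; apply: le_trans (HC1 D _) _; first by rewrite (le_trans _ D3)// ler1n.
  rewrite ler_wpM2l// /D powRM// -powR_mulrn ?(ltW X0)// -powRrM divff ?pnatr_eq0// powRr1 ?(ltW X0)//.
  rewrite ler_wpM2r ?(ltW X0)// -[X in _<=X]powRr1// ler_powR ?ler1n// invf_le1 ?ltr0n// ler1n//.
exists N0=> N NN.
have HB := HN0 N NN; rewrite -/A in HB.
have [Mx [Mx_gt0 tail_gt tail_le tail_sum]] := p_tail X40 N.
pose psi x := expR (x/X) * phi x.
have [psiB psiL] := twist_bounds X1 phi1 phiL phi0.
have psi0 x : ~~ (X/2<=x<=2*X) -> psi x = 0 by move=> /phi0; rewrite /psi=> ->; rewrite mulr0.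
have sumE: \sum_(1<=k<N.+1) (mangoldt R k - 1) / k%:R * phi (lnn R k) =
    \sum_(1<=k<N.+1) cc de k * psi (lnn R k).
  apply: eq_big_nat=> k /andP[k0 _]; rewrite /cc /psi -!mulrA; congr (_ * _); rewrite mulrA; congr (_ * _).
  rewrite powR_expR// -expRD (_ : - (1+de) * lnn R k+lnn R k/X = - lnn R k); last by rewrite /de; ring.
  by rewrite expRN /lnn lnK// posrE ltr0n.
have n0: (0<pn X)%N by []; have n0' := pn0 X.
rewrite sumE; pose ps := psis (pn X) (pth X) psi.
have -> : \sum_(1<=k<N.+1) cc de k * psi (lnn R k) =
   \sum_(1<=k<N.+1) cc de k * ps (lnn R k) + \sum_(1<=k<N.+1) cc de k*(psi (lnn R k)-ps (lnn R k)).
  by rewrite -big_split/=; apply: eq_bigr=> k _; rewrite -mulrDr addrC subrK.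
apply: le_trans (ler_normD _ _) _; rewrite [X in _<=X]mulrDl; apply: lerD.
  have -> : \sum_(1<=k<N.+1) cc de k * ps (lnn R k)=(pn X)%:R^-1 * \sum_(i<pn X) psi (xg (pn X) (pth X) i) *
     \sum_(1<=k<N.+1) cc de k*Kn (pn X) (pth X*(lnn R k-xg (pn X) (pth X) i)).
    rewrite /ps /psis; under eq_bigr do rewrite mulrCA; rewrite -big_distrr/=; congr (_ * _).
    under eq_bigr do rewrite big_distrr/=; rewrite exchange_big/=; apply: eq_bigr=> i _.
    by rewrite big_distrr/=; apply: eq_bigr=> k _; rewrite mulrCA.
  rewrite normrM ger0_norm ?invr_ge0 ?(ltW n0')// ler_pdivrMl//.
  apply: le_trans (ler_norm_sum _ _ _) _.
  apply: le_trans (_ : \sum_(i<pn X) B*W0/X<=_); last first.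
    by rewrite sumr_const card_ord -[_ *+ _]mulr_natl.
  apply: ler_sum=> i _; rewrite normrM.
  have [xs|/psi0 ->] := boolP (X/2<=xg (pn X) (pth X) i<=2*X); last first.
    by rewrite normr0 mul0r; nneg.
  rewrite -mulrA; apply: ler_pM=>//; first exact: psiB.
  have hx: 4^-1<=nrm (1-cis (ph X*xg (pn X) (pth X) i)).
    have z2: 0<2^-1 :> R by rewrite invr_gt0.
    have := @nrm1cis_lower R 2^-1 (ph X*xg (pn X) (pth X) i) z2 (lexx _).
    rewrite (_ : 2^-1/2 = 4^-1 :> R); last by field.
    apply; case/andP: xs=> x1 x2.
    have := ler_wpM2l (ltW h0) x1; have := ler_wpM2l (ltW h0) x2.
    have : ph X*X = pi/2 by rewrite phE//; field; rewrite gt_eqF.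
    have := @pi_ge2 R; clear; move: (ph X) (xg _ _ _)=> a b.
    by move=> h1 h2 h3 h4; apply/andP; split; lra.
  apply: le_trans (@kernel_sum_bound R (pn X) (pM X) 20 (pth X) de N n0 (ltn0Sn _) th0 A D _ A0 HB (pn_D X40) (ph1 X40) hx isT) _.
  have gen (a b c : R) : a*(b*c)/X = a*(b*(c/X)) by rewrite !mulrA.
  rewrite /W0 gen; do 2 (apply: ler_wpM2l; first by nneg).
  have S0: 0<=ph X^+19*(20 * pM X+2 * pn X)%:R+2^+20*(4*(pM X)%:R^+2/(pn X)%:R) by nneg.
  apply: le_trans (ler_pM A0 S0 AX (pS X40)) _; rewrite -/Y.
  have -> : C0*(C1*3)*X*(Y/X^+3) = C0*(C1*3)*Y*(X^+2)^-1.
    by move: (Y)=> Z; field; rewrite gt_eqF.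
  apply: ler_wpM2l; first by nneg.
  by rewrite lef_pV2 ?posrE ?exprn_gt0// expr2 ler_peMr// ltW.
apply: le_trans (ler_norm_sum _ _ _) _.
pose rho := (X^+3)^-1; have rho0: 0<rho by rewrite invr_gt0 exprn_gt0.
have rho1: rho<=2^-1.
  rewrite lef_pV2 ?posrE ?exprn_gt0//; apply: le_trans (_ : X^+1<=_); last by rewrite ler_weXn2l.
  by rewrite expr1 (le_trans _ X40)// ler_nat.
have EX := pE X40 (ltW B0); rewrite -/rho in EX.
set E := _ + _ in EX.
have E0: 0<=E by rewrite /E; nneg.
apply: le_trans (_ : \sum_(1<=k<N.+1) ((1+lnn R k)*k%:R`^(- (1+de))*E +
   (if (Mx<k)%N then (1+lnn R k)*k%:R`^(- (1+de))*B else 0))<=_).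
  apply: ler_sum_nat=> k /andP[k0 kN]; rewrite normrM.
  have w0: 0<=(1+lnn R k)*k%:R`^(- (1+de)) by rewrite mulr_ge0 ?powR_ge0// addr_ge0// lnn_ge0.
  case: ltnP=> kM.
    rewrite -mulrDr; apply: ler_pM=>//; first exact: norm_cc.
    have lk := tail_gt _ kM.
    rewrite psi0; last by rewrite negb_and -!ltNge lk orbT.
    by rewrite sub0r normrN ler_wpDl//; apply: (psis_le n0 th0 psiB).
  rewrite addr0; apply: ler_pM=>//; first exact: norm_cc.
  have thr: pth X*rho<=2^-1.
    by rewrite -[X in _<=X]mul1r ler_pM ?(ltW th0) ?(ltW rho0)// pth1.
  have ra: rho<X/2 by move: rho1 X40; clear; lra.
  have bP: 2*X<2 * pi / pth X-rho.
    have -> : 2 * pi / pth X = 4*((pM X)%:R*X) by rewrite -(pthM X40); field; rewrite gt_eqF.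
    have : X<=(pM X)%:R*X by rewrite ler_peMl ?(ltW X0)// ler1n.
    by move: rho1 X40; clear; lra.
  apply: (@psis_approx R (pn X) n0 (pth X) psi B (2*B) rho (X/2) (2*X) th0 psiB psiL psi0 rho0 thr ra bP).
    exact: lnn_ge0.
  exact: tail_le.
have [MN|MN] := leqP Mx N; last first.
  rewrite (eq_big_nat _ _ (F2 := fun k=> (1+lnn R k)*k%:R`^(- (1+de))*E)); last first.
    by move=> k /andP[_ kN]; rewrite ltnNge (leq_trans _ (ltnW MN)) ?addr0.
  rewrite -big_distrl/= mulrDl; apply: le_trans (_ : 8*X^+2*((2*B+128*B)*rho)<=_).
    apply: ler_pM=>//.
      by apply: sumr_ge0=> k _; rewrite mulr_ge0 ?powR_ge0// addr_ge0// lnn_ge0.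
    by apply: le_trans (sum_all N de0 de_1) _; rewrite /de invrK; lra.
  rewrite (_ : 8*X^+2 * _ = 8*(2*B+128*B)/X); last by rewrite /rho; field; rewrite gt_eqF.
  by rewrite lerDl; nneg.
rewrite big_split/= -big_distrl/= [X in _+X<=_](@big_cat_nat _ _ _ Mx.+1 1 N.+1)//= ?ltnS//.
rewrite [X in _+(X + _)]big_nat_cond [X in _+(X + _)]big1 ?add0r; last first.
  by move=> k /andP[/andP[_ kM] _]; rewrite ltnNge -ltnS kM.
rewrite (_ : \sum_(Mx.+1<=k<N.+1) _=(\sum_(Mx.+1<=k<N.+1) (1+lnn R k)*k%:R`^(- (1+de)))*B); last first.
  by rewrite big_distrl/=; apply: eq_big_nat=> k /andP[kM _]; rewrite kM.
have -> : (8*(2*B+128*B)+32*B)/X=(8*X^+2)*((2*B+128*B)*rho)+32*B/X.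
  by rewrite /rho; field; rewrite gt_eqF.
apply: lerD.
  apply: ler_pM=>//.
    by apply: sumr_ge0=> k _; rewrite mulr_ge0 ?powR_ge0// addr_ge0// lnn_ge0.
  by apply: le_trans (sum_all N de0 de_1) _; rewrite /de invrK; lra.
apply: le_trans (_ : 32/X^+2*B<=_); first by rewrite ler_wpM2r// ltW.
rewrite mulrAC; apply: ler_wpM2l; first by nneg.
by rewrite lef_pV2 ?posrE ?exprn_gt0// expr2 ler_peMr// ltW.
Qed.
End SmoothPNT.

(** * The derivative of log I_0 *)

Section BesselDerivative.
Variable R : realType.
Implicit Types (x u v : R).

(* I_0(u) = J(u^2/4) *)
Definition Jc (n : nat) : R := (n`!%:R^+2)^-1.
Definition Jf x : R := limn (pseries Jc x).
Definition Jd x : R := limn (pseries (pseries_diffs Jc) x).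

Lemma bessel_J u : besselI0 u = Jf (u^+2/4).
Proof.
rewrite /besselI0 /Jf /pseries; congr (limn (series _)); apply/funext=> n /=.
rewrite exprM expr_div_n mulrC (_ : 2^+2 = 4 :> R)//; ring.
Qed.

Lemma fact_neq0 n : n`!%:R != 0 :> R. Proof. by rewrite pnatr_eq0 -lt0n fact_gt0. Qed.

Lemma Jd_coef n : pseries_diffs Jc n=(n`!%:R*n.+1`!%:R)^-1.
Proof.
rewrite /pseries_diffs /Jc factS natrM; have := fact_neq0 n; have : n.+1%:R != 0 :> R by rewrite pnatr_eq0.
by move: (n.+1%:R) (n`!%:R)=> a b a0 b0; field; rewrite a0 b0.
Qed.

Lemma factV_le1 n : (n`!%:R)^-1<=1 :> R.
Proof. by rewrite invf_le1 ?ltr0n ?fact_gt0// ler1n fact_gt0. Qed.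

Lemma factV_ge0 n : 0<=(n`!%:R)^-1 :> R. Proof. by rewrite invr_ge0. Qed.

Lemma cvg_pseries_le (c : nat -> R) K : 0<=K -> (forall n, 0<=c n<=(n`!%:R)^-1) -> cvgn (pseries c K).
Proof.
move=> K0 cb; apply: (@series_le_cvg _ _ (exp_coeff K)).
- by move=> n; rewrite /= mulr_ge0 ?exprn_ge0//; case/andP: (cb n).
- by move=> n; rewrite exp_coeff_ge0.
- by move=> n; rewrite /exp_coeff/= mulrC ler_wpM2l ?exprn_ge0//; case/andP: (cb n).
exact: is_cvg_series_exp_coeff.
Qed.

Lemma Jc_bound n : 0<=Jc n<=(n`!%:R)^-1.
Proof.
rewrite /Jc expr2 invfM mulr_ge0 ?factV_ge0//= -[X in _<=X]mulr1 ler_wpM2l ?factV_ge0//.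
exact: factV_le1.
Qed.

Lemma Jd_bound n : 0<=pseries_diffs Jc n<=Jc n.
Proof.
rewrite Jd_coef /Jc expr2 !invfM mulr_ge0 ?factV_ge0//= ler_wpM2l ?factV_ge0//.
by rewrite lef_pV2 ?posrE ?ltr0n ?fact_gt0// ler_nat factS leq_pmull.
Qed.

Lemma Jdd_bound n : 0<=pseries_diffs (pseries_diffs Jc) n<=(n`!%:R)^-1.
Proof.
rewrite /pseries_diffs -/(pseries_diffs Jc n.+1) Jd_coef.
have -> : n.+1%:R*(n.+1`!%:R*n.+2`!%:R)^-1=(n`!%:R)^-1*(n.+2`!%:R)^-1 :> R.
  rewrite [n.+1`!]factS natrM; have := fact_neq0 n; have := fact_neq0 n.+2; have : n.+1%:R != 0 :> R by rewrite pnatr_eq0.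
  by move: (n.+1%:R) (n`!%:R) (n.+2`!%:R)=> a b c a0 c0 b0; field; rewrite a0 b0 c0.
rewrite mulr_ge0 ?factV_ge0//= -[X in _<=X]mulr1 ler_wpM2l ?factV_ge0//.
exact: factV_le1.
Qed.

Lemma Jc_cvg x : 0<=x -> cvgn (pseries Jc x).
Proof. by move=> x0; apply: cvg_pseries_le=>// n; exact: Jc_bound. Qed.

Lemma Jd_cvg x : 0<=x -> cvgn (pseries (pseries_diffs Jc) x).
Proof.
move=> x0; apply: cvg_pseries_le=>// n; have /andP[a b] := Jd_bound n; have /andP[_ d] := Jc_bound n.
by rewrite a (le_trans b d).
Qed.

Lemma is_derive_J x : is_derive x (1 : R) Jf (Jd x).
Proof.
have K0: 0<=`|x| + 1 by rewrite addr_ge0.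
apply: (@pseries_snd_diffs _ Jc (`|x| + 1)).
- exact: Jc_cvg.
- exact: Jd_cvg.
- by apply: cvg_pseries_le=>// n; exact: Jdd_bound.
by rewrite (ger0_norm K0) ltrDl.
Qed.

Lemma Jd_ge0 x : 0<=x -> 0<=Jd x.
Proof.
move=> x0; apply: limr_ge; first exact: Jd_cvg.
by apply: nearW=> n; apply: sumr_ge0=> i _; rewrite mulr_ge0 ?exprn_ge0//; case/andP: (Jd_bound i).
Qed.

Lemma J_ge_partial x n : 0<=x -> \sum_(0<=i<n) Jc i*x^+i<=Jf x.
Proof.
move=> x0; apply: (@nondecreasing_cvgn_le _ (pseries Jc x)); last exact: Jc_cvg.
by apply: nondecreasing_series=> i _ _; rewrite /= mulr_ge0 ?exprn_ge0//; case/andP: (Jc_bound i).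
Qed.

Lemma Jd_le x : 0<=x -> Jd x<=Jf x.
Proof.
move=> x0; apply: limr_le; first exact: Jd_cvg.
apply: nearW=> n; apply: le_trans (J_ge_partial n x0); apply: ler_sum=> i _.
by rewrite ler_wpM2r ?exprn_ge0//; case/andP: (Jd_bound i).
Qed.

(* The n-th term s^(2n+1)/(n!(n+1)!) is at most the mean of two consecutive terms of J(s^2). *)
Lemma Jd_le_sqrt (s : R) : 0<=s -> s*Jd (s^+2)<=Jf (s^+2).
Proof.
move=> s0; have x0: 0<=s^+2 by rewrite exprn_ge0.
have [->|sn0] := eqVneq s 0.
  by rewrite mul0r; apply: le_trans (Jd_ge0 _) (Jd_le _); rewrite exprn_ge0.
have sp: 0<s by rewrite lt_def sn0.
rewrite mulrC -ler_pdivlMr//; apply: limr_le; first exact: Jd_cvg.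
apply: nearW=> n; rewrite ler_pdivlMr// /series/= mulr_suml.
apply: le_trans (_ : \sum_(0<=i<n) (2^-1*(Jc i*(s^+2)^+i)+2^-1*(Jc i.+1*(s^+2)^+i.+1))<=_).
  apply: ler_sum=> i _; rewrite /= Jd_coef /Jc -!exprM.
  rewrite (_ : (s^+(2 * i))=(s^+i)^+2); last by rewrite -exprM mulnC.
  rewrite (_ : (s^+(2 * i.+1))=(s^+i*s)^+2); last by rewrite -exprSr -exprM mulnC.
  rewrite invfM -!exprVn; move: ((i`!%:R)^-1) ((i.+1`!%:R)^-1) (s^+i)=> p q e.
  have := sqr_ge0 (p * e-q*(e*s)).
  rewrite (_ : (p * e-q*(e*s))^+2 = p^+2 * e^+2+q^+2*(e*s)^+2 - 2*(p*q * e^+2*s)); last by ring.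
  by lra.
rewrite big_split/= -!big_distrr/=.
have h1 := J_ge_partial n x0; have := J_ge_partial n.+1 x0; rewrite big_nat_recl//= => h2.
have : 0<=Jc 0*(s^+2)^+0 by rewrite mulr_ge0 ?exprn_ge0//; case/andP: (Jc_bound 0).
by move: h1 h2; lra.
Qed.

Lemma J_ge1 x : 0<=x -> 1<=Jf x.
Proof.
by move=> x0; have := J_ge_partial 1 x0; rewrite big_nat1 expr0 mulr1 /Jc fact0 expr1n invr1.
Qed.

Lemma lb_J u : lb u = ln (Jf (u^+2/4)). Proof. by rewrite /lb bessel_J. Qed.

Lemma is_derive_lnJ x : 0<=x -> is_derive x (1 : R) (fun y=> ln (Jf y)) ((Jf x)^-1*Jd x).
Proof.
move=> x0; have J0 := lt_le_trans ltr01 (J_ge1 x0).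
exact: (@is_derive1_comp _ (@ln R) Jf x _ _ (is_derive1_ln J0) (is_derive_J x)).
Qed.

Lemma is_derive_lb u : exists d, is_derive u (1 : R) (@lb R) d.
Proof.
have x0: 0<=u^+2/4 by rewrite divr_ge0 ?sqr_ge0.
have d2: is_derive u (1 : R) (fun y : R=> y^+2/4) ((1*u+u*1)*4^-1+u^+2*0).
  have h := is_derive_mul (is_derive_id u (1 : R)) (is_derive_id u (1 : R)).
  have k := is_derive_mul h (is_derive_cst (4^-1 : R) u (1 : R)).
  by apply: (is_derive_eq k); rewrite /cst expr2.
have := @is_derive1_comp _ (fun y=> ln (Jf y)) (fun y : R=> y^+2/4) u _ _ (is_derive_lnJ x0) d2=> h.
eexists; rewrite (_ : @lb R=(fun y=> ln (Jf y)) \o (fun y : R=> y^+2/4)); first exact: h.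
by apply/funext=> y; rewrite lb_J.
Qed.

Lemma continuous_lb : continuous (@lb R).
Proof.
move=> u; have [d dlb] := is_derive_lb u.
by apply/differentiable_continuous/derivable1_diffP; exact: (@ex_derive _ _ _ _ _ _ _ dlb).
Qed.

Variable sigma : R.
Hypotheses (hs1 : 2^-1<sigma) (hs2 : sigma<1).

(** The profile of [lb (k n^-sigma)] in logarithmic scale: with [k = y^sigma], the product
    [n lb (k n^-sigma)] equals [y wl (ln n - ln y)]. *)
Definition wl v : R := expR v * lb (expR (- (sigma * v))).

(** The square wins for [v >= 0] because [2 sigma > 1], the first power for [v < 0] because
    [sigma < 1]. *)
Lemma exp_min v : expR v*Num.min (expR (- (sigma * v))) (expR (- (sigma * v))^+2)<=1.
Proof.
case: (leP 0 v)=> v0.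
  apply: le_trans (_ : expR v * expR (- (sigma * v))^+2<=_).
    by rewrite ler_wpM2l ?expR_ge0// ge_min lexx orbT.
  rewrite -expRM_natl -expRD -[X in _<=X]expR0 ler_expR.
  have : 0<=(2*sigma - 1) * v by rewrite mulr_ge0//; move: hs1; lra.
  by lra.
apply: le_trans (_ : expR v * expR (- (sigma * v))<=_).
  by rewrite ler_wpM2l ?expR_ge0// ge_min lexx.
rewrite -expRD -[X in _<=X]expR0 ler_expR.
have : 0<=(1-sigma)*(- v) by rewrite mulr_ge0//; move: hs2 v0; lra.
by lra.
Qed.

Lemma wl_ge0 v : 0<=wl v. Proof. by rewrite mulr_ge0 ?expR_ge0 ?lb_ge0. Qed.

Lemma wl_le1 v : wl v<=1.
Proof.
apply: le_trans (exp_min v); rewrite ler_wpM2l ?expR_ge0// le_min lb_le ?expR_ge0//=.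
apply: le_trans (lb_lesq _) _; have := sqr_ge0 (expR (- (sigma * v))); lra.
Qed.

(** The derivative is [e^v] times the difference of two terms lying between 0 and the smaller of [u]
    and [u^2], where [u = e^(- sigma v)]. For the second term this uses [Jd_le] and [Jd_le_sqrt];
    then [exp_min] applies. *)
Lemma wl_lip v v' : `|wl v-wl v'| <= 2 * `|v-v'|.
Proof.
pose x (v : R) : R := expR (- (sigma * v))^+2/4.
have wlE y : wl y = expR y * ln (Jf (x y)) by rewrite /wl lb_J.
have dx y : is_derive y (1 : R) x (- (2*sigma)*x y).
  have l: is_derive y (1 : R) (fun y : R=> - (2*sigma)*y) (- (2*sigma)).
    have := is_derive_mul (is_derive_cst (- (2*sigma)) y (1 : R)) (is_derive_id y (1 : R))=> h.
    by apply: (is_derive_eq h); rewrite /cst; ring.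
  have e := @is_derive1_comp _ expR (fun y : R=> - (2*sigma)*y) y _ _ (is_derive_expR _) l.
  have := is_derive_mul e (is_derive_cst (4^-1 : R) y (1 : R))=> h.
  rewrite (_ : x = fun y : R=> (expR \o (fun y : R=> - (2*sigma)*y)) y*4^-1); last first.
    by apply/funext=> t; rewrite /x /= -expRM_natl; congr (expR _ * _); ring.
  by apply: (is_derive_eq h); rewrite /cst /=; ring.
have x0 y : 0<=x y by rewrite divr_ge0 ?sqr_ge0.
pose d y := expR y * ln (Jf (x y))+expR y*((Jf (x y))^-1*Jd (x y)*(- (2*sigma)*x y)).
have dw y : is_derive y (1 : R) wl (d y).
  have h := @is_derive1_comp _ (fun y=> ln (Jf y)) x y _ _ (is_derive_lnJ (x0 y)) (dx y).
  have := is_derive_mul (is_derive_expR y) h=> k.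
  rewrite (_ : wl = fun y=> expR y*((fun y=> ln (Jf y)) \o x) y); last by apply/funext=> t; rewrite wlE.
  exact: k.
have db y : `|d y| <= 2.
  have J1 := J_ge1 (x0 y); have J0 := lt_le_trans ltr01 J1.
  set u := expR (- (sigma*y)); have u0: 0<=u := expR_ge0 _.
  have xE: x y=(u/2)^+2 by rewrite /x -/u expr_div_n (_ : 2^+2 = 4 :> R)//; ring.
  have r0 := Jd_ge0 (x0 y); have r1 := Jd_le (x0 y).
  have r2: u/2*Jd (x y)<=Jf (x y) by rewrite xE; apply: Jd_le_sqrt; rewrite divr_ge0.
  have sg0: 0<=sigma by move: hs1; lra.
  have xy0 := x0 y.
  pose q := (Jf (x y))^-1*Jd (x y).
  have q0: 0<=q by rewrite mulr_ge0 ?invr_ge0 ?(ltW J0).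
  have q1: q<=1 by rewrite /q mulrC ler_pdivrMr// mul1r.
  have q2: u/2*q<=1 by rewrite /q mulrCA mulrC ler_pdivrMr// mul1r.
  have k1: q*(2*sigma*x y)<=u^+2.
    have : q*(2*sigma*x y)<=1*(2*1*x y).
      apply: ler_pM; [by nneg|by nneg|exact: q1|].
      by rewrite ler_wpM2r// ler_wpM2l// ltW.
    by rewrite xE expr_div_n (_ : 2^+2 = 4 :> R); [have := sqr_ge0 u; lra|ring].
  have k2: q*(2*sigma*x y)<=u.
    rewrite xE (_ : q*(2*sigma*(u/2)^+2)=(u/2*q)*(sigma*u)); last by field.
    rewrite -[X in _<=X]mul1r; apply: ler_pM; [by nneg|by nneg|exact: q2|].
    by rewrite -[X in _<=X]mul1r ler_wpM2r// ltW.
  have l1: lb u<=u := lb_le u0.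
  have l2: lb u<=u^+2 by apply: le_trans (lb_lesq _) _; have := sqr_ge0 u; lra.
  have l0 := lb_ge0 u.
  have dE: d y = expR y*(lb u-q*(2*sigma*x y)).
    by rewrite /d lb_J -/(x y) /q; ring.
  have k0: 0<=q*(2*sigma*x y) by nneg.
  rewrite dE normrM (ger0_norm (expR_ge0 _)).
  have m: `|lb u-q*(2*sigma*x y)| <= Num.min u (u^+2).
    by rewrite le_min !ler_norml; apply/andP; split; apply/andP; split; move: k0 k1 k2 l0 l1 l2; lra.
  apply: le_trans (ler_wpM2l (expR_ge0 _) m) _.
  by apply: le_trans (exp_min y) _; lra.
wlog vv : v v' / v'<=v=> [W|].
  case/orP: (le_total v v')=> h; last exact: W.
  by rewrite distrC (distrC v); exact: W.
have := @cmean _ (fun y=> (wl y)%:C) (fun y=> (d y)%:C) v' v 2 vv (fun y _=> cderiv_real (dw y)).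
have Hd y : v'<=y<=v -> nrm (d y)%:C<=2 by move=> _; rewrite nrmC.
have E: nrm ((wl v)%:C-(wl v')%:C) = `|wl v-wl v'| by rewrite -nrmC rmorphB.
have vv0: 0<=v-v' by rewrite subr_ge0.
by move=> /(_ Hd); rewrite E (ger0_norm vv0).
Qed.
End BesselDerivative.

(** * The integral G_1 compared with sums *)

Section BesselIntegral.
Variables (R : realType) (sigma : R).
Hypotheses (hs1 : 2^-1<sigma) (hs2 : sigma<1).
Let mu := @lebesgue_measure R.
Let s0 : 0<sigma. Proof. by move: hs1; lra. Qed.
Let a := sigma^-1.
Let a0 : 0<a. Proof. by rewrite invr_gt0. Qed.
Implicit Types (b c d u k : R).

Definition gi u : R := lb u*u`^(-1-sigma^-1).

Lemma gi_ge0 u : 0<=gi u. Proof. by rewrite mulr_ge0 ?lb_ge0 ?powR_ge0. Qed.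

Lemma measurable_gi (D : set R) : measurable_fun D (fun u=> (gi u)%:E).
Proof.
apply/measurable_EFinP; apply: (@measurable_funS _ _ _ _ setT)=>//.
apply: measurable_funM; last exact: measurable_powR.
exact: continuous_measurable_fun (@continuous_lb R).
Qed.

Definition Gab b c : \bar R := (\int[mu]_(u in `[b, c]) (gi u)%:E)%E.

Lemma int_pow b c : 0<b -> b<c ->
  (\int[mu]_(u in `[b, c]) (u`^(-1-a))%:E=(sigma*(b`^(- a)-c`^(- a)))%:E)%E.
Proof.
move=> b0 bc; pose F (u : R) := - sigma*u`^(- a).
have dF u : 0<u -> is_derive u (1 : R) F (u`^(-1-a)).
  move=> u0; have := is_derive_mul (is_derive_cst (- sigma) u (1 : R)) (is_derive1_powR (- a) u0)=> h.
  apply: (is_derive_eq h); rewrite /cst mul0r add0r [- a - 1]addrC mulrA mulrNN /a divff ?mul1r// gt_eqF//.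
have cF u : 0<u -> {for u, continuous F}.
  by move=> u0; apply/differentiable_continuous/derivable1_diffP; exact: (@ex_derive _ _ _ _ _ _ _ (dF u u0)).
have pos u : b<=u -> 0<u by move=> bu; exact: lt_le_trans bu.
rewrite (@continuous_FTC2 _ (fun u=> u`^(-1-a)) F _ _ bc).
- by rewrite /F -EFinB; congr (_%:E); ring.
- apply: derivable_within_continuous=> u; rewrite in_itv/= => /andP[bu _].
  by apply: derivable_powR; rewrite in_itv/= andbT pos.
- split.
  + by move=> u; rewrite in_itv/= => /andP[bu _]; exact: (@ex_derive _ _ _ _ _ _ _ (dF u (pos _ (ltW bu)))).
  + exact/cvg_at_right_filter/cF.
  + by apply/cvg_at_left_filter/cF; apply: pos; exact: ltW.
- move=> u; rewrite in_itv/= => /andP[bu _]; rewrite derive1E.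
  by have := dF u (pos _ (ltW bu))=> -[].
Qed.

Lemma Gab_le b c : 0<b -> b<c -> (Gab b c<=(lb c*(sigma*(b`^(- a)-c`^(- a))))%:E)%E.
Proof.
move=> b0 bc; rewrite EFinM -(int_pow b0 bc) -ge0_integralZl_EFin; last 4 first.
- exact: measurable_itv.
- by move=> u _; rewrite lee_fin powR_ge0.
- by apply/measurable_EFinP; apply: (@measurable_funS _ _ _ _ setT)=>//; exact: measurable_powR.
- exact: lb_ge0.
apply: ge0_le_integral=>//.
- by move=> u _; rewrite lee_fin gi_ge0.
- exact: measurable_gi.
- apply: measurable_funeM; apply/measurable_EFinP.
  by apply: (@measurable_funS _ _ _ _ setT)=>//; exact: measurable_powR.
- move=> u; rewrite /= in_itv/= => /andP[bu uc]; rewrite -EFinM lee_fin ler_wpM2r ?powR_ge0//.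
  by apply: lb_mono=>//; rewrite (le_trans (ltW b0)).
Qed.

Lemma Gab_ge b c : 0<b -> b<c -> ((lb b*(sigma*(b`^(- a)-c`^(- a))))%:E<=Gab b c)%E.
Proof.
move=> b0 bc; rewrite EFinM -(int_pow b0 bc) -ge0_integralZl_EFin; last 4 first.
- exact: measurable_itv.
- by move=> u _; rewrite lee_fin powR_ge0.
- by apply/measurable_EFinP; apply: (@measurable_funS _ _ _ _ setT)=>//; exact: measurable_powR.
- exact: lb_ge0.
apply: ge0_le_integral=>//.
- by move=> u _; rewrite -EFinM lee_fin mulr_ge0 ?lb_ge0 ?powR_ge0.
- apply: measurable_funeM; apply/measurable_EFinP.
  by apply: (@measurable_funS _ _ _ _ setT)=>//; exact: measurable_powR.
- exact: measurable_gi.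
- move=> u; rewrite /= in_itv/= => /andP[bu uc]; rewrite -EFinM lee_fin ler_wpM2r ?powR_ge0//.
  by apply: lb_mono=>//; exact: ltW.
Qed.

Lemma Gab_split b c d : b<=c -> c<=d -> (Gab b d = Gab b c+Gab c d)%E.
Proof.
move=> bc cd; rewrite /Gab -(@integral_itv_obnd_cbnd _ c); last exact: measurable_gi.
rewrite -ge0_integral_setU//=.
- congr (integral _ _ _); rewrite -itv_bndbnd_setU ?bnd_simp//.
- exact: measurable_gi.
- by move=> u _; rewrite lee_fin gi_ge0.
- apply/disj_setPRL=> u /=; rewrite !in_itv/= => /andP[cu _] /andP[_ uc].
  by move: (lt_le_trans cu uc); rewrite ltxx.
Qed.

Lemma Gab_ge0 b c : (0<=Gab b c)%E.
Proof. by apply: integral_ge0=> u _; rewrite lee_fin gi_ge0. Qed.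

Lemma Gab_sub b c b' c' : b'<=b -> c<=c' -> (Gab b c<=Gab b' c')%E.
Proof.
move=> bb cc; apply: ge0_subset_integral=>//=.
- exact: measurable_gi.
- by move=> u _; rewrite lee_fin gi_ge0.
- by apply: subset_itvScc; rewrite bnd_simp.
Qed.

Lemma Gab_big c d : 0<c -> c<d -> (Gab c d<=(c`^(1-a)/(a - 1))%:E)%E.
Proof.
move=> c0 cd; have a1: 1<a by rewrite /a invf_gt1.
pose F (u : R) := - (a - 1)^-1*u`^(1-a).
have a10: a - 1 != 0 by rewrite gt_eqF// subr_gt0.
have dF u : 0<u -> is_derive u (1 : R) F (u`^(- a)).
  move=> u0; have := is_derive_mul (is_derive_cst (- (a - 1)^-1) u (1 : R)) (is_derive1_powR (1-a) u0)=> h.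
  apply: (is_derive_eq h); rewrite /cst mul0r add0r (_ : 1-a - 1 = - a); last by ring.
  by rewrite mulrA (_ : - (a - 1)^-1*(1-a) = 1) ?mul1r//; field.
have cF u : 0<u -> {for u, continuous F}.
  by move=> u0; apply/differentiable_continuous/derivable1_diffP; exact: (@ex_derive _ _ _ _ _ _ _ (dF u u0)).
have pos u : c<=u -> 0<u by move=> cu; exact: lt_le_trans cu.
have d0: 0<d by exact: lt_trans cd.
apply: le_trans (_ : (\int[mu]_(u in `[c, d]) (u`^(- a))%:E<=_)%E).
  apply: ge0_le_integral=>//.
  - by move=> u _; rewrite lee_fin gi_ge0.
  - exact: measurable_gi.
  - by apply/measurable_EFinP; apply: (@measurable_funS _ _ _ _ setT)=>//; exact: measurable_powR.
  - move=> u; rewrite /= in_itv/= => /andP[cu _]; have u0 := pos _ cu; rewrite lee_fin.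
    apply: le_trans (_ : u*u`^(-1-a)<=_); first by rewrite ler_wpM2r ?powR_ge0// lb_le// ltW.
    rewrite powRD; last by rewrite (gt_eqF u0) implybT.
    by rewrite powR_inv1 ?(ltW u0)// mulrA divff ?mul1r// gt_eqF.
rewrite (@continuous_FTC2 _ (fun u=> u`^(- a)) F _ _ cd).
- rewrite /F -EFinB lee_fin; have := powR_ge0 d (1-a); have : 0<(a - 1)^-1 by rewrite invr_gt0 subr_gt0.
  move=> p q; have := mulr_ge0 (ltW p) q; lra.
- apply: derivable_within_continuous=> u; rewrite in_itv/= => /andP[bu _].
  by apply: derivable_powR; rewrite in_itv/= andbT pos.
- split.
  + by move=> u; rewrite in_itv/= => /andP[bu _]; exact: (@ex_derive _ _ _ _ _ _ _ (dF u (pos _ (ltW bu)))).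
  + exact/cvg_at_right_filter/cF.
  + exact/cvg_at_left_filter/cF.
- move=> u; rewrite in_itv/= => /andP[bu _]; rewrite derive1E.
  by have := dF u (pos _ (ltW bu))=> -[].
Qed.

Variable k : R.
Hypothesis k1 : 1<=k.
Let k0 : 0<k. Proof. exact: lt_le_trans k1. Qed.

(** Sample points for the integral: between consecutive ones the density [u^(-1-1/sigma)] has the
    constant mass [sigma k^(-1/sigma)], so the sums [SN] are Riemann sums, bracketed by monotonicity
    of [lb]. *)
Definition uk (n : nat) : R := k*n%:R`^(- sigma).
Definition SN (N : nat) : R := \sum_(1<=n<N.+1) lb (uk n).

Lemma uk_gt0 n : (0<n)%N -> 0<uk n.
Proof. by move=> n0; rewrite mulr_gt0// powR_gt0// ltr0n. Qed.

Lemma uk1 : uk 1 = k. Proof. by rewrite /uk powR1 mulr1. Qed.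

Lemma uk_lt m n : (0<m)%N -> (m<n)%N -> uk n<uk m.
Proof.
move=> m0 mn; have n0 := ltn_trans m0 mn; rewrite ltr_pM2l// !powRN ltf_pV2 ?posrE ?powR_gt0 ?ltr0n//.
by rewrite gt0_ltr_powR ?nnegrE// ltr_nat.
Qed.

Lemma uk_le_k n : (0<n)%N -> uk n<=k.
Proof. by rewrite -[X in _<=X]uk1; case: n=> [|[|n]] // _; apply/ltW/uk_lt. Qed.

Lemma uk_pow n : (0<n)%N -> uk n`^(- a) = k`^(- a)*n%:R.
Proof.
move=> n0; rewrite powRM ?powR_ge0 ?(ltW k0)// -powRrM (_ : - sigma * - a = 1) ?powRr1//.
by rewrite mulrNN divff// gt_eqF.
Qed.

Lemma piece_le n : (0<n)%N -> (Gab (uk n.+1) (uk n)<=(sigma*k`^(- a) * lb (uk n))%:E)%E.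
Proof.
move=> n0; apply: le_trans (Gab_le (uk_gt0 _) (uk_lt n0 (ltnSn n))) _=>//.
by rewrite lee_fin !uk_pow// -natr1; apply: eq_ler; ring.
Qed.

Lemma piece_ge n : (0<n)%N -> ((sigma*k`^(- a) * lb (uk n.+1))%:E<=Gab (uk n.+1) (uk n))%E.
Proof.
move=> n0; apply: le_trans _ (Gab_ge (uk_gt0 _) (uk_lt n0 (ltnSn n)))=>//.
by rewrite lee_fin !uk_pow// -natr1; apply: eq_ler; ring.
Qed.

Lemma Gab_uk_le N : (0<N)%N -> (Gab (uk N.+1) k<=(sigma*k`^(- a)*SN N)%:E)%E.
Proof.
elim: N=>// N IH _; case: N IH=> [_|N IH].
  rewrite /SN big_nat1; apply: le_trans _ (piece_le (ltnSn 0)).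
  by rewrite uk1.
rewrite (@Gab_split _ (uk N.+2)); last 2 first.
- by apply/ltW/uk_lt.
- exact: uk_le_k.
rewrite /SN big_nat_recr//= mulrDr EFinD [X in (X<=_)%E]addeC; apply: leeD; first exact: IH.
exact: piece_le.
Qed.

Lemma Gab_uk_ge N : (0<N)%N -> ((sigma*k`^(- a)*(SN N-lb k))%:E<=Gab (uk N) k)%E.
Proof.
elim: N=>// N IH _; case: N IH=> [_|N IH].
  by rewrite /SN big_nat1 uk1 subrr mulr0 Gab_ge0.
rewrite (@Gab_split _ (uk N.+1)); last 2 first.
- by apply/ltW/uk_lt.
- exact: uk_le_k.
rewrite /SN big_nat_recr//= addrAC mulrDr EFinD addeC; apply: leeD; last exact: IH.
exact: piece_ge.
Qed.

(** Kept as an extended real, because finiteness is deduced only later from the comparison with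
    sums. *)
Definition GE : \bar R := (\int[mu]_(u in `]0%R, +oo[) (gi u)%:E)%E.

Lemma Gab_GE b c : 0<b -> (Gab b c<=GE)%E.
Proof.
move=> b0; apply: ge0_subset_integral=>//=.
- exact: measurable_gi.
- by move=> u _; rewrite lee_fin gi_ge0.
- by move=> u /=; rewrite !in_itv/= andbT=> /andP[bu _]; exact: lt_le_trans bu.
Qed.

Lemma GE_le (M : \bar R) : (forall b c, 0<b -> b<c -> (Gab b c<=M)%E) -> (GE<=M)%E.
Proof.
move=> H; pose F (n : nat) : set R := `[(n.+2%:R)^-1, n.+2%:R]%classic.
have E: `]0%R, +oo[%classic = \bigcup_n F n.
  apply/seteqP; split=> u /=; last first.
    move=> [n _]; rewrite /F/= !in_itv/= andbT=> /andP[h _]; apply: lt_le_trans h; rewrite invr_gt0//.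
  rewrite in_itv/= andbT=> u0; pose n := (Num.truncn (Num.max u u^-1)).
  have h: Num.max u u^-1<n.+1%:R := truncnS_gt _.
  exists n=>//; rewrite /F/= in_itv/=.
  have nn: n.+1%:R<=n.+2%:R :> R by rewrite ler_nat.
  move: h; rewrite gt_max=> /andP[h1 h2].
  rewrite -[X in _<=X<=_]invrK lef_pV2 ?posrE ?invr_gt0// (ltW (lt_le_trans h2 nn))/= invrK.
  exact: ltW (lt_le_trans h1 nn).
rewrite /GE E.
have := @ge0_nondecreasing_set_cvg_integral _ (measurableTypeR R) R F (fun u=> (gi u)%:E) (@lebesgue_measure R).
move=> /(_ _ _ _ _)/cvg_lim <- //; last 4 first.
- apply/nondecreasing_seqP=> n; rewrite subsetEset; apply: subset_itvScc; rewrite bnd_simp.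
    by rewrite lef_pV2 ?posrE// ler_nat.
  by rewrite ler_nat.
- by move=> i; exact: measurable_itv.
- by move=> i; exact: measurable_gi.
- by move=> i x _; rewrite lee_fin gi_ge0.
apply: lime_le.
  apply: ereal_nondecreasing_is_cvgn; apply: ge0_nondecreasing_set_nondecreasing_integral.
  - apply/nondecreasing_seqP=> n; rewrite subsetEset; apply: subset_itvScc; rewrite bnd_simp.
      by rewrite lef_pV2 ?posrE// ler_nat.
    by rewrite ler_nat.
  - by move=> i; exact: measurable_itv.
  - by move=> i; exact: measurable_gi.
  - by move=> i x _; rewrite lee_fin gi_ge0.
apply: nearW=> n; apply: H; first by rewrite invr_gt0.
by apply: (@lt_trans _ _ 1); rewrite ?invf_lt1// ltr1n.
Qed.

Lemma GE_upper (M : R) : (forall N, SN N<=M) ->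
  (GE<=(sigma*k`^(- a)*M+k`^(1-a)/(a - 1))%:E)%E.
Proof.
move=> HM; apply: GE_le=> b c b0 bc.
pose N := (Num.truncn ((k / b)`^a)).+1.
have Nb: uk N.+1<=b.
  rewrite /uk powRN ler_pdivrMr ?powR_gt0 ?ltr0n// mulrC -ler_pdivrMr//.
  have kb: 0<=k / b by rewrite divr_ge0 ?(ltW k0) ?(ltW b0).
  have -> : k / b=((k / b)`^a)`^sigma by rewrite -powRrM mulVf ?powRr1// gt_eqF.
  rewrite ge0_ler_powR ?nnegrE ?powR_ge0 ?(ltW s0)//.
  by apply: le_trans (ltW (truncnS_gt _)) _; rewrite ler_nat.
pose d := Num.max c (k+1).
have kd: k<d by rewrite lt_max ltrDl ltr01 orbT.
apply: le_trans (@Gab_sub _ _ (uk N.+1) d Nb _) _; first by rewrite le_max lexx.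
rewrite (@Gab_split _ k); last 2 first.
- exact: uk_le_k.
- exact: ltW.
rewrite EFinD; apply: leeD; last exact: Gab_big.
apply: le_trans (Gab_uk_le (ltn0Sn _)) _; rewrite lee_fin ler_wpM2l ?mulr_ge0 ?powR_ge0 ?(ltW s0)//.
Qed.

Lemma GE_lower N : (0<N)%N -> ((sigma*k`^(- a)*(SN N-lb k))%:E<=GE)%E.
Proof.
move=> N0; apply: le_trans (Gab_uk_ge N0) _; apply: Gab_GE.
exact: uk_gt0.
Qed.
End BesselIntegral.

(** * The logarithmic spread of the Bessel sums *)

Section Moments.
Variables (R : realType) (sigma : R).
Hypotheses (hs1 : 2^-1<sigma) (hs2 : sigma<1).
Let s0 : 0<sigma. Proof. by move: hs1; lra. Qed.

Lemma quad_le_exp (be v : R) : 0<be -> 1+v^+2<=(1+2 / be^+2) * expR (be * `|v|).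
Proof.
move=> b0; have t0: 0<=be * `|v| by rewrite mulr_ge0// ltW.
have := expR_ge1Dxn 1 t0; rewrite (_ : 2`! = 2)%N// => h.
have E: (be * `|v|)^+2 = be^+2 * v^+2 by rewrite exprMn real_normK ?num_real.
rewrite E in h; have b2: 0<be^+2 by rewrite exprn_gt0.
have v2 := sqr_ge0 v; have bv: 0<=be^+2 * v^+2/2 by nneg.
rewrite mulrDl mul1r; apply: lerD; first by move: h bv; lra.
apply: le_trans (_ : 2 / be^+2*(be^+2 * v^+2/2)<=_).
  by apply: eq_ler; field; rewrite gt_eqF.
by rewrite ler_wpM2l ?divr_ge0 ?(ltW b2)//; move: h; lra.
Qed.

(** The weight of the sum sits at [n] of order [y]. Below, [lb u <= u] decays; above, [lb u <= u^2]
    does. [be] is half the smaller of the two margins, and [exp(be |v|)] absorbs the quadratic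
    factor. *)
Lemma moment : exists2 C : R, 0<=C & forall y N, 1<=y ->
  \sum_(1<=n<N.+1) lb (uk sigma (y`^sigma) n)*(1+(lnn R n-ln y)^+2)<=C*y.
Proof.
pose be := Num.min (1-sigma) (2*sigma - 1)/2.
have be0: 0<be by rewrite divr_gt0// lt_min; apply/andP; split; move: hs1 hs2; lra.
have be1: be<1-sigma.
  have : Num.min (1-sigma) (2*sigma - 1)<=1-sigma by rewrite ge_min lexx.
  by rewrite /be; move: hs2; lra.
have be2: be<2*sigma - 1.
  have : Num.min (1-sigma) (2*sigma - 1)<=2*sigma - 1 by rewrite ge_min lexx orbT.
  by rewrite /be; move: hs1; lra.
pose Cb := 1+2 / be^+2; have Cb0: 0<=Cb by rewrite /Cb; nneg.
pose c1 := 2/(1-(sigma+be)); have c10: 0<=c1 by rewrite divr_ge0//; lra.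
pose b := 2*sigma-be; have b1: 1<b by rewrite /b; lra.
pose c2 := 4/(b - 1); have c20: 0<=c2 by rewrite divr_ge0//; lra.
exists (Cb*c1+Cb*c2); first by nneg.
move=> y N y1; have y0 := lt_le_trans ltr01 y1.
set X := ln y; pose k := y`^sigma; have k0: 0<k by rewrite powR_gt0.
have k1: 1<=k by rewrite /k -[X in X<=_](powRr0 y) ler_powR// ltW.
pose M := Num.truncn y.
have M1: (0<M)%N by rewrite truncn_gt0.
have M0: 0<M%:R :> R by rewrite ltr0n.
have My: M%:R<=y by rewrite truncn_le ltW.
have yM: y<M.+1%:R by exact: truncnS_gt.
have yM2: y<=2*M%:R.
  by apply: le_trans (ltW yM) _; rewrite -natrM ler_nat mul2n -addnn -addn1 leq_add2l.
pose T n := lb (uk sigma k n)*(1+(lnn R n-X)^+2).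
have T0 n : 0<=T n by rewrite mulr_ge0 ?lb_ge0// addr_ge0// sqr_ge0.
apply: le_trans (_ : \sum_(1<=n<(maxn N M).+1) T n<=_).
  rewrite [X in _<=X](@big_cat_nat _ _ _ N.+1)//= ?ltnS ?leq_maxl// lerDl.
  by apply: sumr_ge0.
rewrite (@big_cat_nat _ _ _ M.+1)//= ?ltnS ?leq_maxr// mulrDl.
have yE (c : R) : y`^c = expR (c*X) by rewrite /powR gt_eqF.
apply: lerD.
  apply: le_trans (_ : \sum_(1<=n<M.+1) (Cb*(k*y`^be))*n%:R`^(- (sigma+be))<=_).
    apply: ler_sum_nat=> n /andP[n0 nM].
    have lX: lnn R n<=X by rewrite ler_ln ?posrE ?ltr0n// (le_trans _ My)// ler_nat.
    apply: le_trans (_ : k*n%:R`^(- sigma)*(Cb * expR (be * `|lnn R n-X|))<=_).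
      apply: ler_pM; rewrite ?lb_ge0 ?addr_ge0 ?sqr_ge0 ?quad_le_exp//.
      by apply: lb_le; apply: ltW; exact: uk_gt0.
    rewrite ler0_norm ?subr_le0// opprB mulrBr expRD opprD powRD; last by rewrite pnatr_eq0 -lt0n n0 implybT.
    rewrite -yE !powR_expR// -[be * lnn R n]opprK -mulNr.
    by apply: eq_ler; rewrite opprK mulNr; ring.
  rewrite -big_distrr/= -mulrA -[X in _<=X]mulrA ler_wpM2l//.
  have sb: 0<sigma+be<1 by apply/andP; split; lra.
  have kb: 0<=k*y`^be by rewrite mulr_ge0 ?powR_ge0.
  apply: le_trans (ler_wpM2l kb (sum_head M sb)) _.
  apply: le_trans (_ : k*y`^be*(c1*y`^(1-(sigma+be)))<=_).
    rewrite ler_wpM2l// ler_wpM2l// ge0_ler_powR ?nnegrE ?(ltW y0)//; lra.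
  apply: eq_ler.
  have gen (p q r s : R) : p*q*(r*s) = r*(p*q*s) by ring.
  rewrite gen; congr (_ * _).
  rewrite /k -!powRD ?(gt_eqF y0) ?implybT// (_ : sigma+be+(1-(sigma+be)) = 1) ?powRr1 ?(ltW y0)//; ring.
apply: le_trans (_ : \sum_(M.+1<=n<(maxn N M).+1) (Cb*(k^+2*y`^(- be)))*n%:R`^(- b)<=_).
  apply: ler_sum_nat=> n /andP[nM _]; have n0: (0<n)%N := leq_ltn_trans (leq0n _) nM.
  have lX: X<=lnn R n by rewrite ler_ln ?posrE ?ltr0n// (le_trans (ltW yM))// ler_nat.
  apply: le_trans (_ : (k*n%:R`^(- sigma))^+2*(Cb * expR (be * `|lnn R n-X|))<=_).
    apply: ler_pM; rewrite ?lb_ge0 ?addr_ge0 ?sqr_ge0 ?quad_le_exp//.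
    by apply: le_trans (lb_lesq _) _; rewrite -/(uk sigma k n); have := sqr_ge0 (uk sigma k n); lra.
  rewrite ger0_norm ?subr_ge0// mulrBr expRD -mulNr -yE !powR_expR//.
  rewrite exprMn -expRM_natl /b.
  have -> : - (2*sigma-be) * lnn R n = 2*(- sigma * lnn R n)+be * lnn R n by ring.
  by rewrite expRD; apply: eq_ler; ring.
rewrite -big_distrr/= -mulrA -[X in _<=X]mulrA ler_wpM2l//.
have kb: 0<=k^+2*y`^(- be) by rewrite mulr_ge0 ?powR_ge0// exprn_ge0// ltW.
apply: le_trans (ler_wpM2l kb (sum_tail (maxn N M) b1 M1)) _.
have Mb: M%:R`^(1-b)<=4*y`^(1-b).
  have -> : 1-b = - (b - 1) by ring.
  rewrite !powRN -[X in X<=_]mul1r ler_pdivrMr ?powR_gt0// mulrAC ler_pdivlMr ?powR_gt0// mul1r.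
  apply: le_trans (_ : (2*M%:R)`^(b - 1)<=_).
    by rewrite ge0_ler_powR ?nnegrE ?mulr_ge0 ?(ltW y0)//; lra.
  rewrite powRM// ler_wpM2r ?powR_ge0//; apply: le_trans (_ : 2`^1<=_); last by rewrite powRr1//; lra.
  rewrite ler_powR ?ler1n// /b; move: be0 hs2; lra.
apply: le_trans (_ : k^+2*y`^(- be)*(4*y`^(1-b)/(b - 1))<=_).
  by rewrite ler_wpM2l// ler_wpM2r// invr_ge0; lra.
apply: eq_ler.
have gen (p q r d : R) : p*q*(4*r / d) = 4 / d*(p*q*r) by ring.
rewrite gen -/c2; congr (_ * _).
rewrite /k expr2 -!powRD ?(gt_eqF y0) ?implybT//.
by rewrite (_ : sigma+sigma + - be+(1-b) = 1) ?powRr1 ?(ltW y0)// /b; ring.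
Qed.
End Moments.

(** * Proper prime powers *)

Section PrimePowers.
Variables (R : realType) (sigma : R).
Hypotheses (hs1 : 2^-1<sigma) (hs2 : sigma<1).
Let s0 : 0<sigma. Proof. by move: hs1; lra. Qed.

Lemma sum_pr (V : nmodType) (z : nat) (f : nat -> V) :
  \sum_(q : pr z) f (pv q) = \sum_(1<=n<z.+1 | prime n) f n.
Proof.
rewrite [RHS](_ : _ = \sum_(0<=n<z.+1) if prime n then f n else 0); last first.
  by rewrite [LHS]big_mkcond/= [RHS]big_ltn//= add0r.
rewrite big_mkord -big_mkcond/=.
rewrite (reindex_omap (fun q : pr z=> val q) (fun i : 'I_z.+1=> insub i))/=; last first.
  by move=> i pi; rewrite insubT.
apply: eq_big=> q; last by [].
by rewrite valK eqxx andbT (valP q).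
Qed.

Lemma sum_pick (z m : nat) (g : nat -> R) : 0<=g m ->
  \sum_(1<=n<z.+1) (if n == m then g n else 0)<=g m.
Proof.
move=> g0; have [mz|mz] := boolP (m \in index_iota 1 z.+1).
  rewrite (bigD1_seq m) ?iota_uniq//= eqxx big1 ?addr0// => n /negbTE -> //.
rewrite big_seq big1// => n nz; case: eqP=>// nm; by rewrite nm (negbTE mz) in nz.
Qed.

(** Such [n] are [q^j] with [j >= 2]: a geometric series in [j] leaves the sum of [q^(-2 sigma)],
    convergent because [2 sigma > 1]. *)
Lemma prime_powers_le : exists2 C : R, 0<=C & forall z,
  \sum_(1<=n<z.+1 | (mangoldt R n != 0) && ~~ prime n) n%:R`^(- sigma)<=C.
Proof.
have x2: 2`^(- sigma)<1 :> R.
  by rewrite powRN invf_lt1 ?powR_gt0// /powR pnatr_eq0/= expR_gt1 mulr_gt0// ln_gt0// ltr1n.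
pose x := 2`^(- sigma) : R; have x0: 0<x by rewrite powR_gt0.
exists ((1-x)^-1*(2*sigma - 1)^-1).
  by rewrite mulr_ge0 ?invr_ge0// ?subr_ge0 ?(ltW x2)//; move: hs1; lra.
move=> z; set g := fun n : nat=> n%:R`^(- sigma) : R.
have g0 n : 0<=g n by exact: powR_ge0.
apply: le_trans (_ : \sum_(1<=n<z.+1) \sum_(2<=q<z.+1) \sum_(2<=j<z.+1) (if n == (q ^ j)%N then g n else 0)<=_).
  rewrite big_mkcond/=; apply: ler_sum_nat=> n /andP[n0 nz].
  have t0 q j : 0<=(if n == (q ^ j)%N then g n else 0) by case: ifP.
  case: ifPn=> [/andP[Ln pn]|_]; last by apply: sumr_ge0=> q _; apply: sumr_ge0.
  have [q [j [pq j0 nE _]]] := mangoldt_neq0 n0 Ln.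
  have j2: (1<j)%N.
    by case: j j0 nE=> [|[|j]]// _ nE; move: pn; rewrite nE expn1 pq.
  have q2 := prime_gt1 pq.
  have qn: (q<=n)%N by rewrite nE -[X in (X<=_)%N]expn1 leq_pexp2l// prime_gt0.
  have jn: (j<=n)%N by rewrite nE ltnW// ltn_expl.
  rewrite (bigD1_seq q) ?iota_uniq//=; last by rewrite mem_index_iota q2/= (leq_ltn_trans qn).
  rewrite (bigD1_seq j) ?iota_uniq//=; last by rewrite mem_index_iota j2/= (leq_ltn_trans jn).
  rewrite -nE eqxx -addrA lerDl addr_ge0 ?sumr_ge0// => i _; exact: sumr_ge0.
rewrite exchange_big/=.
apply: le_trans (_ : \sum_(2<=q<z.+1) (1-x)^-1*q%:R`^(- (2*sigma))<=_); last first.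
  rewrite -big_distrr/=; apply: ler_wpM2l; first by rewrite invr_ge0 subr_ge0 ltW.
  have b1: 1<2*sigma by move: hs1; lra.
  by have := sum_tail z b1 (ltnSn 0); rewrite powR1 mul1r.
apply: ler_sum_nat=> q /andP[q2 _]; rewrite exchange_big/=.
have q0: (0<q)%N := ltnW q2.
apply: le_trans (_ : \sum_(2<=j<z.+1) g (q ^ j)%N<=_).
  by apply: ler_sum=> j _; apply: sum_pick.
have gX j : g (q ^ j)%N = g q^+j.
  by rewrite /g natrX -[q%:R^+j]powR_mulrn// -powRrM mulrC powRrM powR_mulrn// powR_ge0.
have gq: g q<=x.
  rewrite /g /x !powRN lef_pV2 ?posrE ?powR_gt0 ?ltr0n// ge0_ler_powR ?nnegrE ?(ltW s0)// ler_nat//.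
have g2: q%:R`^(- (2*sigma)) = g q^+2.
  by rewrite /g -powR_mulrn ?powR_ge0// -powRrM; congr (_`^_); ring.
rewrite g2; under eq_bigr do rewrite gX.
move: (g q) gq (g0 q)=> w wx w0.
have w1: 0<1-w by rewrite subr_gt0 (le_lt_trans wx).
apply: le_trans (_ : w^+2/(1-w)<=_); last first.
  rewrite mulrC ler_wpM2r ?exprn_ge0// lef_pV2 ?posrE ?subr_gt0//; move: wx; lra.
rewrite ler_pdivlMr//; case: z=> [|z]; first by rewrite big_geq// mul0r exprn_ge0.
suff : (\sum_(2<=j<z.+2) w^+j)*(1-w) = w^+2-w^+z.+2.
  by move=> ->; rewrite gerBl exprn_ge0.
elim: z=> [|z IH]; first by rewrite big_geq// mul0r subrr.
by rewrite big_nat_recr//= mulrDl IH [w^+z.+3]exprS; ring.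
Qed.

Lemma prime_powers : exists2 C : R, 0<=C & forall k z, 1<=k ->
  `|\sum_(1<=n<z.+1) rz R z n * lb (uk sigma k n)-Fz sigma z k| <= C*k.
Proof.
have [C C0 HC] := prime_powers_le; exists C=>// k z k1; have k0 := lt_le_trans ltr01 k1.
have -> : Fz sigma z k = \sum_(1<=n<z.+1 | prime n) lb (uk sigma k n).
  by rewrite /Fz /up (sum_pr z (fun n=> lb (k*n%:R`^(- sigma)))).
rewrite (bigID prime)/= .
have -> : \sum_(1<=n<z.+1 | prime n) rz R z n * lb (uk sigma k n) = \sum_(1<=n<z.+1 | prime n) lb (uk sigma k n).
  rewrite big_nat_cond [RHS]big_nat_cond; apply: eq_bigr=> n /andP[/andP[n0 nz] pn].
  have n1 := prime_gt1 pn; rewrite /rz n1 -ltnS nz/= -{1}(expn1 n) mangoldt_primeX//.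
  by rewrite divff ?mul1r// gt_eqF// lnn_gt0.
rewrite addrAC subrr add0r.
have t0 n : 0<=rz R z n * lb (uk sigma k n) by rewrite mulr_ge0 ?rz_ge0 ?lb_ge0.
rewrite ger0_norm ?sumr_ge0//.
rewrite mulrC; apply: le_trans (ler_wpM2l (ltW k0) (HC z)).
rewrite big_distrr/= big_mkcond/= [X in _<=X]big_mkcond/=; apply: ler_sum_nat=> n /andP[n0 nz].
case: (boolP (prime n))=> pn /=; first by rewrite andbF.
rewrite andbT; case: (eqVneq (mangoldt R n) 0)=> [M0|M0] /=.
  by rewrite /rz M0 mul0r if_same mul0r.
have u0: 0<uk sigma k n by exact: uk_gt0.
apply: le_trans (_ : 1*uk sigma k n<=_); last by rewrite mul1r.
rewrite ler_pM ?rz_ge0 ?lb_ge0 ?lb_le ?(ltW u0)// /rz; case: ifP=>// /andP[n1 _].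
by rewrite ler_pdivrMr ?lnn_gt0// mul1r mangoldt_le_lnn.
Qed.
End PrimePowers.

(** * Asymptotics of the log-Laplace transform *)

Section FzAsymptotics.
Variables (R : realType) (sigma : R).
Hypotheses (hs1 : 2^-1<sigma) (hs2 : sigma<1).
Let s0 : 0<sigma. Proof. by move: hs1; lra. Qed.
Let a := sigma^-1.

Lemma y_k (y : R) : 1<=y -> (y`^sigma)`^(- a) = y^-1.
Proof.
move=> y1; have y0 := lt_le_trans ltr01 y1.
by rewrite -powRrM mulrN divff ?gt_eqF// powR_inv1// ltW.
Qed.

Lemma SN_tail k z N : 0<k -> (0<z)%N ->
  SN sigma k N<=SN sigma k z+k^+2*z%:R`^(1 - 2*sigma)/(2*sigma - 1).
Proof.
move=> k0 z0; have b1: 1<2*sigma by move: hs1; lra.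
have l0 n : 0<=lb (uk sigma k n) by exact: lb_ge0.
apply: le_trans (_ : SN sigma k (maxn N z)<=_).
  rewrite /SN [X in _<=X](@big_cat_nat _ _ _ N.+1)//= ?ltnS ?leq_maxl// lerDl.
  by apply: sumr_ge0.
rewrite /SN (@big_cat_nat _ _ _ z.+1)//= ?ltnS ?leq_maxr// lerD2l.
apply: le_trans (_ : \sum_(z.+1<=n<(maxn N z).+1) k^+2*n%:R`^(- (2*sigma))<=_).
  apply: ler_sum=> n _; apply: le_trans (lb_lesq _) _; rewrite /uk exprMn -[(n%:R`^_)^+2]powR_mulrn ?powR_ge0//.
  rewrite -powRrM (_ : - sigma*2%:R = - (2*sigma)); last by ring.
  have := mulr_ge0 (exprn_ge0 2 (ltW k0)) (powR_ge0 n%:R (- (2*sigma))); lra.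
rewrite -big_distrr/= -mulrA; apply: ler_wpM2l; first by rewrite exprn_ge0// ltW.
exact: sum_tail.
Qed.

Lemma GE_fin : GE sigma \is a fin_num.
Proof.
have [C C0 H] := moment hs1 hs2.
rewrite fin_numE; apply/andP; split.
  rewrite gt_eqF// (lt_le_trans (ltNyr 0))//; apply: integral_ge0=> u _; rewrite lee_fin; exact: gi_ge0.
rewrite lt_eqF//; apply: le_lt_trans (ltry _).
apply: (@GE_upper _ _ hs1 hs2 1 (lexx _) (C*1))=> N.
apply: le_trans (H 1 N (lexx _)); rewrite powR1 /SN; apply: ler_sum=> n _.
by rewrite ler_peMr ?lb_ge0// lerDl sqr_ge0.
Qed.

Lemma G1_GE : (G1 sigma)%:E = GE sigma. Proof. by rewrite -(fineK GE_fin). Qed.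

Lemma G1_gt0 : 0<G1 sigma.
Proof.
have := GE_lower hs1 (lexx 1) (isT : (0<2)%N); rewrite -G1_GE lee_fin; apply: lt_le_trans.
rewrite powR1 mulr1 mulr_gt0// /SN big_nat_recr//= big_nat1 /uk powR1 mulr1 addrAC subrr add0r mul1r.
rewrite ln_gt0//; apply: lt_le_trans (bI0_gesq _); rewrite ltrDl divr_gt0// exprn_gt0// powR_gt0//.
Qed.

(** The lower Riemann sum omits the term [n = 1], at most [k]. In the other direction the integral
    beyond [k], again [O(k)], and the terms [n > z] are missing. *)
Lemma SN_G1 : exists2 C : R, 0<=C & forall y z, 1<=y -> y^+2<=z%:R ->
  `|SN sigma (y`^sigma) z-a*y*G1 sigma| <= C*(y`^sigma+y`^(2 - 2*sigma)).
Proof.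
have a1: 0<a - 1 by rewrite subr_gt0 /a invf_gt1.
have d0: 0<2*sigma - 1 by move: hs1; lra.
pose c1 := a/(a - 1); have c10: 0<=c1 by rewrite divr_ge0 ?(ltW a1)// /a invr_ge0 ltW.
pose c2 := (2*sigma - 1)^-1; have c20: 0<=c2 by rewrite invr_ge0 ltW.
exists (1+c1+c2); first by rewrite !addr_ge0.
move=> y z y1 yz; have y0 := lt_le_trans ltr01 y1.
set k := y`^sigma; have k1: 1<=k by rewrite /k -[X in X<=_](powRr0 y) ler_powR// ltW.
have k0 := lt_le_trans ltr01 k1.
have z0: (0<z)%N by rewrite -(ltr0n R); apply: lt_le_trans yz; rewrite exprn_gt0.
have ka: k`^(- a) = y^-1 by exact: y_k.
have k1a: k`^(1-a) = k / y.
  by rewrite powRD ?(gt_eqF k0) ?implybT// powRr1 ?(ltW k0)// ka.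
set S := SN sigma k z; set G := G1 sigma.
set tl := k^+2*z%:R`^(1 - 2*sigma)/(2*sigma - 1).
have sa: sigma*a = 1 by rewrite /a divff// gt_eqF.
have tle: tl<=c2*y`^(2 - 2*sigma).
  rewrite /tl mulrC; apply: ler_wpM2l; first exact: c20.
  have -> : y`^(2 - 2*sigma) = k^+2*(y^+2)`^(1 - 2*sigma).
    rewrite /k -[(y`^sigma)^+2]powR_mulrn ?powR_ge0// -powRrM -[y^+2]powR_mulrn ?(ltW y0)// -powRrM.
    by rewrite -powRD ?(gt_eqF y0) ?implybT//; congr (_`^_); ring.
  apply: ler_wpM2l; first by rewrite exprn_ge0// ltW.
  have -> : 1 - 2*sigma = - (2*sigma - 1) by ring.
  rewrite !powRN lef_pV2 ?posrE ?powR_gt0 ?exprn_gt0 ?ltr0n//.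
  by rewrite ge0_ler_powR ?nnegrE ?exprn_ge0 ?(ltW y0) ?(ltW d0).
have lo: S-k<=a*y*G.
  have := GE_lower hs1 k1 z0; rewrite -G1_GE lee_fin ka -/S -/G=> h.
  have lk: lb k<=k by exact: lb_le (ltW k0).
  have ay: 0<=a*y by rewrite mulr_ge0 ?(ltW y0)// /a invr_ge0 ltW.
  have := ler_wpM2l ay h.
  rewrite (_ : a*y*(sigma / y*(S-lb k)) = sigma*a*(S-lb k)); last by field; rewrite gt_eqF.
  by rewrite sa mul1r; move: lk; lra.
have hi: a*y*G<=S+tl+c1*k.
  have := @GE_upper _ _ hs1 hs2 k k1 (S+tl) (fun N=> @SN_tail k z N k0 z0).
  rewrite -G1_GE lee_fin ka k1a -/G=> h.
  have ay: 0<=a*y by rewrite mulr_ge0 ?(ltW y0)// /a invr_ge0 ltW.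
  have := ler_wpM2l ay h.
  rewrite (_ : a*y*(sigma / y*(S+tl)+k / y/(a - 1)) = sigma*a*(S+tl)+c1*k); last first.
    by rewrite /c1; field; rewrite !gt_eqF.
  by rewrite sa mul1r.
have k0' := ltW k0; have p0 := powR_ge0 y (2 - 2*sigma).
have h1 := mulr_ge0 c10 k0'; have h2 := mulr_ge0 c20 p0; have h3 := mulr_ge0 c10 p0; have h4 := mulr_ge0 c20 k0'.
have h5: (1+c1+c2)*(k+y`^(2 - 2*sigma)) =
  k+c1*k+c2*k+y`^(2 - 2*sigma)+c1*y`^(2 - 2*sigma)+c2*y`^(2 - 2*sigma) by ring.
rewrite h5 ler_norml; apply/andP; split; move: lo hi tle h1 h2 h3 h4 p0 k0'; clear; lra.
Qed.

(* piecewise linear cutoff: 1 on [3X/4, 5X/4], supported in [X/2, 3X/2] *)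
Definition cut (X x : R) : R := 1-Num.max 0 (1-Num.max 0 (2 - 4 * `|x-X| / X)).

Lemma cut01 X x : 0<=cut X x<=1.
Proof.
rewrite /cut; set t := Num.max 0 (2 - _); have t0: 0<=t by rewrite le_max lexx.
have : 0<=Num.max 0 (1-t) by rewrite le_max lexx.
have : Num.max 0 (1-t)<=1 by rewrite ge_max ler01/= gerBl.
by move=> *; apply/andP; split; lra.
Qed.

Lemma cut1 X x : 0<X -> `|x-X| <= X/4 -> cut X x = 1.
Proof.
move=> X0 h; have h2: 1<=2 - 4 * `|x-X| / X.
  by have : 4 * `|x-X| / X<=1; [rewrite ler_pdivrMr//; move: h; lra|lra].
rewrite /cut; set s := 2 - _ in h2 *.
have -> : Num.max 0 s = s by apply/max_idPr; move: h2; lra.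
have -> : Num.max 0 (1-s) = 0 by apply/max_idPl; move: h2; lra.
by rewrite subr0.
Qed.

Lemma cut0 X x : 0<X -> X/2<=`|x-X| -> cut X x = 0.
Proof.
move=> X0 h; have h2: 2 - 4 * `|x-X| / X<=0.
  by have : 2<=4 * `|x-X| / X; [rewrite ler_pdivlMr//; move: h; lra|lra].
rewrite /cut; set s := 2 - _ in h2 *.
have -> : Num.max 0 s = 0 by apply/max_idPl.
rewrite subr0.
have -> : Num.max 0 1 = 1 :> R by apply/max_idPr.
by rewrite subrr.
Qed.

Lemma max_lip (c x y : R) : `|Num.max c x-Num.max c y| <= `|x-y|.
Proof.
case: (leP c x)=> h1; case: (leP c y)=> h2; rewrite ?subrr ?normr0//.
- rewrite !ger0_norm; move: h1 h2; lra.
- rewrite !ler0_norm; move: h1 h2; lra.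
Qed.

Lemma cut_lip X x y : 4<=X -> `|cut X x-cut X y| <= `|x-y|.
Proof.
move=> X4; have X0: 0<X by apply: lt_le_trans X4.
rewrite /cut.
have sub1 (u v : R) : 1-u-(1-v) = v-u by ring.
rewrite sub1; apply: le_trans (max_lip _ _ _) _; rewrite sub1; apply: le_trans (max_lip _ _ _) _.
rewrite (_ : 2 - 4 * `|x-X| / X-(2 - 4 * `|y-X| / X) = 4 * `|y-X| / X - 4 * `|x-X| / X); last by ring.
rewrite distrC.
rewrite -mulrBl -mulrBr normrM [X in _*X]ger0_norm ?invr_ge0 ?(ltW X0)// ler_pdivrMr//.
rewrite normrM normr_nat; apply: le_trans (_ : 4 * `|x-y| <= _).
  rewrite ler_pM2l//; apply: le_trans (ler_dist_dist _ _) _.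
  by rewrite opprB addrA subrK.
by rewrite mulrC ler_wpM2l.
Qed.

(** The test function fed to [PNT_smooth]. The quotient [X / max x (X/2)] is a Lipschitz version of
    [X/x], and 7 = 4 + 1 + 2 adds up the Lipschitz contributions of the three factors. *)
Definition phiX (X x : R) : R := 7^-1*(wl sigma (x-X)*(X/Num.max x (X/2))*cut X x).

Lemma frac_max (X x : R) : 0<X -> 0<=X/Num.max x (X/2)<=2.
Proof.
move=> X0; have p0: 0<Num.max x (X/2) by rewrite lt_max divr_gt0 ?orbT.
rewrite divr_ge0 ?(ltW X0) ?(ltW p0)//= ler_pdivrMr//.
have : X/2<=Num.max x (X/2) by rewrite le_max lexx orbT.
by lra.
Qed.

Lemma frac_max_lip (X x x' : R) : 4<=X -> `|X/Num.max x (X/2)-X/Num.max x' (X/2)| <= `|x-x'|.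
Proof.
move=> X4; have X0: 0<X by apply: lt_le_trans X4.
have lo u : X/2<=Num.max u (X/2) by rewrite le_max lexx orbT.
have ml: `|Num.max x' (X/2)-Num.max x (X/2)| <= `|x-x'|.
  by rewrite distrC ![Num.max _ (X/2)]maxC; exact: max_lip.
have := lo x; have := lo x'; move: (Num.max x _) (Num.max x' _) ml=> p q ml q2 p2.
have p0: 0<p by apply: lt_le_trans p2; rewrite divr_gt0.
have q0: 0<q by apply: lt_le_trans q2; rewrite divr_gt0.
apply: le_trans ml; have -> : X / p-X / q=(X/(p*q))*(q-p) by field; rewrite !gt_eqF.
rewrite normrM ler_piMl// ger0_norm ?divr_ge0 ?mulr_ge0 ?(ltW X0) ?(ltW p0) ?(ltW q0)//.
rewrite ler_pdivrMr ?mulr_gt0// mul1r.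
apply: le_trans (_ : X/2*(X/2)<=_); last by rewrite ler_pM ?divr_ge0 ?(ltW X0).
by move: X4; nra.
Qed.

Lemma phiX_props (X : R) : 4<=X -> [/\ forall x, `|phiX X x| <= 1,
  forall x x', `|phiX X x-phiX X x'| <= `|x-x'| &
  forall x, ~~ (X/2<=x<=2*X) -> phiX X x = 0].
Proof.
move=> X4; have X0: 0<X by apply: lt_le_trans X4.
have A0 x : 0<=wl sigma (x-X) by exact: wl_ge0.
have A1 x : wl sigma (x-X)<=1 by exact: wl_le1.
have AL x x' : `|wl sigma (x-X)-wl sigma (x'-X)| <= 2 * `|x-x'|.
  by apply: le_trans (wl_lip hs1 hs2 _ _) _; rewrite opprB addrA subrK.
split=> [x|x x'|x].
- have /andP[b0 b2] := frac_max x X0; have /andP[c0 c1] := cut01 X x.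
  rewrite /phiX ger0_norm; last by apply: mulr_ge0; [rewrite invr_ge0|apply: mulr_ge0=>//; apply: mulr_ge0].
  rewrite ler_pdivrMl// mulr1; apply: le_trans (_ : 1*2*1<=_); last by lra.
  by apply: ler_pM=>//; [exact: mulr_ge0|exact: ler_pM].
- have /andP[b0 b2] := frac_max x X0; have /andP[c0 c1] := cut01 X x.
  have /andP[b0' b2'] := frac_max x' X0; have /andP[c0' c1'] := cut01 X x'.
  have bl := frac_max_lip x x' X4; have cl := cut_lip x x' X4; have al := AL x x'.
  have a0 := A0 x; have a0' := A0 x'; have a1 := A1 x; have a1' := A1 x'.
  rewrite /phiX -mulrBr normrM ger0_norm ?invr_ge0// ler_pdivrMl//.
  move: (wl sigma (x-X)) (wl sigma (x'-X)) (X/Num.max x (X/2)) (X/Num.max x' (X/2)) (cut X x) (cut X x') `|x-x'| b0 b2 c0 c1 b0' b2' c0' c1' bl cl al a0 a0' a1 a1'.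
  move=> A A' B B' c c' d b0 b2 c0 c1 b0' b2' c0' c1' bl cl al a0 a0' a1 a1'.
  have -> : A*B*c-A'*B'*c'=(A-A')*(B*c)+A'*c*(B-B')+A'*B'*(c-c') by ring.
  apply: le_trans (ler_normD _ _) _; apply: le_trans (lerD (ler_normD _ _) (lexx _)) _.
  rewrite !normrM (ger0_norm b0) (ger0_norm c0) (ger0_norm a0') (ger0_norm b0').
  have d0: 0<=d by exact: le_trans (normr_ge0 _) bl.
  have h1: `|A-A'| * (B*c)<=2*d*(2*1) by apply: ler_pM; rewrite ?mulr_ge0// ler_pM.
  have h2: A'*c * `|B-B'| <= 1*1*d by apply: ler_pM; rewrite ?mulr_ge0// ler_pM.
  have h3: A'*B' * `|c-c'| <= 1*2*d by apply: ler_pM; rewrite ?mulr_ge0// ler_pM.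
  by move: h1 h2 h3; lra.
- rewrite negb_and -!ltNge=> h; rewrite /phiX cut0 ?mulr0//.
  case/orP: h=> h; first by rewrite ler0_norm; move: h X0; lra.
  by rewrite ger0_norm; move: h X0; lra.
Qed.

Lemma wl_term y n : 1<=y -> (0<n)%N ->
  n%:R^-1*wl sigma (lnn R n-ln y) = y^-1 * lb (uk sigma (y`^sigma) n).
Proof.
move=> y1 n0; have y0 := lt_le_trans ltr01 y1.
rewrite /wl expRD expRN /lnn !lnK ?posrE ?ltr0n// mulrA mulrA mulVf ?mul1r ?pnatr_eq0 -?lt0n//.
congr (_ * lb _); rewrite /uk /powR (gt_eqF y0) pnatr_eq0 eqn0Ngt n0/= -expRD.
by congr expR; ring.
Qed.

Lemma ln2_ge : 2^-1<=ln 2 :> R.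
Proof.
have : ln (1 + - 2^-1) <= - 2^-1 :> R by apply: le_ln1Dx; lra.
rewrite (_ : 1 + - 2^-1 = 2^-1 :> R); last by lra.
by rewrite lnV ?posrE//; lra.
Qed.

(** Replaces [M / v], the weight of [n] with [v = ln n], by [1/X] plus the part seen by the prime
    number theorem. Near [X] the difference is exactly [(X - v)/(v X)]. Far from it the difference
    is at most 5, while [(v - X)^2] is at least [X^2/16]. *)
Lemma weight_error (M v w X : R) : 0<=M -> M<=v -> 2^-1<=v -> 4<=X -> 0<=w -> w<=1 ->
  (`|v-X| <= X/4 -> w = 1) ->
  `|M / v-X^-1-(M - 1)*(w/Num.max v (X/2))| <= 100/X^+2*(1+(v-X)^+2).
Proof.
move=> La Lb v2' X4 c0 c1 w1; set Mx := Num.max _ _; set v2 := (v-X)^+2.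
have v0: 0<v by apply: lt_le_trans v2'.
have Xp: 0<X by apply: lt_le_trans X4.
have X2: 0<X^+2 by rewrite exprn_gt0.
have v20: 0<=v2 by rewrite sqr_ge0.
have Mx0: 0<Mx by rewrite lt_max v0.
rewrite mulrAC ler_pdivlMr//.
have r1: 0<=M / v<=1.
  by rewrite divr_ge0 ?(ltW v0)//= ler_pdivrMr// mul1r.
have iX: 0<=X^-1<=1.
  by rewrite invr_ge0 (ltW Xp)/= invf_le1//; move: X4; lra.
have [near|far] := lerP `|v-X| (X/4).
  have cE: w = 1 by exact: w1.
  have lx: 3/4*X<=v by move: near; rewrite ler_norml=> /andP[]; lra.
  have MxE: Mx = v by apply/max_idPl; move: lx Xp; lra.
  rewrite cE MxE mul1r (_ : _ - _ - _=(X-v)/(v*X)); last first.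
    by field; rewrite !gt_eqF.
  rewrite normrM [X in _*X * _]ger0_norm ?invr_ge0 ?mulr_ge0 ?(ltW v0) ?(ltW Xp)// distrC.
  have d2: `|v-X| <= 1+v2.
    by rewrite /v2 -(real_normK (num_real (v-X))); move: `|v-X| => d; nra.
  apply: le_trans (_ : `|v-X| * 2<=_); last by move: d2 v20; lra.
  rewrite -mulrA ler_wpM2l// ler_pdivrMl ?mulr_gt0// expr2 mulrAC ler_wpM2r ?(ltW Xp)//.
  by move: lx; lra.
have v2b: X^+2<=16 * v2.
  have : (X/4)^+2<=`|v-X| ^+ 2 by rewrite lerXn2r ?nnegrE ?divr_ge0 ?(ltW Xp)// ltW.
  by rewrite (real_normK (num_real _)) -/v2 expr_div_n (_ : 4^+2 = 16 :> R); [lra|ring].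
have B6: `|M / v-X^-1-(M - 1)*(w/Mx)| <= 5.
  have cM: 0<=w/Mx<=2.
    rewrite divr_ge0 ?(ltW Mx0)//= ler_pdivrMr//; have : 2^-1<=Mx by rewrite le_max v2'.
    by move: c1; lra.
  have mM: M*(w/Mx)<=1.
    have : v<=Mx by rewrite le_max lexx.
    move=> lM; rewrite mulrA ler_pdivrMr// mul1r; apply: le_trans lM; apply: le_trans Lb.
    by rewrite ler_piMr.
  have mM0: 0<=M*(w/Mx) by rewrite mulr_ge0// divr_ge0// ltW.
  rewrite mulrBl mul1r ler_norml; move: (M / v) (X^-1) (M*(w/Mx)) (w/Mx) r1 iX cM mM mM0.
  by move=> p q r s /andP[? ?] /andP[? ?] /andP[? ?] *; apply/andP; split; lra.
apply: le_trans (ler_wpM2r (ltW X2) B6) _; move: v2b v20; lra.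
Qed.

(** The relevant primes have [ln p] near [X = ln y], so the density [1/ln p] may be replaced by
    [1/X]; [moment] prices the deviation. The condition [y^2 <= z] makes the test function vanish
    beyond [z]. All errors are [O(y / X^2)]. *)
Lemma Fz_asymp_y : exists C y0 : R, [/\ 0<=C, 1<=y0 & forall y z, y0<=y -> y^+2<=z%:R ->
  `|Fz sigma z (y`^sigma)-a*y*G1 sigma / ln y| <= C*y / ln y^+2].
Proof.
have [C1 [X0 [C10 X01 HP]]] := @PNT_smooth R.
have [C2 C20 HM] := moment hs1 hs2; have [C3 C30 HPP] := prime_powers hs1.
have [C4 C40 HS] := SN_G1.
have e1: 0<1-sigma by rewrite subr_gt0.
have e2: 0<2*sigma - 1 by move: hs1; lra.
have [C5 C51 H5] := ln_pow_le 2 e1; have [C6 C61 H6] := ln_pow_le 2 e2.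
have C50 := le_trans ler01 C51; have C60 := le_trans ler01 C61.
exists (7*C1+100*C2+C3*C5+C4*(C5+C6)), (expR (Num.max 4 X0)); split.
- by nneg.
- by rewrite -[X in X<=_]expR0 ler_expR le_max ler0n.
move=> y z yy yz.
have y1: 1<=y by apply: le_trans yy; rewrite -[X in X<=_]expR0 ler_expR le_max ler0n.
have y0 := lt_le_trans ltr01 y1.
set X := ln y.
have : Num.max 4 X0<=X by rewrite -ler_expR /X lnK.
rewrite ge_max=> /andP[X4 XX0].
have Xp: 0<X by apply: lt_le_trans X4.
pose k := y`^sigma.
have k1: 1<=k by rewrite /k -[X in X<=_](powRr0 y) ler_powR// ltW.
have k0 := lt_le_trans ltr01 k1.
have z0: (0<z)%N by rewrite -(ltr0n R); apply: lt_le_trans yz; rewrite exprn_gt0.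
pose l n := lb (uk sigma k n); have l0 n : 0<=l n by exact: lb_ge0.
have [p1 p2 p3] := phiX_props X4.
have [N1 HN1] := HP X (phiX X) XX0 p1 p2 p3.
pose c n := cut X (lnn R n).
have pnt: `|\sum_(1<=n<z.+1) (mangoldt R n - 1) * l n*(c n/Num.max (lnn R n) (X/2))| <= 7*C1*y/X^+2.
  have := HN1 (maxn N1 z) (leq_maxl _ _).
  rewrite (@big_cat_nat _ _ _ z.+1)//= ?ltnS ?leq_maxr// [X in _+X]big_nat_cond [X in _+X]big1 ?addr0; last first.
    move=> n /andP[/andP[zn _] _]; have n0 := leq_ltn_trans (leq0n _) zn.
    rewrite p3 ?mulr0// negb_and -!ltNge; apply/orP; right.
    have -> : 2*X = ln (y^+2) by rewrite lnXn// mulr_natl.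
    by rewrite ltr_ln ?posrE ?exprn_gt0 ?ltr0n//; apply: le_lt_trans yz _; rewrite ltr_nat.
  have -> : \sum_(1<=n<z.+1) (mangoldt R n - 1) / n%:R * phiX X (lnn R n) =
     (X/(7*y)) * \sum_(1<=n<z.+1) (mangoldt R n - 1) * l n*(c n/Num.max (lnn R n) (X/2)).
    rewrite big_distrr/=; apply: eq_big_nat=> n /andP[n0 _]; have := wl_term y1 n0; rewrite -/X -/k -/(l n)=> h.
    rewrite /phiX -/(c n) (_ : _ / _ * _ = 7^-1*(mangoldt R n - 1)*(n%:R^-1*wl sigma (lnn R n-X)) *
        (X/Num.max (lnn R n) (X/2))*c n); last by ring.
    rewrite h; have : Num.max (lnn R n) (X/2) != 0 by rewrite gt_eqF// lt_max divr_gt0 ?orbT.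
    move: (Num.max _ _) (mangoldt R n) (l n) (c n)=> M m ll cc M0; field; rewrite M0 gt_eqF//.
  rewrite normrM (ger0_norm (divr_ge0 (ltW Xp) (mulr_ge0 (ler0n _ _) (ltW y0)))).
  set S := `|_|; rewrite -ler_pdivlMl ?divr_gt0 ?mulr_gt0// => /le_trans; apply.
  by apply: eq_ler; field; rewrite !gt_eqF.
pose T1 := \sum_(1<=n<z.+1) rz R z n * l n.
have t1: `|T1-SN sigma k z/X| <= (7*C1+100*C2)*y/X^+2.
  have -> : T1-SN sigma k z/X =
     \sum_(1<=n<z.+1) (mangoldt R n - 1) * l n*(c n/Num.max (lnn R n) (X/2)) +
     \sum_(1<=n<z.+1) (rz R z n * l n-l n/X-(mangoldt R n - 1) * l n*(c n/Num.max (lnn R n) (X/2))).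
    rewrite !sumrB addrCA subrr addr0 /T1 /SN; congr (_ - _).
    by rewrite big_distrl.
  apply: le_trans (ler_normD _ _) _.
  rewrite [X in _<=X](_ : _ = 7*C1*y/X^+2+100*C2*y/X^+2); last by ring.
  apply: lerD; first exact: pnt.
  apply: le_trans (ler_norm_sum _ _ _) _.
  apply: le_trans (_ : \sum_(1<=n<z.+1) 100/X^+2*(l n*(1+(lnn R n-X)^+2))<=_); last first.
    rewrite -big_distrr/=.
    have q0: 0<=100/X^+2 by rewrite divr_ge0// exprn_ge0// ltW.
    apply: le_trans (ler_wpM2l q0 (HM y z y1)) _.
    by apply: eq_ler; ring.
  apply: ler_sum_nat=> n /andP[n0 nz].
  have X2: 0<X^+2 by rewrite exprn_gt0.
  rewrite [X in _<=X]mulrCA; set v2 := (lnn R n-X)^+2; have v20: 0<=v2 by rewrite sqr_ge0.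
  pose Mx := Num.max (lnn R n) (X/2).
  have [n1|n1] := leqP n 1.
    have nE: n = 1%N by apply/eqP; rewrite eqn_leq n1 n0.
    have c0': c n = 0.
      by rewrite /c nE /lnn ln1; apply: cut0=>//; rewrite sub0r normrN gtr0_norm//; lra.
    rewrite c0' mul0r mulr0 subr0 /rz nE/= mul0r sub0r normrN ger0_norm ?divr_ge0 ?(ltW Xp)//.
    rewrite -nE; apply: ler_wpM2l=>//; rewrite /v2 nE /lnn ln1 sub0r sqrrN.
    rewrite ler_pdivrMr || idtac.
    rewrite mulrAC ler_pdivlMr// ; apply: le_trans (_ : X<=_); last by move: X4; nra.
    by rewrite expr2 mulrA mulVf ?mul1r// gt_eqF.
  have ln0: 0<lnn R n by exact: lnn_gt0.
  have ln2: 2^-1<=lnn R n.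
    by apply: le_trans ln2_ge _; rewrite ler_ln ?posrE ?ltr0n// ler_nat.
  have La := mangoldt_ge0 R n; have Lb := mangoldt_le_lnn R n.
  have /andP[c0 c1] := cut01 X (lnn R n); rewrite -/(c n) in c0 c1.
  have rzE: rz R z n = mangoldt R n / lnn R n by rewrite /rz n1 -ltnS nz.
  have Mx0: 0<Mx by rewrite lt_max ln0.
  have key: `|rz R z n-X^-1-(mangoldt R n - 1)*(c n/Mx)| <= 100/X^+2*(1+v2).
    by rewrite rzE; apply: weight_error=>//; exact: cut1.
  rewrite (_ : rz R z n * l n - _ - _ = l n*(rz R z n-X^-1-(mangoldt R n - 1)*(c n/Mx))); last by rewrite /Mx; ring.
  by rewrite normrM (ger0_norm (l0 n)) ler_wpM2l.
have t2 := HPP k z k1; have t3 := HS y z y1 yz; rewrite -/k -/T1 in t2 t3.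
have X2: 0<X^+2 by rewrite exprn_gt0.
have lX: X^+2<=(1+X)^+2 by rewrite lerXn2r ?nnegrE ?addr_ge0 ?(ltW Xp)// lerDr.
have k5: k<=C5*y/X^+2.
  rewrite ler_pdivlMr//; apply: le_trans (ler_wpM2l (ltW k0) (le_trans lX (H5 y y1))) _.
  rewrite mulrCA ler_wpM2l// /k -powRD ?(gt_eqF y0) ?implybT//.
  by rewrite addrC subrK powRr1// ltW.
have k6: y`^(2 - 2*sigma)<=C6*y/X^+2.
  rewrite ler_pdivlMr//; apply: le_trans (ler_wpM2l (powR_ge0 _ _) (le_trans lX (H6 y y1))) _.
  rewrite mulrCA ler_wpM2l// -powRD ?(gt_eqF y0) ?implybT//.
  by rewrite (_ : 2 - 2*sigma+(2*sigma - 1) = 1) ?powRr1 ?(ltW y0)//; ring.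
have -> : Fz sigma z k-a*y*G1 sigma/X =
   - (T1-Fz sigma z k)+(T1-SN sigma k z/X)+(SN sigma k z-a*y*G1 sigma)/X by ring.
apply: le_trans (ler_normD _ _) _; apply: le_trans (lerD (ler_normD _ _) (lexx _)) _.
rewrite normrN normrM [`|X^-1|]ger0_norm ?invr_ge0 ?(ltW Xp)//.
have t4: `|SN sigma k z-a*y*G1 sigma| / X<=C4*(C5+C6)*y/X^+2.
  apply: le_trans (_ : `|SN sigma k z-a*y*G1 sigma| <= _).
    by rewrite ler_piMr// invf_le1//; move: X4; lra.
  apply: le_trans t3 _; rewrite [X in _<=X](_ : _ = C4*(C5*y/X^+2+C6*y/X^+2)); last by ring.
  by rewrite ler_wpM2l// lerD.
have t5: C3*k<=C3*C5*y/X^+2 by rewrite -!mulrA ler_wpM2l// mulrA.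
rewrite [X in _<=X](_ : _ = C3*C5*y/X^+2+(7*C1+100*C2)*y/X^+2+C4*(C5+C6)*y/X^+2); last by ring.
by apply: lerD t4; apply: lerD t1; apply: le_trans t2 t5.
Qed.

Lemma Fz_asymp : exists C k0 : R, [/\ 0<=C, 1<k0 & forall k z, k0<=k -> k`^(2*a)<=z%:R ->
  `|Fz sigma z k-G1 sigma*k`^a / ln k| <= C*k`^a / ln k^+2].
Proof.
have [C [y0 [C0 y01 H]]] := Fz_asymp_y.
have a0: 0<a by rewrite invr_gt0.
exists (C*sigma^+2), (Num.max (y0`^sigma) 2); split.
- by nneg.
- by rewrite lt_max ltr1n orbT.
move=> k z; rewrite ge_max=> /andP[ky k2] kz.
have k0: 0<k by apply: lt_le_trans k2.
have k1: 1<k by apply: lt_le_trans k2; rewrite ltr1n.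
have as1: a*sigma = 1 by rewrite mulVf// gt_eqF.
have yk: (k`^a)`^sigma = k by rewrite -powRrM as1 powRr1// ltW.
have y0k: y0<=k`^a.
  have -> : y0=(y0`^sigma)`^a by rewrite -powRrM mulrC as1 powRr1// (le_trans ler01).
  by rewrite ge0_ler_powR ?nnegrE ?powR_ge0 ?(ltW a0) ?(ltW k0).
have yz: (k`^a)^+2<=z%:R by rewrite -powR_mulrn ?powR_ge0// -powRrM mulrC.
have := H _ z y0k yz; rewrite yk ln_powR.
have lk: 0<ln k by exact: ln_gt0.
rewrite (_ : a*k`^a*G1 sigma/(a * ln k) = G1 sigma*k`^a / ln k); last first.
  by field; rewrite !gt_eqF.
move=> h; apply: le_trans h _; apply: eq_ler.
rewrite exprMn /a; field; rewrite !gt_eqF//.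
Qed.
End FzAsymptotics.

(** * Mean squares and high moments of Dirichlet polynomials *)

Section ComplexBounded.
Variables (R : realType) (T : R).
Hypothesis T0 : 0<T.
Implicit Types (F G : R -> R[i]).

Definition cbm F := bm T (fun t=> Re (F t)) /\ bm T (fun t=> Im (F t)).

Lemma eq_cbm F G : F =1 G -> cbm F -> cbm G.
Proof. by move=> /funext ->. Qed.

Lemma cbm_cst (c : R[i]) : cbm (fun=> c).
Proof. by split; exact: bm_cst. Qed.

Lemma cbmD F G : cbm F -> cbm G -> cbm (fun t=> F t+G t).
Proof.
move=> [f1 f2] [g1 g2]; split.
  by rewrite (_ : (fun t=> _) = fun t=> Re (F t)+Re (G t)); [exact: bmD|apply/funext=> t; rewrite ReD].
by rewrite (_ : (fun t=> _) = fun t=> Im (F t)+Im (G t)); [exact: bmD|apply/funext=> t; rewrite ImD].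
Qed.

Lemma bmB (f g : R -> R) : bm T f -> bm T g -> bm T (fun t=> f t-g t).
Proof.
move=> bf bg; rewrite (_ : (fun t=> _) = fun t=> f t+(-1) * g t); first by apply: bmD=>//; exact: bmZ.
by apply/funext=> t; rewrite mulN1r.
Qed.

Lemma cbmM F G : cbm F -> cbm G -> cbm (fun t=> F t*G t).
Proof.
move=> [f1 f2] [g1 g2]; split.
  rewrite (_ : (fun t=> _) = fun t=> Re (F t)*Re (G t)-Im (F t)*Im (G t)).
    by apply: bmB; exact: bmM.
  by apply/funext=> t; rewrite ReM.
rewrite (_ : (fun t=> _) = fun t=> Re (F t)*Im (G t)+Im (F t)*Re (G t)).
  by apply: bmD; exact: bmM.
by apply/funext=> t; rewrite ImM.
Qed.

Lemma cbmX F n : cbm F -> cbm (fun t=> F t^+n).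
Proof.
move=> bF; elim: n=> [|n IH]; first by apply: eq_cbm (cbm_cst 1)=> t; rewrite expr0.
by apply: eq_cbm (cbmM bF IH)=> t; rewrite exprS.
Qed.

Lemma cbm_sum (I : Type) (s : seq I) (F : I -> R -> R[i]) :
  (forall i, cbm (F i)) -> cbm (fun t=> \sum_(i <- s) F i t).
Proof.
move=> bF; elim: s=> [|i s IH]; first by apply: eq_cbm (cbm_cst 0)=> t; rewrite big_nil.
by apply: eq_cbm (cbmD (bF i) IH)=> t; rewrite big_cons.
Qed.

Lemma cbm_nst (s : R) n : cbm (fun t=> nst s t n).
Proof.
apply: cbmM; first exact: cbm_cst.
split.
  rewrite (_ : (fun t=> _) = fun t=> cos (lnn R n * t+0)); first exact: bm_cos.
  by apply/funext=> t; rewrite addr0 mulrC /nit /cis/= cosN.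
rewrite (_ : (fun t=> _) = fun t=> cos (lnn R n * t+pi/2)); first exact: bm_cos.
by apply/funext=> t; rewrite /nit /cis/= cosDpihalf sinN mulrC.
Qed.

Lemma cbm_Dp (s : R) f N : cbm (fun t=> Dp s t f N).
Proof. by apply: cbm_sum=> n; apply: cbmM; [exact: cbm_cst|exact: cbm_nst]. Qed.

Lemma cbm_Rp (s : R) z : cbm (fun t=> Rp s z t).
Proof. by apply: cbm_sum=> q; exact: cbm_nst. Qed.

Lemma bm_nrm2 F : cbm F -> bm T (fun t=> nrm (F t)^+2).
Proof.
move=> [f1 f2]; rewrite (_ : (fun t=> _) = fun t=> Re (F t)^+2+Im (F t)^+2).
  by apply: bmD; exact: bmX.
by apply/funext=> t; rewrite nrm_sqr.
Qed.

Lemma bm_nrm2k F k : cbm F -> bm T (fun t=> nrm (F t)^+(2*k)).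
Proof. by move=> bF; under eq_fun do rewrite exprM; apply: bmX; exact: bm_nrm2. Qed.

Lemma Dp_mean (s : R) (f : nat -> R) N : (0<N)%N ->
  Ex T (fun t=> nrm (Dp s t f N)^+2) <=
  (1+4*N%:R*(1+lnn R N)/T) * \sum_(1<=n<N.+1) (f n*n%:R`^(- s))^+2.
Proof.
move=> N0; pose b (j : 'I_N) : R := f j.+1 * j.+1%:R`^(- s).
have := @mean_value R T T0 'I_N b (fun j=> j.+1) N; have H1: injective (fun j : 'I_N=> j.+1).
  by move=> i j [] /val_inj.
move=> /(_ H1 (fun j=> ltn_ord j)); rewrite ler_norml=> /andP[_].
have -> : (\sum_(1<=n<N.+1) (f n*n%:R`^(- s))^+2) = \sum_j b j^+2.
  by rewrite big_add1 /= big_mkord.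
move=> h; rewrite [X in _<=X]mulrDl mul1r -lerBlDl; apply: le_trans h; rewrite lerD2r; apply: eq_ler.
apply: eq_Ex=> t _; congr (nrm _^+2); rewrite /Dp big_add1/= big_mkord; apply: eq_bigr=> j _.
by rewrite /nst mulrA -rmorphM.
Qed.

Lemma one_lnn_le (N : nat) : (0<N)%N -> 1+lnn R N<=N%:R.
Proof.
move=> N0; have : ln (1+(N%:R - 1))<=N%:R - 1 :> R.
  by apply: le_ln1Dx; rewrite ltrBrDl subrr ltr0n.
by rewrite addrC subrK /lnn=> h; rewrite -lerBrDl.
Qed.

Lemma Dp_mean_short (s : R) (f : nat -> R) N : (0<N)%N -> N%:R^+2<=T ->
  Ex T (fun t=> nrm (Dp s t f N)^+2)<=5 * \sum_(1<=n<N.+1) (f n*n%:R`^(- s))^+2.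
Proof.
move=> N0 NT; apply: le_trans (Dp_mean _ _ N0) _; apply: ler_wpM2r.
  by apply: sumr_ge0=> n _; exact: sqr_ge0.
suff : 4*N%:R*(1+lnn R N)/T<=4 by lra.
rewrite ler_pdivrMr// -mulrA ler_wpM2l//; apply: le_trans NT; rewrite expr2 ler_wpM2l//.
exact: one_lnn_le.
Qed.

Lemma Dp_tail_sum (s : R) (f : nat -> R) (M N : nat) (K e : R) : (0<M)%N -> 0<=K ->
  1<2*(s-e) -> (forall n, (n<=M)%N -> f n = 0) ->
  (forall n, (0<n)%N -> `|f n| <= K*n%:R`^e) ->
  \sum_(1<=n<N.+1) (f n*n%:R`^(- s))^+2 <=
  K^+2*(M%:R`^(1 - 2*(s-e))/(2*(s-e) - 1)).
Proof.
move=> M0 K0 b1 f0 fK; set b := 2*(s-e).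
have tail: \sum_(M.+1<=n<N.+1) (f n*n%:R`^(- s))^+2<=K^+2*(M%:R`^(1-b)/(b - 1)).
  apply: le_trans (ler_wpM2l (sqr_ge0 K) (sum_tail N b1 M0)); rewrite big_distrr/=.
  apply: ler_sum_nat=> n /andP[Mn _]; have n0 := leq_ltn_trans (leq0n _) Mn.
  rewrite -[X in X<=_](real_normK (num_real _)) normrM [X in _*X]ger0_norm ?powR_ge0//.
  apply: le_trans (_ : (K*n%:R`^e*n%:R`^(- s))^+2<=_).
    by rewrite lerXn2r ?nnegrE ?mulr_ge0 ?powR_ge0// ler_wpM2r ?powR_ge0// fK.
  rewrite -mulrA -powRD ?pnatr_eq0 -?lt0n ?n0 ?implybT// exprMn -[(n%:R`^_)^+2]powR_mulrn ?powR_ge0// -powRrM.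
  by apply: eq_ler; congr (_ * _`^_); rewrite /b; ring.
have [NM|MN] := leqP N M.
  rewrite big_nat_cond big1 ?mulr_ge0 ?sqr_ge0 ?invr_ge0 ?powR_ge0 ?subr_ge0 ?(ltW b1)//.
  by move=> n /andP[/andP[_ nN] _]; rewrite f0 ?mul0r ?expr0n// (leq_trans _ NM)// -ltnS.
rewrite (@big_cat_nat _ _ _ M.+1)//=; last by rewrite ltnS ltnW.
rewrite big_nat_cond big1 ?add0r// => n /andP[/andP[_ nM] _].
by rewrite f0 ?mul0r ?expr0n// -ltnS.
Qed.

Lemma cpow_low (f : nat -> R) M k n : (forall n, (n<=M)%N -> f n = 0) ->
  (n<M.+1 ^ k)%N -> cpow f k n = 0.
Proof.
move=> f0; elim: k n=> [|k IH] n; first by rewrite expn0 ltnS leqn0=> /eqP ->; rewrite /= /delta1.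
move=> nk /=; rewrite /conv big1// => a _; rewrite big1// => b _.
case: eqP=> [abn|_]; last by rewrite mul0r.
have [aM|Ma] := leqP a M; first by rewrite f0// mul0r mulr0.
rewrite IH ?mulr0 ?mulr0//.
rewrite ltnNge; apply/negP=> h; move: nk; rewrite -abn expnS ltnNge; move/negP; apply.
exact: leq_mul.
Qed.

Lemma cpow_le (f g : nat -> R) k n : (forall n, 0<=f n<=g n) -> cpow f k n<=cpow g k n.
Proof.
move=> fg; elim: k n=> [|k IH] n //=; apply: le_conv=> a _; first exact: fg.
by rewrite IH andbT; apply: cpow_ge0=> b; case/andP: (fg b).
Qed.

(** The [k]-th power of a polynomial supported beyond [M] is supported beyond [M^k], and its
    coefficients are still at most [n^rho]. Thus the moment of order [2k] is tiny as long as the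
    power has length at most [sqrt T]. *)
Lemma Dp_moment (s rho : R) (z : nat) (f : nat -> R) (M N k : nat) :
  (0<z)%N -> (0<M)%N -> (0<N)%N -> (0<k)%N -> 0<=rho -> 1<2*(s-rho) ->
  (forall n, 0<=f n<=cz R z n) -> (forall n, (n<=M)%N -> f n = 0) ->
  (forall n, (N<n)%N -> f n = 0) ->
  k%:R<=z%:R`^rho -> (N ^ k)%:R^+2<=T ->
  Ex T (fun t=> nrm (Dp s t f N)^+(2*k)) <=
  5*((M ^ k)%:R`^(1 - 2*(s-rho))/(2*(s-rho) - 1)).
Proof.
move=> z0 M0 N0 k0 r0 b1 fc fM fN kz NT.
rewrite (@eq_Ex _ _ _ (fun t=> nrm (Dp s t (cpow f k) (N ^ k))^+2)); last first.
  by move=> t _; rewrite -Dp_cpow// nrmX -exprM mulnC.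
have Nk0: (0<N ^ k)%N by rewrite expn_gt0 N0.
apply: le_trans (Dp_mean_short _ _ Nk0 NT) _; rewrite ler_wpM2l//.
have := @Dp_tail_sum s (cpow f k) (M ^ k) (N ^ k) 1 rho; rewrite expr1n mul1r; apply=>//.
- by rewrite expn_gt0 M0.
- by move=> n nM; apply: (@cpow_low f M)=>//; apply: leq_ltn_trans nM _; rewrite ltn_exp2r.
move=> n n0; rewrite mul1r ger0_norm; last by apply: cpow_ge0=> b; case/andP: (fc b).
by apply: le_trans (cpow_le _ _ fc) _; exact: cpow_cz_le.
Qed.
End ComplexBounded.

Lemma Dp_tail_sum_d (R : realType) (s : R) (f : nat -> R) (M N : nat) (K e d : R) : (0<M)%N -> 0<=K ->
  0<d -> 2*(s-e) = 1+d -> (forall n, (n<=M)%N -> f n = 0) ->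
  (forall n, (0<n)%N -> `|f n| <= K*n%:R`^e) ->
  \sum_(1<=n<N.+1) (f n*n%:R`^(- s))^+2<=K^+2*(M%:R`^(- d) / d).
Proof.
move=> M0 K0 d0 dE f0 fK.
have b1: 1<2*(s-e) by rewrite dE ltrDl.
have := Dp_tail_sum N M0 K0 b1 f0 fK; rewrite dE.
have -> : 1-(1+d) = - d by ring.
by have -> : 1+d - 1 = d by ring.
Qed.

Lemma pred_exp2_gt0 I : (0<I)%N -> (0<(2 ^ I).-1)%N.
Proof. move=> I0; by rewrite -ltnS prednK ?expn_gt0// -(prednK I0) expnS (leq_trans (_ : 1<2*1)%N)// leq_mul// expn_gt0. Qed.

(** * The mollifier identity *)

Section MollifierIdentity.
Variable R : realType.

Definition alt (n : nat) : R := (-1)^+n.+1.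
(** The coefficients of [1 - 2^(1-s)], the factor between zeta and the alternating series. *)
Definition epsf (n : nat) : R := (n == 1)%N%:R - 2*(n == 2)%N%:R.

Lemma sum_dvd_pick (n c : nat) : (0<n)%N -> (0<c)%N ->
  \sum_(1<=d<n.+1 | (d %| n)%N) (d == c)%N%:R=(c %| n)%N%:R :> R.
Proof.
move=> n0 c0; rewrite big_mkcond/=; have [cn|cn] := leqP c n.
  rewrite (bigD1_seq c) ?iota_uniq ?mem_index_iota ?c0 ?ltnS//= eqxx big1 ?addr0; last first.
    by move=> d /negbTE ->; case: ifP.
  by case: ifP.
rewrite big_nat_cond big1; last first.
  move=> d /andP[/andP[_ dn] _]; case: ifP=>// _; case: eqP=>// dc; move: dn.
  by rewrite dc ltnS leqNgt cn.
by case: (boolP (c %| n)%N)=>// /(dvdn_leq n0); rewrite leqNgt cn.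
Qed.

Lemma alt_conv n : (0<n)%N -> alt n = conv epsf (one_fun R) n.
Proof.
move=> n0; rewrite conv_divisors//; under eq_bigr do rewrite /one_fun mulr1 /epsf.
rewrite sumrB -big_distrr/= !sum_dvd_pick// dvd1n dvdn2 /alt exprS -signr_odd.
by case: (odd n)=> /=; rewrite ?expr1 ?expr0; ring.
Qed.

Lemma norm_alt n : `|alt n| <= 1.
Proof. by rewrite /alt normrX normrN1 expr1n. Qed.

Lemma norm_epsf n : `|epsf n| <= 2.
Proof.
rewrite /epsf; case: eqP=> [->|_] /=; first by rewrite mulr0 subr0 normr1; lra.
by case: eqP=> _; rewrite ?mulr1 ?mulr0 sub0r normrN ?normr0// ger0_norm.
Qed.

Variables (z I N Y : nat).
Hypotheses (z2 : (1<z)%N) (I0 : (0<I)%N) (YE : Y=(2 ^ I).-1) (YN : (Y<=N)%N) (N2 : (1<N)%N).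
Let Z := (z ^ I)%N.

(** The remainder when eta times the mollifier is replaced by [1 - 2^(1-s)] times the part [n <= Y]
    of the mollified series. [Y = 2^I - 1] is the last index up to which [mI] is guaranteed exact,
    so the remainder starts beyond [Y]. *)
Definition rho (n : nat) : R :=
  conv (trunc N alt) (trunc Z (mI R z I)) n-conv (trunc 2 epsf) (trunc Y (cz R z)) n.

Let Y2 : (Y<2 ^ I)%N. Proof. by rewrite YE prednK// expn_gt0. Qed.
Let YZ : (Y<=Z)%N. Proof. by apply: ltnW; apply: leq_trans Y2 _; rewrite leq_exp2r. Qed.

Lemma rho_small n : (n<=Y)%N -> rho n = 0.
Proof.
case: n=> [_|n nY]; first by rewrite /rho !conv0 subr0.
rewrite /rho conv_trunc2 ?(leq_trans nY)//.
rewrite (_ : conv (trunc 2 epsf) _ _ = conv epsf (cz R z) n.+1).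
  rewrite (@eq_conv _ alt (conv epsf (one_fun R)) (mI R z I) (expz z (-1))).
  - by rewrite convA subrr.
  - by move=> a /andP[a0 _]; exact: alt_conv.
  - by move=> a /andP[_ an]; apply: mI_eq; apply: leq_ltn_trans an (leq_ltn_trans nY Y2).
apply: eq_conv=> a /andP[a0 an]; rewrite /trunc.
  case: leqP=> a2; rewrite ?mul1r// mul0r /epsf.
  by rewrite !gtn_eqF ?mulr0 ?subr0// ltnW.
by rewrite (leq_trans an nY) mul1r.
Qed.

Lemma norm_rho n : `|rho n| <= 3*dvn R n.
Proof.
apply: le_trans (ler_normB _ _) _; rewrite (_ : 3*dvn R n = dvn R n+2*dvn R n); last by ring.
apply: lerD.
  apply: le_conv_dvn=> a; apply: norm_trunc=> b; [exact: norm_alt|exact: norm_mI_le1].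
rewrite -convZl; apply: le_norm_conv=> a _.
  rewrite /trunc normrM /one_fun mulr1; case: leqP=> _; rewrite ?normr1 ?normr0 ?mul1r ?mul0r//.
  exact: norm_epsf.
rewrite /one_fun; apply: norm_trunc=> b; rewrite ger0_norm ?cz_ge0// cz_le1//.
exact: ltnW.
Qed.

Lemma mollifier_identity (s t : R) :
  Dp s t alt N*Dp s t (mI R z I) Z =
  Dp s t epsf 2*Dp s t (cz R z) Y+Dp s t rho (N*Z).
Proof.
have NZ: (2*Y<=N*Z)%N by apply: leq_mul.
rewrite !DpM (@Dp_widen _ _ _ _ (2*Y) (N*Z))//.
  rewrite /Dp -big_split/=; apply: eq_bigr=> n _; rewrite -mulrDl -rmorphD; congr (_%:C * _).
  by rewrite /rho; ring.
move=> n nY; rewrite /conv big1// => a _; rewrite big1// => b _.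
case: eqP=> [abn|_]; last by rewrite mul0r.
rewrite /trunc; have [a2|] := leqP a 2; last by rewrite !mul0r mulr0.
have [bY|] := leqP b Y; last by rewrite !mul0r !mulr0.
by move: nY; rewrite -abn ltnNge leq_mul.
Qed.

Lemma Dp_epsf (s t : R) : Dp s t epsf 2 = 1 - 2*nst s t 2.
Proof.
rewrite /Dp big_nat_recr//= big_nat1 nst1 /epsf/= !(mulr0, mulr1, subr0, sub0r).
by congr (_ + _); rewrite rmorphN mulNr rmorph_nat.
Qed.

Definition rhol (M n : nat) : R := if (n<=M)%N then rho n else 0.
Definition rhoh (M n : nat) : R := if (n<=M)%N then 0 else rho n.

Lemma Dp_rho_split (s t : R) M : (M<=N*Z)%N ->
  Dp s t rho (N*Z) = Dp s t (rhol M) M+Dp s t (rhoh M) (N*Z).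
Proof.
move=> MN; rewrite (@Dp_widen _ _ _ (rhol M) M (N*Z))//; last first.
  by move=> n nM; rewrite /rhol leqNgt nM.
rewrite /Dp -big_split/=; apply: eq_bigr=> n _; rewrite -mulrDl -rmorphD; congr (_%:C * _).
by rewrite /rhol /rhoh; case: ifP=> _; rewrite ?addr0 ?add0r.
Qed.

(** Below [M] the polynomial is short and its mean square is diagonal, starting at [Y]. Above [M]
    the loss due to the length is to be compensated by [M^(-d1)]. *)
Lemma rem_mean (sigma CD T : R) M : 2^-1<sigma -> 0<T -> 0<=CD ->
  (forall n, (0<n)%N -> dvn R n<=CD*n%:R`^((2*sigma - 1)/8)) ->
  (0<M)%N -> (M<=N*Z)%N -> M%:R^+2<=T -> forall d1, d1 = 3/4*(2*sigma - 1) ->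
  Ex T (fun t=> nrm (Dp sigma t rho (N*Z))^+2) <=
  90*CD^+2 / d1*(Y%:R`^(- d1)+(1+4*(N*Z)%:R*(1+lnn R (N*Z))/T)*M%:R`^(- d1)).
Proof.
move=> s1 T0 CD0 HD M0 MN MT d1 d1E.
have d10: 0<d1 by rewrite d1E; move: s1; lra.
have Y0: (0<Y)%N.
  by rewrite YE pred_exp2_gt0.
have Z0: (0<Z)%N by rewrite expn_gt0 (ltnW z2).
have NZ0: (0<N*Z)%N by rewrite muln_gt0 Z0 (ltnW N2).
have K0: 0<=3*CD by rewrite mulr_ge0.
have rK n : (0<n)%N -> `|rho n| <= 3*CD*n%:R`^((2*sigma - 1)/8).
  by move=> n0; apply: le_trans (norm_rho n) _; rewrite -mulrA ler_wpM2l// HD.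
have bE: 2*(sigma-(2*sigma - 1)/8) = 1+d1 by rewrite d1E; field.
have b1: 1<2*(sigma-(2*sigma - 1)/8) by rewrite bE ltrDl.
have lo: Ex T (fun t=> nrm (Dp sigma t (rhol M) M)^+2)<=5*((3*CD)^+2*(Y%:R`^(- d1) / d1)).
  apply: le_trans (Dp_mean_short T0 _ _ M0 MT) _; rewrite ler_wpM2l//.
  apply: (@Dp_tail_sum_d _ _ _ _ _ _ ((2*sigma - 1)/8))=>//.
    by move=> n nY; rewrite /rhol rho_small//; case: ifP.
  by move=> n n0; rewrite /rhol; case: ifP=> _; rewrite ?rK// normr0 mulr_ge0 ?powR_ge0.
set P := 1+4*(N*Z)%:R*(1+lnn R (N*Z))/T.
have P0: 0<=P by rewrite /P addr_ge0// !mulr_ge0 ?invr_ge0 ?addr_ge0 ?lnn_ge0// ltW.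
have hi: Ex T (fun t=> nrm (Dp sigma t (rhoh M) (N*Z))^+2)<=P*((3*CD)^+2*(M%:R`^(- d1) / d1)).
  apply: le_trans (Dp_mean T0 _ _ NZ0) _; rewrite -/P ler_wpM2l//.
  apply: (@Dp_tail_sum_d _ _ _ _ _ _ ((2*sigma - 1)/8))=>//.
    by move=> n nY; rewrite /rhoh nY.
  by move=> n n0; rewrite /rhoh; case: ifP=> _; rewrite ?rK// normr0 mulr_ge0 ?powR_ge0.
have bl: bm T (fun t=> nrm (Dp sigma t (rhol M) M)^+2) by apply: bm_nrm2; exact: cbm_Dp.
have bh: bm T (fun t=> nrm (Dp sigma t (rhoh M) (N*Z))^+2) by apply: bm_nrm2; exact: cbm_Dp.
apply: le_trans (_ : Ex T (fun t=> 2*nrm (Dp sigma t (rhol M) M)^+2+2*nrm (Dp sigma t (rhoh M) (N*Z))^+2)<=_).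
  apply: Ex_le=>//; first by apply: bm_nrm2; exact: cbm_Dp.
    by apply: bmD=>//; exact: bmZ.
  move=> t _; rewrite (Dp_rho_split _ _ MN).
  have h := nrmD (Dp sigma t (rhol M) M) (Dp sigma t (rhoh M) (N*Z)).
  apply: le_trans (_ : (nrm (Dp sigma t (rhol M) M)+nrm (Dp sigma t (rhoh M) (N*Z)))^+2<=_).
    by rewrite lerXn2r ?nnegrE ?addr_ge0 ?nrm_ge0.
  have gen (x y : R) : (x+y)^+2<=2*x^+2+2*y^+2.
    by have := sqr_ge0 (x-y); rewrite !expr2; lra.
  exact: gen.
rewrite ExD ?ExZ//; [|exact: bmZ|exact: bmZ].
apply: le_trans (lerD (ler_wpM2l _ lo) (ler_wpM2l _ hi)) _=>//.
have u0 := powR_ge0 Y%:R (- d1); have v0 := mulr_ge0 P0 (powR_ge0 M%:R (- d1)).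
move: (Y%:R`^_) (M%:R`^_) u0 v0=> u v u0 v0.
have w0: 0<=CD^+2 / d1 by rewrite divr_ge0 ?sqr_ge0 ?ltW.
rewrite (_ : 2 * _ + _ = CD^+2 / d1*(90*u+18*(P * v))); last by ring.
rewrite [X in _<=X](_ : _ = CD^+2 / d1*(90*u+90*(P * v))); last by ring.
by apply: ler_wpM2l=>//; move: v0; lra.
Qed.
End MollifierIdentity.

Lemma block_exponent j : (6+2 * j<=8*2 ^ j)%N.
Proof. by have : (j<2 ^ j)%N by [exact: ltn_expl]; lia. Qed.

Lemma block_final (R : realType) (a w l : R) : a*(l/16)<=a*w -> a/2*w + - a*w <= - (a/32 * l).
Proof. by lra. Qed.

(** * Blocks of the mollified series *)

Section Blocks.
Variables (R : realType) (z Y : nat).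
Hypotheses (z2 : (1<z)%N) (Y0 : (0<Y)%N).

(** Each endpoint is the square of the previous one, so [ln n] varies by a factor 2 inside a block
    and one moment order suits the whole block. *)
Definition Nj (j : nat) : nat := (z ^ (2 ^ j))%N.
Definition fj (j n : nat) : R := if (Nj j<n<=Nj j.+1)%N then trunc Y (cz R z) n else 0.

Lemma Nj_gt0 j : (0<Nj j)%N. Proof. by rewrite expn_gt0 (ltnW z2). Qed.
Lemma NjS j : Nj j.+1=(Nj j ^ 2)%N. Proof. by rewrite /Nj expnS mulnC expnM. Qed.
Lemma Nj_le j : (Nj j<=Nj j.+1)%N.
Proof. by rewrite NjS -{1}[Nj j]expn1 leq_pexp2l ?Nj_gt0. Qed.

Lemma fjP j n : 0<=fj j n<=cz R z n.
Proof.
have c0 := cz_ge0 R z n; rewrite /fj /trunc; case: ifP=> _; rewrite ?lexx//.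
by case: leqP; rewrite ?mul1r ?mul0r ?lexx ?c0.
Qed.

Lemma fj_low j n : (n<=Nj j)%N -> fj j n = 0.
Proof. by move=> h; rewrite /fj ltnNge h. Qed.
Lemma fj_high j n : (Nj j.+1<n)%N -> fj j n = 0.
Proof. by move=> h; rewrite /fj [X in _ && X]leqNgt h andbF. Qed.
Lemma fj_Y j n : (Y<=Nj j)%N -> fj j n = 0.
Proof.
move=> h; rewrite /fj; case: ifP=>// /andP[n1 _]; rewrite /trunc leqNgt (leq_ltn_trans h n1).
by rewrite mul0r.
Qed.

Lemma Dp_blocks (s t : R) J : (Y<=Nj J)%N ->
  Dp s t (cz R z) Y = 1 + \sum_(j<J) Dp s t (fj j) (Nj j.+1).
Proof.
move=> YJ.
have -> : Dp s t (cz R z) Y = Dp s t (trunc Y (cz R z)) Y.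
  by apply: eq_Dp=> n /andP[_ nY]; rewrite /trunc nY mul1r.
rewrite (@Dp_widen _ _ _ _ Y (Nj J))//; last by move=> n; rewrite /trunc ltnNge=> /negbTE ->; rewrite mul0r.
elim: J {YJ} => [|J IH].
  rewrite big_ord0 addr0 /Nj expn0 expn1 /Dp big_ltn ?ltnS ?(ltnW z2)// /trunc Y0 cz1 nst1 !mul1r.
  rewrite big_nat_cond big1 ?addr0// => n /andP[nz _].
  by rewrite cz_small// mulr0 mul0r.
rewrite big_ord_recr/= addrA -IH /Dp (@big_cat_nat _ _ _ (Nj J).+1)//= ?ltnS ?Nj_le//.
congr (_ + _); rewrite [RHS](@big_cat_nat _ _ _ (Nj J).+1)//= ?ltnS ?Nj_le//.
rewrite [X in _ = X + _]big_nat_cond [X in _ = X + _]big1 ?add0r; last first.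
  by move=> n /andP[/andP[_ nJ] _]; rewrite fj_low ?mul0r// -ltnS.
by apply: eq_big_nat=> n nJ; rewrite /fj nJ.
Qed.

(** [k] is about [ln T / (8 ln Nj)], so that the [k]-th power of the block has length at most
    [sqrt T]. The saving [Nj^(- d1 k)] is then a power of [T]. The weight [(8 * 2^j)^(2k)] consumes
    at most half of its exponent because [z^(d1/2) >= 2^8]. *)
Lemma block_moment (sigma T : R) j : 2^-1<sigma -> 0<T -> 16<=ln T ->
  ln T<=z%:R`^((2*sigma - 1)/8) -> lnn R (Nj j)<=ln T/16 ->
  let d1 := 3/4*(2*sigma - 1) in 2^+8<=z%:R`^(d1/2) ->
  exists2 k : nat, (0<k)%N &
  Ex T (fun t=> (8*2^+j)^+(2*k)*nrm (Dp sigma t (fj j) (Nj j.+1))^+(2*k)) <=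
  5 / d1 * expR (- (d1/32 * ln T)).
Proof.
move=> s1; have r0: 0<=(2*sigma - 1)/8 by move: s1; lra.
move=> T0 L16 Lz NL d1 zd; set L := ln T in L16 Lz NL *.
have d10: 0<d1 by rewrite /d1; lra.
have N1: (1<Nj j)%N by apply: leq_trans z2 _; rewrite /Nj -{1}[z]expn1 leq_pexp2l ?expn_gt0 ?(ltnW z2).
have l0: 0<lnn R (Nj j) by exact: lnn_gt0.
set l := lnn R (Nj j) in NL l0 *.
have L0: 0<L by apply: lt_le_trans L16.
have q0: 0<=L/(8 * l) by rewrite divr_ge0 ?mulr_ge0 ?(ltW l0) ?(ltW L0).
pose k := Num.truncn (L/(8 * l)).
have k1: k%:R<=L/(8 * l) by rewrite truncn_le.
have k2: L/(8 * l)<k%:R+1 by rewrite -[X in _<X]natr1 || (rewrite natr1; exact: truncnS_gt).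
have kl: k%:R * l<=L/8.
  by move: k1; rewrite ler_pdivlMr ?mulr_gt0//; lra.
have kl2: L/16<=k%:R * l.
  move: k2; rewrite ltr_pdivrMr ?mulr_gt0//; move: NL l0; clear; nra.
have k0: (0<k)%N.
  rewrite lt0n; apply/eqP=> kE; move: kl2; rewrite kE mul0r; move: L0; lra.
exists k=>//.
have Nl: (Nj j)%:R = expR l by rewrite /l /lnn lnK ?posrE ?ltr0n ?Nj_gt0.
have lz2: ln 2<=l.
  by rewrite /l /lnn ler_ln ?posrE ?ltr0n ?Nj_gt0// ler_nat.
have kL: k%:R<=L.
  apply: le_trans k1 _; rewrite ler_pdivrMr ?mulr_gt0//; have := @ln2_ge R; move: lz2 L0; clear; nra.
have NT: ((Nj j.+1) ^ k)%:R^+2<=T.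
  rewrite NjS -expnM natrX -exprM Nl -expRM_natl -[X in _<=X](lnK T0) ler_expR -/L.
  by rewrite !natrM; move: kl L0; lra.
have mom := @Dp_moment R T T0 sigma ((2*sigma - 1)/8) z (fj j) (Nj j) (Nj j.+1) k.
have bE: 2*(sigma-(2*sigma - 1)/8) = 1+d1 by rewrite /d1; field.
have e1: 1-(1+d1) = - d1 by ring.
have e2: 1+d1 - 1 = d1 by ring.
rewrite bE e1 e2 in mom.
have {}mom := mom (ltnW z2) (Nj_gt0 _) (Nj_gt0 _) k0.
rewrite ExZ//; last by apply: bm_nrm2k=>//; exact: cbm_Dp.
set c := (8*2^+j)^+(2*k).
have c0: 0<=c by rewrite exprn_ge0// mulr_ge0// exprn_ge0.
apply: le_trans (ler_wpM2l c0 (mom r0 _ _ _ _ _ NT)) _.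
- by rewrite ltrDl.
- exact: fjP.
- exact: fj_low.
- exact: fj_high.
- exact: le_trans Lz.
have cE: c<=expR (d1/2*(k%:R * l)).
  have -> : expR (d1/2*(k%:R * l))=(z%:R`^(d1/2))^+(2 ^ j*k).
    rewrite -powR_mulrn ?powR_ge0// -powRrM /powR pnatr_eq0 eqn0Ngt (ltnW z2)/=.
    by congr expR; rewrite /l /lnn /Nj natrX lnXn ?ltr0n ?(ltnW z2)// natrM -[_ *+ _]mulr_natl; ring.
  rewrite /c exprM [X in _<=X]exprM lerXn2r ?nnegrE ?exprn_ge0 ?mulr_ge0 ?powR_ge0 ?exprn_ge0//.
  apply: le_trans (_ : ((2 : R)^+8)^+(2 ^ j)<=_); last by rewrite lerXn2r ?nnegrE ?powR_ge0.
  rewrite (_ : (8*2^+j)^+2 = 2^+(6+2 * j) :> R); last first.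
    by rewrite exprMn exprD mulnC exprM; congr (_ * _); ring.
  rewrite -exprM ler_weXn2l ?ler1n//.
  by rewrite block_exponent.
apply: le_trans (ler_wpM2r _ cE) _; first by rewrite mulr_ge0// mulr_ge0 ?powR_ge0 ?invr_ge0 ?(ltW d10).
rewrite natrX Nl -expRM_natl /powR (gt_eqF (expR_gt0 _)) expRK.
rewrite [X in X<=_](_ : _ = 5 / d1*(expR (d1/2*(k%:R * l)) * expR (- d1*(k%:R * l)))); last by ring.
rewrite ler_wpM2l ?divr_ge0 ?(ltW d10)// -expRD ler_expR.
exact: block_final (ler_wpM2l (ltW d10) kl2).
Qed.
End Blocks.

(** * From the identity to log |zeta| at a point *)

Section MollifierPointwise.
Variable R : realType.

Lemma expR1_le4 : expR 1<=4 :> R.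
Proof.
have h: 2^-1<=expR (- 2^-1) :> R by have := expR_ge1Dx (- 2^-1 : R); lra.
have h2: expR 1 = expR (- 2^-1) ^- 2 :> R.
  by rewrite -expRN_natl || rewrite -exprVn -expRN opprK -expRM_natl; congr expR; lra.
rewrite h2 (_ : 4=(2^-1) ^- 2 :> R); last by field.
by rewrite lef_pV2 ?posrE ?exprn_gt0 ?expR_gt0 ?invr_gt0// lerXn2r ?nnegrE ?expR_ge0.
Qed.

Lemma exp_term_le (x : R) n : 0<=x -> x^+n / n`!%:R<=expR x.
Proof.
move=> x0; case: n=> [|n]; first by rewrite expr0 fact0 divr1 -expR0 ler_expR.
by have := expR_ge1Dxn n x0; lra.
Qed.

(** [x^n / n!] is at most [e^(16 x) 16^-n], hence at most [e^(16 x - 2 n)]. Two more factors [e^x]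
    give [18 x - 2 n], which is below [- n] when [x <= n/20]. *)
Lemma taylor_tail (x : R) n : 0<=x -> x<=n%:R/20 ->
  x^+n.+1 / n`!%:R * expR x<=expR (- n%:R).
Proof.
move=> x0 xn; have h := exp_term_le n (mulr_ge0 (ler0n R 16) x0).
have e16: expR (2*n%:R)<=16^+n :> R.
  rewrite mulrC expRM_natl lerXn2r ?nnegrE ?expR_ge0//.
  rewrite (_ : 2 = 1+1 :> R) ?expRD// (_ : 16 = 4*4 :> R); last by ring.
  by rewrite ler_pM ?expR_ge0 ?expR1_le4.
have p16: 0<16^+n :> R by rewrite exprn_gt0.
have xn': x^+n / n`!%:R<=expR (16*x) * expR (- (2*n%:R)).
  rewrite exprMn -mulrA in h; rewrite expRN -ler_pdivrMr ?invr_gt0 ?expR_gt0// invrK mulrC.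
  by apply: le_trans h; rewrite ler_wpM2r// divr_ge0// exprn_ge0.
have xe: x<=expR x by apply: le_trans (expR_ge1Dx x); rewrite lerDr.
rewrite exprS -(mulrA x).
apply: le_trans (_ : expR x*(expR (16*x) * expR (- (2*n%:R))) * expR x<=_).
  rewrite ler_wpM2r ?expR_ge0// ler_pM//; by rewrite divr_ge0// exprn_ge0.
by rewrite -!expRD ler_expR; move: xn; lra.
Qed.

(** Up to constant factors [eta * M0] has the size of [Ev], and [M0] the size of [exp(- R')]. So
    [eta / Ev] is comparable to [exp R'], within [[1/5, 2]]. *)
Lemma log_ratio (eta etaN M0 R' Ev B Rem : R[i]) : 0<nrm Ev ->
  etaN*M0 = Ev*B+Rem -> nrm (1-M0*cexp R')<=4^-1 -> nrm (B - 1)<=4^-1 ->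
  nrm Rem<=nrm Ev/8 -> nrm (eta-etaN)*nrm M0<=nrm Ev/8 ->
  `|ln (nrm eta / nrm Ev)-Re R'| <= 4.
Proof.
move=> E0 eqn hM hB hR hE; set e := nrm Ev in E0 hR hE *.
have nB1: nrm B<=5/4 by have := nrmD (B - 1) 1; rewrite subrK nrm1; move: hB; lra.
have nB2: 3/4<=nrm B by have := nrm_leB 1 (1-B); rewrite subKr nrm1 nrmBC; move: hB; lra.
have nM1: nrm M0 * expR (Re R')<=5/4.
  have := nrmD (1-M0*cexp R') (- 1); rewrite addrAC subrr sub0r !nrmN nrm1 nrmM nrm_cexp.
  by move: hM; lra.
have nM2: 3/4<=nrm M0 * expR (Re R').
  have := nrm_leB 1 (1-M0*cexp R'); rewrite subKr nrm1 nrmM nrm_cexp.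
  by move: hM; lra.
have eq2: eta*M0 = Ev*B+(Rem+(eta-etaN)*M0).
  by rewrite addrA -eqn mulrBl addrC subrK.
have k1: nrm eta*nrm M0<=3/2 * e.
  rewrite -nrmM eq2; apply: le_trans (nrmD _ _) _; rewrite nrmM -/e.
  have := nrmD Rem ((eta-etaN)*M0); rewrite nrmM.
  by have := ler_wpM2l (ltW E0) nB1; move: hR hE; lra.
have k2: e/2<=nrm eta*nrm M0.
  rewrite -nrmM; have := nrm_leB (Ev*B) (- (Rem+(eta-etaN)*M0)).
  rewrite opprK -eq2 nrmN nrmM -/e.
  have := nrmD Rem ((eta-etaN)*M0); rewrite nrmM.
  by have := ler_wpM2l (ltW E0) nB2; move: hR hE; lra.
have M0p: 0<nrm M0.
  rewrite lt_neqAle nrm_ge0 andbT eq_sym; apply/eqP=> h; move: k2; rewrite h mulr0; move: E0; lra.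
have etap: 0<nrm eta.
  rewrite lt_neqAle nrm_ge0 andbT eq_sym; apply/eqP=> h; move: k2; rewrite h mul0r; move: E0; lra.
set X := Re R' in nM1 nM2 *; have X0 := expR_gt0 X.
have -> : ln (nrm eta / e)-X = ln (nrm eta / e / expR X).
  by rewrite [RHS]ln_div ?posrE ?divr_gt0// expRK.
have q1: nrm eta / e / expR X<=2.
  rewrite !ler_pdivrMr//; have := ler_wpM2l (nrm_ge0 eta) nM2.
  have := ler_wpM2r (ltW X0) k1; move: (nrm eta) (nrm M0) (expR X)=> n m x; lra.
have q2: 5^-1<=nrm eta / e / expR X.
  rewrite !ler_pdivlMr//; have := ler_wpM2l (nrm_ge0 eta) nM1.
  have := ler_wpM2r (ltW X0) k2; move: X0 E0; move: (nrm eta) (nrm M0) (expR X)=> n m x x0 e0; have := mulr_gt0 e0 x0; lra.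
have q0: 0<nrm eta / e / expR X by rewrite !divr_gt0.
move: (nrm eta / e / expR X) q0 q1 q2=> w w0 w1 w2.
rewrite ler_norml; apply/andP; split.
  have : ln (1+(w^-1 - 1))<=w^-1 - 1.
    by apply: le_ln1Dx; rewrite ltrBrDl subrr invr_gt0.
  rewrite addrC subrK lnV ?posrE//; have : w^-1<=5 by rewrite invf_ple ?posrE.
  by lra.
have : ln (1+(w - 1))<=w - 1 by apply: le_ln1Dx; rewrite ltrBrDl subrr.
by rewrite addrC subrK; lra.
Qed.

Lemma two_pow (s : R) : 2`^(1-s) = 2*2`^(- s) :> R.
Proof.
have e: (2 == 0 :> R) = false by rewrite pnatr_eq0.
by rewrite powRD ?e ?implybT// powRr1.
Qed.

Lemma abs_zetaE (sigma t : R) : abs_zeta sigma t = nrm (etac sigma t) / nrm (Dp sigma t (epsf R) 2).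
Proof.
rewrite /abs_zeta; congr (_ / _); rewrite /abs_den Dp_epsf /nrm /nst /nit /cis /lnn cosN sinN.
have -> : 2`^(1-sigma) = 2*2`^(- sigma) :> R.
  exact: two_pow.
rewrite (_ : 1 - _=(1 - 2*2`^(- sigma)*cos (t * ln 2)) +i* (2*2`^(- sigma)*sin (t * ln 2)))//.
rewrite (_ : 2*((2`^(- sigma))%:C*(cos (t * ln 2) -i* sin (t * ln 2)%R)) =
  (2*2`^(- sigma)*cos (t * ln 2)) +i* (- (2*2`^(- sigma)*sin (t * ln 2)))).
  by apply/eqP; rewrite eq_complex /= opprK add0r !eqxx.
apply/eqP; rewrite eq_complex; apply/andP; split; apply/eqP; rewrite [LHS](@ReM R) || rewrite [LHS](@ImM R).
all: by rewrite /=; ring.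
Qed.

Lemma nrm_epsf_ge (sigma t : R) : 2`^(1-sigma) - 1<=nrm (Dp sigma t (epsf R) 2).
Proof.
rewrite Dp_epsf nrmBC; apply: le_trans (nrm_leB _ _); rewrite nrm1 nrmM nrm_nst nrm_nat.
by rewrite two_pow.
Qed.

Lemma Rp_rz (sigma : R) : 2^-1<sigma -> exists2 C : R, 0<=C & forall z t,
  nrm (Dp sigma t (rz R z) z-Rp sigma z t)<=C.
Proof.
move=> hs1; have [C C0 HC] := prime_powers_le hs1; exists C=>// z t.
rewrite /Rp (sum_pr z (fun n=> nst sigma t n)) /Dp (bigID prime)/=.
have -> : \sum_(1<=n<z.+1 | prime n) (rz R z n)%:C*nst sigma t n =
    \sum_(1<=n<z.+1 | prime n) nst sigma t n.
  rewrite big_nat_cond [RHS]big_nat_cond; apply: eq_bigr=> n /andP[/andP[_ nz] np].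
  rewrite /rz (prime_gt1 np) -ltnS nz/= -{1}[n]expn1 mangoldt_primeX// divff ?mul1r// gt_eqF//.
  by apply: lnn_gt0; exact: prime_gt1.
rewrite addrAC subrr add0r; apply: le_trans (nrm_sum _ _ _) _.
apply: le_trans (HC z); rewrite big_mkcondl; apply: ler_sum=> n np.
rewrite nrmM nrm_nst nrmC; have [m0|mn0] := eqVneq (mangoldt R n) 0; rewrite /=.
  by rewrite /rz; case: ifP=> _; rewrite ?m0 ?mul0r normr0 mul0r.
rewrite ler_piMl ?powR_ge0// ger0_norm ?rz_ge0// /rz; case: ifP=>// /andP[n1 _].
by rewrite ler_pdivrMr ?lnn_gt0// mul1r mangoldt_le_lnn.
Qed.
End MollifierPointwise.

(** * Means of the remainder and of the blocks *)

Section MollifierMean.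
Variables (R : realType) (sigma : R).
Hypotheses (hs1 : 2^-1<sigma) (hs2 : sigma<1).
Let d0 := 2*sigma - 1.
Let d1 := 3/4*(2*sigma - 1).
Let d1p : 0<d1. Proof. by rewrite /d1; move: hs1; lra. Qed.
Let d1l : d1<=1. Proof. by rewrite /d1; move: hs2; lra. Qed.

Lemma powRN_le (x b d : R) : 0<x -> 0<=d<=1 -> b-ln 2<=ln x ->
  x`^(- d)<=2 * expR (- (d*b)).
Proof.
move=> x0 /andP[dd0 dd1] h; have e2: 2 = expR (ln 2) :> R by rewrite lnK ?posrE.
rewrite /powR (gt_eqF x0) [X in _<=X * _]e2 -expRD ler_expR.
have l2: 0<=ln 2 :> R by rewrite ln_ge0// ler1n.
have := ler_wpM2l dd0 h; have := ler_wpM2r l2 dd1; move: (ln 2) (ln x)=> u v; lra.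
Qed.

Lemma Y_bound (I : nat) : (0<I)%N -> ((2 ^ I).-1)%:R`^(- d1)<=2 * expR (- (d1/2*I%:R)).
Proof.
move=> I0; have Y0: (0<(2 ^ I).-1)%N.
  exact: pred_exp2_gt0.
have h: I%:R/2-ln 2<=ln ((2 ^ I).-1)%:R :> R.
  have : ln (2 ^ I)%:R<=ln (2*((2 ^ I).-1)%:R) :> R.
    rewrite ler_ln ?posrE ?mulr_gt0 ?ltr0n ?expn_gt0// -natrM ler_nat.
    by move: Y0; move: (2 ^ I)%N=> w; lia.
  rewrite lnM ?posrE ?ltr0n// natrX lnXn// -[ln 2 *+ I]mulr_natl.
  have := ler_wpM2l (ler0n R I) (@ln2_ge R); lra.
have Yp: 0<((2 ^ I).-1)%:R :> R by rewrite ltr0n.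
have dd: 0<=d1<=1 by rewrite (ltW d1p) d1l.
by apply: le_trans (powRN_le Yp dd h) _; rewrite (_ : d1*(I%:R/2) = d1/2*I%:R)//; ring.
Qed.

Lemma rem_final : exists2 C : R, 0<=C & forall (T : R) (z I N : nat), 0<T -> 16<=ln T ->
  (1<z)%N -> (0<I)%N -> I%:R * lnn R z<=d0/64 * ln T -> N=(Num.truncn (2*T)).+1 ->
  Ex T (fun t=> nrm (Dp sigma t (rho R z I N (2 ^ I).-1) (N*z ^ I))^+2) <=
  C*(expR (- (d1/2*I%:R))+expR (- (d1/4 * ln T))).
Proof.
have e0: 0<(2*sigma - 1)/8 by move: hs1; lra.
have [CD CD1 HD] := divisor_bound e0; have CD0 := le_trans ler01 CD1.
have e1: 0<d1/16 by rewrite divr_gt0.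
have [CL CL1 HL] := ln_pow_le 1 e1; have CL0 := le_trans ler01 CL1.
exists (90*CD^+2 / d1*(2+2*(1+12*CL))).
  have i0: 0<=d1^-1 by rewrite invr_ge0 ltW.
  by nneg.
move=> T z I N T0 L16 z2 I0 Iz NE; set L := ln T in L16 Iz *.
have TE: T = expR L by rewrite lnK.
have T1: 1<=T by rewrite TE -expR0 ler_expR; move: L16; lra.
have N1: 2*T<N%:R by rewrite NE truncnS_gt.
have N3: N%:R<=3*T.
  rewrite NE -natr1; have : (Num.truncn (2*T))%:R<=2*T by rewrite truncn_le mulr_ge0// ltW.
  by move: T1; lra.
have N2: (1<N)%N by rewrite -(ltr_nat R); move: N1 T1; lra.
have lz0 := lnn_ge0 R z.
have zI: (z ^ I)%:R = expR (I%:R * lnn R z) :> R.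
  by rewrite natrX expRM_natl /lnn lnK ?posrE ?ltr0n ?(ltnW z2).
have Zb: (z ^ I)%:R<=expR (d1/48*L) :> R.
  rewrite zI ler_expR; apply: le_trans Iz _; rewrite /d1 /d0; lra.
have ZT: (z ^ I)%:R<=T.
  apply: le_trans Zb _; rewrite TE ler_expR; have := ler_wpM2r (_ : 0<=L) d1l; move: L16; lra.
have YN: ((2 ^ I).-1<=N)%N.
  apply: leq_trans (leq_pred _) _; apply: (@leq_trans (z ^ I)); first by rewrite leq_exp2r.
  by rewrite -(ler_nat R); move: ZT N1 T1; lra.
(* About [sqrt T], the longest length at which the mean value theorem loses only a constant. For the
   long part the loss is at most of order [T^(d1/4)], and [M^(-d1)] recovers [T^(d1/2)]. *)
pose M := Num.truncn (expR (L/2)).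
have Mle: M%:R<=expR (L/2) by rewrite truncn_le expR_ge0.
have Mge: expR (L/2)<M%:R+1 by rewrite natr1 truncnS_gt.
have E1: 1+L/2<=expR (L/2) by exact: expR_ge1Dx.
have M0: (0<M)%N by rewrite -(ltr_nat R); move: Mge E1 L16; lra.
have M1: 1<=M%:R :> R by rewrite ler1n.
have MT: M%:R^+2<=T.
  apply: le_trans (_ : expR (L/2)^+2<=_); first by rewrite lerXn2r ?nnegrE ?expR_ge0.
  by rewrite -expRM_natl TE ler_expR; lra.
have MNZ: (M<=N*z ^ I)%N.
  apply: (@leq_trans N); last by rewrite leq_pmulr// expn_gt0 (ltnW z2).
  rewrite -(ler_nat R); apply: le_trans Mle _; apply: le_trans (_ : T<=_); last by move: N1 T1; lra.
  by rewrite TE ler_expR; move: L16; lra.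
apply: le_trans (rem_mean z2 I0 erefl YN N2 hs1 T0 CD0 HD M0 MNZ MT erefl) _; rewrite -/d1 -[X in _<=X]mulrA.
apply: ler_wpM2l; first by rewrite mulr_ge0 ?invr_ge0 ?(ltW d1p)// mulr_ge0// sqr_ge0.
have dd: 0<=d1<=1 by rewrite (ltW d1p) d1l.
have Mb: M%:R`^(- d1)<=2 * expR (- (d1*(L/2))).
  apply: powRN_le=>//; first by rewrite ltr0n.
  have : ln (expR (L/2))<=ln (2*M%:R) by rewrite ler_ln ?posrE ?expR_gt0 ?mulr_gt0 ?ltr0n//; move: Mge M1; lra.
  by rewrite expRK lnM ?posrE ?ltr0n//; lra.
set P := 1 + _; have Pb: P<=(1+12*CL) * expR (d1/4*L).
  have NZ0: (0<N*z ^ I)%N by rewrite muln_gt0 (ltnW N2) expn_gt0 (ltnW z2).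
  have NZ1: (N*z ^ I)%:R<=3*T * expR (d1/48*L) by rewrite natrM; apply: ler_pM.
  have NZ2: (N*z ^ I)%:R<=expR (3*L).
    rewrite natrM (_ : 3*L = L+L+L) ?expRD; last by lra.
    rewrite -TE; apply: ler_pM=>//; apply: le_trans N3 _; rewrite ler_wpM2r ?(ltW T0)//.
    by rewrite TE; apply: le_trans (expR_ge1Dx L); move: L16; lra.
  have l1: 1+lnn R (N*z ^ I)<=CL * expR (3*L*(d1/16)).
    have := HL (N*z ^ I)%:R; rewrite ler1n NZ0 expr1=> /(_ isT) h; apply: le_trans h _.
    rewrite ler_wpM2l// /powR pnatr_eq0 eqn0Ngt NZ0/= ler_expR mulrC ler_wpM2r ?(ltW e1)//.
    by rewrite -[X in _<=X]expRK ler_ln ?posrE ?expR_gt0 ?ltr0n.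
  rewrite /P; set q := 4 * _ * _ / _.
  have q1: q<=12*CL*(expR (d1/48*L) * expR (3*L*(d1/16))).
    rewrite /q ler_pdivrMr//.
    apply: le_trans (_ : 4*(3*T * expR (d1/48*L))*(CL * expR (3*L*(d1/16)))<=_).
      by apply: ler_pM=>//; rewrite ?mulr_ge0 ?addr_ge0 ?lnn_ge0// ler_wpM2l.
    by apply: eq_ler; ring.
  rewrite mulrDl mul1r; apply: lerD.
    by rewrite -expR0 ler_expR mulr_ge0 ?divr_ge0 ?(ltW d1p)//; move: L16; lra.
  apply: le_trans q1 _; rewrite ler_wpM2l ?mulr_ge0// -expRD ler_expR.
  have := mulr_ge0 (ltW d1p) (_ : 0<=L); move: L16; lra.
have u0 := expR_ge0 (- (d1/2*I%:R)); have v0 := expR_ge0 (- (d1/4*L)).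
have Pv: P*M%:R`^(- d1)<=2*(1+12*CL) * expR (- (d1/4*L)).
  apply: le_trans (_ : (1+12*CL) * expR (d1/4*L)*(2 * expR (- (d1*(L/2))))<=_).
    apply: ler_pM=>//; rewrite ?powR_ge0//.
    by rewrite /P addr_ge0// !mulr_ge0 ?invr_ge0 ?addr_ge0 ?lnn_ge0// ltW.
  rewrite (_ : _*(2 * _) = 2*(1+12*CL)*(expR (d1/4*L) * expR (- (d1*(L/2))))); last by ring.
  rewrite -expRD (_ : d1/4*L + - (d1*(L/2)) = - (d1/4*L))//; by field.
have Yb := Y_bound I0.
have h1 := lerD Yb Pv; apply: le_trans h1 _.
have w0: 0<=2*(1+12*CL) by nneg.
move: (2*(1+12*CL)) (expR (- (d1/2 * _))) (expR (- (d1/4 * _))) u0 v0 w0=> w u v u0 v0 w0.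
rewrite (_ : (2+w)*(u+v) = 2*u+w * v+(2 * v+w*u)); last by ring.
by rewrite lerDl addr_ge0// mulr_ge0.
Qed.

Lemma blocks_final (T : R) (z I : nat) : 0<T -> 16<=ln T ->
  (1<z)%N -> (0<I)%N -> I%:R * lnn R z<=d0/64 * ln T ->
  ln T<=z%:R`^(d0/8) -> 2^+8<=z%:R`^(d1/2) ->
  exists k : nat -> nat, forall j, (0<k j)%N /\
  Ex T (fun t=> (8*2^+j)^+(2*k j)*nrm (Dp sigma t (fj R z (2 ^ I).-1 j) (Nj z j.+1))^+(2*k j)) <=
  5 / d1 * expR (- (d1/32 * ln T)).
Proof.
move=> T0 L16 z2 I0 Iz Lz zd.
suff : forall j, exists k : nat, (0<k)%N /\
  Ex T (fun t=> (8*2^+j)^+(2*k)*nrm (Dp sigma t (fj R z (2 ^ I).-1 j) (Nj z j.+1))^+(2*k)) <=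
  5 / d1 * expR (- (d1/32 * ln T)) by move=> /choice[k Hk]; exists k.
move=> j; have [YN|NY] := leqP (2 ^ I).-1 (Nj z j).
  exists 1%N; split=>//; rewrite (@eq_Ex _ _ _ (fun=> 0)).
    by rewrite Ex_cst// mulr_ge0 ?expR_ge0// divr_ge0// ltW.
  move=> t _; rewrite [X in nrm X](_ : _ = 0) ?nrm0 ?expr0n ?mulr0//.
  by rewrite /Dp big1// => n _; rewrite fj_Y// mul0r.
have h: lnn R (Nj z j)<=I%:R * lnn R z.
  rewrite /lnn mulr_natl -lnXn ?ltr0n ?(ltnW z2)// ler_ln ?posrE ?exprn_gt0 ?ltr0n ?Nj_gt0 ?(ltnW z2)//.
  rewrite -natrX ler_nat; apply: leq_trans (ltnW NY) _; apply: leq_trans (leq_pred _) _.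
  by rewrite leq_exp2r.
have NL: lnn R (Nj z j)<=ln T/16; last first.
  by have [k k0 kb] := @block_moment R z (2 ^ I).-1 z2 sigma T j hs1 T0 L16 Lz NL zd; exists k.
apply: le_trans h _; apply: le_trans Iz _; rewrite /d0.
have : (1-sigma) * ln T >= 0 by rewrite mulr_ge0 ?subr_ge0 ?(ltW hs2)//; move: L16; lra.
by move: L16; lra.
Qed.

Lemma sum_halves (I : nat) : \sum_(j<I) (8*2^+j)^-1<=4^-1 :> R.
Proof.
have -> : \sum_(j<I) (8*2^+j)^-1 = 4^-1 - 4^-1/2^+I :> R.
  elim: I=> [|I IH]; first by rewrite big_ord0 expr0; field.
  rewrite big_ord_recr/= IH exprS; field.
  by rewrite expf_neq0.
by rewrite gerBl divr_ge0// exprn_ge0.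
Qed.
End MollifierMean.

(** * The mollified approximation of log |zeta| *)

Section Mollifier.
Variables (R : realType) (sigma : R).
Hypotheses (hs1 : 2^-1<sigma) (hs2 : sigma<1).
Let d0 := 2*sigma - 1.
Let d1 := 3/4*(2*sigma - 1).
Let d1p : 0<d1. Proof. by rewrite /d1; move: hs1; lra. Qed.
Let d1l : d1<=1. Proof. by rewrite /d1; move: hs2; lra. Qed.
Let s0 : 0<sigma. Proof. by move: hs1; lra. Qed.

Lemma Dp_alt (t : R) N : Dp sigma t (alt R) N = \sum_(1<=m<N.+1) (-1)^+m.+1*nst sigma t m.
Proof.
apply: eq_bigr=> m _; congr (_ * _); rewrite /alt rmorphXn; congr (_^+_).
by rewrite rmorphN rmorph1.
Qed.

(** The mollifier may be as large as [exp(I/20)], but [I <= ln T / 32], while truncating eta at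
    [N >= T] costs only [T^(-1/2)]. *)
Lemma eta_error (T t e0 : R) (I N : nat) (M0 R' : R[i]) : 0<T -> 0<e0 -> 240 / e0<=ln T -> 16<=ln T ->
  T<=t -> t<=N%:R -> T<=N%:R -> I%:R<=ln T/32 -> nrm (1-M0*cexp R')<=4^-1 -> nrm R'<=I%:R/20 ->
  nrm (etac sigma t-Dp sigma t (alt R) N)*nrm M0<=e0/8.
Proof.
move=> T0 e00 Le L16 Tt tN TN IL hM hR'; set L := ln T in Le L16 IL *.
have t0: 0<t := lt_le_trans T0 Tt.
have N0: (0<N)%N by rewrite -(ltr0n R); apply: lt_le_trans tN.
have h := eta_approx s0 t0 N0 tN; rewrite -Dp_alt in h.
have Nb: N%:R`^(- sigma)<=expR (- (L/2)).
  rewrite /powR pnatr_eq0 eqn0Ngt N0/= ler_expR.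
  have lN: L<=ln N%:R by rewrite ler_ln ?posrE// ltr0n.
  have := ler_wpM2l (ltW s0) lN; have := ler_wpM2r (_ : 0<=L) (ltW hs1).
  by move: L16; lra.
have Mb: nrm M0<=5/4 * expR (I%:R/20).
  have nM1: nrm M0 * expR (Re R')<=5/4.
    have := nrmD (1-M0*cexp R') (- 1); rewrite addrAC subrr sub0r !nrmN nrm1 nrmM nrm_cexp.
    by move: hM; lra.
  rewrite -ler_pdivrMr ?expR_gt0// -expRN; apply: le_trans nM1; rewrite ler_wpM2l ?nrm_ge0// ler_expR.
  by have := Re_le_nrm R'; rewrite ler_norml=> /andP[]; move: hR'; lra.
apply: le_trans (ler_pM (nrm_ge0 _) (nrm_ge0 _) h Mb) _.
apply: le_trans (_ : 6 * expR (- (L/2))*(5/4 * expR (I%:R/20))<=_).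
  by rewrite ler_wpM2r ?ler_wpM2l// mulr_ge0 ?expR_ge0.
have ee: expR (- (L/2)) * expR (I%:R/20)<=expR (- (L/4)).
  by rewrite -expRD ler_expR; move: IL L16; lra.
have L0: 0<L by move: L16; lra.
have e4: expR (- (L/4))<=4/L.
  rewrite expRN -[4/L]invrK lef_pV2 ?posrE ?expR_gt0 ?invr_gt0 ?divr_gt0// invf_div.
  by apply: le_trans (expR_ge1Dx _); rewrite lerDr.
have L30: 30/L<=e0/8.
  rewrite ler_pdivrMr//; move: Le; rewrite ler_pdivrMr//; lra.
apply: le_trans L30; move: ee e4; rewrite (_ : 30/L = 15/2*(4/L)); last by field; rewrite gt_eqF.
by move: (expR _) (expR _) (expR _) (4/L)=> a b c d; lra.
Qed.

(** One nonnegative function [Q] carries all exceptional events: [Q t < 1] forces the remainder and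
    every block to be small, and the mean of [Q] bounds the measure of the complement. The block
    weights [8 * 2^j] make the block bounds add up to at most 1/4. The term [e^(-c0 I)] comes from
    the remainder, which starts at [2^I]. *)
Theorem mollifier : exists C0 c0 L0 : R, [/\ 4<=C0, 0<c0, 16<=L0 &
  forall (T : R) (z I : nat), 0<T -> L0<=ln T -> (1<z)%N -> (0<I)%N ->
  I%:R * lnn R z<=d0/64 * ln T -> ln T<=z%:R`^(d0/8) -> 2^+8<=z%:R`^(d1/2) ->
  exists Q : R -> R, [/\ bm T Q, forall t, 0<=Q t,
    Ex T Q<=C0*(expR (- (c0*I%:R))+(1+I%:R) * expR (- (c0 * ln T))) &
    forall t, T<=t<=2*T -> Q t<1 -> nrm (Rp sigma z t)+C0<=I%:R/20 ->
      `|ln (abs_zeta sigma t)-Re (Rp sigma z t)| <= C0]].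
Proof.
have [C1 C10 H1] := rem_final hs1 hs2; have [C2 C20 H2] := Rp_rz hs1.
pose e0 := 2`^(1-sigma) - 1 : R.
have e00: 0<e0.
  by rewrite /e0 subr_gt0 /powR pnatr_eq0/= expR_gt1 mulr_gt0 ?subr_gt0// ln_gt0// ltr1n.
(* Scaled so that [Q t < 1] yields a remainder of at most [e0/8], where [e0] is a lower bound for
   [|1 - 2^(1-s)|]. *)
pose K := (8 / e0)^+2; have K0: 0<=K by exact: sqr_ge0.
have i0: 0<=d1^-1 by rewrite invr_ge0 ltW.
exists (4+C2+K*C1+5 / d1), (d1/32), (Num.max 16 (240 / e0)); split.
- by have : 0<=C2+K*C1+5 / d1 by [nneg]; lra.
- by rewrite divr_gt0.
- by rewrite le_max lexx.
move=> T z I T0; rewrite ge_max=> /andP[L16 Le] z2 I0 Iz Lz zd.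
set L := ln T in L16 Le Iz Lz *.
have L0: 0<=L by move: L16; lra.
pose N := (Num.truncn (2*T)).+1; pose Y := (2 ^ I).-1.
have T1: 1<=T by rewrite -[T](lnK T0) -expR0 ler_expR.
have N1: 2*T<N%:R by rewrite truncnS_gt.
have N2: (1<N)%N by rewrite -(ltr_nat R); move: N1 T1; lra.
have Y0: (0<Y)%N.
  exact: pred_exp2_gt0.
have IL: I%:R<=L/32.
  have lz: 2^-1<=lnn R z by apply: le_trans (@ln2_ge R) _; rewrite ler_ln ?posrE ?ltr0n ?(ltnW z2)// ler_nat.
  have := ler_wpM2l (ler0n R I) lz; have := mulr_ge0 (_ : 0<=1-sigma) L0.
  by rewrite subr_ge0=> /(_ (ltW hs2)); move: Iz; rewrite /d0; lra.
have YN: (Y<=N)%N.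
  rewrite /Y; apply: leq_trans (leq_pred _) _; rewrite -(ler_nat R).
  apply: le_trans (_ : T<=_); last by move: N1 T1; lra.
  have l2: ln 2<=1 :> R by exact: ln2_le1.
  have l20: 0<=ln 2 :> R by rewrite ln_ge0// ler1n.
  rewrite natrX -[2^+I](lnK _) ?posrE ?exprn_gt0// -[T](lnK T0) ler_expR lnXn// -[ln 2 *+ I]mulr_natl.
  have := ler_wpM2l (ler0n R I) l2; rewrite -/L; move: IL L0; lra.
have [k Hk] := blocks_final hs1 hs2 T0 L16 z2 I0 Iz Lz zd.
pose D t j := Dp sigma t (fj R z Y j) (Nj z j.+1).
pose Rm t := Dp sigma t (rho R z I N Y) (N*z ^ I).
pose q t j := (8*2^+j)^+(2*k j)*nrm (D t j)^+(2*k j).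
have q0 t j : 0<=q t j.
  by rewrite /q mulr_ge0// exprn_ge0 ?nrm_ge0// mulr_ge0// exprn_ge0.
pose Q t := K*nrm (Rm t)^+2 + \sum_(j<I) q t j.
have bR: bm T (fun t=> nrm (Rm t)^+2) by apply: bm_nrm2=>//; exact: cbm_Dp.
have bq j : bm T (fun t=> q t j) by apply: bmZ=>//; apply: bm_nrm2k=>//; exact: cbm_Dp.
have bK: bm T (fun t=> K*nrm (Rm t)^+2) by exact: bmZ.
have bs: bm T (fun t=> \sum_(j<I) q t j) by apply: bm_sum.
exists Q; split.
- exact: bmD.
- by move=> t; apply: addr_ge0; [apply: mulr_ge0=>//; exact: sqr_ge0|exact: sumr_ge0].
- rewrite /Q ExD// ExZ// Ex_sum//.
  have r1: K*Ex T (fun t=> nrm (Rm t)^+2)<=K*(C1*(expR (- (d1/2*I%:R))+expR (- (d1/4*L)))).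
    by rewrite ler_wpM2l//; exact: H1.
  have r2: \sum_(j<I) Ex T (fun t=> q t j)<=I%:R*(5 / d1 * expR (- (d1/32*L))).
    apply: le_trans (_ : \sum_(j<I) (5 / d1 * expR (- (d1/32*L)))<=_).
      by apply: ler_sum=> j _; case: (Hk j).
    by rewrite sumr_const card_ord [X in _<=X]mulr_natl.
  apply: le_trans (lerD r1 r2) _.
  set c := d1/32.
  have u1: expR (- (d1/2*I%:R))<=expR (- (c*I%:R)).
    by rewrite ler_expR lerN2 ler_wpM2r// /c; move: d1p; lra.
  have u2: expR (- (d1/4*L))<=expR (- (c*L)).
    by rewrite ler_expR lerN2 ler_wpM2r// /c; move: d1p; lra.
  have e1 := expR_ge0 (- (c*I%:R)); have e2 := expR_ge0 (- (c*L)).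
  move: (expR (- (c*I%:R))) (expR (- (c*L))) e1 e2 u1 u2=> u v e1 e2 u1 u2.
  apply: le_trans (lerD (ler_wpM2l K0 (ler_wpM2l C10 (lerD u1 u2))) (lexx _)) _.
  have KC: 0<=K*C1 by nneg.
  have D5: 0<=5 / d1 by nneg.
  have Iv: 0<=I%:R * v by nneg.
  rewrite (_ : (4+C2+K*C1+5 / d1) * _ = K*(C1*(u+v))+I%:R*(5 / d1 * v) +
    ((4+C2)*(u+v)+(4+C2)*(I%:R * v)+K*C1*(I%:R * v)+5 / d1*(u+v))); last by ring.
  by rewrite lerDl; nneg.
move=> t /andP[Tt tT] Qt hR.
have t0: 0<t := lt_le_trans T0 Tt.
have sq0: 0 <= \sum_(j<I) q t j by rewrite sumr_ge0.
have KR0: 0<=K*nrm (Rm t)^+2 by rewrite mulr_ge0// exprn_ge0// nrm_ge0.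
set R' := Dp sigma t (rz R z) z.
have R'b: nrm R'<=I%:R/20.
  have := nrmD (R'-Rp sigma z t) (Rp sigma z t); rewrite subrK; have := H2 z t; rewrite -/R'.
  have : 0<=K*C1+5 / d1 by nneg.
  by move: hR; lra.
have I80: 80<=I%:R :> R.
  have : 0<=K*C1+5 / d1 by nneg.
  by have := nrm_ge0 (Rp sigma z t); move: hR C20; lra.
have taylor: nrm (1-Dp sigma t (mI R z I) (z ^ I)*cexp R')<=4^-1.
  rewrite -Dp_mI ?(ltnW z2)//; have := cexp_taylor (- R') I; rewrite opprK nrmN=> h.
  apply: le_trans h _; apply: le_trans (taylor_tail (nrm_ge0 _) R'b) _.
  rewrite expRN lef_pV2 ?posrE ?expR_gt0//; apply: le_trans (expR_ge1Dx _); move: I80; lra.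
have ediff: `|Re R'-Re (Rp sigma z t)| <= C2.
  by rewrite -ReN -ReD; apply: le_trans (Re_le_nrm _) _; exact: H2.
have Ege: e0<=nrm (Dp sigma t (epsf R) 2) by exact: nrm_epsf_ge.
have Ep: 0<nrm (Dp sigma t (epsf R) 2) by exact: lt_le_trans Ege.
have main: `|ln (nrm (etac sigma t) / nrm (Dp sigma t (epsf R) 2))-Re R'| <= 4.
  apply: (@log_ratio _ _ (Dp sigma t (alt R) N) (Dp sigma t (mI R z I) (z ^ I)) R' _ (Dp sigma t (cz R z) Y) (Rm t))=>//.
  - exact: mollifier_identity.
  - rewrite (@Dp_blocks _ _ _ z2 Y0 sigma t I); last first.
      rewrite /Y; apply: leq_trans (leq_pred _) _; apply: (@leq_trans (z ^ I)); first by rewrite leq_exp2r.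
      by rewrite /Nj leq_exp2l// ltnW// ltn_expl.
    rewrite addrAC subrr add0r; apply: le_trans (nrm_sum _ _ _) _.
    apply: le_trans (@sum_halves R I); apply: ler_sum=> j _.
    have qj: q t j<1.
      apply: le_lt_trans Qt; rewrite /Q; apply: le_trans (_ : \sum_(j<I) q t j<=_); last by rewrite lerDr.
      by rewrite (bigD1 j)//= lerDl sumr_ge0.
    have p0: 0<8*2^+j :> R by rewrite mulr_gt0// exprn_gt0.
    rewrite -[X in _<=X]div1r ler_pdivlMr// mulrC leNgt; apply/negP=> h.
    move: qj; rewrite ltNge /q -exprMn=> /negP; apply; rewrite -/(D t j) in h.
    by apply: exprn_ege1; exact: ltW.
  - have h: K*nrm (Rm t)^+2<=1 by apply: le_trans (ltW Qt); rewrite lerDl.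
    apply: le_trans (_ : e0/8<=_); last by rewrite ler_wpM2r.
    rewrite -(@ler_pXn2r _ 2) ?nnegrE ?nrm_ge0 ?divr_ge0 ?(ltW e00)//.
    have Kp: 0<K by rewrite /K exprn_gt0// divr_gt0.
    rewrite (_ : (e0/8)^+2 = 1/K) ?ler_pdivlMr// 1?mulrC//.
    by rewrite /K; field; rewrite gt_eqF.
  - apply: le_trans (_ : e0/8<=_); last by rewrite ler_wpM2r.
    apply: (@eta_error T t e0 I N _ R')=>//; by move: tT N1 T1; lra.
rewrite abs_zetaE; set X := ln _ in main *.
apply: le_trans (ler_distD (Re R') _ _) _.
have t5: 0<=K*C1+5 / d1 by nneg.
by apply: le_trans (lerD main ediff) _; rewrite -[X in _<=X]addrA lerDl.
Qed.
End Mollifier.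

Lemma fact_le_pow n : (n`! <= n ^ n)%N.
Proof.
elim: n=>// n IH; rewrite factS expnS leq_mul2l/=; apply: leq_trans IH _.
by case: n=>// n; rewrite leq_exp2r.
Qed.

(** * Polynomials approximating the exponential of the prime sum *)

Section Laplace.
Variables (R : realType) (sigma T : R) (z : nat).
Hypotheses (T0 : 0<T) (z2 : (1<z)%N).

(** The Taylor polynomial of [exp(k Rp / 2)]. Its squared modulus stands for [exp(k Re Rp)], and it
    is a Dirichlet polynomial of length at most [z^I], so its mean square is computable. *)
Definition Ak (k : R) (I : nat) (t : R) : R[i] :=
  \sum_(i<I.+1) ((k/2)^+i / i`!%:R : R)%:C*Rp sigma z t^+i.

Lemma Ak_approx (k : R) I t : 0<=k -> (3<=I)%N -> k/2*nrm (Rp sigma z t)<=I%:R/20 ->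
  9/16 * expR (k*Re (Rp sigma z t))<=nrm (Ak k I t)^+2<=25/16 * expR (k*Re (Rp sigma z t)).
Proof.
move=> k0 I3 h; set X := Re _.
pose c := (k/2)%:C*Rp sigma z t.
have nc: nrm c = k/2*nrm (Rp sigma z t) by rewrite nrmM nrm_real_ge0// divr_ge0.
have := cexp_taylor c I; rewrite (_ : \sum_(i<I.+1) _ = Ak k I t); last first.
  apply: eq_bigr=> i _; rewrite /c; move: (k/2)=> h'; rewrite exprMn mulrAC; congr (_ * _).
  by rewrite [RHS]rmorphM fmorphV rmorph_nat rmorphXn.
move=> h1; have {}h1 : nrm (1-Ak k I t*cexp (- c))<=4^-1.
  apply: le_trans h1 _; apply: le_trans (taylor_tail (nrm_ge0 _) _) _; first by rewrite nc.
  rewrite expRN lef_pV2 ?posrE ?expR_gt0//; apply: le_trans (expR_ge1Dx _).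
  by have : 3<=I%:R :> R by [rewrite ler_nat]; lra.
pose A := nrm (Ak k I t); pose y := expR (k/2*X).
have y0: 0<y by exact: expR_gt0.
have nA: nrm (Ak k I t*cexp (- c)) = A / y.
  by rewrite nrmM nrm_cexp ReN ReZ expRN.
have u1: A / y<=5/4.
  by have := nrmD (1-Ak k I t*cexp (- c)) (- 1); rewrite addrAC subrr sub0r !nrmN nrm1 nA; move: h1; lra.
have u2: 3/4<=A / y.
  by have := nrm_leB 1 (1-Ak k I t*cexp (- c)); rewrite subKr nrm1 nA; move: h1; lra.
have yE: expR (k*X) = y^+2 by rewrite /y -expRM_natl; congr expR; field.
rewrite yE; rewrite ler_pdivrMr// in u1; rewrite ler_pdivlMr// in u2.
have A0: 0<=A by exact: nrm_ge0.
rewrite (_ : 9/16*y^+2=(3/4*y)^+2); last by field.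
rewrite (_ : 25/16*y^+2=(5/4*y)^+2); last by field.
by rewrite !lerXn2r ?nnegrE ?mulr_ge0 ?(ltW y0)//.
Qed.

Lemma mean_factor (I : nat) : 16*(z ^ I)%:R^+2<=T ->
  0<=4*(z ^ I)%:R*(1+lnn R (z ^ I))/T<=4^-1.
Proof.
move=> h; have Z0: (0<z ^ I)%N by rewrite expn_gt0 (ltnW z2).
rewrite divr_ge0 ?mulr_ge0 ?addr_ge0 ?lnn_ge0 ?(ltW T0)//= ler_pdivrMr//.
have := ler_wpM2l (ler0n R (z ^ I)) (@one_lnn_le R _ Z0); move: h; rewrite expr2; lra.
Qed.

Lemma mean_Rp_le (I : nat) (q : nat -> R) (k : R) : 16*(z ^ I)%:R^+2<=T -> 0<=k ->
  (forall i, (i<=I)%N -> 0<=q i<=(k/2)^+i / i`!%:R) ->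
  Ex T (fun t=> nrm (\sum_(i<I.+1) (q i)%:C*Rp sigma z t^+i)^+2)<=5/4 * expR (Fz sigma z k).
Proof.
move=> hT k0 qk; have := @mean_poly_Rp R sigma z I T q T0 (ltnW z2); rewrite ler_norml=> /andP[_].
have /andP[f0 f1] := mean_factor hT.
have m0: 0<=msum sigma z I q by apply: sumr_ge0=> al _; exact: sqr_ge0.
have := @msum_le R sigma z I q (k/2) (divr_ge0 k0 (ler0n _ _)) qk.
have -> : 2*(k/2) = k by field.
have := ler_wpM2r m0 f1; lra.
Qed.

Lemma mean_Ak_ge (I : nat) (k : R) : 16*(z ^ I)%:R^+2<=T -> 0<=k ->
  (z.+2)%:R*4 ^- I * expR (Fz sigma z (2*k))<=4^-1 ->
  9/16 * expR (Fz sigma z k)<=Ex T (fun t=> nrm (Ak k I t)^+2).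
Proof.
move=> hT k0 h; have := @mean_poly_Rp R sigma z I T (fun i=> (k/2)^+i / i`!%:R) T0 (ltnW z2).
rewrite ler_norml=> /andP[+ _].
have /andP[f0 f1] := mean_factor hT.
set m := msum _ _ _ _.
have m0: 0<=m by apply: sumr_ge0=> al _; exact: sqr_ge0.
have := @msum_ge R sigma z I (k/2) (divr_ge0 k0 (ler0n _ _)); rewrite -/m.
have -> : 2*(k/2) = k by field.
have -> : 4*(k/2) = 2*k by field.
have e0 := expR_ge0 (Fz sigma z k); set e := expR (Fz sigma z k) in e0 *.
have e1: e*(3/4)<=e*(1-(z.+2)%:R*4 ^- I * expR (Fz sigma z (2*k))).
  by rewrite ler_wpM2l//; move: h; lra.
move=> /(le_trans e1) m1; rewrite -/(Ak k I _)=> h2.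
have := ler_wpM2r m0 f1; move: h2; set E := Ex _ _; rewrite -/E.
by move: (4 * _ * _ / _ * m)=> w; move: m1; lra.
Qed.

Lemma tail_coef (x k : R) (m j : nat) : 0<=x -> 0<=k -> (j<=m)%N ->
  x^+j / j`!%:R*(k^+(m-j)/(m-j)`!%:R)<=(k+x)^+m / m`!%:R.
Proof.
move=> x0 k0 jm; rewrite ler_pdivlMr ?ltr0n ?fact_gt0// exprDn.
apply: le_trans (_ : k^+(m-j)*x^+j *+ 'C(m, j)<=_).
  rewrite -(bin_fact jm) natrM -mulr_natr natrM.
  by apply: eq_ler; field; rewrite !pnatr_eq0 -!lt0n !fact_gt0.
have jm1: (j<m.+1)%N by [].
rewrite (bigD1 (Ordinal jm1))//= lerDl sumr_ge0// => i _.
by rewrite mulrn_wge0// mulr_ge0// exprn_ge0.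
Qed.

(** Where [|Rp| >= W] the weight is at least 1. Up to the factor [j! / x^j] the product [Rp^j Ak]
    has coefficients dominated by those of [exp((k/2 + x) Rp)], which again leads to a Bessel
    product. The condition [j <= x W / 4] turns the remaining factor into [16^-j]. *)
Lemma mean_tail (I j : nat) (k x W : R) : 16*(z ^ (I+j))%:R^+2<=T -> 0<=k -> 0<x -> 0<W ->
  j%:R<=x*W/4 ->
  Ex T (fun t=> (nrm (Rp sigma z t)/W)^+(2 * j)*nrm (Ak k I t)^+2) <=
  5/4*(16 ^- j * expR (Fz sigma z (k+2*x))).
Proof.
move=> hT k0 x0 W0 jx.
pose q m : R := if (j<=m)%N then x^+j / j`!%:R*((k/2)^+(m-j)/(m-j)`!%:R) else 0.
pose P t := \sum_(m<(I+j).+1) (q m)%:C*Rp sigma z t^+m.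
have PE t : P t=(x^+j / j`!%:R)%:C*Rp sigma z t^+j*Ak k I t.
  rewrite /P -(big_mkord xpredT (fun m=> (q m)%:C*Rp sigma z t^+m)).
  rewrite (@big_cat_nat _ _ _ j)//=; last by rewrite ltnW// ltnS leq_addl.
  rewrite big_nat_cond big1 ?add0r; last first.
    by move=> m /andP[/andP[_ mj] _]; rewrite /q leqNgt mj mul0r.
  rewrite -{1}[j]add0n big_addn -addSn addnK big_mkord /Ak big_distrr/=.
  apply: eq_bigr=> i _; rewrite /q leq_addl addnK rmorphM exprD.
  by rewrite [Rp _ _ _^+i * _]mulrC !mulrA; congr (_ * _); rewrite -!mulrA; congr (_ * _); rewrite mulrC.
pose c := j`!%:R/(x*W)^+j.
have xW: 0<x*W by rewrite mulr_gt0.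
have cE t : (nrm (Rp sigma z t)/W)^+(2 * j)*nrm (Ak k I t)^+2 = c^+2*nrm (P t)^+2.
  rewrite PE !nrmM nrmX nrm_real_ge0; last by rewrite divr_ge0 ?exprn_ge0 ?ltW.
  move: (nrm _) (nrm _)=> r A; rewrite /c mulnC exprM -!exprMn; congr (_^+2); rewrite expr_div_n exprMn; field.
  by rewrite !expf_neq0 ?gt_eqF// pnatr_eq0 -lt0n fact_gt0.
rewrite (@eq_Ex _ _ _ (fun t=> c^+2*nrm (P t)^+2)); last by move=> t _; exact: cE.
have bP: bm T (fun t=> nrm (P t)^+2).
  by apply: bm_nrm2=>//; apply: cbm_sum=>// m; apply: cbmM=>//; [exact: cbm_cst|apply: cbmX=>//; exact: cbm_Rp].
rewrite ExZ//.
have c0: 0<=c by rewrite divr_ge0// exprn_ge0// ltW.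
have c4: c<=4 ^- j.
  rewrite /c ler_pdivrMr ?exprn_gt0//; apply: le_trans (_ : j%:R^+j<=_).
    by rewrite -natrX ler_nat fact_le_pow.
  rewrite mulrC -expr_div_n lerXn2r ?nnegrE ?divr_ge0 ?(ltW xW)//.
have c16: c^+2<=16 ^- j.
  rewrite (_ : 16 ^- j=(4 ^- j)^+2 :> R); first by rewrite lerXn2r ?nnegrE ?invr_ge0 ?exprn_ge0.
  rewrite [RHS]exprVn -[(4^+j)^+2]exprM mulnC exprM (_ : 4^+2 = 16 :> R)//; by ring.
have key := @mean_Rp_le (I+j) q (k+2*x) hT.
have {}key : Ex T (fun t=> nrm (P t)^+2)<=5/4 * expR (Fz sigma z (k+2*x)).
  apply: key; first by rewrite addr_ge0// mulr_ge0// ltW.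
  move=> i _; rewrite /q; case: ifP=> ji; last first.
    by rewrite lexx/= divr_ge0// exprn_ge0// divr_ge0// addr_ge0// mulr_ge0// ltW.
  rewrite mulr_ge0/= ?divr_ge0 ?exprn_ge0 ?divr_ge0 ?(ltW x0)//.
  rewrite (_ : (k+2*x)/2 = k/2+x); last by field.
  by apply: tail_coef=>//; [exact: ltW|exact: divr_ge0].
apply: le_trans (ler_pM _ _ c16 key) _; rewrite ?sqr_ge0//.
  by apply: Ex_ge0=>// t _; exact: sqr_ge0.
by rewrite mulrCA.
Qed.
End Laplace.

(** * Growth comparisons *)

Section Eventually.
Variable R : realType.

Definition ev (P : R -> Prop) := exists L0 : R, forall L, L0<=L -> P L.

Lemma ev_ge (K : R) : ev (fun L=> K<=L). Proof. by exists K. Qed.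

Lemma ev_growth (K : R) n (e : R) : 0<e -> ev (fun L=> K*(1+ln L)^+n<=L`^e).
Proof.
move=> e0; have e2: 0<e/2 by rewrite divr_gt0.
have [C C1 HC] := ln_pow_le n e2; have C0 := lt_le_trans ltr01 C1.
exists (Num.max 1 ((`|K| * C)`^(e/2)^-1))=> L; rewrite ge_max=> /andP[L1 LK].
have L0 := lt_le_trans ltr01 L1.
have KC: 0<=`|K| * C by rewrite mulr_ge0// ltW.
have h: `|K| * C<=L`^(e/2).
  have := ge0_ler_powR (ltW e2) (powR_ge0 _ _) (ltW L0) LK.
  by rewrite -powRrM mulVf ?gt_eqF// powRr1.
apply: le_trans (_ : `|K| * (1+ln L)^+n<=_).
  by rewrite ler_wpM2r ?ler_norm// exprn_ge0// addr_ge0// ln_ge0.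
apply: le_trans (ler_wpM2l (normr_ge0 K) (HC _ L1)) _; rewrite mulrA.
have -> : L`^e = L`^(e/2)*L`^(e/2).
  by rewrite -powRD ?(gt_eqF L0) ?implybT//; congr (_`^_); field.
by rewrite ler_wpM2r ?powR_ge0.
Qed.

Lemma ev_ln (K : R) : ev (fun L=> K<=ln L).
Proof.
exists (expR K)=> L h; rewrite -[X in X<=_]expRK ler_ln ?posrE ?expR_gt0//.
by apply: lt_le_trans h; exact: expR_gt0.
Qed.

Lemma ev_ell (K c : R) : 0<c -> ev (fun L=> K * ln L+K<=c*(L / ln L)).
Proof.
move=> c0; have [a ha] := ev_growth (`|K| / c) 2 (@ltr01 R); have [b hb] := ev_ln 1; have [d hd] := ev_ge 1.
exists (Num.max a (Num.max b d))=> L; rewrite !ge_max=> /and3P[/ha h1 /hb h2 /hd h3].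
have L0 := lt_le_trans ltr01 h3; have l0: 0<ln L by apply: lt_le_trans h2.
rewrite mulrA ler_pdivlMr//; move: h1; rewrite powRr1 ?(ltW L0)// mulrAC ler_pdivrMr// [L*c]mulrC.
apply: le_trans; rewrite (_ : (_ + _) * _ = K*((1+ln L) * ln L)); last by ring.
have p0: 0<=(1+ln L) * ln L by rewrite mulr_ge0 ?addr_ge0// ltW.
apply: le_trans (ler_wpM2r p0 (ler_norm K)) _; rewrite ler_wpM2l//.
by rewrite expr2 ler_wpM2l ?addr_ge0 ?(ltW l0)// lerDr.
Qed.
End Eventually.

(** * An upper bound for the log-Laplace transform *)

Section FzUpper.
Variables (R : realType) (sigma : R).
Hypotheses (hs1 : 2^-1<sigma) (hs2 : sigma<1).
Let s0 : 0<sigma. Proof. by move: hs1; lra. Qed.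
Let a := sigma^-1.

(** The factor [s^(1/sigma)] is what matters: a small constant [s] brings the transform below any
    fixed multiple of [L / ln L], hence below the degree [I]. *)
Lemma Fz_upper : exists2 B : R, 0<B & forall s, 0<s -> s<=1 -> ev (fun L : R=> forall z : nat,
  L^+2<=z%:R -> Fz sigma z (s*L`^sigma)<=B*s`^a*(L / ln L)).
Proof.
have [C [k0 [C0 k01 H]]] := Fz_asymp hs1 hs2; have G0 := G1_gt0 hs1 hs2.
exists ((G1 sigma+C)*(2 / sigma)); first by rewrite mulr_gt0 ?divr_gt0// ltr_pwDl.
move=> s sp s1.
have [x1 g1] := ev_ge (Num.max 1 ((Num.max k0 (expR 1) / s)`^a)).
have [x2 g2] := ev_ln (Num.max 1 (- (2 / sigma) * ln s)).
exists (Num.max x1 x2)=> L; rewrite !ge_max=> /andP[/g1 + /g2]; rewrite !ge_max.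
move=> /andP[L1 Lk] /andP[l1 ls] z Lz.
have L0 := lt_le_trans ltr01 L1; have l0 := lt_le_trans ltr01 l1.
set k := s*L`^sigma.
have a0: 0<a by rewrite invr_gt0.
have kk: Num.max k0 (expR 1)<=k.
  rewrite /k mulrC -ler_pdivrMr//; have m0: 0<=Num.max k0 (expR 1) / s.
    by rewrite divr_ge0 ?(ltW sp)// le_max expR_ge0 orbT.
  have := ge0_ler_powR (ltW s0) (powR_ge0 _ _) (ltW L0) Lk.
  by rewrite -powRrM mulVf ?gt_eqF// powRr1.
move: kk; rewrite ge_max=> /andP[kk0 kk1].
have kp: 0<k by rewrite mulr_gt0// powR_gt0.
have lk1: 1<=ln k by rewrite -(expRK 1) ler_ln ?posrE ?expR_gt0.
have lk0 := lt_le_trans ltr01 lk1.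
have kaE: k`^a = s`^a*L.
  by rewrite /k powRM ?powR_ge0 ?(ltW sp)// -powRrM mulfV ?gt_eqF// powRr1// ltW.
have sa1: s`^a<=1.
  by have := ge0_ler_powR (ltW a0) (ltW sp) ler01 s1; rewrite powR1.
have kz: k`^(2*a)<=z%:R.
  rewrite mulrC powRrM powR_mulrn ?powR_ge0// kaE; apply: le_trans Lz.
  by rewrite lerXn2r ?nnegrE ?mulr_ge0 ?powR_ge0 ?(ltW L0)// ler_piMl// ltW.
have := H k z kk0 kz; rewrite ler_norml=> /andP[_ h].
have lk2: sigma/2 * ln L<=ln k.
  rewrite lnM ?posrE ?powR_gt0// ln_powR; move: ls; rewrite mulNr=> ls.
  have := ler_wpM2l (ltW (divr_gt0 s0 (ltr0n R 2))) ls; rewrite mulrN mulrA.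
  rewrite (_ : sigma/2*(2 / sigma) = 1) ?mul1r; last by field; rewrite gt_eqF.
  by lra.
have ka0: 0<=k`^a by exact: powR_ge0.
have sq: k`^a / ln k^+2<=k`^a / ln k.
  by rewrite ler_wpM2l// lef_pV2 ?posrE ?exprn_gt0// expr2 ler_peMl// ltW.
have up: Fz sigma z k<=(G1 sigma+C)*(k`^a / ln k).
  move: h; rewrite lerBlDl=> h; apply: le_trans h _; rewrite mulrDl -!mulrA lerD2l ler_wpM2l//.
apply: le_trans up _; rewrite -!mulrA; apply: ler_wpM2l; first by rewrite addr_ge0// ltW.
rewrite kaE (_ : 2*(sigma^-1*(s`^a*(L / ln L))) = s`^a*L/(sigma/2 * ln L)); last first.
  by field; rewrite !gt_eqF.
rewrite -kaE ler_wpM2l// lef_pV2 ?posrE// !mulr_gt0// divr_gt0.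
Qed.
End FzUpper.

(** * The truncated Laplace transform *)

Section LaplaceCore.
Variables (R : realType) (sigma T : R) (z : nat).
Hypotheses (T0 : 0<T) (z2 : (1<z)%N).

Definition GW (W : R) : set R := [set t | nrm (Rp sigma z t)^+2<=W^+2].

Lemma measurable_GW W : measurable (GW W).
Proof.
have [mf _] := bm_nrm2 (cbm_Rp 1 sigma z).
have := mf measurableT `]-oo, W^+2]%classic (measurable_itv _); rewrite setTI.
by congr measurable; apply/seteqP; split=> t /=; rewrite in_itv.
Qed.

Lemma bm_exp (f : R -> R) (k : R) : bm T f -> bm T (fun t=> expR (k * f t)).
Proof.
move=> [mf [M HM]]; split; first by apply: measurableT_comp=>//; exact: measurable_funM.
exists (expR (`|k| * M))=> t tT; rewrite ger0_norm ?expR_ge0// ler_expR.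
apply: le_trans (ler_norm _) _; rewrite normrM ler_wpM2l//; exact: HM.
Qed.

Lemma Ak_0 I t : Ak sigma z 0 I t = 1.
Proof.
rewrite /Ak big_ord_recl/= !expr0 fact0 divr1 mulr1 big1 ?addr0// => i _.
by rewrite mul0r /bump/= exprS !mul0r.
Qed.

Lemma nrm_le_W W t : 0<W -> GW W t -> nrm (Rp sigma z t)<=W.
Proof. by move=> W0; rewrite /GW/= ler_pXn2r// nnegrE ?nrm_ge0// ltW. Qed.

(** On [GW] the polynomial and the exponential agree up to constant factors; off it the weighted
    mean shows that the polynomial carries little mass. So the restricted mean of the exponential is
    that of [|Ak|^2] up to constants, and the latter is known from both sides. *)
Lemma laplace_core (I j : nat) (k W : R) : (3<=I)%N -> 0<=k -> 0<W ->
  16*(z ^ I)%:R^+2<=T -> k/2*W<=I%:R/20 ->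
  Ex T (fun t=> (nrm (Rp sigma z t)/W)^+(2 * j)*nrm (Ak sigma z k I t)^+2)<=16^-1 ->
  (z.+2)%:R*4 ^- I * expR (Fz sigma z (2*k))<=4^-1 ->
  expR (Fz sigma z k)/4<=Ex T (fun t=> \1_(GW W) t * expR (k*Re (Rp sigma z t))) <=
  4 * expR (Fz sigma z k).
Proof.
move=> I3 k0 W0 hT kW tl ze.
have bR: bm T (fun t=> Re (Rp sigma z t)) by case: (cbm_Rp T sigma z).
have bE: bm T (fun t=> \1_(GW W) t * expR (k*Re (Rp sigma z t))).
  by apply: bmM=>//; [apply: bm_indic; exact: measurable_GW|exact: bm_exp].
have cA: cbm T (fun t=> Ak sigma z k I t).
  by apply: cbm_sum=>// i; apply: cbmM=>//; [exact: cbm_cst|apply: cbmX=>//; exact: cbm_Rp].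
have bA: bm T (fun t=> nrm (Ak sigma z k I t)^+2) by exact: bm_nrm2.
have bt: bm T (fun t=> (nrm (Rp sigma z t)/W)^+(2 * j)*nrm (Ak sigma z k I t)^+2).
  apply: bmM=>//; rewrite (_ : (fun t=> _) = fun t=> W ^- (2 * j)*nrm (Rp sigma z t)^+(2 * j)).
    by apply: bmZ=>//; apply: bm_nrm2k=>//; exact: cbm_Rp.
  by apply/funext=> t; rewrite expr_div_n mulrC.
have app t : GW W t -> 9/16 * expR (k*Re (Rp sigma z t))<=nrm (Ak sigma z k I t)^+2 <=
    25/16 * expR (k*Re (Rp sigma z t)).
  move=> Gt; apply: Ak_approx=>//; apply: le_trans kW; rewrite ler_wpM2l ?divr_ge0//.
  exact: nrm_le_W.
have F1: 1<=expR (Fz sigma z k) by rewrite -expR0 ler_expR Fz_ge0.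
apply/andP; split.
  have low := mean_Ak_ge T0 z2 hT k0 ze.
  have : Ex T (fun t=> nrm (Ak sigma z k I t)^+2 + -1*((nrm (Rp sigma z t)/W)^+(2 * j)*nrm (Ak sigma z k I t)^+2))
      <= Ex T (fun t=> 25/16*(\1_(GW W) t * expR (k*Re (Rp sigma z t)))).
    apply: Ex_le=>//; [by apply: bmD=>//; exact: bmZ|exact: bmZ|move=> t _].
    rewrite indicE; have [Gt|Gt] := boolP (t \in GW W).
      have /andP[_ h] := app t (set_mem Gt); rewrite mul1r mulN1r; apply: le_trans h; rewrite gerBl.
      by rewrite mulr_ge0 ?sqr_ge0// exprn_ge0// divr_ge0 ?nrm_ge0// ltW.
    rewrite mul0r mulr0 mulN1r subr_le0 ler_peMl ?sqr_ge0//; apply: exprn_ege1.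
    rewrite ler_pdivlMr// mul1r leNgt; apply/negP=> h; move/negP: Gt; apply; rewrite inE /GW/=.
    by rewrite lerXn2r ?nnegrE ?nrm_ge0 ?(ltW W0)// ltW.
  rewrite ExD// ?ExZ//; last exact: bmZ.
  move: low tl F1; move: (expR (Fz _ _ _)) (Ex T _) (Ex T _) (Ex T _)=> e u v w; lra.
have up := @mean_Rp_le R sigma T z T0 z2 I (fun i=> (k/2)^+i / i`!%:R) k hT k0.
have {}up : Ex T (fun t=> nrm (Ak sigma z k I t)^+2)<=5/4 * expR (Fz sigma z k).
  by apply: up=> i _; rewrite lexx divr_ge0 ?exprn_ge0 ?divr_ge0.
have : Ex T (fun t=> \1_(GW W) t * expR (k*Re (Rp sigma z t)))<=Ex T (fun t=> 16/9*nrm (Ak sigma z k I t)^+2).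
  apply: Ex_le=>//; first exact: bmZ.
  move=> t _; rewrite indicE; have [Gt|Gt] := boolP (t \in GW W).
    have /andP[h _] := app t (set_mem Gt); rewrite mul1r; move: h; move: (expR _) (nrm _^+2)=> u v; lra.
  by rewrite mul0r mulr_ge0// sqr_ge0.
rewrite ExZ//; move: up F1; move: (expR (Fz _ _ _)) (Ex T _) (Ex T _)=> e u v; lra.
Qed.
End LaplaceCore.

(** * The number of primes used *)

Section Tuning.
Variables (R : realType) (sigma : R).
Hypotheses (hs1 : 2^-1<sigma) (hs2 : sigma<1).
Let d0 := 2*sigma - 1.
Let d1 := 3/4*(2*sigma - 1).
Let A := 8 / d0.
Let d0p : 0<d0. Proof. by rewrite /d0; move: hs1; lra. Qed.
Let d0l : d0<1. Proof. by rewrite /d0; move: hs2; lra. Qed.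
Let A8 : 8<=A. Proof. by rewrite /A ler_pdivlMr//; move: d0l; lra. Qed.

(** The exponent [A = 8 / d0] gives [z^(d0/8) >= L], which admits the moments of order up to
    [L = ln T] in [block_moment]. *)
Definition zL (L : R) : nat := (Num.truncn (L`^A)).+1.

Lemma zL_props : ev (fun L=> [/\ L^+2<=(zL L)%:R, (1<zL L)%N, L<=(zL L)%:R`^(d0/8),
  2^+8<=(zL L)%:R`^(d1/2) & lnn R (zL L)<=2*A * ln L] /\ (zL L).+2%:R<=4 * expR (A * ln L)).
Proof.
have [x2 g2] := @ev_ln R 1.
exists (Num.max (2^+8) x2)=> L; rewrite !ge_max=> /andP[L1 /g2 l1].
have L1': 1<=L by apply: le_trans L1; apply: exprn_ege1; rewrite ler1n.
have L0 := lt_le_trans ltr01 L1'; have A0: 0<=A by apply: le_trans A8.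
set z := zL L; have LA0: 0<=L`^A by exact: powR_ge0.
have zl: L`^A<z%:R by rewrite truncnS_gt.
have zu: z%:R<=L`^A+1 by rewrite /z /zL -[_.+1%:R]natr1 lerD2r truncn_le.
have LA2: L^+2<=L`^A.
  by rewrite -powR_mulrn ?(ltW L0)// ler_powR//; move: A8; lra.
have L2: 2<=L.
  by apply: le_trans L1; rewrite -[X in X<=_]expr1 ler_weXn2l ?ler1n.
have LL: L<=L^+2 by rewrite expr2 ler_peMl// ltW.
have z0: (0<z)%N by [].
have AE: A*(d0/8) = 1 by rewrite /A; field; rewrite gt_eqF.
have AE2: A*(d1/2) = 3 by rewrite /A /d1 -/d0; field; rewrite gt_eqF.
have LA: L`^A = expR (A * ln L) by rewrite /powR (gt_eqF L0).
split; last first.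
  rewrite -[_.+2]addn2 natrD -LA; move: zu LA2 LL L2; lra.
split.
- by apply: le_trans LA2 (ltW zl).
- by rewrite -(ltr_nat R); move: zl LA2 LL L2; lra.
- apply: le_trans (_ : (L`^A)`^(d0/8)<=_); first by rewrite -powRrM AE powRr1// ltW.
  by rewrite ge0_ler_powR ?nnegrE ?(ltW zl) ?divr_ge0 ?(ltW d0p).
- apply: le_trans (_ : (L`^A)`^(d1/2)<=_).
    rewrite -powRrM AE2; apply: le_trans L1 _; rewrite -[X in X<=_]powRr1 ?(ltW L0)// ler_powR//; lra.
  by rewrite ge0_ler_powR ?nnegrE ?(ltW zl) ?divr_ge0// /d1 mulr_ge0 ?(ltW d0p).
have : lnn R z<=ln (2*L`^A).
  rewrite ler_ln ?posrE ?mulr_gt0 ?powR_gt0 ?ltr0n//; move: zu LA2 LL L2; lra.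
rewrite lnM ?posrE ?powR_gt0// ln_powR; have := @ln2_le1 R.
have : A<=A * ln L by rewrite ler_peMr.
by move: A8; lra.
Qed.
End Tuning.

Section SmallLemmas.
Variable R : realType.

Lemma pow16_le (j : nat) (y : R) : y - 1<=j%:R -> 16 ^- j<=16 * expR (- (2*y)).
Proof.
move=> h; have e4 := @expR1_le4 R.
have e16: expR (2 : R)<=16.
  rewrite (_ : 2 = 1+1 :> R) ?expRD// (_ : 16 = 4*4 :> R); last by ring.
  by rewrite ler_pM ?expR_ge0.
have h1: expR (2 * j%:R)<=16^+j :> R.
  by rewrite mulrC expRM_natl lerXn2r ?nnegrE ?expR_ge0.
apply: le_trans (_ : expR (- (2 * j%:R))<=_).
  by rewrite expRN lef_pV2 ?posrE ?expR_gt0 ?exprn_gt0.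
apply: le_trans (_ : expR 2 * expR (- (2*y))<=_); last by rewrite ler_wpM2r ?expR_ge0.
by rewrite -expRD ler_expR; move: h; lra.
Qed.

Lemma exp_half_ge (L : R) : 640<=L -> 16<=expR (L/2).
Proof. by move=> h; apply: le_trans (expR_ge1Dx _); lra. Qed.

Lemma expRN4_le : expR (- (4 : R))<=16^-1.
Proof.
rewrite expRN lef_pV2 ?posrE ?expR_gt0// -[X in expR X]mulr1 expRM_natl.
apply: le_trans (_ : (2 : R)^+4<=_); first by rewrite !exprS expr0; lra.
by rewrite lerXn2r ?nnegrE ?expR_ge0//; apply: le_trans (expR_ge1Dx _); lra.
Qed.

Lemma pow4_le (I : nat) : 4 ^- I<=expR (- I%:R) :> R.
Proof.
rewrite expRN lef_pV2 ?posrE ?expR_gt0 ?exprn_gt0// -[X in expR X]mulr1 expRM_natl.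
by rewrite lerXn2r ?nnegrE ?expR_ge0// expR1_le4.
Qed.

Lemma bad_total (C0 c0 b l L I c' kap : R) : 0<=C0 -> 0<c0 -> 0<=l -> l<=L -> 0<=I ->
  I<=L -> kap * l/2<=I -> c'<=c0*kap/2 -> c'<=c0/2 -> c'<=b ->
  C0*(expR (- (c0*I))+(1+I) * expR (- (c0*L)))+20 * expR (- (b * l)) <=
  (C0+C0*(1+2 / c0)+20) * expR (- (c' * l)).
Proof.
move=> C00 c00 l0 lL I0 IL kI h1 h2 h3.
have u1: expR (- (c0*I))<=expR (- (c' * l)).
  rewrite ler_expR lerN2; apply: le_trans (ler_wpM2r l0 h1) _.
  by have := ler_wpM2l (ltW c00) kI; lra.
have L0: 0<=L := le_trans l0 lL.
have q0: 0<=2 / c0 by rewrite divr_ge0// ltW.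
have u2: (1+I) * expR (- (c0*L))<=(1+2 / c0) * expR (- (c' * l)).
  apply: le_trans (_ : (1+2 / c0) * expR (c0/2*L) * expR (- (c0*L))<=_).
    rewrite ler_wpM2r ?expR_ge0//; have e1 := expR_ge1Dx (c0/2*L).
    have cL: 0<=c0/2*L by rewrite mulr_ge0// divr_ge0// ltW.
    apply: le_trans (_ : 1+L<=_); first by rewrite lerD2l.
    rewrite mulrDl mul1r; apply: lerD; first by move: e1 cL; lra.
    apply: le_trans (ler_wpM2l q0 e1); rewrite mulrDr mulr1 mulrA.
    rewrite (_ : 2 / c0*(c0/2) = 1) ?mul1r ?lerDr//; by field; rewrite gt_eqF.
  rewrite -mulrA ler_wpM2l ?addr_ge0// -expRD ler_expR.
  have := ler_wpM2r l0 h2; have := ler_wpM2l (ltW c00) lL; lra.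
have u3: expR (- (b * l))<=expR (- (c' * l)) by rewrite ler_expR lerN2 ler_wpM2r.
move: (expR (- (c' * l))) u1 u2 u3=> u u1 u2 u3.
rewrite [X in _<=X](_ : _ = C0*(u+(1+2 / c0)*u)+20*u); last by ring.
by apply: lerD; [apply: ler_wpM2l=>//; apply: lerD|apply: ler_wpM2l].
Qed.
End SmallLemmas.

(** * Laplace transform and exceptional set, uniformly in k *)

Section LaplaceMain.
Variables (R : realType) (sigma : R).
Hypotheses (hs1 : 2^-1<sigma) (hs2 : sigma<1).
Let s0 : 0<sigma. Proof. by move: hs1; lra. Qed.
Let d0 := 2*sigma - 1.
Let A := 8 / d0.
Let d0p : 0<d0. Proof. by rewrite /d0; move: hs1; lra. Qed.
Let d0l : d0<1. Proof. by rewrite /d0; move: hs2; lra. Qed.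
Let A8 : 8<=A. Proof. by rewrite /A ler_pdivlMr//; move: d0l; lra. Qed.
(** With [I <= kap L / ln L] and [ln z <= 2 A ln L] this yields [I ln z <= d0 L / 64], the length
    allowed by the mollifier. *)
Let kap := d0/(128*A).
Let kap0 : 0<kap. Proof. by rewrite divr_gt0// mulr_gt0// (lt_le_trans _ A8). Qed.
Let kap1 : kap<=1.
Proof.
have A0: 0<A by apply: lt_le_trans A8.
have A1: 0<128*A by exact: mulr_gt0.
rewrite /kap ler_pdivrMr// mul1r; move: d0l A8; lra.
Qed.

Theorem laplace : exists c2 c0 C0 L0 : R, [/\ 0<c2, c2<=1, 0<c0 & forall T : R, 0<T -> L0<=ln T ->
  exists (z : nat) (W : R) (Q : R -> R),
  [/\ ln T^+2<=z%:R, bm T Q /\ (forall t, 0<=Q t), Ex T Q<=expR (- (c0*(ln T / ln (ln T)))),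
    forall t, T<=t<=2*T -> Q t<1 ->
      GW sigma z W t /\ `|ln (abs_zeta sigma t)-Re (Rp sigma z t)| <= C0 &
    forall k : R, 0<=k -> k<=c2 * ln T`^sigma ->
      expR (Fz sigma z k)/4<=Ex T (fun t=> \1_(GW sigma z W) t * expR (k*Re (Rp sigma z t))) <=
      4 * expR (Fz sigma z k)]].
Proof.
have aux1 (L : R) : 0<L -> L/2+2*(L/64+L/64)<=L by lra.
have aux2 (k u y : R) : k<=u/3*y -> k+2*(u/3*y)<=u*y by lra.
have aux3 (u : R) : 0<=u -> 5/4*(16*u)<=20*u by lra.
have aux4 (c l : R) : c/2 * l + - (c * l) <= - (c/2 * l) by lra.
have aux5 (r w k l c i : R) : r<=w -> w<=k/80 * l -> c<=k/80 * l -> k * l/2<=i -> r+c<=i/20 by lra.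
have aux6 (w k y : R) : 0<k -> 80*w / k<=y -> w<=k/80*y.
  by move=> k0; rewrite ler_pdivrMr//; lra.
have aux7 (c w k : R) : 0<w -> c<=k/(20*w) -> c*w<=k/20.
  by move=> w0; rewrite ler_pdivlMr ?mulr_gt0//; lra.
have aux8 (c k l i : R) : c * l<=k/20 * l -> k * l/2<=i -> c * l/2<=i/20 by lra.
have aux9 (e : R) : 320<=e -> 20 / e<=16^-1.
  move=> h; have e0: 0<e by apply: lt_le_trans h; rewrite ltr0n.
  by rewrite ler_pdivrMr//; move: h; lra.
have aux10 (k u y : R) : 0<u*y -> k<=u/3*y -> 2*k<=u*y by lra.
have aux11 (q l k e i : R) : 1<=l -> 0<=q -> (q+5) * l+(q+5)<=k/2 * e -> k * e<i+1 ->
    q * l + - i+k/2 * e <= - 4 by lra.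
have aux13 (c k l : R) : c * l<=k/2 * l -> 320<=c * l -> 640<=k * l by lra.
have aux14 (u i : R) : u<i+1 -> 640<=u -> u/2<=i by lra.
have aux15 (u i : R) : u/2<=i -> 640<=u -> 3<=i by lra.
have aux16 (c k : R) : c<=k/2 -> 0<k -> c<=k by lra.
have aux17 (u i : R) : u<i+1 -> 320<=u -> 0<i by lra.
have aux18 (d l : R) : d * l<=1 * l -> d/64 * l<=l/64 by lra.
have aux12 (u v : R) : u<=v -> v<=16^-1 -> 4*u<=4^-1 by lra.
have e4_16 := @expRN4_le R.
have [C0 [cm [LM [C04 cm0 LM16 HM]]]] := mollifier hs1 hs2.
have [B B0 HB] := Fz_upper hs1 hs2.
pose a := sigma^-1; have a0: 0<a by rewrite invr_gt0.
(* Makes the transform at most [b ell] on [[0, s L^sigma]] with [b <= kap/2], so that [4^-I] beats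
   the exponential of [Fz (2 k)]. *)
pose s := Num.min 1 ((kap/(2*B))`^sigma).
have q0: 0<kap/(2*B) by rewrite divr_gt0// mulr_gt0.
have sp: 0<s by rewrite lt_min ltr01 powR_gt0.
have s1: s<=1 by rewrite ge_min lexx.
have sa: s`^a<=kap/(2*B).
  have : s<=(kap/(2*B))`^sigma by rewrite ge_min lexx orbT.
  move/(ge0_ler_powR (ltW a0) (ltW sp) (powR_ge0 _ _)); rewrite -powRrM mulfV ?gt_eqF// powRr1//; exact: ltW.
pose b := B*s`^a; have b0: 0<b by rewrite mulr_gt0// powR_gt0.
have bk: b<=kap/2.
  apply: le_trans (ler_wpM2l (ltW B0) sa) _; apply: eq_ler.
  by field; rewrite gt_eqF.
(* A third, because [mean_tail] evaluates the transform at [k + 2 x] with [k <= x]. *)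
pose x0 := s/3; have x00: 0<x0 by rewrite divr_gt0.
(* Gives [x W / 4 = b ell]. The moment order [j], the integer part of [b ell], is then admissible,
   and [16^-j], of order at most [e^(-2 b ell)], beats [e^(b ell)]. *)
pose w0 := 4*b / x0; have w00: 0<w0 by rewrite divr_gt0// mulr_gt0.
pose c2 := Num.min x0 (kap/(20*w0)).
have c20: 0<c2 by rewrite lt_min x00 divr_gt0// mulr_gt0.
pose c' := Num.min (cm*kap/2) (Num.min (cm/2) b).
have c'0: 0<c' by rewrite /c' !lt_min; apply/and3P; split=>//; apply: divr_gt0=>//; exact: mulr_gt0.
pose CC := C0+C0*(1+2 / cm)+20.
have C00: 0<=C0 by apply: le_trans C04.
have CC0: 0<=CC by rewrite /CC; nneg.
have [y1 g1] := zL_props hs1 hs2; have [y2 g2] := HB s sp s1.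
have k80: 0<kap/80 by rewrite divr_gt0.
have k2: 0<kap/2 by rewrite divr_gt0.
have c2': 0<c'/2 by rewrite divr_gt0.
have [y3 g3] := ev_ell C0 k80.
have [y4 g4] := ev_ell (A+5) k2.
have [y5 g5] := ev_ell 320 b0.
have [y6 g6] := ev_ell CC c2'.
have [y7 g7] := ev_growth (80*w0 / kap) 0 s0.
have [y8 g8] := @ev_ln R 1.
exists c2, (c'/2), C0, (Num.max y1 (Num.max y2 (Num.max y3 (Num.max y4 (Num.max y5 (Num.max y6 (Num.max y7 (Num.max y8 LM)))))))).
split=>//.
  by rewrite ge_min; apply/orP; left; rewrite /x0; move: s1; lra.
move=> T T0; rewrite !ge_max; set L := ln T.
move=> /andP[/g1 [[Lz2 z2 Lz zd lz] z4]] /andP[/g2 FzU] /and5P[/g3 e3 /g4 e4 /g5 e5 /g6 e6].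
move=> /and3P[/g7 e7 /g8 l1 LLM].
clear g1 g2 g3 g4 g5 g6 g7 g8 y1 y2 y3 y4 y5 y6 y7 y8.
have l0 := lt_le_trans ltr01 l1; have L16 := le_trans LM16 LLM.
have L0: 0<L by apply: lt_le_trans L16.
set z := zL sigma L in Lz2 z2 Lz zd lz z4.
set ell := L / ln L in e3 e4 e5 e6 *.
have ell0: 0<ell by rewrite divr_gt0.
have ellL: ell<=L by rewrite ler_pdivrMr// ler_peMr// ltW.
have {}e3 : C0<=kap/80 * ell by apply: le_trans e3; rewrite lerDr mulr_ge0// ltW.
have {}e5 : 320<=b * ell by apply: le_trans e5; rewrite lerDr; exact: mulr_ge0 (ler0n _ _) (ltW l0).
have {}e6 : CC<=c'/2 * ell by apply: le_trans e6; rewrite lerDr mulr_ge0// ltW.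
rewrite expr0 mulr1 in e7.
pose I := Num.truncn (kap * ell); pose j := Num.truncn (b * ell).
have kl0: 0<=kap * ell by rewrite mulr_ge0// ltW.
have bl0: 0<=b * ell by rewrite mulr_ge0// ltW.
have I1: I%:R<=kap * ell by rewrite truncn_le.
have I2: kap * ell<I%:R+1 by rewrite natr1 truncnS_gt.
have j1: j%:R<=b * ell by rewrite truncn_le.
have j2: b * ell<j%:R+1 by rewrite natr1 truncnS_gt.
have kl640: 640<=kap * ell by exact: aux13 (ler_wpM2r (ltW ell0) bk) e5.
have I3: kap * ell/2<=I%:R by exact: aux14 I2 kl640.
have I3n: (3<=I)%N by rewrite -(ler_nat R); exact: aux15 I3 kl640.
have jI: (j<=I)%N.
  rewrite -ltnS -(ltr_nat R); apply: le_lt_trans j1 _; rewrite -[I.+1%:R]natr1; apply: le_lt_trans I2.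
  by rewrite ler_wpM2r ?(ltW ell0)//; exact: aux16 bk kap0.
have j0: (0<j)%N by rewrite -(ltr0n R); exact: aux17 j2 e5.
have IL: I%:R<=L.
  apply: le_trans I1 _; apply: le_trans ellL; rewrite ler_piMl// ltW//.
pose W := w0*L`^(1-sigma) / ln L.
have W0: 0<W by rewrite divr_gt0// mulr_gt0// powR_gt0.
pose x : R := x0*L`^sigma; have xp: 0<x by rewrite mulr_gt0// powR_gt0.
have LL: L`^sigma*L`^(1-sigma) = L.
  by rewrite -powRD ?(gt_eqF L0) ?implybT// addrC subrK powRr1// ltW.
have cWE c : c*L`^sigma*W = c*w0 * ell.
  transitivity (c*w0*(L`^sigma*L`^(1-sigma) / ln L)); last by rewrite LL.
  by rewrite /W; ring.
have xW: x*W/4 = b * ell.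
  by rewrite cWE /w0; field; rewrite gt_eqF.
have Iz: I%:R * lnn R z<=d0/64*L.
  apply: le_trans (ler_pM _ _ I1 lz) _=>//; first exact: lnn_ge0.
  apply: eq_ler; rewrite /kap /ell -/A.
  by field; rewrite !gt_eqF// (lt_le_trans _ A8).
have zI: (z ^ I)%:R<=expR (L/64).
  rewrite natrX -[z%:R]lnK ?posrE ?ltr0n ?(ltnW z2)// -expRM_natl ler_expR; apply: le_trans Iz _.
  by exact: aux18 (ler_wpM2r (ltW L0) (ltW d0l)).
have zj: (z ^ j)%:R<=expR (L/64).
  by apply: le_trans zI; rewrite ler_nat leq_pexp2l// ltnW.
have TE: T = expR L by rewrite lnK.
have e16: 16<=expR (L/2).
  apply: exp_half_ge; apply: le_trans kl640 _; apply: le_trans ellL.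
  by rewrite ler_piMl// ltW.
have hTj: 16*(z ^ (I+j))%:R^+2<=T.
  apply: le_trans (_ : expR (L/2)*(expR (L/64) * expR (L/64))^+2<=_).
    rewrite ler_pM ?exprn_ge0// lerXn2r ?nnegrE ?mulr_ge0 ?expR_ge0// expnD natrM.
    exact: ler_pM.
  by rewrite -expRD -expRM_natl -expRD [X in _<=X]TE ler_expR; exact: aux1.
have hT: 16*(z ^ I)%:R^+2<=T.
  apply: le_trans hTj; rewrite ler_wpM2l// lerXn2r ?nnegrE// ler_nat leq_pexp2l ?leq_addr//; exact: ltnW.
have FzB (k : R) : 0<=k -> k<=s*L`^sigma -> Fz sigma z k<=b * ell.
  move=> k0 ks; apply: le_trans (Fz_mono _ _ k0 ks) _; exact: FzU.
have tail (k : R) : 0<=k -> k<=x ->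
    Ex T (fun t=> (nrm (Rp sigma z t)/W)^+(2 * j)*nrm (Ak sigma z k I t)^+2)<=20 * expR (- (b * ell)).
  move=> k0 kx; have jx: j%:R<=x*W/4 by rewrite xW.
  apply: le_trans (@mean_tail R sigma T z T0 z2 I j k x W hTj k0 xp W0 jx) _.
  have h1: 16 ^- j<=16 * expR (- (2*(b * ell))) by apply: pow16_le; rewrite lerBlDr ltW.
  have h2: expR (Fz sigma z (k+2*x))<=expR (b * ell).
    rewrite ler_expR; apply: FzB; first by rewrite addr_ge0// mulr_ge0// ltW.
    exact: aux2.
  apply: le_trans (_ : 5/4*(16 * expR (- (2*(b * ell))) * expR (b * ell))<=_).
    by rewrite ler_wpM2l// ler_pM ?expR_ge0// invr_ge0 exprn_ge0.
  rewrite -(mulrA 16) -expRD (_ : - (2*(b * ell))+b * ell = - (b * ell)); last by ring.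
  exact: aux3 (expR_ge0 _).
have [Q0 [bQ0 Q00 EQ0 HQ0]] := HM T z I T0 LLM z2 (leq_trans (isT : 0<3)%N I3n) Iz Lz zd.
pose P t := (nrm (Rp sigma z t)/W)^+(2 * j).
have P0 t : 0<=P t by rewrite exprn_ge0// divr_ge0 ?nrm_ge0// ltW.
have bP: bm T P.
  rewrite (_ : P = fun t=> W ^- (2 * j)*nrm (Rp sigma z t)^+(2 * j)).
    by apply: bmZ=>//; apply: bm_nrm2k=>//; exact: cbm_Rp.
  by apply/funext=> t; rewrite /P expr_div_n mulrC.
exists z, W, (fun t=> Q0 t+P t); split=>//.
- by split; [exact: bmD|move=> t; rewrite addr_ge0].
- rewrite ExD//.
  have EP: Ex T P<=20 * expR (- (b * ell)).
    have := tail 0 (lexx _) (ltW xp); rewrite (@eq_Ex _ _ _ P)// => t _.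
    by rewrite Ak_0 nrm1 expr1n mulr1.
  apply: le_trans (lerD EQ0 EP) _.
  have cc1: c'<=cm*kap/2 by rewrite ge_min lexx.
  have cc2: c'<=cm/2 by rewrite !ge_min lexx orbT.
  have cc3: c'<=b by rewrite !ge_min lexx !orbT.
  apply: le_trans (bad_total C00 cm0 (ltW ell0) ellL (ler0n _ _) IL I3 cc1 cc2 cc3) _; rewrite -/CC.
  have CE: CC<=expR (c'/2 * ell).
    by apply: le_trans (expR_ge1Dx _); apply: le_trans e6 _; rewrite lerDr.
  apply: le_trans (ler_wpM2r (expR_ge0 _) CE) _; rewrite -expRD ler_expR; exact: aux4.
- move=> t tT Qt; have Q1: Q0 t<1 by apply: le_lt_trans Qt; rewrite lerDl.
  have P1: P t<1 by apply: le_lt_trans Qt; rewrite lerDr.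
  have RW: nrm (Rp sigma z t)<=W.
    rewrite leNgt; apply/negP=> h; move: P1; rewrite ltNge=> /negP; apply.
    by rewrite exprn_ege1// ler_pdivlMr// mul1r ltW.
  split; first by rewrite /GW/= lerXn2r ?nnegrE ?nrm_ge0// ltW.
  apply: HQ0=>//.
  have WB: W<=kap/80 * ell.
    rewrite /W /ell -[X in _<=_*(X / _)]LL !mulrA ler_wpM2r ?invr_ge0 ?(ltW l0)// ler_wpM2r ?powR_ge0//.
    exact: aux6.
  exact: aux5 RW WB e3 I3.
move=> k k0 kc.
have kx: k<=x by apply: le_trans kc _; rewrite ler_wpM2r ?powR_ge0// ge_min lexx.
apply: (@laplace_core R sigma T z T0 z2 I j k W)=>//.
- apply: le_trans (_ : c2*L`^sigma/2*W<=_).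
    by rewrite ler_wpM2r ?(ltW W0)// ler_wpM2r.
  have cw: c2*w0<=kap/20.
    by apply: aux7=>//; rewrite ge_min lexx orbT.
  rewrite mulrAC cWE; exact: aux8 (ler_wpM2r (ltW ell0) cw) I3.
- apply: le_trans (tail k k0 kx) _; rewrite expRN.
  by apply: aux9; apply: le_trans (expR_ge1Dx _); apply: le_trans e5 _; rewrite lerDr.
have F2: expR (Fz sigma z (2*k))<=expR (kap/2 * ell).
  rewrite ler_expR; apply: le_trans (FzB _ _ _) _; first by rewrite mulr_ge0.
    by apply: aux10=>//; rewrite mulr_gt0// powR_gt0.
  by rewrite ler_wpM2r// ltW.
have p4 := pow4_le R I.
have h4: 4 * expR (A * ln L) * expR (- I%:R) * expR (kap/2 * ell)<=4^-1.
  have I5: expR (A * ln L) * expR (- I%:R) * expR (kap/2 * ell)<=expR (- (4 : R)).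
    by rewrite -!expRD ler_expR; apply: aux11 e4 I2=>//; apply: le_trans A8.
  by rewrite -!(mulrA 4); exact: aux12 I5 e4_16.
apply: le_trans h4; apply: ler_pM; rewrite ?mulr_ge0 ?invr_ge0 ?exprn_ge0 ?expR_ge0//.
by apply: ler_pM; rewrite ?invr_ge0 ?exprn_ge0.
Qed.
End LaplaceMain.

(** * Variation of the main term *)

Section Bernoulli.
Variable R : realType.

(** Weighted arithmetic-geometric mean of [u] and 1, obtained from [ln x <= x - 1] at [u / m] and
    [1 / m]. *)
Lemma bernoulli_le (u p : R) : 0<u -> 0<=p<=1 -> u`^p<=1+p*(u - 1).
Proof.
move=> u0 /andP[p0 p1]; set m := 1+p*(u - 1).
have m0: 0<m.
  rewrite /m (_ : 1+p*(u - 1) = p*u+(1-p)); last by ring.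
  have [->|pn] := eqVneq p 0; first by rewrite mul0r add0r subr0.
  by rewrite ltr_pwDl ?subr_ge0// mulr_gt0// lt_neqAle eq_sym pn.
have h1: ln (u / m)<=u / m - 1.
  by have := @le_ln1Dx R (u / m - 1); rewrite ltrBrDl subrr divr_gt0// addrC subrK; apply.
have h2: ln m^-1<=m^-1 - 1.
  by have := @le_ln1Dx R (m^-1 - 1); rewrite ltrBrDl subrr invr_gt0// addrC subrK; apply.
rewrite ln_div ?posrE// in h1; rewrite lnV ?posrE// in h2.
rewrite /powR (gt_eqF u0) -[X in _<=X]lnK ?posrE// ler_expR.
have q0: 0<=1-p by rewrite subr_ge0.
have k1 := ler_wpM2l p0 h1; have k2 := ler_wpM2l q0 h2.
have mm: p*(u / m - 1)+(1-p)*(m^-1 - 1) = 0.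
  have -> : p*(u / m - 1)+(1-p)*(m^-1 - 1)=(1+p*(u - 1)) / m - 1 by ring.
  by rewrite -/m divff ?subrr// gt_eqF.
by move: k1 k2 mm; lra.
Qed.

Lemma powR1D_le (t a : R) : -1<t -> 1<=a<=2 -> (1+t)`^a<=1+a * t+t^+2.
Proof.
move=> t1 /andP[a1 a2]; have u0: 0<1+t by move: t1; lra.
have p01: 0<=a - 1<=1 by apply/andP; split; move: a1 a2; lra.
have := bernoulli_le u0 p01; rewrite addrAC subrr add0r=> h.
have -> : (1+t)`^a=(1+t)*(1+t)`^(a - 1).
  by rewrite -{2}[1+t]powRr1 ?(ltW u0)// -powRD ?(gt_eqF u0) ?implybT//; congr (_`^_); ring.
apply: le_trans (ler_wpM2l (ltW u0) h) _.
by have := mulr_ge0 (sqr_ge0 t) (_ : 0<=2-a); rewrite subr_ge0=> /(_ a2); rewrite !expr2; lra.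
Qed.

Lemma powR1D_ge (t a : R) : -1<t -> 1<=a -> 1+a * t<=(1+t)`^a.
Proof.
move=> t1 a1; have u0: 0<1+t by move: t1; lra.
have a0 := lt_le_trans ltr01 a1.
have p01: 0<=a^-1<=1 by rewrite invr_ge0 (ltW a0) invf_le1.
have := bernoulli_le (powR_gt0 a u0) p01; rewrite -powRrM mulfV ?gt_eqF// powRr1 ?(ltW u0)//.
rewrite lerD2l ler_pdivlMl// lerBrDl; exact.
Qed.

Variables (g a : R).
Hypotheses (g0 : 0<g) (a1 : 1<=a) (a2 : a<=2).
(** With [g = G_1(sigma)] and [a = 1/sigma] this is the main term of [Fz]. *)
Definition lam (k : R) : R := g*k`^a / ln k.

Lemma lam_scale (k u : R) : 0<k -> 0<u -> ln k != 0 ->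
  lam (k*u) = lam k*(u`^a*(ln k/(ln k+ln u))).
Proof.
move=> k0 u0 lk; rewrite /lam powRM ?(ltW k0) ?(ltW u0)// lnM ?posrE//.
have [->|h] := eqVneq (ln k+ln u) 0; first by rewrite invr0 !mulr0.
by field; rewrite lk h.
Qed.

Lemma lam_ge0 (k : R) : 1<=k -> 0<=lam k.
Proof. by move=> k1; rewrite divr_ge0 ?ln_ge0// mulr_ge0 ?powR_ge0// ltW. Qed.

Lemma lam_up (k d : R) : 0<k -> 0<ln k -> 0<=d -> lam (k*(1+d))<=lam k*(1+a*d+d^+2).
Proof.
move=> k0 lk d0; have u0: 0<1+d by move: d0; lra.
have L0: 0<=lam k by rewrite divr_ge0 ?(ltW lk)// mulr_ge0 ?powR_ge0// ltW.
rewrite lam_scale// ?gt_eqF//; apply: ler_wpM2l=>//.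
have lu: 0<=ln (1+d) by rewrite ln_ge0// lerDl.
apply: le_trans (_ : (1+d)`^a<=_); last first.
  by apply: powR1D_le; [move: d0; lra|rewrite a1].
by rewrite ler_piMr ?powR_ge0// ler_pdivrMr ?mul1r ?lerDl// ltr_pwDl.
Qed.

Lemma lam_up_ge (k d : R) : 0<k -> 0<ln k -> 0<=d ->
  lam k*((1+a*d)*(ln k/(ln k+d)))<=lam (k*(1+d)).
Proof.
move=> k0 lk d0; have u0: 0<1+d by move: d0; lra.
have L0: 0<=lam k by rewrite divr_ge0 ?(ltW lk)// mulr_ge0 ?powR_ge0// ltW.
rewrite lam_scale// ?gt_eqF//; apply: ler_wpM2l=>//.
have lu: 0<=ln (1+d) by rewrite ln_ge0// lerDl.
have lu2: ln (1+d)<=d by apply: le_ln1Dx; move: d0; lra.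
apply: ler_pM.
- by rewrite addr_ge0// mulr_ge0//; apply: le_trans a1.
- by rewrite divr_ge0 ?addr_ge0// ltW.
- by apply: powR1D_ge=>//; move: d0; lra.
- by rewrite ler_wpM2l ?(ltW lk)// lef_pV2 ?posrE ?ltr_pwDl// lerD2l.
Qed.

Lemma lam_dn (k d : R) : 0<k -> 2<=ln k -> 0<=d -> d<=2^-1 ->
  lam (k*(1-d))<=lam k*(1-a*d+d^+2+2 / ln k) /\ ln k/2<=ln (k*(1-d)).
Proof.
move=> k0 lk2 d0 d2; have u0: 0<1-d by move: d2; lra.
have lk: 0<ln k by apply: lt_le_trans lk2.
have L0: 0<=lam k by rewrite divr_ge0 ?(ltW lk)// mulr_ge0 ?powR_ge0// ltW.
have lu: - (2*d)<=ln (1-d).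
  have h: ln (1+d/(1-d))<=d/(1-d).
    by apply: le_ln1Dx; apply: lt_le_trans (_ : 0<=_); [rewrite oppr_lt0|rewrite divr_ge0// ltW].
  rewrite (_ : 1+d/(1-d)=(1-d)^-1) in h; last by field; rewrite gt_eqF.
  rewrite lnV ?posrE// in h; have : d/(1-d)<=2*d.
    by rewrite ler_pdivrMr//; have := mulr_ge0 d0 (_ : 0<=1 - 2*d); move: d2; lra.
  by move: h; lra.
have lu': ln (1-d)<=0 by have := @le_ln1Dx R (- d); move: d0 d2; lra.
have den: ln k/2<=ln k+ln (1-d) by move: lu d2 lk2; lra.
split; last by rewrite lnM ?posrE.
rewrite lam_scale// ?gt_eqF//; apply: ler_wpM2l=>//.
have den0: 0<ln k+ln (1-d) by move: den lk; lra.
have r1: ln k/(ln k+ln (1-d))<=1+2 / ln k.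
  rewrite ler_pdivrMr// mulrDl mul1r.
  have : 2 / ln k*(ln k/2)<=2 / ln k*(ln k+ln (1-d)).
    by rewrite ler_wpM2l// divr_ge0// ltW.
  rewrite (_ : 2 / ln k*(ln k/2) = 1); last by field; rewrite gt_eqF.
  by move: lu d2; lra.
have r0: 0<=ln k/(ln k+ln (1-d)) by rewrite divr_ge0// ltW.
have p1: (1-d)`^a<=1+a*(- d)+(- d)^+2.
  by apply: powR1D_le; [move: d2; lra|rewrite a1].
have p2: (1-d)`^a<=1.
  rewrite -(powRr0 (1-d)); have := @ge0_ler_powR R a (le_trans ler01 a1) (1-d) 1.
  rewrite !nnegrE (ltW u0) ler01 powR1 powRr0; apply=>//; move: d0; lra.
apply: le_trans (ler_wpM2l (powR_ge0 _ _) r1) _; rewrite mulrDr mulr1.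
rewrite (_ : 1-a*d+d^+2 = 1+a*(- d)+(- d)^+2); last by ring.
by apply: lerD=>//; rewrite ler_piMl// divr_ge0// ltW.
Qed.
End Bernoulli.

(** * Chernoff's bound and exponential tilting *)

Section Tilting.
Variables (R : realType) (T : R).
Hypothesis T0 : 0<T.
Variables (G : set R) (X : R -> R).
Hypotheses (mG : measurable G) (bX : bm T X).

Definition Sx (x : R) : set R := G `&` [set t | x<=X t].

Lemma measurable_Sx x : measurable (Sx x).
Proof.
apply: measurableI=>//; have [mX _] := bX.
have := mX measurableT `[x, +oo[%classic (measurable_itv _); rewrite setTI.
by congr measurable; apply/seteqP; split=> t /=; rewrite in_itv/= andbT.
Qed.

Lemma bm_expX (k : R) : bm T (fun t=> expR (k*X t)).
Proof.
exact: bm_exp.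
Qed.

Let Mk k := Ex T (fun t=> \1_G t * expR (k*X t)).
Let bGX k : bm T (fun t=> \1_G t * expR (k*X t)).
Proof. by apply: bmM=>//; [exact: bm_indic|exact: bm_expX]. Qed.

Lemma chernoff (k x : R) : 0<=k -> Ex T (\1_(Sx x))<=expR (- (k*x))*Mk k.
Proof.
move=> k0; rewrite -ExZ//; apply: Ex_le=>//.
- by apply: bm_indic; exact: measurable_Sx.
- exact: bmZ.
move=> t _; rewrite !indicE; have [St|St] := boolP (t \in Sx x).
  have [Gt xt] := set_mem St; rewrite (mem_set Gt) mul1r -expRD -expR0 ler_expR.
  by have := ler_wpM2l k0 xt; lra.
by rewrite !mulr_ge0 ?expR_ge0.
Qed.

(** The mean of [e^(kX)] is split at [x1] and [x2]. In the middle the exponential is at most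
    [e^(k x2)]; on either side it is compared with the transform at [k(1+d)] or [k(1-d)]. *)
Lemma tilt (k d x1 x2 : R) : 0<=k -> 0<=d ->
  Mk k<=expR (k*x2)*Ex T (\1_(Sx x1))+expR (- (k*d*x2))*Mk (k*(1+d)) +
    expR (k*d*x1)*Mk (k*(1-d)).
Proof.
move=> k0 d0; have kd: 0<=k*d by exact: mulr_ge0.
have bS: bm T (\1_(Sx x1)) by apply: bm_indic; exact: measurable_Sx.
have b1 := bmZ (expR (k*x2)) bS.
have b2 := bmZ (expR (- (k*d*x2))) (bGX (k*(1+d))).
have b3 := bmZ (expR (k*d*x1)) (bGX (k*(1-d))).
rewrite /Mk -(ExZ T0 _ bS) -!(ExZ T0 _ (bGX _)) -(ExD T0 b1 b2) -(ExD T0 (bmD b1 b2) b3).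
apply: Ex_le=>//; first by apply: bmD=>//; exact: bmD.
move=> t _; rewrite !indicE; have [Gt|Gt] := boolP (t \in G); last first.
  by rewrite !mul0r !mulr0 !addr0 mulr_ge0 ?expR_ge0.
rewrite !mul1r.
have p1 := mulr_ge0 (expR_ge0 (- (k*d*x2))) (expR_ge0 (k*(1+d)*X t)).
have p2 := mulr_ge0 (expR_ge0 (k*d*x1)) (expR_ge0 (k*(1-d)*X t)).
have p3: 0<=expR (k*x2)*(t \in Sx x1)%:R by rewrite mulr_ge0 ?expR_ge0.
have [X1|X1] := leP x1 (X t); last first.
  apply: le_trans (_ : expR (k*d*x1) * expR (k*(1-d)*X t)<=_); last by rewrite lerDr addr_ge0.
  by rewrite -expRD ler_expR; have := ler_wpM2l kd (ltW X1); lra.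
have [X2|X2] := leP (X t) x2; last first.
  apply: le_trans (_ : expR (- (k*d*x2)) * expR (k*(1+d)*X t)<=_); last first.
    by rewrite addrAC lerDr addr_ge0.
  by rewrite -expRD ler_expR; have := ler_wpM2l kd (ltW X2); lra.
have -> : t \in Sx x1 by apply: mem_set; split=>//; exact: set_mem.
rewrite mulr1 -addrA; apply: le_trans (_ : expR (k*x2)<=_); last by rewrite lerDl addr_ge0.
by rewrite ler_expR ler_wpM2l.
Qed.
End Tilting.

(** * Lower bound for the tail of the prime sum *)

Section LDLower.
Variable R : realType.

Lemma expRN6_le : expR (- (6 : R))<=64^-1.
Proof.
rewrite expRN lef_pV2 ?posrE ?expR_gt0// -[X in expR X]mulr1 expRM_natl.
apply: le_trans (_ : (2 : R)^+6<=_); first by rewrite !exprS expr0; lra.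
by rewrite lerXn2r ?nnegrE ?expR_ge0//; apply: le_trans (expR_ge1Dx _); lra.
Qed.

(* Exponents of the two discarded tails, with [q = lam / ln k] and [eta ^+ 2 = D ^+ 2 / ln k]. *)
Lemma tail_up (lm lm2 F F2 q a d eta c : R) : 0<=q -> 0<=c -> 1<=a -> 0<=lm -> d = eta/2 -> 0<=eta ->
  eta^+2 * lm=(4*(1+c))^+2*q -> lm2<=lm*(1+a*d+d^+2) -> F2<=lm2+4*c*q ->
  lm-c*q<=F -> F2-d*a * lm*(1+eta)<=F - 2*q.
Proof.
move=> q0 c0 a1 lm0 -> e0 he h2 hF2 hF.
have t1: 0<=(a - 1)*(eta^+2 * lm).
  by rewrite mulr_ge0 ?subr_ge0// mulr_ge0// sqr_ge0.
have t2: 0<=c*c*q by rewrite !mulr_ge0.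
have t3 := mulr_ge0 c0 q0.
move: he h2 hF2 hF t1; rewrite !expr2; lra.
Qed.

Lemma tail_dn (lm lm3 F F3 q a d eta c : R) : 0<=q -> 0<=c -> 1<=a -> 0<=lm -> d = eta/2 -> 0<=eta ->
  eta^+2 * lm=(4*(1+c))^+2*q -> lm3<=lm*(1-a*d+d^+2)+2*q -> F3<=lm3+4*c*q ->
  lm-c*q<=F -> F3+d*a * lm*(1-eta)<=F - 2*q.
Proof.
move=> q0 c0 a1 lm0 -> e0 he h2 hF2 hF.
have t1: 0<=(a - 1)*(eta^+2 * lm).
  by rewrite mulr_ge0 ?subr_ge0// mulr_ge0// sqr_ge0.
have t2: 0<=c*c*q by rewrite !mulr_ge0.
have t3 := mulr_ge0 c0 q0.
move: he h2 hF2 hF t1; rewrite !expr2; lra.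
Qed.

Variables (T : R) (G : set R) (X F : R -> R) (g a c K0 K1 : R).
Hypotheses (T0 : 0<T) (mG : measurable G) (bX : bm T X).
Hypotheses (g0 : 0<g) (a1 : 1<=a) (a2 : a<=2) (c0 : 0<=c) (K01 : 1<K0).
Let Mk k := Ex T (fun t=> \1_G t * expR (k*X t)).
Hypothesis HM : forall k, K0<=k -> k<=K1 -> expR (F k)/4<=Mk k<=4 * expR (F k).
Hypothesis HF : forall k, K0<=k -> k<=K1 -> `|F k-lam g a k| <= c*(lam g a k / ln k).

(** [k x = a * lam k] makes [x] the saddle value, and tilting by [1 +- eta/2] gains an amount of
    order [eta^2 lam]. The choice of [eta] lets this exceed the uncertainty [c lam / ln k] of the
    transform, so each side loses at most a sixteenth of [e^F]. Of the quarter guaranteed, an eighth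
    remains in the window. *)
Lemma ld_lower (k eta x : R) : K0<=k/2 -> 2*k<=K1 -> 2<=ln k ->
  0<=eta -> eta<=1 -> eta^+2 * ln k=(4*(1+c))^+2 -> k*x = a * lam g a k ->
  3<=lam g a k / ln k ->
  expR (lam g a k-c*(lam g a k / ln k)-k*x*(1+eta))/8<=Ex T (\1_(Sx G X (x*(1-eta)))).
Proof.
have aux1 (f l y : R) : - y<=f-l -> l-y<=f by lra.
have aux2 (u : R) : u<=2/2 -> u<=1 by lra.
have aux3 (u : R) : u<=2^-1 -> u<=1 by lra.
have aux4 (u v w : R) : u<=1 -> v<=w -> w<=2^-1 -> 1+u+v<=4 by lra.
have aux5 (u v w t : R) : v<=w -> w<=u -> t<=1 -> 1-u+v+t<=2 by lra.
have aux6 (f l y w : R) : f-l<=y -> y<=w -> f<=l+w by lra.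
have aux7 (q : R) : 3<=q -> 6<=2*q by lra.
have aux8 (u v w : R) : u<=v*w -> v*w<=v*64^-1 -> 4*u<=v/16 by lra.
have aux9 (m u v w e : R) : m<=u+v+w -> v<=e/16 -> w<=e/16 -> e/4<=m -> e/8<=u by lra.
have aux10 (f l y w : R) : l-y<=f -> l-y-w<=f + - w by lra.
have aux11 (u e s p : R) : u<=e*s -> e/8*s<=p -> u/8<=p by lra.
move=> kK kK1 lk2 e0 e1 he kx q3; set lm := lam g a k in kx q3 *; set l := ln k in lk2 he q3 *.
have k2: 1<k/2 := lt_le_trans K01 kK.
have k0: 0<k by move: k2; lra.
have l0: 0<l by apply: lt_le_trans lk2.
set q := lm / l in q3 *; have q0: 0<=q by move: q3; lra.
have lmE: lm = q * l by rewrite /q divfK// gt_eqF.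
have lm0: 0<=lm by rewrite lmE mulr_ge0// ltW.
pose d := eta/2; have d0: 0<=d by rewrite divr_ge0.
have d2: d<=2^-1 by rewrite /d; move: e1; lra.
have he': eta^+2 * lm=(4*(1+c))^+2*q by rewrite lmE [q * l]mulrC mulrA he.
have kb: K0<=k<=K1 by apply/andP; split; move: kK kK1 k0; lra.
have dk0: 0<=k*d by rewrite mulr_ge0// ltW.
have dk2: k*d<=k/2 by rewrite ler_wpM2l// ltW.
have kub: K0<=k*(1+d)<=K1.
  by apply/andP; split; rewrite mulrDr mulr1; move: kb dk0 dk2 kK1 k0=> /andP[]; lra.
have kdb: K0<=k*(1-d)<=K1.
  by apply/andP; split; rewrite mulrBr mulr1; move: kb kK dk0 dk2 kK1 k0=> /andP[]; lra.
have /andP[M1 M2] := HM (proj1 (andP kb)) (proj2 (andP kb)).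
have /andP[_ M3] := HM (proj1 (andP kub)) (proj2 (andP kub)).
have /andP[_ M4] := HM (proj1 (andP kdb)) (proj2 (andP kdb)).
have Fl: lm-c*q<=F k.
  by have := HF (proj1 (andP kb)) (proj2 (andP kb)); rewrite -/lm -/l -/q ler_norml=> /andP[/aux1].
have lmu := lam_up g0 a1 a2 k0 l0 d0; rewrite -/lm in lmu.
have [lmd lnd] := lam_dn g0 a1 a2 k0 lk2 d0 d2; rewrite -/lm -/l in lmd lnd.
have ad: 0<=a*d by rewrite mulr_ge0//; apply: le_trans a1.
have ad2: a*d<=1 by apply: aux2; exact: ler_pM (le_trans ler01 a1) d0 a2 d2.
have dd: d^+2<=d by rewrite expr2 ler_piMl//; exact: aux3.
have da: d<=a*d by rewrite ler_peMl.
have tl: 2 / l<=1 by rewrite ler_pdivrMr// mul1r.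
have u4: lam g a (k*(1+d))<=4 * lm.
  apply: le_trans lmu _; by rewrite mulrC ler_wpM2r//; exact: aux4 ad2 dd d2.
have d4: lam g a (k*(1-d))<=2 * lm.
  apply: le_trans lmd _; by rewrite mulrC ler_wpM2r//; exact: aux5 dd da tl.
have lnu: l<=ln (k*(1+d)).
  by rewrite ler_ln ?posrE ?mulr_gt0 ?ltr_pwDl// ler_peMr ?lerDl// ltW.
have F2: F (k*(1+d))<=lam g a (k*(1+d))+4*c*q.
  have := HF (proj1 (andP kub)) (proj2 (andP kub)); rewrite ler_norml=> /andP[_ h].
  apply: aux6 h _; apply: le_trans (_ : c*(4 * lm / l)<=_); last first.
    by apply: eq_ler; rewrite /q; ring.
    rewrite ler_wpM2l//; apply: ler_pM=>//.
    - by apply: lam_ge0=>//; apply: le_trans (proj1 (andP kub)); exact: ltW.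
    - by rewrite invr_ge0 (le_trans (ltW l0)).
    by rewrite lef_pV2 ?posrE// (lt_le_trans l0).
have F3: F (k*(1-d))<=lam g a (k*(1-d))+4*c*q.
  have := HF (proj1 (andP kdb)) (proj2 (andP kdb)); rewrite ler_norml=> /andP[_ h].
  have l20: 0<l/2 by rewrite divr_gt0.
  apply: aux6 h _; apply: le_trans (_ : c*(2 * lm/(l/2))<=_); last first.
    by apply: eq_ler; rewrite /q; field; rewrite gt_eqF.
    rewrite ler_wpM2l//; apply: ler_pM=>//.
    - by apply: lam_ge0=>//; apply: le_trans (proj1 (andP kdb)); exact: ltW.
    - by rewrite invr_ge0 (le_trans (ltW l20)).
    by rewrite lef_pV2 ?posrE// (lt_le_trans l20).
have lmd': lam g a (k*(1-d))<=lm*(1-a*d+d^+2)+2*q.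
  apply: le_trans lmd _; rewrite mulrDr lerD2l /q.
  by apply: eq_ler; ring.
have T2 := tail_up q0 c0 a1 lm0 erefl e0 he' lmu F2 Fl.
have T3 := tail_dn q0 c0 a1 lm0 erefl e0 he' lmd' F3 Fl.
have small: expR (- (2*q))<=64^-1.
  by apply: le_trans expRN6_le; rewrite ler_expR lerN2; exact: aux7.
have tt2: expR (- (k*d*(x*(1+eta))))*Mk (k*(1+d))<=expR (F k)/16.
  apply: le_trans (ler_wpM2l (expR_ge0 _) M3) _; rewrite mulrCA -expRD.
  have -> : - (k*d*(x*(1+eta)))+F (k*(1+d)) = F (k*(1+d))-d*a * lm*(1+eta).
    by rewrite -(mulrA d) -kx; ring.
  have : expR (F (k*(1+d))-d*a * lm*(1+eta))<=expR (F k) * expR (- (2*q)) by rewrite -expRD ler_expR.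
  by move=> h; exact: aux8 h (ler_wpM2l (expR_ge0 (F k)) small).
have tt3: expR (k*d*(x*(1-eta)))*Mk (k*(1-d))<=expR (F k)/16.
  apply: le_trans (ler_wpM2l (expR_ge0 _) M4) _; rewrite mulrCA -expRD.
  have -> : k*d*(x*(1-eta))+F (k*(1-d)) = F (k*(1-d))+d*a * lm*(1-eta).
    by rewrite -(mulrA d) -kx; ring.
  have : expR (F (k*(1-d))+d*a * lm*(1-eta))<=expR (F k) * expR (- (2*q)) by rewrite -expRD ler_expR.
  by move=> h; exact: aux8 h (ler_wpM2l (expR_ge0 (F k)) small).
have := tilt T0 mG bX (x*(1-eta)) (x*(1+eta)) (ltW k0) d0; rewrite -/Mk -!/(Mk _)=> tl'.
set P := Ex T _ in tl' *.
have key: expR (F k)/8<=expR (k*(x*(1+eta)))*P by exact: aux9 tl' tt2 tt3 M1.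
have e8: expR (lm-c*q-k*x*(1+eta))<=expR (F k) * expR (- (k*(x*(1+eta)))).
  by rewrite -expRD ler_expR mulrA; exact: aux10.
have := ler_wpM2r (expR_ge0 (- (k*(x*(1+eta))))) key.
have ee: expR (k*(x*(1+eta)))*P * expR (- (k*(x*(1+eta)))) = P.
  by rewrite mulrAC -expRD subrr expR0 mul1r.
by rewrite ee; exact: aux11 e8.
Qed.
End LDLower.

(** * Arithmetic of the relative errors *)

Section FinalArithmetic.
Variable R : realType.

Lemma lam_le_arith (lm P e eps s : R) : 0<=lm -> 0<eps -> eps<=2^-1 -> `|e| <= eps ->
  lm*(1+e) = s*P -> lm<=s*P*(1+2 * eps).
Proof.
move=> l0 e0 e2; rewrite ler_norml=> /andP[ee _] <-.
have h1: 1<=(1+e)*(1+2 * eps).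
  have : 0<=(e+eps)*(1+2 * eps) by rewrite mulr_ge0; [|move: ee; lra|move: e0; lra].
  have : 0<=eps*(1 - 2 * eps) by rewrite mulr_ge0; [|exact: ltW|move: e2; lra].
  lra.
by have := ler_wpM2l l0 h1; rewrite mulr1 mulrA.
Qed.

Lemma upper_arith (P k C0 F lm r r0 c s eps : R) : 0<=P -> 0<eps -> eps<=2^-1 -> 0<=c -> 0<=r0 ->
  0<s -> s<1 -> 0<=lm -> lm<=s*P*(1+2 * eps) -> 0<=r -> r<=r0 * eps ->
  F<=lm+c*(lm*r) -> k*C0<=P * eps -> 2<=P * eps ->
  - P+k*C0+F+2 <= - ((1-s)*P)+(4+2*c*r0)*(P * eps).
Proof.
move=> P0 e0 e2 c0 r00 s0 s1 l0 hl r0' hr hF hk h2.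
have Pe: 0<=P * eps by rewrite mulr_ge0// ltW.
have l2: lm<=2*P.
  apply: le_trans hl _; have sP: s*P<=P by rewrite ler_piMl// ltW.
  have : s*P*(1+2 * eps)<=P*2; last by lra.
  by apply: ler_pM=>//; rewrite ?mulr_ge0 ?(ltW s0)//; move: e0 e2; lra.
have lr: c*(lm*r)<=2*c*r0*(P * eps).
  have := ler_pM l0 r0' l2 hr=> /(ler_wpM2l c0) h; apply: le_trans h _.
  by apply: eq_ler; ring.
have sPe: s*(P * eps)<=P * eps by rewrite ler_piMl// ltW.
by move: hl hF hk h2 lr sPe; lra.
Qed.

(** Raising [k] by the factor [1 + th] moves the saddle value far enough that even the lower end of
    its window lies above [tau (1 + eps)]; [th] of order [eps] suffices. *)
Lemma lower_x_arith (tau x x' e eps th a l eta K4 : R) : 0<tau -> 0<eps -> `|e| <= eps ->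
  x*(1+e) = tau -> 0<x -> 1<a -> 0<=th -> th<=1 -> 0<l -> l^-1<=eps ->
  x*((1+a * th)/(1+th)*(l/(l+th)))<=x' -> 0<=eta -> eta<=K4 * eps -> 0<=K4 ->
  (a - 1) * th/2=(4+K4) * eps -> (4+K4)*(2+K4) * eps<=1 ->
  tau*(1+eps)<=x'*(1-eta).
Proof.
move=> t0 e0 ee hx x0 a1 th0 th1 l0 le hx' n0 nK K40 hth sm.
have ep1: eps*(8+K4)<=1.
  have : 0<=eps*(K4^+2+5*K4) by rewrite mulr_ge0 ?(ltW e0)// addr_ge0 ?sqr_ge0// mulr_ge0.
  by move: sm; rewrite expr2; lra.
have K4e: 0<=K4 * eps by rewrite mulr_ge0// ltW.
have r1: 1+(4+K4) * eps<=(1+a * th)/(1+th).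
  rewrite -hth ler_pdivlMr; last by move: th0; lra.
  have : 0<=(a - 1) * th*(1-th) by rewrite !mulr_ge0 ?subr_ge0// ltW.
  lra.
have r2: 1-eps<=l/(l+th).
  rewrite ler_pdivlMr ?ltr_pwDl//.
  have : 1<=eps * l by rewrite -ler_pdivrMr// div1r.
  have : 0<=eps * th by rewrite mulr_ge0// ltW.
  by move: th1; lra.
have r3: tau*(1-eps)<=x.
  rewrite -hx -mulrA ger_pMr//; move: ee; rewrite ler_norml=> /andP[_ ee].
  have : 0<=(eps-e)*(1-eps) by rewrite mulr_ge0 ?subr_ge0//; move: ep1 K4e; lra.
  have := sqr_ge0 eps; rewrite expr2; lra.
have eps1: 0<=1-eps by move: ep1 K4e; lra.
have n1: 1-K4 * eps<=1-eta by move: nK; lra.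
have k1: 0<=1-K4 * eps by move: ep1 e0; lra.
have A1: 0<=1+(4+K4) * eps by move: K4e e0; lra.
have B1: (1+(4+K4) * eps)*(1-eps)<=(1+a * th)/(1+th)*(l/(l+th)) by exact: ler_pM.
have B2: tau*(1-eps)*((1+(4+K4) * eps)*(1-eps))<=x'.
  apply: le_trans hx'; apply: ler_pM=>//; first by rewrite mulr_ge0// ltW.
  by rewrite mulr_ge0.
have B3: tau*(1-eps)*((1+(4+K4) * eps)*(1-eps))*(1-K4 * eps)<=x'*(1-eta).
  by apply: ler_pM=>//; rewrite !mulr_ge0// ltW.
apply: le_trans B3; rewrite -!mulrA ler_wpM2l ?(ltW t0)//.
have C1: 1-(2+K4) * eps<=(1-eps)*(1-eps)*(1-K4 * eps).
  have : 0<=eps * eps*(1-K4 * eps) by rewrite !mulr_ge0// ltW.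
  have : 0<=eps*(K4 * eps) by rewrite mulr_ge0// ltW.
  lra.
have := ler_wpM2l A1 C1; have := ler_wpM2l (ltW e0) sm; lra.
Qed.

Lemma lower_exp_arith (P lm lm' q' a s th eps eta K4 Kth c r0 r : R) : 0<=P -> 0<eps -> eps<=1 ->
  0<s -> s<1 -> a*s = 1 -> 1<=a -> a<=2 -> 0<=lm -> lm<=s*P*(1+2 * eps) -> 0<=th -> th<=1 ->
  th = Kth * eps -> 0<=Kth -> 0<=lm' -> lm'<=lm*(1+a * th+th^+2) -> q' = lm'*r -> 0<=r -> r<=r0 * eps ->
  0<=r0 -> 0<=c -> 0<=eta -> eta<=K4 * eps -> 0<=K4 ->
  - ((1-s)*P)-(2+9*Kth+(2*K4+c*r0)*(3+9*Kth))*(P * eps) <=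
  lm'-c*q'-a * lm'*(1+eta).
Proof.
move=> P0 e0 e1 s0 s1 as1 a1 a2 l0 hl t0 t1 thE Kt0 l0' hl' -> r0' hr r00 c0 n0 nK K40.
set K5 := 2*K4+c*r0.
have K50: 0<=K5 by rewrite addr_ge0 ?mulr_ge0.
have b1: lm'<=s*P*(1+(2+9*Kth) * eps).
  apply: le_trans hl' _; apply: le_trans (_ : lm*(1+3 * th)<=_).
    rewrite ler_wpM2l//; have : th^+2<=th by rewrite expr2 ler_piMl.
    by have := ler_wpM2r t0 a2; lra.
  apply: le_trans (ler_wpM2r _ hl) _; first by move: t0; lra.
  rewrite -(mulrA (s*P)) ler_wpM2l ?mulr_ge0 ?(ltW s0)// thE.
  have : Kth * eps * eps<=Kth * eps by rewrite ler_piMr// mulr_ge0// ltW.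
  lra.
have b2: a * eta+c*r<=K5 * eps.
  have := ler_pM (le_trans ler01 a1) n0 a2 nK; have := ler_wpM2l c0 hr; rewrite /K5; lra.
have b3: lm'-c*(lm'*r)-a * lm'*(1+eta) = - (lm'*((a - 1)+(a * eta+c*r))) by ring.
rewrite b3 (_ : - _ - _ = - ((1-s)*P+(2+9*Kth+K5*(3+9*Kth))*(P * eps))); last by ring.
rewrite lerN2; apply: le_trans (_ : lm'*((a - 1)+K5 * eps)<=_).
  by rewrite ler_wpM2l// lerD2l.
have a10: 0<=a - 1+K5 * eps by rewrite addr_ge0 ?subr_ge0// mulr_ge0// ltW.
apply: le_trans (ler_wpM2r a10 b1) _.
have sa: s*(a - 1) = 1-s by rewrite mulrBr mulr1 mulrC as1.
rewrite (_ : s*P * _ * _ = P*(1+(2+9*Kth) * eps)*(s*(a - 1)+s*(K5 * eps))); last by ring.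
rewrite sa.
have Ke: 0<=K5 * eps by rewrite mulr_ge0// ltW.
have sK: s*(K5 * eps)<=K5 * eps by rewrite ler_piMl// ltW.
have p0: 0<=P*(1+(2+9*Kth) * eps).
  by rewrite mulr_ge0// addr_ge0// mulr_ge0 ?(ltW e0)// addr_ge0// mulr_ge0.
apply: le_trans (ler_wpM2l p0 (lerD (lexx (1-s)) sK)) _.
have PK: 0<=P * eps*(2+9*Kth) by rewrite !mulr_ge0 ?(ltW e0)// addr_ge0// mulr_ge0.
have h1 := mulr_ge0 PK (ltW s0).
have h2: 0<=P * eps*(2+9*Kth)*K5*(1-eps) by apply: mulr_ge0 (mulr_ge0 PK K50) _; rewrite subr_ge0.
lra.
Qed.
End FinalArithmetic.

(** * The saddle point and the constant A_1 *)

Section Scale.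
Variables (R : realType) (sigma g tau : R).
Hypotheses (hs0 : 0<sigma) (hs2 : sigma<1) (g0 : 0<g) (t0 : 0<tau).
Let u := ln tau.
Hypothesis (u0 : 0<u).
Let b := sigma/(1-sigma).
Let m := sigma^+2/((1-sigma) * g).
Let s1 : 0<1-sigma. Proof. by rewrite subr_gt0. Qed.
Let m0 : 0<m. Proof. by rewrite divr_gt0 ?mulr_gt0 ?exprn_gt0. Qed.
Let b0 : 0<b. Proof. by rewrite divr_gt0. Qed.

(** The solution of [sigma^-1 * lam k = k * tau] when [ln k] is replaced by its leading term
    [b ln tau]. *)
Definition ktau : R := (m * tau*u)`^b.

Let mt0 : 0<m * tau*u. Proof. exact: mulr_gt0 (mulr_gt0 m0 t0) u0. Qed.

Lemma ktau_gt0 : 0<ktau. Proof. by rewrite /ktau powR_gt0. Qed.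

Lemma ln_ktau : ln ktau = b*(u+ln u+ln m).
Proof.
rewrite /ktau ln_powR (lnM (_ : m * tau \is Num.pos)) ?posrE ?(mulr_gt0 m0 t0)// (lnM (_ : m \is Num.pos)) ?posrE//.
by rewrite -/u; congr (b * _); ring.
Qed.

Lemma ln_m : ln m = 2 * ln sigma-(ln (1-sigma)+ln g).
Proof.
have p: 0<(1-sigma) * g by exact: mulr_gt0.
rewrite /m ln_div ?posrE ?exprn_gt0// lnXn// lnM ?posrE//.
by congr (_ - _); rewrite mulr_natl.
Qed.

(** [A_1] appears here. At the saddle [lam] is nearly [sigma k tau], so the exponent [k tau - lam]
    is nearly [(1 - sigma) k tau]; comparing logarithms gives the closed form. *)
Lemma ktau_rate : (1-sigma)*(ktau * tau) =
  (sigma`^(2*sigma)/((1-sigma)`^(2*sigma - 1) * g`^sigma))`^(1-sigma)^-1 *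
  tau`^((1-sigma)^-1)*u`^(sigma/(1-sigma)).
Proof.
have p1: 0<sigma`^(2*sigma) by exact: powR_gt0.
have p2: 0<(1-sigma)`^(2*sigma - 1) by exact: powR_gt0.
have p3: 0<g`^sigma by exact: powR_gt0.
have p4: 0<sigma`^(2*sigma)/((1-sigma)`^(2*sigma - 1) * g`^sigma).
  by rewrite divr_gt0// mulr_gt0.
have k0 := ktau_gt0.
have lhs0: 0<(1-sigma)*(ktau * tau) by rewrite !mulr_gt0.
set rhs := RHS.
have rhs0: 0<rhs by rewrite /rhs !mulr_gt0 ?powR_gt0.
apply: (@ln_inj R); rewrite ?posrE//.
have q1: 0<(1-sigma)`^(2*sigma - 1) * g`^sigma by exact: mulr_gt0.
have q2: 0<(sigma`^(2*sigma)/((1-sigma)`^(2*sigma - 1) * g`^sigma))`^(1-sigma)^-1 by exact: powR_gt0.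
have q3: 0<tau`^(1-sigma)^-1 by exact: powR_gt0.
have q4: 0<u`^(sigma/(1-sigma)) by exact: powR_gt0.
rewrite /rhs (lnM (_ : (1-sigma) \is Num.pos)) ?posrE ?(mulr_gt0 k0 t0)// (lnM (_ : ktau \is Num.pos)) ?posrE//.
rewrite (lnM _ (_ : u`^_ \is Num.pos)) ?posrE ?(mulr_gt0 q2 q3)// (lnM _ (_ : tau`^_ \is Num.pos)) ?posrE//.
have e1: ln ((sigma`^(2*sigma)/((1-sigma)`^(2*sigma - 1) * g`^sigma))`^(1-sigma)^-1) =
    (1-sigma)^-1*(2*sigma * ln sigma-((2*sigma - 1) * ln (1-sigma)+sigma * ln g)).
  by rewrite ln_powR ln_div ?posrE// lnM ?posrE// !ln_powR.
rewrite e1 (ln_powR tau) (ln_powR u) ln_ktau ln_m -/u /b.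
by field; rewrite gt_eqF.
Qed.

Lemma lam_ktau : ln ktau != 0 ->
  lam g sigma^-1 ktau*(u+ln u+ln m) = sigma*(ktau * tau)*u.
Proof.
move=> lk; have k0 := ktau_gt0.
have sn: u+ln u+ln m != 0.
  by apply/eqP=> h; move: lk; rewrite ln_ktau h mulr0 eqxx.
have kE: ktau`^sigma^-1 = ktau*(m * tau*u).
  rewrite {1}(_ : sigma^-1 = 1+b^-1); last by rewrite /b; field; rewrite !gt_eqF.
  rewrite powRD ?(gt_eqF k0) ?implybT// powRr1 ?(ltW k0)//; congr (_ * _).
  by rewrite /ktau -powRrM mulfV ?(gt_eqF b0)// powRr1// (ltW mt0).
rewrite /lam kE ln_ktau /m -/m.
have -> : g*(ktau*(m * tau*u))/(b*(u+ln u+ln m))*(u+ln u+ln m) =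
    g * m / b*(ktau * tau)*u.
  by field; rewrite sn gt_eqF.
congr (_ * _ * _); rewrite /m /b; field; rewrite !gt_eqF//.
Qed.
End Scale.

(** * The distribution function *)

Section PhiTBounds.
Variable R : realType.
Local Notation mu := (@lebesgue_measure R).

(** Valid for arbitrary sets, as the measure is evaluated through its outer extension. The level
    sets of [ln (abs_zeta sigma t)] can thus be compared without establishing their
    measurability. *)
Lemma lebesgue_mono (A B : set R) : A `<=` B -> (mu A<=mu B)%E.
Proof. by move=> AB; rewrite /lebesgue_measure /lebesgue_stieltjes_measure /measure_extension/=; exact: le_mu_ext. Qed.

Variables (T sigma tau : R).
Hypothesis T0 : 0<T.
Let A := [set t : R | T<=t<=2*T /\ tau<=ln (abs_zeta sigma t)].

Lemma fin_seg (B : set R) : B `<=` `[T, 2*T]%classic -> mu B \is a fin_num.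
Proof.
move=> BT; rewrite ge0_fin_numE ?measure_ge0//; apply: le_lt_trans (lebesgue_mono BT) _.
by rewrite [X in (X<_)%E](mu_seg T0) ltry.
Qed.

Lemma PhiT_ge (S : set R) : measurable S ->
  (forall t, T<=t<=2*T -> S t -> tau<=ln (abs_zeta sigma t)) -> Ex T (\1_S)<=PhiT T sigma tau.
Proof.
move=> mS h; rewrite Ex_indic// /PhiT -/A ler_wpM2l ?invr_ge0 ?(ltW T0)//.
apply: fine_le; [by apply: fin_seg=> t []|by apply: fin_seg=> t [tT _]; rewrite /= in_itv|].
apply: lebesgue_mono=> t [St]; rewrite /= in_itv/= => tT; split=>//; exact: h.
Qed.

Lemma PhiT_le (S : set R) : measurable S ->
  (forall t, T<=t<=2*T -> tau<=ln (abs_zeta sigma t) -> S t) -> PhiT T sigma tau<=Ex T (\1_S).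
Proof.
move=> mS h; rewrite Ex_indic// /PhiT -/A ler_wpM2l ?invr_ge0 ?(ltW T0)//.
apply: fine_le; [by apply: fin_seg=> t [tT _]; rewrite /= in_itv|by apply: fin_seg=> t []|].
apply: lebesgue_mono=> t [tT th]; split; first exact: h.
by rewrite /= in_itv.
Qed.
End PhiTBounds.

(** * Transfer from the prime sum to zeta *)

Section Assembly.
Variable R : realType.

Lemma num_upper (Phi S q I Pe K k tau C0 F : R) : Phi<=S+q ->
  S<=expR (- (k*(tau-C0)))*(4 * expR F) -> q<=expR (- (2*I)) ->
  - (k * tau)+k*C0+F+2 <= - I+K*Pe -> 0<=I -> 0<=K -> 1<=Pe ->
  Phi<=expR (- I+(K+1)*Pe).
Proof.
move=> hP hS hq h I0 K0 Pe1.
have KP: 0<=K*Pe by rewrite mulr_ge0// (le_trans ler01).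
have e2: 2<=expR 1 :> R by apply: le_trans (expR_ge1Dx _); lra.
have e4: 4<=expR 2 :> R.
  by rewrite -[X in expR X]mulr1 expRM_natl; move: e2; move: (expR 1)=> x; rewrite expr2; nra.
have S1: S<=expR (- I+K*Pe).
  apply: le_trans hS _; apply: le_trans (_ : expR (- (k*(tau-C0)))*(expR 2 * expR F)<=_).
    by rewrite ler_wpM2l ?expR_ge0// ler_wpM2r ?expR_ge0.
  by rewrite -!expRD ler_expR; move: h; lra.
have q1: q<=expR (- I+K*Pe) by apply: le_trans hq _; rewrite ler_expR; move: I0 KP; lra.
apply: le_trans hP _; apply: le_trans (lerD S1 q1) _.
apply: le_trans (_ : expR 1 * expR (- I+K*Pe)<=_).
  by have := ler_wpM2r (expR_ge0 (- I+K*Pe)) e2; move: (expR (- I + _))=> x; lra.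
by rewrite -expRD ler_expR; move: Pe1; lra.
Qed.

Lemma num_lower (Phi S q I Pe K : R) : S-q<=Phi -> expR (- I-K*Pe)/8<=S ->
  q<=expR (- (2*I)) -> K*Pe<=I/2 -> 8<=I -> 4<=Pe ->
  expR (- I-(K+1)*Pe)<=Phi.
Proof.
move=> hP hS hq KI I8 Pe4.
have e2: 2<=expR 1 :> R by apply: le_trans (expR_ge1Dx _); lra.
have e16: 16<=expR 4 :> R.
  have : 2^+4<=expR 1^+4 :> R by rewrite lerXn2r ?nnegrE ?expR_ge0.
  by rewrite -[X in _ -> _<=expR X]mulr1 expRM_natl !exprS expr0; lra.
have q1: 16*q<=expR (- I-K*Pe).
  apply: le_trans (_ : expR 4 * expR (- (2*I))<=_); last first.
    by rewrite -expRD ler_expR; move: KI I8; lra.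
  apply: le_trans (ler_wpM2l _ hq) _=>//; by rewrite ler_wpM2r ?expR_ge0.
have q2: 16 * expR (- I-(K+1)*Pe)<=expR (- I-K*Pe).
  apply: le_trans (_ : expR 4 * expR (- I-(K+1)*Pe)<=_); first by rewrite ler_wpM2r ?expR_ge0.
  by rewrite -expRD ler_expR; move: Pe4; lra.
by move: hP hS q1 q2; lra.
Qed.

Lemma rate_of_bounds (Phi I K1 K2 K d : R) : 0<I -> expR (- I-K1*(I*d))<=Phi ->
  Phi<=expR (- I+K2*(I*d)) -> K1<=K -> K2<=K -> 0<=d ->
  exists2 E : R, `|E| <= K*d & Phi = expR (- (I*(1+E))).
Proof.
move=> I0 h1 h2 k1 k2 d0; have P0: 0<Phi := lt_le_trans (expR_gt0 _) h1.
exists (- (ln Phi/I) - 1); last first.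
  rewrite (_ : - (I * _) = ln Phi) ?lnK ?posrE//; by field; rewrite gt_eqF.
have l1: - I-K1*(I*d)<=ln Phi by rewrite -[X in X<=_]expRK ler_ln ?posrE ?expR_gt0.
have l2: ln Phi <= - I+K2*(I*d) by rewrite -[X in _<=X]expRK ler_ln ?posrE ?expR_gt0.
have Id: 0<=I*d by rewrite mulr_ge0// ltW.
have m1 := ler_wpM2r Id k1; have m2 := ler_wpM2r Id k2.
rewrite ler_norml; set y := ln Phi in l1 l2 *.
have yI: (- (y/I) - 1)*I = - y-I by field; rewrite gt_eqF.
apply/andP; split; rewrite -(ler_pM2r I0).
  by rewrite yI; move: l2 m2; lra.
by rewrite yI; move: l1 m1; lra.
Qed.

(** Where [Q t < 1] the two level sets differ by a shift of [C0]; elsewhere an indicator is at most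
    [Q]. *)
Lemma phi_sandwich (T sigma tau C0 : R) (G : set R) (X Q : R -> R) : 0<T -> measurable G -> bm T X -> bm T Q ->
  (forall t, 0<=Q t) ->
  (forall t, T<=t<=2*T -> Q t<1 -> G t /\ `|ln (abs_zeta sigma t)-X t| <= C0) ->
  Ex T (\1_(Sx G X (tau+C0)))-Ex T Q<=PhiT T sigma tau<=Ex T (\1_(Sx G X (tau-C0)))+Ex T Q.
Proof.
move=> T0 mG bX bQ Q0 H.
have mB: measurable [set t | 1<=Q t].
  have [mQ _] := bQ; have := mQ measurableT `[1, +oo[%classic (measurable_itv _); rewrite setTI.
  by congr measurable; apply/seteqP; split=> t /=; rewrite in_itv/= andbT.
have mS x : measurable (Sx G X x) by exact: (measurable_Sx (T := T)).
apply/andP; split.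
  pose S := Sx G X (tau+C0) `\` [set t | 1<=Q t].
  have mS': measurable S by exact: measurableD.
  have h: Ex T (\1_(Sx G X (tau+C0)))<=Ex T (fun t=> \1_S t+Q t).
    apply: Ex_le=>//; [exact: bm_indic|by apply: bmD=>//; exact: bm_indic|move=> t _].
    rewrite !indicE; have [St|_] := boolP (t \in Sx G X (tau+C0)); last by rewrite addr_ge0.
    have [Q1|Q1] := leP 1 (Q t); first by rewrite ler_wpDl.
    rewrite (_ : t \in S) ?lerDl//; apply: mem_set; split; first exact: set_mem.
    by move=> /=; apply/negP; rewrite -ltNge.
  rewrite ExD// in h; last exact: bm_indic.
  rewrite lerBlDr; apply: le_trans h _; rewrite lerD2r; apply: PhiT_ge=>// t tT [[Gt Xt] /= /negP].
  rewrite -ltNge=> Q1; have [_] := H t tT Q1; rewrite ler_norml=> /andP[+ _].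
  by move: Xt=> /=; lra.
pose S := Sx G X (tau-C0) `|` [set t | 1<=Q t].
have mS': measurable S by exact: measurableU.
apply: le_trans (_ : Ex T (\1_S)<=_).
  apply: PhiT_le=>// t tT tz; have [Q1|Q1] := leP 1 (Q t); first by right.
  left; have [Gt] := H t tT Q1; rewrite ler_norml=> /andP[_ h]; split=>//=.
  by move: h tz; lra.
rewrite -ExD//; last exact: bm_indic.
apply: Ex_le=>//; [exact: bm_indic|by apply: bmD=>//; exact: bm_indic|move=> t _].
rewrite !indicE; have [St|_] := boolP (t \in S); last by rewrite addr_ge0.
case: (set_mem St)=> [St'|/= Q1]; first by rewrite (mem_set St') lerDl.
by rewrite ler_wpDl.
Qed.

Lemma ev_comp_ln (P : R -> Prop) : ev P -> ev (fun t=> P (ln t)).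
Proof. by move=> [K HK]; have [x hx] := ev_ln K; exists x=> L /hx; exact: HK. Qed.

(** The inverse square root of [ln tau] dominates [ln ln tau / ln tau], the relative error made by
    the closed form of the saddle point. *)
Lemma tau_large (sigma g C0 Kbig S : R) : 0<sigma -> sigma<1 -> 0<g -> 0<=C0 -> 0<S ->
  let m := sigma^+2/((1-sigma) * g) in
  ev (fun tau=> [/\ 3<=tau, 1<=ln tau & Kbig<=ktau sigma g tau] /\
    let eps := (Num.sqrt (ln tau))^-1 in
    [/\ 0<eps, eps*S<=1, `|(ln (ln tau)+ln m) / ln tau| <= eps, eps^+2=(ln tau)^-1 & C0<=tau * eps]).
Proof.
move=> s0 s1 g0 C00 S0 m.
have s10: 0<1-sigma by rewrite subr_gt0.
have m0: 0<m by rewrite divr_gt0 ?mulr_gt0 ?exprn_gt0.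
pose b := sigma/(1-sigma); have b0: 0<b by rewrite divr_gt0.
have h2: 0<2^-1 :> R by [].
have [x1 g1] := ev_comp_ln (ev_growth (1 + `|ln m|) 1 h2).
have [x2 g2] := ev_ln (Num.max 1 (S^+2)).
have [x3 g3] := ev_growth C0 1 (@ltr01 R).
exists (Num.max 3 (Num.max x1 (Num.max x2 (Num.max x3 (`|Kbig| `^ b^-1 / m)))))=> t.
rewrite !ge_max=> /and5P[t3 /g1 e1 /g2 e2 /g3 e3 e4].
move: e2; rewrite ge_max=> /andP[u1 uS].
set u := ln t in e1 e3 u1 uS *.
have u0: 0<u by apply: lt_le_trans u1.
have t0: 0<t by apply: lt_le_trans t3.
have r0: 0<Num.sqrt u by rewrite sqrtr_gt0.
have rr: Num.sqrt u^+2 = u by rewrite sqr_sqrtr// ltW.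
split; first split=>//.
- have : `|Kbig| `^ b^-1<=m * t*u.
    move: e4; rewrite ler_pdivrMr// => h; apply: le_trans h _; rewrite mulrC ler_peMr//.
    by rewrite mulr_ge0// ltW.
  move/(ge0_ler_powR (ltW b0) (powR_ge0 _ _) (ltW (mulr_gt0 (mulr_gt0 m0 t0) u0))).
  rewrite -powRrM mulVf ?gt_eqF// powRr1// => h.
  by apply: le_trans (ler_norm _) h.
move=> eps; have eps0: 0<eps by rewrite invr_gt0.
split=>//.
- rewrite mulrC ler_pdivrMr// mul1r -(@ler_pXn2r _ 2) ?nnegrE ?(ltW S0) ?(ltW r0)//.
  by rewrite rr.
- rewrite normrM [`|u^-1|]ger0_norm ?invr_ge0 ?(ltW u0)// ler_pdivrMr//.
  have -> : eps*u = Num.sqrt u by rewrite -[X in _*X]rr expr2 mulrA mulVf ?mul1r// gt_eqF.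
  apply: le_trans (ler_normD _ _) _; rewrite [`|ln u|]ger0_norm ?ln_ge0//.
  move: e1; rewrite expr1 powR12_sqrt ?(ltW u0)// => h; apply: le_trans h.
  have := mulr_ge0 (normr_ge0 (ln m)) (ln_ge0 u1); lra.
- by rewrite /eps exprVn rr.
move: e3; rewrite expr1 powRr1 ?(ltW t0)// -/u=> h.
rewrite -[X in X<=_]mulr1 -(mulfV (lt0r_neq0 r0)) mulrA ler_wpM2r ?(ltW eps0)//.
apply: le_trans h; rewrite ler_wpM2l//; apply: le_trans (_ : u<=_); last by rewrite lerDr.
have r1: 1<=Num.sqrt u by rewrite -sqrtr1 ler_wsqrtr.
by rewrite -[X in _<=X]rr expr2 ler_peMl// ltW.
Qed.
End Assembly.

(** * Both bounds at the saddle point *)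

Section LDFinal.
Variables (R : realType) (sigma g C0 c k0 : R).
Hypotheses (hs1 : 2^-1<sigma) (hs2 : sigma<1) (g0 : 0<g) (C00 : 0<=C0) (c0 : 0<=c) (k01 : 1<k0).
Let s0 : 0<sigma. Proof. by move: hs1; lra. Qed.
Let s10 : 0<1-sigma. Proof. by rewrite subr_gt0. Qed.
Let a := sigma^-1.
Let a1 : 1<a. Proof. by rewrite /a invf_gt1. Qed.
Let a2 : a<=2. Proof. by rewrite /a invf_ple ?posrE// ltW. Qed.
Let as1 : a*sigma = 1. Proof. by rewrite /a mulVf ?gt_eqF. Qed.
Let b := sigma/(1-sigma).
Let b0 : 0<b. Proof. by rewrite /b divr_gt0. Qed.
Let m := sigma^+2/((1-sigma) * g).
(** The constants measure everything against [eps]: [r0 eps^2] bounds [1/ln k], [K4 eps] the width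
    of the window, [Kth eps] is the relative shift of [k], and [Kup0], [Klo0] are the resulting
    errors in the exponent. [S] is large enough that [eps * S <= 1] makes all of them small. *)
Let r0 := 2 / b.
Let D := 4*(1+c).
Let K4 := 1+D^+2*r0.
Let Kth := 2*(4+K4)/(a - 1).
Let Kup0 := 4+2*c*r0.
Let Klo0 := 2+9*Kth+(2*K4+c*r0)*(3+9*Kth).
Let S := 2+(4+K4)*(2+K4)+Kth+r0+2*Klo0/(1-sigma).
Let r00 : 0<=r0. Proof. by rewrite /r0 divr_ge0// ltW. Qed.
Let K41 : 1<=K4. Proof. by rewrite /K4 lerDl mulr_ge0// sqr_ge0. Qed.
Let K40 : 0<=K4. Proof. exact: le_trans K41. Qed.
Let Kth0 : 0<=Kth.
Proof. by rewrite /Kth divr_ge0 ?subr_ge0 ?(ltW a1)// mulr_ge0// addr_ge0. Qed.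
Let Klo00 : 0<=Klo0.
Proof. by rewrite /Klo0; nneg. Qed.
Let S2 : 0<=2*Klo0/(1-sigma). Proof. by rewrite divr_ge0 ?(ltW s10)//; nneg. Qed.
Let Kq : 0<=(4+K4)*(2+K4). Proof. by nneg. Qed.
Let Sp : 0<S. Proof. by rewrite /S; move: Kq Kth0 r00 S2; lra. Qed.

Lemma eps_small eps : 0<eps -> eps*S<=1 -> [/\ eps<=2^-1, (4+K4)*(2+K4) * eps<=1,
  Kth * eps<=1, r0 * eps<=1 & Klo0 * eps<=(1-sigma)/2].
Proof.
move=> e0 eS; have e0' := ltW e0.
have p1 := mulr_ge0 Kq e0'; have p2 := mulr_ge0 Kth0 e0'; have p3 := mulr_ge0 r00 e0'.
have p4 := mulr_ge0 S2 e0'.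
have E: eps*S = 2 * eps+(4+K4)*(2+K4) * eps+Kth * eps+r0 * eps+2*Klo0/(1-sigma) * eps.
  by rewrite /S; ring.
have q: 2*Klo0/(1-sigma) * eps<=1 by move: eS p1 p2 p3 p4; rewrite E; move: e0; lra.
split; try by move: eS p1 p2 p3 p4; rewrite E; move: e0; lra.
move: q; rewrite mulrAC ler_pdivrMr// mul1r; lra.
Qed.

Lemma lam_over_ln : exists2 K : R, 0<=K & forall k, K<=k -> expR 2<=k -> 3<=lam g a k / ln k.
Proof.
have h2: 0<2^-1 :> R by [].
have [C7 C71 H7] := ln_pow_le 2 h2; have C70 := lt_le_trans ltr01 C71.
exists ((3*C7 / g)`^2); first exact: powR_ge0.
move=> k kK ke; have k1: 1<=k by apply: le_trans ke; rewrite -expR0 ler_expR.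
have kp := lt_le_trans ltr01 k1.
have l0: 0<ln k by apply: lt_le_trans (_ : 2<=_)=>//; rewrite -(expRK 2) ler_ln ?posrE ?expR_gt0.
have q0: 0<=3*C7 / g by rewrite divr_ge0 ?mulr_ge0 ?(ltW g0) ?(ltW C70).
have h: 3*C7 / g<=k`^2^-1.
  have := ge0_ler_powR (ltW h2) (powR_ge0 _ _) (ltW kp) kK.
  by rewrite -powRrM mulfV// powRr1.
rewrite /lam -mulrA -invfM -expr2 ler_pdivlMr ?exprn_gt0//.
apply: le_trans (_ : 3*(C7*k`^2^-1)<=_).
  by rewrite ler_wpM2l//; apply: le_trans (H7 k k1); rewrite lerXn2r ?nnegrE ?addr_ge0 ?(ltW l0)// lerDr.
have ka: k<=k`^a by rewrite -{1}[k]powRr1 ?(ltW kp)// ler_powR// ltW.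
apply: le_trans (_ : g*k<=_); last by rewrite ler_wpM2l// ltW.
have kk: k = k`^2^-1*k`^2^-1.
  by rewrite -powRD ?(gt_eqF kp) ?implybT//; rewrite (_ : 2^-1+2^-1 = 1 :> R) ?powRr1 ?(ltW kp)//; field.
rewrite [X in _<=_*X]kk !mulrA ler_wpM2r ?powR_ge0//.
by move: h; rewrite ler_pdivrMr// [g * _]mulrC.
Qed.

Lemma ld_final : exists S' Kbig Klo Kup : R, 0<S' /\
  forall (tau T K1 q Phi : R) (G : set R) (X F : R -> R), let k := ktau sigma g tau in
    let eps := (Num.sqrt (ln tau))^-1 in let I := (1-sigma)*(k * tau) in
  3<=tau -> 1<=ln tau -> Kbig<=k -> 0<eps -> eps*S'<=1 ->
  `|(ln (ln tau)+ln m) / ln tau| <= eps -> eps^+2=(ln tau)^-1 -> C0+4/(1-sigma)<=tau * eps ->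
  0<T -> measurable G -> bm T X ->
  (forall k, k0<=k -> k<=K1 ->
    expR (F k)/4<=Ex T (fun t=> \1_G t * expR (k*X t))<=4 * expR (F k)) ->
  (forall k, k0<=k -> k<=K1 -> `|F k-lam g a k| <= c*(lam g a k / ln k)) ->
  4*k<=K1 ->
  Ex T (\1_(Sx G X (tau+C0)))-q<=Phi<=Ex T (\1_(Sx G X (tau-C0)))+q ->
  q<=expR (- (2*I)) ->
  0<I /\ expR (- I-Klo*(I * eps))<=Phi<=expR (- I+Kup*(I * eps)).
Proof.
have aux1 (x : R) : x<=1 -> 1+x<=2 by lra.
have aux2 (P K e s : R) : P*(K * e)<=P*((1-s)/2) -> K*(P * e)<=(1-s)*P/2 by lra.
have aux3 (k k' K : R) : k'<=2*k -> 4*k<=K -> 2*k'<=K by lra.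
have aux4 (l k k' : R) : 2 * l<=k -> k<=k' -> l<=k'/2 by lra.
have aux5 (K : R) : 0<=K -> K<=(4+K)*(2+K) by move=> h; have := mulr_ge0 h h; lra.
have aux6 (x : R) : 4<=x -> 2<=x by lra.
have aux7 (x : R) : 4<=x -> 1<=x by lra.
have aux8 (k K : R) : 4*k<=K -> 0<k -> k<=K by lra.
have aux9 (l k : R) : 2 * l<=k -> 1<l -> l<=k by lra.
have aux10 (e : R) : e<=2^-1 -> e<=1 by lra.
have aux11 (e d : R) : - d<=e -> d<=2^-1 -> 2^-1<=1+e by lra.
have q4: 4<=4/(1-sigma) by rewrite ler_pdivlMr//; move: s0; lra.
have q40: 0<=4/(1-sigma) := le_trans (ler0n _ 4) q4.
have [Kl Kl0 HKl] := lam_over_ln.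
exists S, (Num.max (2*k0) (Num.max (expR 2) Kl)), ((Klo0+1)/(1-sigma)), ((Kup0+1)/(1-sigma)).
split=>// tau T K1 q Phi G X F k eps I t3 u1 kbig e0 eS ee e2 Ct T0 mG bX HM HF kK1 /andP[Phi1 Phi2] hq.
have [eh eK eth er eKlo] := eps_small e0 eS.
move: kbig; rewrite !ge_max=> /and3P[kk0 ke kKl].
set u := ln tau in u1 ee e2 *; have u0: 0<u := lt_le_trans ltr01 u1.
have t0: 0<tau by apply: lt_le_trans t3.
have k1: 1<=k by apply: le_trans ke; rewrite -expR0 ler_expR.
have kp := lt_le_trans ltr01 k1.
set l := ln k; have l2: 2<=l by rewrite -(expRK 2) /l ler_ln ?posrE ?expR_gt0.
have l0: 0<l by apply: lt_le_trans l2.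
set e := (ln u+ln m) / u in ee.
have ue: u+ln u+ln m = u*(1+e) by rewrite /e; field; rewrite gt_eqF.
have lE: l = b*u*(1+e) by rewrite /l ln_ktau// -/u -/b -/m ue mulrA.
set lm := lam g a k.
have lmE: lm*(1+e) = sigma*(k * tau).
  have := @lam_ktau R sigma g tau s0 hs2 g0 t0 u0; rewrite -/k -/l -/u -/m -/a -/lm ue=> /(_ (lt0r_neq0 l0)).
  rewrite mulrCA=> h; apply: (mulfI (lt0r_neq0 u0)); rewrite h; ring.
pose P := k * tau; pose Pe := P * eps.
have lm0: 0<=lm by exact: lam_ge0.
have P0: 0<P by exact: mulr_gt0.
have Pt: tau<=P by rewrite ler_peMl// ltW.
have Pe4: 4/(1-sigma)+C0<=Pe.
  by rewrite addrC; apply: le_trans Ct _; rewrite ler_wpM2r// ltW.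
have Pe4': 4<=Pe by move: Pe4 q4 C00; lra.
have Ip: 0<I by exact: mulr_gt0.
have IE: I=(1-sigma)*P by [].
have I8: 8<=I.
  have h: 4/(1-sigma)<=tau/2.
    apply: le_trans (_ : tau * eps<=_); last by rewrite ler_wpM2l// ltW.
    by apply: le_trans Ct; rewrite lerDr.
  have P2: tau/2<=P/2 by rewrite ler_wpM2r.
  have := ler_wpM2l (ltW s10) (le_trans h P2).
  rewrite (_ : (1-sigma)*(4/(1-sigma)) = 4); last by field; rewrite gt_eqF.
  by rewrite IE mulrA; lra.
have PeI K : K/(1-sigma)*(I * eps) = K*Pe.
  by rewrite IE /Pe; field; rewrite gt_eqF.
have ehalf: 2^-1<=1+e by move: ee; rewrite ler_norml=> /andP[/aux11 h _]; exact: h.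
have li: l^-1<=r0 * eps^+2.
  rewrite e2 (_ : r0*u^-1=(b*u*2^-1)^-1); last by rewrite /r0; field; rewrite !gt_eqF.
  rewrite lef_pV2 ?posrE//; last by apply: divr_gt0=>//; exact: mulr_gt0 b0 u0.
  by rewrite lE ler_wpM2l// mulr_ge0 ?(ltW b0) ?(ltW u0).
have eps1: eps<=1 by exact: aux10.
have re2: r0 * eps^+2<=r0 * eps by rewrite ler_wpM2l// expr2 ler_piMl// ltW.
have li1: l^-1<=r0 * eps := le_trans li re2.
have lie: l^-1<=eps by apply: le_trans li _; rewrite expr2 mulrA ler_piMl// ltW.
have liv: 0<=l^-1 by rewrite invr_ge0 ltW.
have lmle := lam_le_arith lm0 e0 eh ee lmE; rewrite -/P in lmle.
have kk: k0<=k by exact: aux9.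
have kK: k<=K1 by exact: aux8.
split=>//; rewrite !PeI; apply/andP; split; last first.
  have hF: F k<=lm+c*(lm * l^-1).
    by have := HF k kk kK; rewrite -/lm -/l ler_norml=> /andP[_]; rewrite lerBlDl.
  have kC: k*C0<=P * eps.
    rewrite -mulrA ler_wpM2l ?(ltW kp)//; apply: le_trans Ct; rewrite lerDl; exact: q40.
  have Pe2: 2<=P * eps by exact: aux6.
  have ua := upper_arith (ltW P0) e0 eh c0 r00 s0 hs2 lm0 lmle liv li1 hF kC Pe2.
  have ch := chernoff T0 mG bX (tau-C0) (ltW kp).
  have /andP[_ hM] := HM k kk kK.
  apply: (num_upper Phi2 (le_trans ch (ler_wpM2l (expR_ge0 _) hM)) hq ua (ltW Ip)).
    by nneg.
  exact: aux7.
(* The lower bound tilts at [k' > k]: the whole window around [x'] must lie to the right of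
   [tau + C0]. *)
pose th := Kth * eps; have th0: 0<=th by rewrite mulr_ge0// ltW.
pose k' := k*(1+th); have kk': k<=k' by rewrite /k' ler_peMr ?lerDl// ltW.
have k'p := lt_le_trans kp kk'.
pose l' := ln k'; have ll': l<=l' by rewrite /l /l' ler_ln ?posrE.
have l'0 := lt_le_trans l0 ll'.
pose lm' := lam g a k'; pose x' := a * lm' / k'; pose x := a * lm / k.
have kx': k'*x' = a * lm' by rewrite /x'; field; rewrite gt_eqF.
have lm'0: 0<=lm' by apply: lam_ge0=>//; exact: le_trans kk'.
pose eta := D/Num.sqrt l'; have D0: 0<=D by rewrite /D mulr_ge0// addr_ge0.
have sl': 0<Num.sqrt l' by rewrite sqrtr_gt0.
have eta0: 0<=eta by rewrite divr_ge0// ltW.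
have slE: Num.sqrt l'^+2 = l' by rewrite sqr_sqrtr// ltW.
have etaE: eta^+2 * l' = D^+2.
  by rewrite /eta expr_div_n slE divfK// gt_eqF.
have l'i: l'^-1<=l^-1 by rewrite lef_pV2 ?posrE.
have l'iv: 0<=l'^-1 by rewrite invr_ge0 ltW.
have etaK: eta<=K4 * eps.
  have Ke0: 0<=K4 * eps := mulr_ge0 K40 (ltW e0).
  rewrite -(@ler_pXn2r _ 2) ?nnegrE//.
  have -> : eta^+2 = D^+2 * l'^-1 by rewrite -etaE mulfK// gt_eqF.
  apply: le_trans (ler_wpM2l (sqr_ge0 D) (le_trans l'i li)) _; rewrite mulrA [X in _<=X]exprMn ler_wpM2r ?sqr_ge0//.
  have K4D: D^+2*r0<=K4 by rewrite /K4 lerDr.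
  by apply: le_trans K4D _; rewrite expr2 ler_peMl.
have K4e: K4 * eps<=1.
  apply: le_trans eK; rewrite ler_wpM2r ?(ltW e0)//.
  exact: aux5.
have a10: 0<a - 1 by rewrite subr_gt0.
have lmx: 0<lm.
  rewrite lt_neqAle lm0 andbT eq_sym; apply/eqP=> h; move: lmE; rewrite h mul0r=> /esym/eqP.
  by rewrite gt_eqF// mulr_gt0.
have xarith: tau*(1+eps)<=x'*(1-eta).
  apply: (@lower_x_arith R tau x x' e eps th a l eta K4)=>//.
  - transitivity (a*(lm*(1+e)) / k); first by rewrite /x; ring.
    rewrite lmE (_ : a*(sigma*(k * tau)) / k = a*sigma*(tau*(k / k))); last by ring.
    by rewrite as1 mul1r divff ?mulr1// gt_eqF.
  - by rewrite divr_gt0// mulr_gt0// (lt_trans ltr01).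
  - have h := lam_up_ge g0 (ltW a1) kp l0 th0; rewrite -/lm -/l -/k' -/lm' in h.
    have t1: 0<1+th by rewrite ltr_pwDl.
    rewrite (_ : x * _ = a / k'*(lm*((1+a * th)*(l/(l+th))))); last first.
      by rewrite /x /k'; field; rewrite !gt_eqF// ltr_pwDl.
    rewrite (_ : x' = a / k' * lm'); last by rewrite /x'; ring.
    by rewrite ler_wpM2l// divr_ge0 ?(ltW k'p)// (le_trans ler01)// ltW.
  - by rewrite /th /Kth; field; rewrite gt_eqF.
have xC: tau+C0<=x'*(1-eta).
  apply: le_trans xarith; rewrite mulrDr mulr1 lerD2l; apply: le_trans Ct; rewrite lerDl; exact: q40.
have ld := @ld_lower R T G X F g a c k0 K1 T0 mG bX g0 (ltW a1) a2 c0 k01 HM HF k' eta x'.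
have q3: 3<=lam g a k' / ln k' by apply: HKl; [exact: le_trans kk'|exact: le_trans kk'].
have {}ld := ld _ _ (le_trans l2 ll') eta0 (le_trans etaK K4e) etaE kx' q3.
have ldx: k0<=k'/2 by exact: aux4 kk0 kk'.
have ldy: 2*k'<=K1.
  suff h : k'<=2*k by exact: aux3 h kK1.
  by rewrite /k' mulrC ler_wpM2r ?(ltW kp)//; exact: aux1.
have {}ld := ld ldx ldy; rewrite -/lm' -/l' in ld.
have lmu: lm'<=lm*(1+a * th+th^+2) := lam_up g0 (ltW a1) a2 kp l0 th0.
have la := @lower_exp_arith R P lm lm' (lm' / l') a sigma th eps eta K4 Kth c r0 l'^-1 (ltW P0) e0 eps1 s0 hs2 as1
  (ltW a1) a2 lm0 lmle th0 eth erefl Kth0 lm'0 lmu erefl l'iv (le_trans l'i li1) r00 c0 eta0 etaK K40.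
have lS: expR (- I-Klo0*Pe)/8<=Ex T (\1_(Sx G X (tau+C0))).
  apply: le_trans (_ : expR (lm'-c*(lm' / l')-k'*x'*(1+eta))/8<=_).
    by rewrite ler_wpM2r ?invr_ge0// ler_expR kx'.
  apply: le_trans ld _; apply: Ex_le=>//.
  - by apply: bm_indic; exact: (measurable_Sx (T := T)).
  - by apply: bm_indic; exact: (measurable_Sx (T := T)).
  move=> t _; rewrite !indicE; have [St|_] := boolP (t \in Sx G X (x'*(1-eta)))=>//.
  rewrite (_ : t \in Sx G X (tau+C0)) //; apply: mem_set.
  by have [Gt Xt] := set_mem St; split=>//=; exact: le_trans xC Xt.
apply: (num_lower Phi1 lS hq)=>//.
by rewrite IE /Pe; exact: aux2 (ler_wpM2l (ltW P0) eKlo).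
Qed.
End LDFinal.

(** * The admissible range of tau *)

Section Range.
Variables (R : realType) (sigma g c1 c2 cb L tau : R).
Hypotheses (s0 : 0<sigma) (s1 : sigma<1) (g0 : 0<g) (c10 : 0<c1) (c11 : c1<=1) (c1b : c1<=cb)
  (c20 : 0<c2) (c21 : c2<=1) (L1 : 1<=L) (lL1 : 1<=ln L) (t3 : 3<=tau)
  (tL : tau<=c1*L`^(1-sigma) / ln L).
Let m := sigma^+2/((1-sigma) * g).
Let b := sigma/(1-sigma).
Hypothesis c1m : c1<=(c2/4)`^b^-1 / m.

(** The range condition keeps the saddle point where the Laplace transform is known, with a margin
    of 4, and keeps twice the main exponent below that of the exceptional set. *)
Lemma range_bounds : 4*ktau sigma g tau<=c2*L`^sigma /\
  2*((1-sigma)*(ktau sigma g tau * tau))<=cb*(L / ln L).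
Proof.
have s10: 0<1-sigma by rewrite subr_gt0.
have m0: 0<m by rewrite divr_gt0 ?mulr_gt0 ?exprn_gt0.
have b0: 0<b by rewrite divr_gt0.
have L0 := lt_le_trans ltr01 L1; have lL0 := lt_le_trans ltr01 lL1.
have t0: 0<tau by apply: lt_le_trans t3.
have Ls: L`^(1-sigma)<=L.
  by rewrite -[X in _<=X]powRr1 ?(ltW L0)// ler_powR//; move: s0; lra.
have tLL: tau<=L.
  apply: le_trans tL _; rewrite ler_pdivrMr//; apply: le_trans (_ : L`^(1-sigma)<=_).
    by rewrite ler_piMl// powR_ge0.
  by apply: le_trans Ls _; rewrite ler_peMr// ltW.
have u0: 0<ln tau by rewrite ln_gt0//; move: t3; lra.
have lu: ln tau<=ln L by rewrite ler_ln ?posrE.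
have mtu: m * tau * ln tau<=(c2/4)`^b^-1*L`^(1-sigma).
  apply: le_trans (_ : m*(c1*L`^(1-sigma))<=_).
    rewrite -mulrA ler_wpM2l ?(ltW m0)//; apply: le_trans (ler_wpM2l (ltW t0) lu) _.
    by move: tL; rewrite ler_pdivlMr.
  rewrite mulrA ler_wpM2r ?powR_ge0//; move: c1m; rewrite ler_pdivlMr//; by rewrite mulrC.
have c4: 0<c2/4 by rewrite divr_gt0.
have kb: ktau sigma g tau<=c2/4*L`^sigma.
  rewrite /ktau -/m -/b; have mt0: 0<=m * tau * ln tau by exact: mulr_ge0 (mulr_ge0 (ltW m0) (ltW t0)) (ltW u0).
  have := ge0_ler_powR (ltW b0) mt0 (mulr_ge0 (powR_ge0 _ _) (powR_ge0 _ _)) mtu.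
  have -> // : ((c2/4)`^b^-1*L`^(1-sigma))`^b = c2/4*L`^sigma.
  rewrite powRM ?powR_ge0// -!powRrM mulVf ?gt_eqF// powRr1 ?(ltW c4)//.
  by rewrite (_ : (1-sigma)*b = sigma)//; rewrite /b; field; rewrite gt_eqF.
split; first by move: kb; lra.
have kt: ktau sigma g tau * tau<=c2/4*c1*(L / ln L).
  apply: le_trans (ler_pM (ltW (ktau_gt0 s0 s1 g0 t0 u0)) (ltW t0) kb tL) _.
  apply: eq_ler.
  have LL: L`^sigma*L`^(1-sigma) = L.
    by rewrite -powRD ?(gt_eqF L0) ?implybT// addrC subrK powRr1// ltW.
  transitivity (c2/4*c1*(L`^sigma*L`^(1-sigma) / ln L)); first by ring.
  by rewrite LL.
have l0: 0<=L / ln L by rewrite divr_ge0 ?ltW.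
have kp: 0<=ktau sigma g tau * tau by rewrite mulr_ge0 ?(ltW t0)//; exact: powR_ge0.
have h1: (1-sigma)*(ktau sigma g tau * tau)<=ktau sigma g tau * tau.
  by rewrite ler_piMl//; move: s0; lra.
have h2: c2/4*c1*(L / ln L)<=cb/4*(L / ln L).
  rewrite ler_wpM2r//; have := ler_wpM2r (ltW c10) c21; move: c1b; lra.
have h3: 0<=cb*(L / ln L) by rewrite mulr_ge0// (le_trans (ltW c10)).
by move: h1 h2 h3 kt; lra.
Qed.
End Range.

Theorem theorem1p1 (R : realType) (sigma : R)
  (hs1 : 2^-1 < sigma) (hs2 : sigma < 1) :
  exists c1 : R, 0 < c1 /\
  exists tau0 C T0 : R, 3 <= tau0 /\ 0 < C /\
  forall T tau : R, T0 <= T -> tau0 <= tau ->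
    tau <= c1 * (ln T) `^ (1 - sigma) / ln (ln T) ->
    exists E : R,
      `|E| <= C * ((Num.sqrt (ln tau))^-1 + rr sigma (ln T) tau) /\
      PhiT T sigma tau =
        expR (- (A1 sigma * tau `^ ((1 - sigma)^-1)
                 * (ln tau) `^ (sigma / (1 - sigma)) * (1 + E))).
Proof.
have s0: 0<sigma by move: hs1; lra.
have s10: 0<1-sigma by rewrite subr_gt0.
have g0 := G1_gt0 hs1 hs2; set g := G1 sigma in g0.
have [c2 [cb [C0' [L0 [c20 c21 cb0 HL]]]]] := laplace hs1 hs2.
have [C [k0 [C_0 k01 HF]]] := Fz_asymp hs1 hs2.
pose C0 := `|C0'|; have C00: 0<=C0 by exact: normr_ge0.
pose c := C / g; have c0: 0<=c by rewrite divr_ge0// ltW.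
pose b := sigma/(1-sigma); pose m := sigma^+2/((1-sigma) * g).
have m0: 0<m by rewrite divr_gt0 ?mulr_gt0 ?exprn_gt0.
have [S [Kbig [Klo [Kup [S0 HLD]]]]] := ld_final hs1 hs2 g0 C00 c0 k01.
have Kl: Klo<=1 + `|Klo| + `|Kup| by have := ler_norm Klo; have := normr_ge0 Kup; lra.
have Ku: Kup<=1 + `|Klo| + `|Kup| by have := ler_norm Kup; have := normr_ge0 Klo; lra.
have C40: 0<=C0+4/(1-sigma) by rewrite addr_ge0// divr_ge0// ltW.
have [t0 Ht] := tau_large Kbig s0 hs2 g0 C40 S0.
pose q := (c2/4)`^b^-1 / m; have q0: 0<q by rewrite divr_gt0// powR_gt0// divr_gt0.
(* The bound 1 ensures [tau <= ln T], [cb] makes the exceptional set negligible, and [q] keeps the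
   saddle point in range. *)
pose c1 := Num.min 1 (Num.min cb q).
have c10: 0<c1 by rewrite !lt_min ltr01 cb0 q0.
exists c1; split=>//.
exists (Num.max 3 t0), (1 + `|Klo| + `|Kup|), (expR (Num.max L0 (expR 1))).
split; first by rewrite le_max lexx.
split; first by rewrite ltr_pwDl// ltr_pwDl.
move=> T tau TT; rewrite ge_max=> /andP[t3 tt0] tL.
have T0: 0<T := lt_le_trans (expR_gt0 _) TT.
have : Num.max L0 (expR 1)<=ln T by rewrite -ler_expR lnK.
rewrite ge_max=> /andP[LL0 Le]; set L := ln T in LL0 Le tL *.
have L1: 1<=L by apply: le_trans Le; rewrite -expR0 ler_expR.
have Lp := lt_le_trans ltr01 L1.
have lL1: 1<=ln L by rewrite -(expRK 1) ler_ln ?posrE ?expR_gt0.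
have [[_ u1 kb] [e0 eS ee e2 Ct]] := Ht tau tt0.
set eps := (Num.sqrt (ln tau))^-1 in e0 eS ee e2 Ct *.
have c11: c1<=1 by rewrite ge_min lexx.
have c1b: c1<=cb by rewrite !ge_min lexx orbT.
have c1q: c1<=q by rewrite !ge_min lexx !orbT.
have [k4 bad] := range_bounds s0 hs2 g0 c10 c11 c1b c20 c21 L1 lL1 t3 tL c1q.
have [z [W [Q [Lz [bQ Q0] EQ HQ HM]]]] := HL T T0 LL0.
set k := ktau sigma g tau in kb k4 bad.
set I := (1-sigma)*(k * tau) in bad.
have qI: Ex T Q<=expR (- (2*I)) by apply: le_trans EQ _; rewrite ler_expR lerN2.
pose X t := complex.Re (Rp sigma z t).
have mG := measurable_GW sigma z W.
have bX: bm T X by case: (cbm_Rp T sigma z).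
have HQ' t : T<=t<=2*T -> Q t<1 -> GW sigma z W t /\ `|ln (abs_zeta sigma t)-X t| <= C0.
  by move=> tT Qt; have [Gt h] := HQ t tT Qt; split=>//; apply: le_trans h (ler_norm _).
have sw := phi_sandwich tau T0 mG bX bQ Q0 HQ'.
pose K1 := c2*L`^sigma.
have HM' k' : k0<=k' -> k'<=K1 ->
   expR (Fz sigma z k')/4<=Ex T (fun t=> \1_(GW sigma z W) t * expR (k'*X t))<=4 * expR (Fz sigma z k').
  by move=> kk kK; apply: HM=>//; apply: le_trans kk; exact: le_trans (ltW k01).
have HF' k' : k0<=k' -> k'<=K1 ->
   `|Fz sigma z k'-lam g sigma^-1 k'| <= c*(lam g sigma^-1 k' / ln k').
  move=> kk kK; have k'0: 0<k' by apply: lt_le_trans kk; exact: lt_trans k01.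
  have lk: 0<ln k' by apply: ln_gt0; exact: lt_le_trans kk.
  have a0: 0<sigma^-1 by rewrite invr_gt0.
  (* From [k' <= L^sigma] the left side is at most [L^2], which [z] exceeds by construction. *)
  have kz: k'`^(2*sigma^-1)<=z%:R.
    apply: le_trans Lz; rewrite mulrC powRrM powR_mulrn ?powR_ge0// lerXn2r ?nnegrE ?powR_ge0 ?(ltW Lp)//.
    have kL: k'<=L`^sigma by apply: le_trans kK _; rewrite ler_piMl ?powR_ge0.
    have := ge0_ler_powR (ltW a0) (ltW k'0) (powR_ge0 _ _) kL.
    by rewrite -powRrM mulfV ?gt_eqF// powRr1// ltW.
  apply: le_trans (HF k' z kk kz) _; apply: eq_ler.
  by rewrite /c /lam; field; rewrite !gt_eqF.
have [Ip /andP[lo up]] := HLD tau T K1 (Ex T Q) (PhiT T sigma tau) (GW sigma z W) X (Fz sigma z)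
  t3 u1 kb e0 eS ee e2 Ct T0 mG bX HM' HF' k4 sw qI.
have [E hE PE] := rate_of_bounds Ip lo up Kl Ku (ltW e0).
have tp: 0<tau by apply: lt_le_trans t3.
exists E; split; last by rewrite PE /A1 -/g -(ktau_rate s0 hs2 g0 tp (lt_le_trans ltr01 u1)).
apply: le_trans hE _; rewrite ler_wpM2l ?addr_ge0// lerDl; exact: powR_ge0.
Qed.
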